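(* If $f\in\mathcal A^{(n)}(q^{1/2}u_0;p,q)$, $g\in\mathcal A^{(n)}(u_1;p,q)$ and $t^{2n-2}u_0u_1t_0t_1t_2t_3=pq$, then $$\langle\mathcal D^{(n)}_q(u_0,t_0,t_1;t,p)f,\,g\rangle_{t_0,t_1,t_2,t_3;u_0,u_1;t,p,q}=\langle f,\,\mathcal D^{(n)}_q(u_1',t_2',t_3';t,p)g\rangle_{t_0',t_1',t_2',t_3';u_0',u_1';t,p,q},$$ where $$(t_0',t_1',t_2',t_3',u_0',u_1')=(q^{1/2}t_0,q^{1/2}t_1,q^{-1/2}t_2,q^{-1/2}t_3,q^{1/2}u_0,q^{-1/2}u_1).$$
   Context: Parameters: $0<|p|,|q|,|t|<1$, the other parameters generic in $\mathbb C^*$; a square root $q^{1/2}$ is fixed. $(p;p)=\prod_{k\ge1}(1-p^k)$, $\theta(x;p)=\prod_{k\ge0}(1-p^kx)(1-p^{k+1}/x)$, $\Gamma(x;p,q)=\prod_{j,k\ge0}(1-p^{j+1}q^{k+1}/x)(1-p^jq^kx)^{-1}$; several arguments before the semicolon, or signs $\pm$, denote products. $\theta(x;p,q)_{l,m}=\prod_{0\le k<l}\theta(p^kx;q)\prod_{0\le k<m}\theta(q^kx;p)$. Spaces: a $BC_n$-symmetric $p$-abelian function is a meromorphic function on $(\mathbb C^* )^n$ invariant under permutations of the variables, under $z_i\mapsto1/z_i$ for each $i$, and under $z_i\mapsto pz_i$ for each $i$. $A^{(n)}(u_0;p,q)$ is the space of $BC_n$-symmetric $p$-abelian $f$ such that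 $\prod_i\theta(pqz_i^{\pm1}/u_0;p,q)_{0,m}f$ is holomorphic on $(\mathbb C^* )^n$ for sufficiently large $m$; $A^{(n)}(u_0;q,p)$ is the same with $p,q$ exchanged. $\mathcal A^{(n)}(u_0;p,q)$ is the linear span of products $gh$ with $g\in A^{(n)}(u_0;p,q)$, $h\in A^{(n)}(u_0;q,p)$; for $f$ in it, $\prod_i\theta(pqz_i^{\pm1}/u_0;p,q)_{l,m}f$ is holomorphic for large $l,m$. Difference operator: $$(D^{(n)}_q(u_0,u_1,u_2,u_3;t,p)f)(\dots z_i\dots)=\sum_{\sigma\in\{\pm1\}^n}\prod_{1\le i\le n}\frac{\prod_{0\le r\le3}\theta(u_rz_i^{\sigma_i};p)}{\theta(z_i^{2\sigma_i};p)}\prod_{1\le i<j\le n}\frac{\theta(tz_i^{\sigma_i}z_j^{\sigma_j};p)}{\theta(z_i^{\sigma_i}z_j^{\sigma_j};p)}f(\dots q^{\sigma_i/2}z_i\dots),$$ $$\mathcal D^{(n)}_q(u_0,u_1,u_2;t,p)f=\frac{D^{(n)}_q(u_0,u_1,u_2,t^{1-n}p/u_0u_1u_2;t,p)f}{\prod_{1\le i\le n}\theta(t^{n-i}u_0u_1,t^{n-i}u_0u_2,t^{n-i}u_1u_2;p)},$$ which maps $\mathcal A^{(n)}(q^{1/2}u_0;p,q)$ to $\mathcal A^{(n)}(u_0;p,q)$. Scalar product: for $t^{2n-2}u_0u_1t_0t_1t_2t_3=pq$, $f\in\mathcal A^{(n)}(u_0;p,q)$, $g\in\mathcal A^{(n)}(u_1;p,q)$,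 and with $t_4=u_0$, $t_5=u_1$, $$\langle f,g\rangle_{t_0,t_1,t_2,t_3;u_0,u_1;t,p,q}=\frac1Z\int_{C^n}f(z)g(z)\prod_{1\le i<j\le n}\frac{\Gamma(tz_i^{\pm1}z_j^{\pm1};p,q)}{\Gamma(z_i^{\pm1}z_j^{\pm1};p,q)}\prod_{1\le i\le n}\frac{\prod_{0\le r\le5}\Gamma(t_rz_i^{\pm1};p,q)}{\Gamma(z_i^{\pm2};p,q)}\frac{dz_i}{2\pi\sqrt{-1}z_i},$$ $$Z=\frac{2^nn!}{(p;p)^n(q;q)^n\Gamma(t;p,q)^n}\prod_{1\le i\le n}\Gamma(t^i;p,q)\prod_{0\le r<s\le5}\Gamma(t^{n-i}t_rt_s;p,q).$$ The contour is chosen after absorbing the poles of $f,g$ into the factors $\Gamma(u_0z_i^{\pm1};p,q)$, $\Gamma(u_1z_i^{\pm1};p,q)$: if $\prod_i\theta(pqz_i^{\pm1}/u_0;p,q)_{l,m}f$ and $\prod_i\theta(pqz_i^{\pm1}/u_1;p,q)_{l',m'}g$ are holomorphic, $C=C^{-1}$ contains $p^iq^jt_r$ ($0\le r\le3$), $p^{i-l}q^{j-m}u_0$, $p^{i-l'}q^{j-m'}u_1$ for $i,j\ge0$, excludes their reciprocals, and contains the contours $p^iq^jtC$ for $i,j\ge0$. *)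

(* Defs.v *)
From HB Require Import structures.
From mathcomp Require Import all_boot all_order all_algebra.
From mathcomp Require Import all_fingroup.
From mathcomp Require Import all_classical all_reals all_analysis.
From mathcomp Require Import complex.
Set Implicit Arguments.
Unset Strict Implicit.
Unset Printing Implicit Defensive.
Import Order.TTheory GRing.Theory Num.Theory.
Import numFieldNormedType.Exports.
Local Open Scope classical_set_scope.
Local Open Scope ring_scope.

(* The topology of the complex plane R[i] is carried by the alias R[i]^o. *)

Section SpecialFunctions.
Variable R : realType.
Implicit Types x p q : R[i].

Definition infprod (u : nat -> R[i]) : R[i] :=
  limn (fun N => (\prod_(k < N) u k : R[i]^o)).

Definition pochhammer p : R[i] := infprod (fun k => 1 - p ^+ k.+1).

Definition theta x p : R[i] :=
  infprod (fun k => (1 - p ^+ k * x) * (1 - p ^+ k.+1 / x)).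

(* The double product is absolutely convergent, so it is the limit of its
   square partial products.  Since 0^-1 = 0, the value at a pole is 0. *)
Definition ellGamma x p q : R[i] :=
  limn (fun N => (\prod_(j < N) \prod_(k < N)
     ((1 - p ^+ j.+1 * q ^+ k.+1 / x) / (1 - p ^+ j * q ^+ k * x)) : R[i]^o)).

Definition theta2 x p q (l m : nat) : R[i] :=
  (\prod_(k < l) theta (p ^+ k * x) q) * (\prod_(k < m) theta (q ^+ k * x) p).

(* A sign is a boolean e, so that x ^ sg e ranges over x and 1/x. *)
Definition sg (e : bool) : int := (-1) ^+ e.

End SpecialFunctions.

(* A meromorphic function on the torus (C^* )^n is represented by a total
   function whose values at the zeros of local denominators are irrelevant;
   two such functions are identified when they differ only on a thin set. *)
Section Meromorphic.
Variables (R : realType) (n : nat).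
Local Notation V := 'rV[R[i]]_n.
Implicit Types (z : V) (U S : set V) (f g h : V -> R[i]).

(* 'rV[R[i]^o]_n is the same type as V, with its topology. *)
Definition open_rV U : Prop := open (U : set 'rV[R[i]^o]_n).

Definition torus : set V := [set z | forall i, z 0 i != 0].

Definition holomorphic_on U f : Prop :=
  forall z : 'rV[R[i]^o]_n, U z -> differentiable (f : 'rV[R[i]^o]_n -> R[i]^o) z.

Definition nowhere_null U h : Prop :=
  forall W : set V, open_rV W -> W `<=` U -> W !=set0 -> exists2 w, W w & h w != 0.

Definition thin S : Prop :=
  forall z, torus z -> exists U h,
    [/\ open_rV U, U z, U `<=` torus, holomorphic_on U h & nowhere_null U h] /\
    (forall w, U w -> S w -> h w = 0).

Definition mero_eq f g : Prop := thin [set z | torus z /\ f z <> g z].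

Definition meromorphic f : Prop :=
  forall z, torus z -> exists U a b,
    [/\ open_rV U, U z, U `<=` torus, holomorphic_on U a & holomorphic_on U b] /\
    (nowhere_null U b /\ forall w, U w -> b w != 0 -> f w = a w / b w).

Definition is_holomorphic f : Prop :=
  exists2 F, holomorphic_on torus F & mero_eq f F.

Definition set_coord (i : 'I_n) (x : R[i]) z : V :=
  \row_j (if j == i then x else z 0 j).

Definition BCn_symmetric f : Prop :=
  (forall s : 'S_n, mero_eq (fun z => f (col_perm s z)) f) /\
  (forall i, mero_eq (fun z => f (set_coord i (z 0 i)^-1 z)) f).

Definition abelian_fun (p : R[i]) f : Prop :=
  forall i, mero_eq (fun z => f (set_coord i (p * z 0 i) z)) f.

Definition pole_factor (u0 p q : R[i]) (l m : nat) z : R[i] :=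
  \prod_(i < n) \prod_(e : bool) theta2 (p * q * z 0 i ^ sg e / u0) p q l m.

Definition Aspace (u0 p q : R[i]) f : Prop :=
  [/\ meromorphic f, BCn_symmetric f, abelian_fun p f &
    exists m0 : nat, forall m : nat, (m0 <= m)%N ->
      is_holomorphic (fun z => pole_factor u0 p q 0 m z * f z)].

Definition calAspace (u0 p q : R[i]) f : Prop :=
  meromorphic f /\
  exists (N : nat) (c : 'I_N -> R[i]) (g h : 'I_N -> V -> R[i]),
    [/\ forall k, Aspace u0 p q (g k),
        forall k, Aspace u0 q p (h k) &
        mero_eq f (fun z => \sum_(k < N) c k * (g k z * h k z))].

(* sq stands for the chosen square root of q. *)
Definition diff_op (sq u0 u1 u2 u3 t p : R[i]) f z : R[i] :=
  \sum_(s : {ffun 'I_n -> bool})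
    (\prod_(i < n)
       ((\prod_(u <- [:: u0; u1; u2; u3]) theta (u * z 0 i ^ sg (s i)) p)
        / theta (z 0 i ^ (2 * sg (s i))) p)) *
    (\prod_(i < n) \prod_(j < n | (i < j)%N)
       (theta (t * z 0 i ^ sg (s i) * z 0 j ^ sg (s j)) p
        / theta (z 0 i ^ sg (s i) * z 0 j ^ sg (s j)) p)) *
    f (\row_i (sq ^ sg (s i) * z 0 i)).

Definition cal_diff_op (sq u0 u1 u2 t p : R[i]) f z : R[i] :=
  diff_op sq u0 u1 u2 (t ^ (1 - n%:Z) * p / (u0 * u1 * u2)) t p f z /
  \prod_(1 <= i < n.+1)
     (theta (t ^+ (n - i) * u0 * u1) p * theta (t ^+ (n - i) * u0 * u2) p *
      theta (t ^+ (n - i) * u1 * u2) p).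

End Meromorphic.

Section Contours.
Variable R : realType.
Local Notation mu := (@lebesgue_measure R).
Implicit Type a : R[i].

Definition C1 (x : R -> R) : Prop :=
  (forall s, derivable x s 1) /\ continuous (derive1 x).

(* x and y below are C^1 on the whole line, which amounts to being C^1 up to
   the endpoints on the closed piece where they agree with c. *)
Definition piecewise_C1 (c : R -> R[i]) : Prop :=
  exists b : seq R, [/\ path <%R 0 b, last 0 b = 1 &
    forall k : nat, (k < size b)%N -> exists x y : R -> R,
      [/\ C1 x, C1 y & forall s, nth 0 (0 :: b) k <= s <= nth 0 b k ->
                         c s = (x s +i* y s)%C]].

Definition curve_derive (c : R -> R[i]) (s : R) : R[i] :=
  (derive1 (fun r => complex.Re (c r)) s +i*
   derive1 (fun r => complex.Im (c r)) s)%C.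

Definition unit_integral (f : R -> R[i]) : R[i] :=
  ((\int[mu]_(s in `[0%R, 1%R]) complex.Re (f s))%R +i*
   (\int[mu]_(s in `[0%R, 1%R]) complex.Im (f s))%R)%C.

Definition curve_integral (c : R -> R[i]) (phi : R[i] -> R[i]) : R[i] :=
  unit_integral (fun s => phi (c s) * curve_derive c s).

(* A finite family of closed curves parametrized by [0, 1]; the contours used
   below need not be connected. *)
Record contour := Contour { ncurves : nat; curve_of : 'I_ncurves -> R -> R[i] }.
Implicit Type C : contour.

Definition trace C : set R[i] :=
  [set z | exists (k : 'I_(ncurves C)) (s : R), 0 <= s <= 1 /\ z = curve_of k s].

Definition contour_integral C (phi : R[i] -> R[i]) : R[i] :=
  \sum_(k < ncurves C) curve_integral (curve_of k) phi.

Definition two_pi_i : R[i] := (0 +i* (2 * pi))%C.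

Definition winding C a : R[i] :=
  contour_integral C (fun z => (z - a)^-1) / two_pi_i.

Definition inside C a : Prop := ~ trace C a /\ winding C a = 1.
Definition outside C a : Prop := ~ trace C a /\ winding C a = 0.

Definition is_contour C : Prop :=
  [/\ forall k, piecewise_C1 (curve_of (c := C) k) /\ curve_of (c := C) k 0 = curve_of k 1,
      forall (k k' : 'I_(ncurves C)) (s s' : R), 0 <= s < 1 -> 0 <= s' < 1 ->
        curve_of k s = curve_of k' s' -> k = k' /\ s = s',
      forall z, trace C z -> z != 0 &
      forall a, [\/ trace C a, inside C a | outside C a]].

(* Iterated integral of phi over C^n against prod_i dz_i / (2 pi i z_i). *)
Fixpoint torus_integral C (n : nat) : ('rV[R[i]]_n -> R[i]) -> R[i] :=
  match n with
  | 0 => fun phi => phi 0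
  | m.+1 => fun phi =>
      contour_integral C (fun z =>
        @torus_integral C m (fun v : 'rV[R[i]]_m => phi (row_mx z%:M v))
        / (two_pi_i * z))
  end.

(* A contour containing C' contains the curves of C' and all the points they
   enclose; this matters when the contour is not connected. *)
Definition admissible_contour (n : nat)
    (t0 t1 t2 t3 u0 u1 t p q : R[i]) (f g : 'rV[R[i]]_n -> R[i]) C : Prop :=
  is_contour C /\ (forall z, trace C z -> trace C z^-1) /\
  exists l m l' m' : nat,
    [/\ is_holomorphic (fun z => pole_factor u0 p q l m z * f z),
        is_holomorphic (fun z => pole_factor u1 p q l' m' z * g z) &
        forall i j : nat,
          (forall a, a \in [:: p ^+ i * q ^+ j * t0; p ^+ i * q ^+ j * t1;
                       p ^+ i * q ^+ j * t2; p ^+ i * q ^+ j * t3;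
                       p ^ (i%:Z - l%:Z) * q ^ (j%:Z - m%:Z) * u0;
                       p ^ (i%:Z - l'%:Z) * q ^ (j%:Z - m'%:Z) * u1] ->
             inside C a /\ outside C a^-1) /\
          (forall z, trace C z \/ inside C z ->
             inside C (p ^+ i * q ^+ j * t * z))].

Definition selberg_norm (n : nat) (T : 6.-tuple R[i]) (t p q : R[i]) : R[i] :=
  2 ^+ n * n`!%:R /
    (pochhammer p ^+ n * pochhammer q ^+ n * ellGamma t p q ^+ n) *
  \prod_(1 <= i < n.+1)
    (ellGamma (t ^+ i) p q *
     \prod_(r < 6) \prod_(s < 6 | (r < s)%N)
       ellGamma (t ^+ (n - i) * tnth T r * tnth T s) p q).

Definition selberg_density (n : nat) (T : 6.-tuple R[i]) (t p q : R[i])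
    (z : 'rV[R[i]]_n) : R[i] :=
  (\prod_(i < n) \prod_(j < n | (i < j)%N) \prod_(e : bool) \prod_(e' : bool)
     (ellGamma (t * z 0 i ^ sg e * z 0 j ^ sg e') p q
      / ellGamma (z 0 i ^ sg e * z 0 j ^ sg e') p q)) *
  \prod_(i < n) \prod_(e : bool)
     ((\prod_(r < 6) ellGamma (tnth T r * z 0 i ^ sg e) p q)
      / ellGamma (z 0 i ^ (2 * sg e)) p q).

Definition scalar_product (n : nat) (t0 t1 t2 t3 u0 u1 t p q : R[i]) C
    (f g : 'rV[R[i]]_n -> R[i]) : R[i] :=
  let T := [tuple t0; t1; t2; t3; u0; u1] in
  (selberg_norm n T t p q)^-1 *
  torus_integral C (fun z => f z * g z * selberg_density T t p q z).

(* Explicit genericity: the gamma factors at products of two parameters have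
   no zero or pole, nor do the theta denominators of the difference
   operators vanish, and no two of the points to be separated by a contour
   collide. *)
Definition generic_params (t0 t1 t2 t3 u0 u1 t p q : R[i]) : Prop :=
  let T := [tuple t0; t1; t2; t3; u0; u1] in
  forall (r s : 'I_6) (i j k : int),
    tnth T r * tnth T s != p ^ i * q ^ j * t ^ k.

End Contours.

(* Main.v *)
(* Both scalar products are integrals of sums over sign vectors.  By the
   symmetry z_i -> 1/z_i each equals 2^n times the integral of one term of its
   sum, and after w = q^(1/2) z the two terms are the same meromorphic function
   Phi, the normalisations agreeing by Gamma(qx) = theta(x;p) Gamma(x).  What
   remains is that the two contours give the same integral of Phi.  A contour
   C = C^-1 encloses exactly one of z and 1/z (a parity argument), so by Cauchy's
   theorem it may be replaced by the boundary of a region made of small grid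
   cells.  Two regions that contain the required points and their own multiples
   by p^i q^j t are joined by flipping one cell at a time (drop the cell of
   largest modulus, or add the one of smallest), which keeps these conditions and
   hence crosses no pole of Phi.  Identities of meromorphic functions are only
   claimed off sets with countable slices, which integrals do not see. *)
Require Import Defs.
From HB Require Import structures.
From mathcomp Require Import all_boot all_order all_algebra.
From mathcomp Require Import all_fingroup.
From mathcomp Require Import all_classical all_reals all_analysis.
From mathcomp Require Import measurable_realfun.
From mathcomp Require Import complex.
From mathcomp Require Import ring lra zify.
Set Implicit Arguments.
Unset Strict Implicit.
Unset Printing Implicit Defensive.
Import Order.TTheory GRing.Theory Num.Theory.
Import numFieldNormedType.Exports.
Local Open Scope classical_set_scope.
Local Open Scope ring_scope.
Local Notation Re := complex.Re.
Local Notation Im := complex.Im.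

(** The obstacle is that a single summand has more poles than the integrand. The contour given for
    [Df] is only assumed to separate the poles recorded for [Df] and [g], while each summand carries
    the poles of [f] at shifted points. So the contour is first moved, with the whole integrand on
    it, to the boundary of an explicit region ([star_region]) that separates every pole in play, and
    only there is the sum split. Inversion exchanges that region exactly with its complement, which
    is why all 2^n summands have the same integral. The explicit regions of the two sides differ by
    the factor q^(1/2). They can be compared because, in the product x y of two variables, the
    chosen summand has poles only at x y = m and q m x y = 1 with m = t p^i q^j, and both regions
    exclude these; the parameter [kappa], equal to 1 or q, keeps track of this. Integration over a
    chain enters as an abstract functional ([cyc]), so that curves, grid boundaries and their images
    under inversion and scaling obey the same lemmas and can be exchanged one variable at a time. *)

Section Modulus.
Variable R : realType.
Local Notation C := R[i].
Implicit Types z w : C.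

(** A real-valued modulus: the norm of [R[i]] takes values in the partially ordered [R[i]], where
    neither totality nor [lra] can be used. *)
Definition nm z : R := ComplexField.Normc.normc z.

Lemma normE z : `|z| = (nm z)%:C%C.
Proof. by rewrite normc_def /nm /=; case: z. Qed.

Lemma nmE z : nm z = Num.sqrt (Re z ^+ 2 + Im z ^+ 2).
Proof. by case: z. Qed.

Lemma nm_ge0 z : 0 <= nm z. Proof. by rewrite nmE sqrtr_ge0. Qed.
Lemma nmM z w : nm (z * w) = nm z * nm w. Proof. exact: ComplexField.Normc.normcM. Qed.
Lemma nmD z w : nm (z + w) <= nm z + nm w. Proof. exact: le_normcD. Qed.
Lemma nmN z : nm (- z) = nm z. Proof. exact: normcN. Qed.
Lemma nmV z : nm z^-1 = (nm z)^-1. Proof. exact: ComplexField.Normc.normcV. Qed.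
Lemma nm0 : nm 0 = 0. Proof. exact: ComplexField.Normc.normc0. Qed.
Lemma nm1 : nm 1 = 1. Proof. exact: ComplexField.Normc.normc1. Qed.
Lemma nm_eq0 z : (nm z == 0) = (z == 0).
Proof. by apply/eqP/eqP => [|->]; [exact: ComplexField.Normc.eq0_normc|exact: nm0]. Qed.
Lemma nm_gt0 z : (0 < nm z) = (z != 0).
Proof. by rewrite lt_neqAle nm_ge0 andbT eq_sym nm_eq0. Qed.
Lemma nmB z w : nm (z - w) <= nm z + nm w.
Proof. by rewrite -(nmN w); exact: nmD. Qed.
Lemma nm_sub z w : nm (z - w) = nm (w - z).
Proof. by rewrite -nmN opprB. Qed.
Lemma nm_tri z w y : nm (z - y) <= nm (z - w) + nm (w - y).
Proof. by rewrite (le_trans _ (nmD _ _))// (_ : _ - y = z - w + (w - y))//; ring. Qed.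
Lemma nm_subge z w : nm z - nm w <= nm (z - w).
Proof. by rewrite lerBlDr (le_trans _ (nmD _ _))// subrK. Qed.
Lemma nm_addge z w : nm z - nm w <= nm (z + w).
Proof. by have := nm_subge z (- w); rewrite nmN opprK. Qed.
Lemma nmX z n : nm (z ^+ n) = nm z ^+ n.
Proof. by elim: n => [|n IH]; rewrite ?expr0 ?nm1// !exprS nmM IH. Qed.
Lemma nm_real (x : R) : nm (x%:C%C) = `|x|.
Proof. by rewrite nmE /= expr0n addr0 sqrtr_sqr. Qed.
Lemma nm_i : nm ('i%C : C) = 1.
Proof. by rewrite nmE /= expr0n expr1n add0r sqrtr1. Qed.
Lemma nm_Re z : `|Re z| <= nm z.
Proof. by rewrite nmE -sqrtr_sqr ler_wsqrtr// lerDl sqr_ge0. Qed.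
Lemma nm_Im z : `|Im z| <= nm z.
Proof. by rewrite nmE -sqrtr_sqr ler_wsqrtr// lerDr sqr_ge0. Qed.
Lemma nm_le z : nm z <= `|Re z| + `|Im z|.
Proof.
rewrite nmE -(@ger0_norm _ (`|_| + _)) ?addr_ge0// -sqrtr_sqr ler_wsqrtr//.
rewrite sqrrD !real_normK ?num_real// lerD2r lerDl.
by rewrite mulrn_wge0// mulr_ge0.
Qed.
Lemma nm_sum (I : Type) (r : seq I) (P : pred I) (F : I -> C) :
  nm (\sum_(i <- r | P i) F i) <= \sum_(i <- r | P i) nm (F i).
Proof.
elim/big_rec2: _ => [|i y1 y2 _ H]; first by rewrite nm0.
by rewrite (le_trans (nmD _ _))// lerD2l.
Qed.
Lemma nm_prod (I : Type) (r : seq I) (P : pred I) (F : I -> C) :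
  nm (\prod_(i <- r | P i) F i) = \prod_(i <- r | P i) nm (F i).
Proof. by rewrite (big_morph nm nmM nm1). Qed.

Lemma nm_eq0_all z : (forall e, 0 < e -> nm z < e) -> z = 0.
Proof.
move=> H; apply/eqP; rewrite -nm_eq0 eq_le nm_ge0 andbT leNgt.
by apply/negP => /H; rewrite ltxx.
Qed.

(** Many limiting arguments below end in this form, with an error bounded by a fixed multiple of an
    arbitrary [e]. No sign of [B] is required. *)
Lemma nm_eq0_le z (B : R) : (forall e, 0 < e -> nm z <= B * e) -> z = 0.
Proof.
move=> H; apply: nm_eq0_all => e e0.
have B1 : 0 < `|B| + 1 by rewrite ltr_wpDl.
have := H (e / (`|B| + 1)) (divr_gt0 e0 B1).
move/le_lt_trans; apply; rewrite mulrA ltr_pdivrMr// mulrC ltr_pM2l//.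
by rewrite (le_lt_trans (ler_norm _))// ltrDl.
Qed.

Lemma ReD z w : Re (z + w) = Re z + Re w.
Proof. by case: z; case: w. Qed.
Lemma ImD z w : Im (z + w) = Im z + Im w.
Proof. by case: z; case: w. Qed.
Lemma ReN z : Re (- z) = - Re z. Proof. by case: z. Qed.
Lemma ImN z : Im (- z) = - Im z. Proof. by case: z. Qed.
Lemma ReM z w : Re (z * w) = Re z * Re w - Im z * Im w.
Proof. by case: z; case: w. Qed.
Lemma ImM z w : Im (z * w) = Re z * Im w + Im z * Re w.
Proof. by case: z => a b; case: w => c d /=; rewrite addrC. Qed.
Lemma ceqP z w : Re z = Re w -> Im z = Im w -> z = w.
Proof. by case: z => a b; case: w => c d /= -> ->. Qed.

Lemma unit_neq0 z : 0 < nm z < 1 -> z != 0.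
Proof. by rewrite -nm_gt0 => /andP[]. Qed.

Lemma unit_lt1 z : 0 < nm z < 1 -> nm z < 1.
Proof. by case/andP. Qed.

Lemma sqrt_neq0 z w : 0 < nm w < 1 -> z ^+ 2 = w -> z != 0.
Proof. by move=> /unit_neq0 w0 e; apply: contraTneq w0 => z0; rewrite -e z0 expr0n eqxx. Qed.

End Modulus.

(** * Integrals of complex functions over a real segment *)

Section IntervalIntegral.
Variable R : realType.
Local Notation C := R[i].
Local Notation mu := (@lebesgue_measure R).
Implicit Types (a b c : R) (f g : R -> C).

Definition ig a b f : C :=
  ((\int[mu]_(s in `[a, b]) Re (f s))%R +i*
   (\int[mu]_(s in `[a, b]) Im (f s))%R)%C.

(** Boundedness is asked for instead of integrability because it is stable under products ([bmM]);
    on a segment it makes both parts integrable. *)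
Definition bm a b f :=
  [/\ measurable_fun `[a, b] (fun s => Re (f s)),
      measurable_fun `[a, b] (fun s => Im (f s)) &
      exists B, forall s, a <= s <= b -> nm (f s) <= B].

Definition contR a b f := forall s, a <= s <= b -> forall e, 0 < e ->
  exists2 d, 0 < d & forall r, a <= r <= b -> `|r - s| < d -> nm (f r - f s) < e.

Lemma bounded_mint a b (u : R -> R) (B : R) :
  measurable_fun `[a, b] u -> (forall s, a <= s <= b -> `|u s| <= B) ->
  mu.-integrable `[a, b] (EFin \o u).
Proof.
move=> mu_ uB; apply: measurable_bounded_integrable => //.
  by rewrite /= lebesgue_measure_itv/=; case: ifP => // _; rewrite -EFinD ltry.
exists B; split; first exact: num_real.
by move=> M BM s /=; rewrite in_itv/= => /uB /le_trans; apply; exact: ltW.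
Qed.

Lemma bm_Re a b f : bm a b f -> mu.-integrable `[a, b] (EFin \o (fun s => Re (f s))).
Proof.
by move=> [mr mi [B H]]; apply: (bounded_mint mr) => s /H; apply: le_trans; exact: nm_Re.
Qed.

Lemma bm_Im a b f : bm a b f -> mu.-integrable `[a, b] (EFin \o (fun s => Im (f s))).
Proof.
by move=> [mr mi [B H]]; apply: (bounded_mint mi) => s /H; apply: le_trans; exact: nm_Im.
Qed.

Lemma eq_bm a b f g : (forall s, a <= s <= b -> f s = g s) -> bm a b f -> bm a b g.
Proof.
move=> fg [mr mi [B H]]; split.
- by apply: eq_measurable_fun mr => s; rewrite inE/= in_itv/= => /fg ->.
- by apply: eq_measurable_fun mi => s; rewrite inE/= in_itv/= => /fg ->.
- by exists B => s sab; rewrite -fg// H.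
Qed.

Lemma eq_ig a b f g : (forall s, a <= s <= b -> f s = g s) -> ig a b f = ig a b g.
Proof.
by move=> fg; congr Complex; apply: eq_Rintegral => s; rewrite inE/= in_itv/= => /fg ->.
Qed.

Lemma bmD a b f g : bm a b f -> bm a b g -> bm a b (fun s => f s + g s).
Proof.
move=> [mr mi [B H]] [mr' mi' [B' H']]; split.
- apply: (eq_measurable_fun (fun s => Re (f s) + Re (g s))).
    by move=> s _; rewrite ReD.
  exact: measurable_funD.
- apply: (eq_measurable_fun (fun s => Im (f s) + Im (g s))).
    by move=> s _; rewrite ImD.
  exact: measurable_funD.
- by exists (B + B') => s sab; rewrite (le_trans (nmD _ _))// lerD// ?H// H'.
Qed.

Lemma bmM a b f g : bm a b f -> bm a b g -> bm a b (fun s => f s * g s).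
Proof.
move=> [mr mi [B H]] [mr' mi' [B' H']]; split.
- apply: (eq_measurable_fun (fun s => Re (f s) * Re (g s) -
    Im (f s) * Im (g s))); first by move=> s _; rewrite ReM.
  by apply: measurable_funB; exact: measurable_funM.
- apply: (eq_measurable_fun (fun s => Re (f s) * Im (g s) +
    Im (f s) * Re (g s))); first by move=> s _; rewrite ImM.
  by apply: measurable_funD; exact: measurable_funM.
- exists (B * B') => s sab; rewrite nmM ler_pM ?nm_ge0// ?H// H'//.
Qed.

Lemma bm_cst a b (k : C) : bm a b (fun=> k).
Proof. by split; [exact: measurable_cst|exact: measurable_cst|exists (nm k)]. Qed.

Lemma bmZ a b (k : C) f : bm a b f -> bm a b (fun s => k * f s).
Proof. by move=> H; apply: bmM => //; exact: bm_cst. Qed.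

Lemma bmN a b f : bm a b f -> bm a b (fun s => - f s).
Proof. by move=> /(bmZ (-1)); apply: eq_bm => s _; rewrite mulN1r. Qed.

Lemma contR_within a b f (h : C -> R) : (forall z w, `|h z - h w| <= nm (z - w)) ->
  contR a b f -> {within `[a, b], continuous (fun s => h (f s))}.
Proof.
move=> hl fc; apply/subspace_continuousP => s; rewrite /= in_itv/= => sab.
apply/cvgrPdist_lt => e e0; have [d d0 H] := fc s sab e e0.
apply/nbhs_ballP; exists d => //= r /= sr; rewrite in_itv/= => rab.
apply: le_lt_trans (H r rab _); first by rewrite distrC; exact: hl.
by rewrite distrC.
Qed.

Lemma contR_bounded a b f : contR a b f -> exists B, forall s, a <= s <= b -> nm (f s) <= B.
Proof.
move=> fc; have [ab|ba] := leP a b; last first.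
  by exists 0 => s /andP[/le_trans H /H]; rewrite leNgt ba.
have hc : {within `[a, b], continuous (fun s => nm (f s))}.
  apply: contR_within fc => z w; rewrite ler_norml; apply/andP; split.
    by rewrite lerNl opprB nm_sub nm_subge.
  exact: nm_subge.
have [x xab H] := EVT_max ab hc.
by exists (nm (f x)) => s sab; apply: H; rewrite in_itv.
Qed.
Lemma Re_lip (z w : C) : `|Re z - Re w| <= nm (z - w).
Proof. by rewrite -ReN -ReD nm_Re. Qed.
Lemma Im_lip (z w : C) : `|Im z - Im w| <= nm (z - w).
Proof. by rewrite -ImN -ImD nm_Im. Qed.

Lemma contR_bm a b f : contR a b f -> bm a b f.
Proof.
move=> fc; split; last exact: contR_bounded.
- by apply: subspace_continuous_measurable_fun => //; exact: contR_within (@Re_lip) fc.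
- by apply: subspace_continuous_measurable_fun => //; exact: contR_within (@Im_lip) fc.
Qed.

Lemma igD a b f g : bm a b f -> bm a b g ->
  ig a b (fun s => f s + g s) = ig a b f + ig a b g.
Proof.
move=> hf hg; apply: ceqP; rewrite ?ReD ?ImD /=.
- rewrite -RintegralD//; [|exact: bm_Re|exact: bm_Re].
  by apply: eq_Rintegral => s _; rewrite ReD.
- rewrite -RintegralD//; [|exact: bm_Im|exact: bm_Im].
  by apply: eq_Rintegral => s _; rewrite ImD.
Qed.

Lemma igZ a b (k : C) f : bm a b f -> ig a b (fun s => k * f s) = k * ig a b f.
Proof.
move=> hf; have hr := bm_Re hf; have hi := bm_Im hf.
have iZ (r : R) u : mu.-integrable `[a, b] (EFin \o u) ->
    mu.-integrable `[a, b] (EFin \o (fun s => r * u s)).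
  move=> iu; have := @integrableZl _ _ _ mu _ (measurable_itv `[a, b]) r _ iu.
  by apply: eq_integrable => //= s _; rewrite EFinM.
apply: ceqP; rewrite ?ReM ?ImM /=.
- rewrite -!RintegralZl// -RintegralB//; try exact: iZ.
  by apply: eq_Rintegral => s _; rewrite ReM.
- rewrite -!RintegralZl// -RintegralD//; try exact: iZ.
  by apply: eq_Rintegral => s _; rewrite ImM.
Qed.

Lemma igN a b f : bm a b f -> ig a b (fun s => - f s) = - ig a b f.
Proof.
by move=> hf; rewrite -mulN1r -igZ//; apply: eq_ig => s _; rewrite mulN1r.
Qed.

(** The factor 2 comes from estimating the real and imaginary parts separately. *)
Lemma ig_bound a b f (B : R) : a <= b -> bm a b f ->
  (forall s, a <= s <= b -> nm (f s) <= B) -> nm (ig a b f) <= 2 * B * (b - a).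
Proof.
move=> ab hf fB.
have Rb u : mu.-integrable `[a, b] (EFin \o u) ->
    (forall s, a <= s <= b -> `|u s| <= B) ->
    `|\int[mu]_(s in `[a, b]) u s| <= B * (b - a).
  move=> iu uB; rewrite (le_trans (le_normr_Rintegral _ iu))//.
  have -> : B * (b - a) = \int[mu]_(s in `[a, b]) (cst B) s.
    rewrite Rintegral_cst//= lebesgue_measure_itv/= lte_fin.
    case: ltP => //= ba; suff -> : b = a by rewrite subrr.
    by apply/eqP; rewrite eq_le ab ba.
  apply: le_Rintegral => //.
  - exact: (@integrable_norm _ _ _ mu _ _ iu).
  - by apply: (@bounded_mint _ _ _ `|B|) => //; exact: measurable_cst.
rewrite (le_trans (nm_le _))//= -mulrA mulr_natl mulr2n lerD//.
- apply: Rb; first exact: bm_Re.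
  by move=> s /fB; apply: le_trans; exact: nm_Re.
- apply: Rb; first exact: bm_Im.
  by move=> s /fB; apply: le_trans; exact: nm_Im.
Qed.

Lemma bm_sub a b c d f : a <= c -> d <= b -> bm a b f -> bm c d f.
Proof.
move=> ac db [mr mi [B H]].
have sub : `[c, d] `<=` `[a, b]%classic.
  move=> s /=; rewrite !in_itv/= => /andP[cs sd].
  by rewrite (le_trans ac cs) (le_trans sd db).
split; [exact: measurable_funS mr|exact: measurable_funS mi|].
by exists B => s /andP[cs sd]; rewrite H// (le_trans ac cs) (le_trans sd db).
Qed.

Lemma ig_split a b c f : a <= b -> b <= c -> bm a c f ->
  ig a c f = ig a b f + ig b c f.
Proof.
move=> ab bc hf.
have key u : mu.-integrable `[a, c] (EFin \o u) ->
    \int[mu]_(s in `[a, c]) u s = \int[mu]_(s in `[a, b]) u s + \int[mu]_(s in `[b, c]) u s.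
  move=> iu; have := @Rintegral_itvB R u (BLeft a) (BRight c) b iu.
  rewrite !bnd_simp => /(_ ab bc).
  rewrite Rintegral_itv_obnd_cbnd; last first.
    apply: integrableS iu => //; apply: subset_itvr; rewrite bnd_simp//.
  by move=> <-; rewrite addrC subrK.
apply: ceqP; rewrite ?ReD ?ImD /=; apply: key; [exact: bm_Re|exact: bm_Im].
Qed.

Lemma ig_point a f : ig a a f = 0.
Proof. by rewrite /ig set_itv1 !Rintegral_set1. Qed.

(** No regularity of [f] is assumed: its preimages differ from those of [g] by subsets of the
    countable set [D], and these are all measurable. Values at poles and at break points of curves
    thereby become irrelevant. *)
Lemma eq_countable_ig a b f g (D : set R) : bm a b g -> countable D ->
  (forall s, a <= s <= b -> ~ D s -> f s = g s) -> ig a b f = ig a b g.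
Proof.
move=> bg cD fg.
have key u v : measurable_fun `[a, b] v ->
   (forall s, a <= s <= b -> ~ D s -> u s = v s) ->
   \int[mu]_(s in `[a, b]) u s = \int[mu]_(s in `[a, b]) v s.
  move=> mv uv; congr fine.
  have cm (A : set R) : A `<=` D -> measurable A.
    by move=> AD; apply: countable_measurable => //; apply: sub_countable cD; exact: subset_card_le.
  apply: ae_eq_integral => //.
  - apply/measurable_EFinP => _ Y mY.
    rewrite (_ : _ `&` _ = (((`[a, b] `&` v @^-1` Y) `\` D) `|`
        ((`[a, b] `&` u @^-1` Y) `&` D))).
      apply: measurableU; last by apply: cm => s [].
      by apply: measurableD; [exact: mv|exact: cm].
    apply/seteqP; split=> s /=; rewrite in_itv/=.
      by move=> [sab us]; have [Ds|nDs] := pselect (D s); [right|left; rewrite -uv].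
    by case=> [[[sab vs] nDs]|[]//]; rewrite uv.
  - by apply/measurable_EFinP.
  - exists D; split; first exact: cm.
      exact: countable_lebesgue_measure0.
    move=> s /= H; apply: contrapT => nDs; apply: H; rewrite in_itv/= => sab.
    by rewrite uv.
case: bg => mr mi _; congr Complex; apply: key => // s sab nDs; by rewrite fg.
Qed.

End IntervalIntegral.

(** * Integration over compact chains as abstract functionals *)

Section Functionals.
Variable R : realType.
Local Notation C := R[i].
Implicit Types (T : set C) (J : (C -> C) -> C) (f g : C -> C).

Definition contT T f := forall x, T x -> forall e, 0 < e ->
  exists2 d, 0 < d & forall y, T y -> nm (y - x) < d -> nm (f y - f x) < e.

(* Every gauge on T has a finite subcover: compactness of T, stated so that
   no topology on the complex numbers is needed. *)
Definition gcompact T := forall d : C -> R, (forall x, T x -> 0 < d x) ->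
  exists s : seq C, (forall x, x \in s -> T x) /\
    (forall y, T y -> exists2 x, x \in s & nm (y - x) < d x).

(** An integral over a chain supported on the compact set [T], reduced to the properties used later.
    [J] accepts every function, but is linear and bounded only on those continuous on [T]. In
    [cyc_countable] the function [f] is arbitrary, so that identities valid off a countable set can
    be used under [J]. *)
Record cyc T J : Prop := Cyc {
  cyc_compact : gcompact T;
  cyc_lin : forall a f g, contT T f -> contT T g ->
    J (fun z => a * f z + g z) = a * J f + J g;
  cyc_bound : exists2 L, 0 <= L & forall f B, 0 <= B -> contT T f ->
    (forall z, T z -> nm (f z) <= B) -> nm (J f) <= L * B;
  cyc_ext : forall f g, (forall z, T z -> f z = g z) -> J f = J g;
  cyc_countable : forall f g (D : set C), contT T g -> countable D ->
    (forall z, T z -> ~ D z -> f z = g z) -> J f = J g }.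

Lemma contT_cst T k : contT T (fun=> k).
Proof. by move=> x _ e e0; exists 1 => // y _ _; rewrite subrr nm0. Qed.

Lemma contT_id T : contT T (fun z => z).
Proof. by move=> x _ e e0; exists e. Qed.

Lemma eq_contT T f g : (forall z, T z -> f z = g z) -> contT T f -> contT T g.
Proof.
move=> fg fc x Tx e e0; have [d d0 H] := fc x Tx e e0.
by exists d => // y Ty yx; rewrite -!fg//; exact: H.
Qed.

Lemma sub_contT T T' f : T `<=` T' -> contT T' f -> contT T f.
Proof.
move=> TT' fc x /TT' Tx e e0; have [d d0 H] := fc x Tx e e0.
by exists d => // y /TT' Ty; exact: H.
Qed.

Lemma contT_D T f g : contT T f -> contT T g -> contT T (fun z => f z + g z).
Proof.
move=> fc gc x Tx e e0; have e2 : 0 < e / 2 by rewrite divr_gt0.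
have [d d0 H] := fc x Tx _ e2; have [d' d'0 H'] := gc x Tx _ e2.
exists (Num.min d d'); first by rewrite lt_min d0.
move=> y Ty; rewrite lt_min => /andP[h1 h2].
rewrite opprD addrACA (le_lt_trans (nmD _ _))// (splitr e) ltrD//; [exact: H|exact: H'].
Qed.

(** One choice of a small number that serves all cross terms of the product and chain rules, in a
    form that [lra] can use. *)
Lemma small_tolerance (e K : R) : 0 < e -> 0 <= K ->
  exists e1 : R, [/\ 0 < e1, e1 <= 1 & e1 * (K + 1) <= e / 2].
Proof.
move=> e0 K0; have K1 : 0 < 2 * (K + 1) by lra.
exists (Num.min 1 (e / (2 * (K + 1)))).
rewrite lt_min ltr01 divr_gt0// ge_min lexx; split=> //.
suff : Num.min 1 (e / (2 * (K + 1))) * (2 * (K + 1)) <= e by lra.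
by rewrite -ler_pdivlMr// ge_min lexx orbT.
Qed.

Lemma mul_close (a b : C) (e : R) : 0 < e -> exists2 d, 0 < d &
  forall x y, nm (x - a) < d -> nm (y - b) < d -> nm (x * y - a * b) < e.
Proof.
move=> e0; have [d [d0 d1 dK]] := small_tolerance e0 (addr_ge0 (nm_ge0 a) (nm_ge0 b)).
exists d => // x y; set u := x - a; set v := y - b => hu hv.
have -> : x * y - a * b = u * v + u * b + a * v by rewrite /u /v; ring.
have := nmD (u * v + u * b) (a * v); have := nmD (u * v) (u * b); rewrite !nmM.
have : nm u * nm v <= 1 * nm v by rewrite ler_wpM2r ?nm_ge0//; lra.
have : nm u * nm b <= d * nm b by rewrite ler_wpM2r ?nm_ge0// ltW.
have : nm a * nm v <= nm a * d by rewrite ler_wpM2l ?nm_ge0// ltW.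
lra.
Qed.

Lemma contT_M T f g : contT T f -> contT T g -> contT T (fun z => f z * g z).
Proof.
move=> fc gc x Tx e /(mul_close (f x) (g x))[r r0 Hr].
have [d d0 H] := fc x Tx _ r0; have [d' d'0 H'] := gc x Tx _ r0.
exists (Num.min d d'); first by rewrite lt_min d0.
by move=> y Ty; rewrite lt_min => /andP[h1 h2]; apply: Hr; [exact: H|exact: H'].
Qed.

Lemma contT_V T f : (forall z, T z -> f z != 0) -> contT T f -> contT T (fun z => (f z)^-1).
Proof.
move=> f0 fc x Tx e e0; have fx0 := f0 _ Tx.
have n0 : 0 < nm (f x) by rewrite nm_gt0.
pose e' := Num.min (nm (f x) / 2) (e * nm (f x) ^+ 2 / 2).
have e'0 : 0 < e' by rewrite lt_min !divr_gt0// mulr_gt0// exprn_gt0.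
have [d d0 H] := fc x Tx _ e'0; exists d => // y Ty /(H y Ty) h.
have fy0 := f0 _ Ty.
have h1 : nm (f x) / 2 <= nm (f y).
  have : nm (f y - f x) < nm (f x) / 2 by rewrite (lt_le_trans h)// /e' ge_min lexx.
  have := nm_subge (f x) (f y); rewrite nm_sub; lra.
have -> : (f y)^-1 - (f x)^-1 = - (f y - f x) / (f y * f x) by field; rewrite fy0 fx0.
rewrite nmM nmN nmV nmM ltr_pdivrMr; last by rewrite mulr_gt0// nm_gt0.
rewrite (lt_le_trans h)// (@le_trans _ _ (e * nm (f x) ^+ 2 / 2))//.
  by rewrite /e' ge_min lexx orbT.
rewrite -mulrA ler_pM2l// expr2 mulrAC ler_pM2r//.
Qed.

Lemma contT_sum (I : Type) (r : seq I) (P : pred I) (F : I -> C -> C) T :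
  (forall i, P i -> contT T (F i)) -> contT T (fun z => \sum_(i <- r | P i) F i z).
Proof.
move=> H; elim: r => [|i r IH].
  by apply: eq_contT (@contT_cst T 0) => z _; rewrite big_nil.
have [Pi|nPi] := boolP (P i).
  by apply: eq_contT (contT_D (H i Pi) IH) => z _; rewrite big_cons Pi.
by apply: eq_contT IH => z _; rewrite big_cons (negbTE nPi).
Qed.

Lemma real_complexB (x y : R) : x%:C%C - y%:C%C = (x - y)%:C%C.
Proof. by rewrite -rmorphB. Qed.

Section Cyc.
Variables (T : set C) (J : (C -> C) -> C).
Hypothesis cJ : cyc T J.

Lemma cyc0 : J (fun=> 0) = 0.
Proof.
have := cyc_lin cJ (-1) (@contT_cst T 0) (@contT_cst T 0).
move=> H; have E : J (fun=> 0) = J (fun=> -1 * 0 + 0).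
  by apply: (cyc_ext cJ) => z _; rewrite mulr0 addr0.
by rewrite E H mulN1r addNr.
Qed.

Lemma cycD f g : contT T f -> contT T g -> J (fun z => f z + g z) = J f + J g.
Proof.
move=> fc gc; rewrite -[J f]mul1r -(cyc_lin cJ)//.
by apply: (cyc_ext cJ) => z _; rewrite mul1r.
Qed.

Lemma cycZ a f : contT T f -> J (fun z => a * f z) = a * J f.
Proof.
move=> fc; rewrite -[RHS]addr0 -cyc0 -(cyc_lin cJ)//; last exact: contT_cst.
by apply: (cyc_ext cJ) => z _; rewrite addr0.
Qed.

Lemma cycB f g : contT T f -> contT T g -> J (fun z => f z - g z) = J f - J g.
Proof.
move=> fc gc; rewrite [RHS]addrC -mulN1r -(cyc_lin cJ)//.
by apply: (cyc_ext cJ) => z _; rewrite mulN1r addrC.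
Qed.

Lemma cyc_sum (I : Type) (r : seq I) (P : pred I) (F : I -> C -> C) :
  (forall i, P i -> contT T (F i)) ->
  J (fun z => \sum_(i <- r | P i) F i z) = \sum_(i <- r | P i) J (F i).
Proof.
move=> H; elim: r => [|i r IH].
  rewrite [RHS]big_nil; transitivity (J (fun=> 0)); last exact: cyc0.
  by apply: (cyc_ext cJ) => z _; rewrite big_nil.
rewrite [RHS]big_cons -IH; case: ifP => Pi.
  rewrite -cycD; [|exact: H|exact: contT_sum].
  by apply: (cyc_ext cJ) => z _; rewrite big_cons Pi.
by apply: (cyc_ext cJ) => z _; rewrite big_cons Pi.
Qed.

End Cyc.

Definition hat (d : R) (c z : C) : C := (Num.max 0 (d - nm (z - c)))%:C%C.

Lemma contT_hat T d c : contT T (hat d c).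
Proof.
move=> x Tx e e0; exists e => // y Ty yx; rewrite /hat real_complexB nm_real.
apply: le_lt_trans yx.
have h1 := nm_tri y x c; have h2 := nm_tri x y c; rewrite (nm_sub x y) in h2.
by rewrite ler_norml; do 2 case: (leP 0) => ?; apply/andP; split; lra.
Qed.

(** Tents of radius [d] over a finite [d]-net, divided by their sum. The last clause is a convexity
    bound: at [z] only the nodes within [d] carry weight, so a weighted mean of the [h k] is bounded
    as soon as those nearby are. *)
Lemma partition_of_unity T d : gcompact T -> 0 < d ->
  exists (N : nat) (x : 'I_N -> C) (u : 'I_N -> C -> C),
   [/\ forall k, T (x k), forall k, contT T (u k),
    forall z, T z -> \sum_k u k z = 1 &
    forall z (h : 'I_N -> C) B, T z -> 0 <= B ->
     (forall k, nm (z - x k) < d -> nm (h k) <= B) -> nm (\sum_k u k z * h k) <= B].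
Proof.
move=> gT d0; have [s [sT scov]] := gT (fun=> d) (fun _ _ => d0).
pose x (k : 'I_(size s)) := nth 0 s k.
pose S z := \sum_k hat d (x k) z.
have hge z k : 0 <= Re (hat d (x k) z) by rewrite /= le_max lexx.
have SE z : S z = (\sum_k Re (hat d (x k) z))%:C%C.
  by rewrite rmorph_sum /=.
have S0 z : T z -> 0 < \sum_k Re (hat d (x k) z).
  move=> /scov[y ys zy]; have ks : (index y s < size s)%N by rewrite index_mem.
  rewrite (bigD1 (Ordinal ks))//= ltr_pwDl//.
    by rewrite lt_max /x /= nth_index// subr_gt0 zy orbT.
  by apply: sumr_ge0 => k _; exact: hge.
have S1 z : T z -> S z != 0.
  by move=> Tz; rewrite -nm_gt0 SE nm_real normr_gt0 gt_eqF// S0.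
exists (size s), x, (fun k z => hat d (x k) z / S z); split.
- by move=> k; apply: sT; exact: mem_nth.
- move=> k; apply: contT_M; first exact: contT_hat.
  by apply: contT_V => //; apply: contT_sum => i _; exact: contT_hat.
- by move=> z Tz; rewrite -mulr_suml divff// S1.
- move=> z h B Tz B0 hB; rewrite (le_trans (nm_sum _ _ _))//.
  under eq_bigr => k _ do rewrite nmM nmM nmV SE !nm_real -mulrA mulrCA.
  rewrite -mulr_sumr ger0_norm ?(ltW (S0 _ Tz))// mulrC ler_pdivrMr ?S0//.
  rewrite mulr_sumr ler_sum// => k _; rewrite mulrC.
  rewrite /= ger0_norm ?le_max ?lexx//.
  have [h0|h0] := ltP (nm (z - x k)) d; first by rewrite ler_wpM2r ?le_max ?lexx// hB.
  by rewrite (@max_l _ _ 0) ?subr_le0// !mulr0.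
Qed.

Definition UC2 T1 T2 (h : C -> C -> C) := forall e, 0 < e -> exists2 d, 0 < d &
  forall x x' y y', T1 x -> T1 x' -> T2 y -> T2 y' -> nm (x - x') < d -> nm (y - y') < d ->
  nm (h x y - h x' y') < e.

Lemma UC2_l T1 T2 h y : UC2 T1 T2 h -> T2 y -> contT T1 (fun x => h x y).
Proof.
move=> uh Ty x Tx e e0; have [d d0 H] := uh e e0; exists d => // x' Tx' xx'.
by apply: H => //; rewrite subrr nm0.
Qed.

Lemma UC2_r T1 T2 h x : UC2 T1 T2 h -> T1 x -> contT T2 (h x).
Proof.
move=> uh Tx y Ty e e0; have [d d0 H] := uh e e0; exists d => // y' Ty' yy'.
by apply: H => //; rewrite subrr nm0.
Qed.

Lemma UC2_sym T1 T2 h : UC2 T1 T2 h -> UC2 T2 T1 (fun y x => h x y).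
Proof.
move=> uh e e0; have [d d0 H] := uh e e0; exists d => // x x' y y' *; exact: H.
Qed.

Lemma cyc_param T1 T2 J2 h : cyc T2 J2 -> UC2 T1 T2 h -> contT T1 (fun x => J2 (h x)).
Proof.
move=> c2 uh x Tx e e0; have [L L0 HL] := cyc_bound c2.
have L1 : 0 < L + 1 by rewrite ltr_wpDl.
have [d d0 H] := uh (e / (L + 1)) (divr_gt0 e0 L1).
exists d => // y Ty yx; rewrite -(cycB c2); [|exact: UC2_r uh _..].
apply: (@le_lt_trans _ _ (L * (e / (L + 1)))).
  apply: HL; [by rewrite divr_ge0// ltW| |].
    by apply: contT_D; [exact: UC2_r uh _|apply: eq_contT (contT_M (@contT_cst T2 (-1)) (UC2_r uh Tx)) => z _; rewrite mulN1r].
  by move=> z Tz; rewrite ltW// H// subrr nm0.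
by rewrite mulrCA gtr_pMr// ltr_pdivrMr// mul1r ltrDl.
Qed.

Lemma contT_N T f : contT T f -> contT T (fun z => - f z).
Proof. by move=> /(contT_M (@contT_cst T (-1))); apply: eq_contT => z _; rewrite mulN1r. Qed.

Lemma contT_B T f g : contT T f -> contT T g -> contT T (fun z => f z - g z).
Proof. by move=> fc /contT_N; exact: contT_D. Qed.

Lemma contT_Z T a f : contT T f -> contT T (fun z => a * f z).
Proof. by apply: contT_M; exact: contT_cst. Qed.

(** Fubini for abstract functionals. A partition of unity replaces [h z y] by the sum of the
    products [u k z * h (x k) y], uniformly up to [e]. On such a sum both orders give the sum of the
    [J1 (u k) * J2 (h (x k))], and boundedness turns the two errors into multiples of [e]. *)
Lemma cyc_swap T1 J1 T2 J2 h : cyc T1 J1 -> cyc T2 J2 -> UC2 T1 T2 h ->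
  J1 (fun x => J2 (h x)) = J2 (fun y => J1 (fun x => h x y)).
Proof.
move=> c1 c2 uh; apply/eqP; rewrite -subr_eq0; apply/eqP.
have [L1 L10 HL1] := cyc_bound c1; have [L2 L20 HL2] := cyc_bound c2.
have uh' := UC2_sym uh.
apply: (@nm_eq0_le _ _ (L1 * L2 + L2 * L1)) => e e0.
have [d d0 H] := uh e e0.
have [N [x [u [xT uc u1 ub]]]] := partition_of_unity (cyc_compact c1) d0.
have approx z y : T1 z -> T2 y -> nm (h z y - \sum_k u k z * h (x k) y) <= e.
  move=> Tz Ty; rewrite -[h z y]mul1r -(u1 z Tz) mulr_suml -sumrB.
  under eq_bigr => k _ do rewrite -mulrBr.
  apply: ub => //; first exact: ltW.
  by move=> k hk; rewrite ltW// H// subrr nm0.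
have hc1 y : T2 y -> contT T1 (fun z => \sum_k u k z * h (x k) y).
  by move=> Ty; apply: contT_sum => k _; apply: contT_M => //; exact: contT_cst.
have hc2 z : contT T2 (fun y => \sum_k u k z * h (x k) y).
  by apply: contT_sum => k _; apply: contT_Z; exact: UC2_r uh _.
have E12 : J1 (fun z => J2 (fun y => \sum_k u k z * h (x k) y)) =
           \sum_k J1 (u k) * J2 (h (x k)).
  rewrite -[RHS](eq_bigr _ (fun k _ => mulrC _ _)).
  under [RHS]eq_bigr => k _ do rewrite -(cycZ c1)//.
  rewrite -(cyc_sum c1); last by move=> k _; exact: contT_Z.
  apply: (cyc_ext c1) => z _; rewrite (cyc_sum c2).
    by apply: eq_bigr => k _; rewrite (cycZ c2) 1?mulrC//; exact: UC2_r uh _.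
  by move=> k _; apply: contT_Z; exact: UC2_r uh _.
have E21 : J2 (fun y => J1 (fun z => \sum_k u k z * h (x k) y)) =
           \sum_k J1 (u k) * J2 (h (x k)).
  under [RHS]eq_bigr => k _ do (rewrite -(cycZ c2); last exact: UC2_r uh _).
  rewrite -(cyc_sum c2); last by move=> k _; apply: contT_Z; exact: UC2_r uh _.
  apply: (cyc_ext c2) => y Ty; rewrite (cyc_sum c1).
    apply: eq_bigr => k _; rewrite mulrC -(cycZ c1)//.
    by apply: (cyc_ext c1) => z _; rewrite mulrC.
  by move=> k _; apply: contT_M => //; exact: contT_cst.
have P1 : contT T1 (fun z => J2 (fun y => \sum_k u k z * h (x k) y)).
  apply: (@eq_contT _ (fun z => \sum_k J2 (h (x k)) * u k z)).
    move=> z Tz; rewrite (cyc_sum c2).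
      by apply: eq_bigr => k _; rewrite (cycZ c2) 1?mulrC//; exact: UC2_r uh _.
    by move=> k _; apply: contT_Z; exact: UC2_r uh _.
  by apply: contT_sum => k _; exact: contT_Z.
have P2 : contT T2 (fun y => J1 (fun z => \sum_k u k z * h (x k) y)).
  apply: (@eq_contT _ (fun y => \sum_k J1 (u k) * h (x k) y)).
    move=> y Ty; rewrite (cyc_sum c1).
      apply: eq_bigr => k _; rewrite mulrC -(cycZ c1)//.
      by apply: (cyc_ext c1) => z _; rewrite mulrC.
    by move=> k _; apply: contT_M => //; exact: contT_cst.
  by apply: contT_sum => k _; apply: contT_Z; exact: UC2_r uh _.
set A := J1 _; set B := J2 _.
have -> : A - B = (A - \sum_k J1 (u k) * J2 (h (x k))) -
                  (B - \sum_k J1 (u k) * J2 (h (x k))) by ring.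
rewrite {1}(esym E12) (esym E21) mulrDl (le_trans (nmB _ _))// lerD//.
- rewrite -(cycB c1)//; last exact: cyc_param uh.
  rewrite -mulrA; apply: HL1; [by rewrite mulr_ge0// ltW| |].
    by apply: contT_B => //; exact: cyc_param uh.
  move=> z Tz; rewrite -(cycB c2)//; last exact: UC2_r uh _.
  apply: HL2; [exact: ltW| |by move=> y Ty; exact: approx].
  by apply: contT_B => //; exact: UC2_r uh _.
- rewrite -(cycB c2)//; last exact: cyc_param uh'.
  rewrite -mulrA; apply: HL2; [by rewrite mulr_ge0// ltW| |].
    by apply: contT_B => //; exact: cyc_param uh'.
  move=> y Ty; rewrite -(cycB c1)//; [|exact: UC2_l uh _|exact: hc1].
  apply: HL1; [exact: ltW| |by move=> z Tz; exact: approx].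
  by apply: contT_B; [exact: UC2_l uh _|exact: hc1].
Qed.

End Functionals.

(** * Iterated integrals in several variables, and sets they do not see *)

Section IteratedIntegral.
Variable R : realType.
Local Notation C := R[i].
Local Notation fnl := ((C -> C) -> C).
Implicit Types (Ts : nat -> set C) (Js : nat -> fnl).

Definition cns n (x : C) (v : 'rV[C]_n) : 'rV[C]_n.+1 := row_mx x%:M v.

Lemma cns0 n x (v : 'rV[C]_n) : cns x v 0 ord0 = x.
Proof.
transitivity ((x%:M : 'rV[C]_1) 0 (ord0 : 'I_1)); last by rewrite mxE ord1 eqxx mulr1n.
rewrite -(row_mxEl (x%:M : 'rV_1) v 0 (ord0 : 'I_1)).
by congr (row_mx _ _ _ _); exact: val_inj.
Qed.

Lemma cnsS n x (v : 'rV[C]_n) i : cns x v 0 (lift ord0 i) = v 0 i.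
Proof.
rewrite -(row_mxEr (x%:M : 'rV_1) v 0 i).
by congr (row_mx _ _ _ _); exact: val_inj.
Qed.

Lemma cnsE n (z : 'rV[C]_n.+1) : z = cns (z 0 ord0) (\row_i z 0 (lift ord0 i)).
Proof.
apply/rowP => i; case: (unliftP ord0 i) => [j|] ->; last by rewrite cns0.
by rewrite cnsS mxE.
Qed.

(** Unlike in [torus_integral], each coordinate has its own functional, so that these can be
    exchanged one at a time. *)
Fixpoint mint Js n : ('rV[C]_n -> C) -> C :=
  match n with
  | 0 => fun Phi => Phi 0
  | m.+1 => fun Phi => Js 0 (fun x => mint (fun k => Js k.+1) (fun v : 'rV_m => Phi (cns x v)))
  end.

Definition inT Ts n (z : 'rV[C]_n) := forall i : 'I_n, Ts i (z 0 i).

Definition rclose n (d : R) (z w : 'rV[C]_n) := forall i, nm (z 0 i - w 0 i) < d.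

Definition UC Ts n (Phi : 'rV[C]_n -> C) := forall e, 0 < e ->
  exists2 d, 0 < d & forall z w, inT Ts z -> inT Ts w -> rclose d z w ->
    nm (Phi z - Phi w) < e.


Definition contV Ts n (Phi : 'rV[C]_n -> C) := forall z, inT Ts z -> forall e, 0 < e ->
  exists2 d, 0 < d & forall w, inT Ts w -> rclose d w z -> nm (Phi w - Phi z) < e.

Lemma inT0 Ts (z : 'rV[C]_0) : inT Ts z. Proof. by case. Qed.

Lemma inT_cns Ts n x (v : 'rV[C]_n) :
  Ts 0 x -> inT (fun k => Ts k.+1) v -> inT Ts (cns x v).
Proof.
move=> Tx Tv i; case: (unliftP ord0 i) => [j|] ->; last by rewrite cns0.
by rewrite cnsS; exact: Tv.
Qed.

Lemma rclose_cns n d x y (v w : 'rV[C]_n) :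
  nm (x - y) < d -> rclose d v w -> rclose d (cns x v) (cns y w).
Proof.
move=> xy vw i; case: (unliftP ord0 i) => [j|] ->; last by rewrite !cns0.
by rewrite !cnsS; exact: vw.
Qed.

Lemma rclosexx n d (z : 'rV[C]_n) : 0 < d -> rclose d z z.
Proof. by move=> d0 i; rewrite subrr nm0. Qed.

Lemma UC_cns Ts n (Phi : 'rV[C]_n.+1 -> C) x : UC Ts Phi -> Ts 0 x ->
  UC (fun k => Ts k.+1) (fun v => Phi (cns x v)).
Proof.
move=> uP Tx e e0; have [d d0 H] := uP e e0; exists d => // z w Tz Tw zw.
by apply: H; [exact: inT_cns..|apply: rclose_cns => //; rewrite subrr nm0].
Qed.

Lemma UCD Ts n (Phi Psi : 'rV[C]_n -> C) a : UC Ts Phi -> UC Ts Psi ->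
  UC Ts (fun z => a * Phi z + Psi z).
Proof.
move=> uP uQ e e0; have a0 : 0 < nm a + 1 by rewrite ltr_wpDl ?nm_ge0.
have e1 : 0 < e / 2 / (nm a + 1) by rewrite !divr_gt0.
have e2 : 0 < e / 2 by rewrite divr_gt0.
have [d d0 H] := uP _ e1; have [d' d'0 H'] := uQ _ e2.
exists (Num.min d d'); first by rewrite lt_min d0.
move=> z w Tz Tw zw.
have zw1 : rclose d z w by move=> i; have := zw i; rewrite lt_min => /andP[].
have zw2 : rclose d' z w by move=> i; have := zw i; rewrite lt_min => /andP[].
have h := H z w Tz Tw zw1; have h' := H' z w Tz Tw zw2.
rewrite opprD addrACA -mulrBr (le_lt_trans (nmD _ _))// [ltRHS]splitr ler_ltD//.
rewrite nmM (le_trans (y := nm a * (e / 2 / (nm a + 1))))//.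
  by rewrite ler_wpM2l ?nm_ge0// ltW.
by rewrite mulrCA ger_pMr// ler_pdivrMr// mul1r lerDl.
Qed.

Lemma UCN Ts n (Phi : 'rV[C]_n -> C) : UC Ts Phi -> UC Ts (fun z => - Phi z).
Proof.
move=> uP e e0; have [d d0 H] := uP e e0; exists d => // z w Tz Tw zw.
by rewrite -opprD nmN; exact: H.
Qed.

Lemma UC_B Ts n (Phi Psi : 'rV[C]_n -> C) : UC Ts Phi -> UC Ts Psi ->
  UC Ts (fun z => Phi z - Psi z).
Proof.
move=> uP uQ e e0; have [d d0 H] := UCD 1 uP (UCN uQ) e0; exists d => // z w Tz Tw zw.
by have := H z w Tz Tw zw; rewrite !mul1r.
Qed.

Lemma sub_UC Ts Ts' n (Phi : 'rV[C]_n -> C) : (forall k, Ts k `<=` Ts' k) ->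
  UC Ts' Phi -> UC Ts Phi.
Proof.
move=> TT uP e e0; have [d d0 H] := uP e e0; exists d => // z w Tz Tw zw.
by apply: H => // i; apply: TT.
Qed.

(** The two claims are proved together: linearity in the outer variable requires the inner integral
    to depend continuously on it, and this continuity comes from linearity and the bound in one
    dimension less. *)
Lemma mint_linear_bound n Js Ts : (forall k, cyc (Ts k) (Js k)) ->
  (forall a (Phi Psi : 'rV[C]_n -> C), UC Ts Phi -> UC Ts Psi ->
     mint Js (fun z => a * Phi z + Psi z) = a * mint Js Phi + mint Js Psi) /\
  (exists2 L, 0 <= L & forall (Phi : 'rV[C]_n -> C) B, 0 <= B -> UC Ts Phi ->
     (forall z, inT Ts z -> nm (Phi z) <= B) -> nm (mint Js Phi) <= L * B).
Proof.
elim: n Js Ts => [|n IH] Js Ts cJ.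
  split=> //=; exists 1 => // Phi B B0 _ H; rewrite mul1r; apply: H; exact: inT0.
have cJ' k : cyc (Ts k.+1) (Js k.+1) by [].
have [lin [L L0 HL]] := IH _ _ cJ'.
have c0 := cJ 0%N; have [L' L'0 HL'] := cyc_bound c0.
have pc (Phi : 'rV[C]_n.+1 -> C) : UC Ts Phi ->
    contT (Ts 0%N) (fun x => mint (fun k => Js k.+1) (fun v => Phi (cns x v))).
  move=> uP x Tx e e0; have L1 : 0 < L + 1 by rewrite ltr_wpDl.
  have [d d0 H] := uP (e / (L + 1)) (divr_gt0 e0 L1).
  exists d => // y Ty yx; rewrite addrC -mulN1r -lin; [|exact: UC_cns..].
  apply: (@le_lt_trans _ _ (L * (e / (L + 1)))).
    apply: HL; [by rewrite divr_ge0// ltW| |].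
      by apply: UCD; exact: UC_cns.
    move=> z Tz; rewrite mulN1r addrC ltW// H//; [exact: inT_cns..|].
    by apply: rclose_cns => //; exact: rclosexx.
  by rewrite mulrCA gtr_pMr// ltr_pdivrMr// mul1r ltrDl.
split.
  move=> a Phi Psi uP uQ /=; rewrite -(cyc_lin c0)//; [|exact: pc..].
  by apply: (cyc_ext c0) => x Tx; rewrite lin//; exact: UC_cns.
exists (L' * L); first exact: mulr_ge0.
move=> Phi B B0 uP PB /=; rewrite -mulrA; apply: HL'; [exact: mulr_ge0|exact: pc|].
move=> x Tx; apply: HL => //; first exact: UC_cns.
by move=> z Tz; apply: PB; exact: inT_cns.
Qed.

Lemma mint_lin n Js Ts a (Phi Psi : 'rV[C]_n -> C) : (forall k, cyc (Ts k) (Js k)) ->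
  UC Ts Phi -> UC Ts Psi ->
  mint Js (fun z => a * Phi z + Psi z) = a * mint Js Phi + mint Js Psi.
Proof. by move=> cJ; have [H _] := mint_linear_bound n cJ; exact: H. Qed.

Lemma mint_bound n Js Ts : (forall k, cyc (Ts k) (Js k)) ->
  exists2 L, 0 <= L & forall (Phi : 'rV[C]_n -> C) B, 0 <= B -> UC Ts Phi ->
     (forall z, inT Ts z -> nm (Phi z) <= B) -> nm (mint Js Phi) <= L * B.
Proof. by move=> cJ; have [_] := mint_linear_bound n cJ. Qed.

Lemma mint_close n Js Ts : (forall k, cyc (Ts k) (Js k)) -> forall e, 0 < e ->
  exists2 d, 0 < d & forall (Phi Psi : 'rV[C]_n -> C), UC Ts Phi -> UC Ts Psi ->
     (forall z, inT Ts z -> nm (Phi z - Psi z) <= d) -> nm (mint Js Phi - mint Js Psi) < e.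
Proof.
move=> cJ e e0; have [L L0 HL] := mint_bound n cJ.
have L1 : 0 < L + 1 by rewrite ltr_wpDl.
exists (e / (L + 1)); first exact: divr_gt0.
move=> Phi Psi uP uQ PQ; rewrite addrC -mulN1r -(mint_lin _ cJ)//.
apply: (@le_lt_trans _ _ (L * (e / (L + 1)))).
  apply: HL; [by rewrite divr_ge0// ltW|exact: UCD|].
  by move=> z Tz; rewrite mulN1r addrC PQ.
by rewrite mulrCA gtr_pMr// ltr_pdivrMr// mul1r ltrDl.
Qed.

Lemma mint_contT n Js Ts (Phi : 'rV[C]_n.+1 -> C) : (forall k, cyc (Ts k.+1) (Js k)) ->
  UC Ts Phi -> contT (Ts 0%N) (fun x => mint Js (fun v => Phi (cns x v))).
Proof.
move=> cJ uP x Tx e e0; have [d d0 H] := mint_close n cJ e0.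
have [d' d'0 H'] := uP d d0; exists d' => // y Ty yx.
apply: H; [exact: UC_cns uP Ty|exact: UC_cns uP Tx|].
move=> z Tz; rewrite ltW// H'//; [exact: inT_cns..|].
by apply: rclose_cns => //; exact: rclosexx.
Qed.

Lemma eq_mint n Js Ts (Phi Psi : 'rV[C]_n -> C) : (forall k, cyc (Ts k) (Js k)) ->
  (forall z, inT Ts z -> Phi z = Psi z) -> mint Js Phi = mint Js Psi.
Proof.
elim: n Js Ts Phi Psi => [|n IH] Js Ts Phi Psi cJ PQ /=.
  by apply: PQ; exact: inT0.
apply: (cyc_ext (cJ 0%N)) => x Tx; apply: (IH _ (fun k => Ts k.+1)) => // v Tv.
by apply: PQ; exact: inT_cns.
Qed.

Lemma mint_sum n Js Ts (I : Type) (r : seq I) (F : I -> 'rV[C]_n -> C) :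
  (forall k, cyc (Ts k) (Js k)) -> (forall i, UC Ts (F i)) ->
  UC Ts (fun z => \sum_(i <- r) F i z) /\
  mint Js (fun z => \sum_(i <- r) F i z) = \sum_(i <- r) mint Js (F i).
Proof.
move=> cJ uF; have u0 : UC Ts (fun _ : 'rV[C]_n => 0).
  by move=> e e0; exists 1 => // *; rewrite subrr nm0.
elim: r => [|i r [IH1 IH2]].
  split.
    by move=> e e0; have [d d0 H] := u0 e e0; exists d => // z w *; rewrite !big_nil; exact: (H z w).
  rewrite big_nil; transitivity (mint Js (fun _ : 'rV[C]_n => 0)).
    by apply: (eq_mint cJ) => z _; rewrite big_nil.
  have H2 (w : C) : -1 * w + w = 0 by ring.
  rewrite -[RHS](H2 (mint Js (fun _ : 'rV[C]_n => 0))) -(mint_lin _ cJ)//.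
  by apply: (eq_mint cJ) => z _; rewrite mulr0 addr0.
have uu := UCD 1 (uF i) IH1; split.
  move=> e e0; have [d d0 H] := uu e e0; exists d => // z w Tz Tw zw.
  by rewrite !big_cons; have := H z w Tz Tw zw; rewrite !mul1r.
rewrite big_cons -IH2 -[mint Js (F i)]mul1r -(mint_lin _ cJ)//.
by apply: (eq_mint cJ) => z _; rewrite big_cons mul1r.
Qed.

Lemma mintZ n Js Ts a (Phi : 'rV[C]_n -> C) : (forall k, cyc (Ts k) (Js k)) ->
  UC Ts Phi -> mint Js (fun z => a * Phi z) = a * mint Js Phi.
Proof.
move=> cJ uP; have u0 : UC Ts (fun _ : 'rV[C]_n => 0).
  by move=> e e0; exists 1 => // *; rewrite subrr nm0.
have E0 : mint Js (fun _ : 'rV[C]_n => 0) = 0.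
  have H2 (w : C) : -1 * w + w = 0 by ring.
  rewrite -[RHS](H2 (mint Js (fun _ : 'rV[C]_n => 0))) -(mint_lin _ cJ)//.
  by apply: (eq_mint cJ) => z _; rewrite mulr0 addr0.
rewrite -[RHS]addr0 -E0 -(mint_lin _ cJ)//.
by apply: (eq_mint cJ) => z _; rewrite addr0.
Qed.

Definition consT (T : set C) Ts : nat -> set C := fun k => if k is j.+1 then Ts j else T.

(** Repeated use of [cyc_swap]. In the resulting form the variable of [J] is innermost and all the
    others are parameters. *)
Lemma mint_pull n T J Js Ts (Phi : 'rV[C]_n.+1 -> C) : cyc T J ->
  (forall k, cyc (Ts k) (Js k)) -> UC (consT T Ts) Phi ->
  J (fun x => mint Js (fun v => Phi (cns x v))) = mint Js (fun v => J (fun x => Phi (cns x v))).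
Proof.
elim: n Js Ts Phi => [//|n IH] Js Ts Phi cJ cJs uP /=.
have uS y : Ts 0%N y -> UC (consT T (fun k => Ts k.+1)) (fun v : 'rV_n.+1 =>
    Phi (cns (v 0 ord0) (cns y (\row_i v 0 (lift ord0 i))))).
  move=> Ty e e0; have [d d0 H] := uP e e0; exists d => // z w Tz Tw zw; apply: H.
  - apply: inT_cns; [exact: (Tz ord0)|apply: inT_cns => // i; rewrite mxE].
    exact: (Tz (lift ord0 i)).
  - apply: inT_cns; [exact: (Tw ord0)|apply: inT_cns => // i; rewrite mxE].
    exact: (Tw (lift ord0 i)).
  - apply: rclose_cns; first exact: zw.
    apply: rclose_cns; first by rewrite subrr nm0.
    by move=> i; rewrite !mxE; exact: zw.
have tailE (x : C) (v : 'rV[C]_n) : \row_i cns x v 0 (lift ord0 i) = v.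
  by apply/rowP => i; rewrite mxE cnsS.
pose h x y := mint (fun k => Js k.+1) (fun v : 'rV_n => Phi (cns x (cns y v))).
have u2 : UC2 T (Ts 0%N) h.
  move=> e e0; have [d d0 H] := mint_close n (fun k => cJs k.+1) e0.
  have [d' d'0 H'] := uP d d0; exists d' => // x x' y y' Tx Tx' Ty Ty' xx' yy'.
  apply: H.
  - exact: UC_cns (UC_cns uP Tx) Ty.
  - exact: UC_cns (UC_cns uP Tx') Ty'.
  - move=> z Tz; rewrite ltW// H'//; [by do 2 apply: inT_cns => //..|].
    by do 2 apply: rclose_cns => //; exact: rclosexx.
rewrite (cyc_swap cJ (cJs 0%N) u2); apply: (cyc_ext (cJs 0%N)) => y Ty.
have := IH _ _ _ cJ (fun k => cJs k.+1) (uS y Ty).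
rewrite (cyc_ext cJ (g := h^~ y)); last first.
  by move=> x Tx; apply: (eq_mint (fun k => cJs k.+1)) => v _; rewrite cns0 tailE.
move=> ->; apply: (eq_mint (fun k => cJs k.+1)) => v _.
by apply: (cyc_ext cJ) => x _; rewrite cns0 tailE.
Qed.

Definition upd A (f : nat -> A) k a : nat -> A := fun j => if j == k then a else f j.

(** Once coordinate [k] is innermost, the exchange of its functional is a statement in one variable,
    to be checked only while the other coordinates lie on their own chains. Uniform continuity is
    asked on both supports because the variable is pulled in with the old functional and out with
    the new one. *)
Lemma mint_replace n k Js Ts J' T' (Phi : 'rV[C]_n -> C) :
  (forall j, cyc (Ts j) (Js j)) -> cyc T' J' -> (k < n)%N ->
  UC Ts Phi -> UC (upd Ts k T') Phi ->
  (forall (i : 'I_n) (z : 'rV[C]_n), i = k :> nat -> (forall j : 'I_n, j != i -> Ts j (z 0 j)) ->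
     Js k (fun x => Phi (set_coord i x z)) = J' (fun x => Phi (set_coord i x z))) ->
  mint Js Phi = mint (upd Js k J') Phi.
Proof.
elim: n k Js Ts Phi => [//|n IH] [|k] Js Ts Phi cJ cJ' kn uP uP' H /=.
- have E : upd Js 0 J' 0 = J' by [].
  rewrite E.
  have p1 := @mint_pull n _ _ _ (fun k => Ts k.+1) Phi (cJ 0%N) (fun k => cJ k.+1).
  have p2 := @mint_pull n _ _ (fun k => Js k.+1) (fun k => Ts k.+1) Phi cJ' (fun k => cJ k.+1).
  rewrite p1; last by apply: sub_UC uP; case=> [|j] x.
  transitivity (mint (fun k => Js k.+1) (fun v => J' (fun x => Phi (cns x v)))).
    apply: (eq_mint (fun k => cJ k.+1)) => v Tv.
    have := H ord0 (cns 0 v) erefl; rewrite /=.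
    have scE x : set_coord ord0 x (cns 0 v) = cns x v.
      apply/rowP => i; rewrite mxE; case: (unliftP ord0 i) => [j|] -> /=; last by rewrite cns0.
      by rewrite !cnsS.
    rewrite (cyc_ext (cJ 0%N) (g := fun x => Phi (cns x v))); last by move=> x _; rewrite scE.
    rewrite (cyc_ext cJ' (g := fun x => Phi (cns x v))); last by move=> x _; rewrite scE.
    apply=> j; case: (unliftP ord0 j) => [i|] -> // _; rewrite cnsS; exact: Tv.
  by rewrite -p2//; apply: sub_UC uP'; case=> [|j] x.
- apply: (cyc_ext (cJ 0%N)) => x Tx.
  have -> : (fun j => upd Js k.+1 J' j.+1) = upd (fun j => Js j.+1) k J' by [].
  apply: (IH _ _ (fun j => Ts j.+1)) => //.
  + exact: UC_cns.
  + by apply: UC_cns uP' _.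
  + move=> i z ik Hz.
    have scE y : cns x (set_coord i y z) = set_coord (lift ord0 i) y (cns x z).
      apply/rowP => j; rewrite [RHS]mxE; case: (unliftP ord0 j) => [l|] ->; last by rewrite !cns0.
      by rewrite (inj_eq lift_inj) !cnsS mxE.
    rewrite (cyc_ext (cJ k.+1) (g := fun y => Phi (set_coord (lift ord0 i) y (cns x z)))); last first.
      by move=> y _; rewrite scE.
    rewrite (cyc_ext cJ' (g := fun y => Phi (set_coord (lift ord0 i) y (cns x z)))); last first.
      by move=> y _; rewrite scE.
    apply: H; first by rewrite /= /bump /= add1n ik.
    move=> j; case: (unliftP ord0 j) => [l|] ->; last by rewrite cns0.
    by rewrite (inj_eq lift_inj) cnsS; exact: Hz.
Qed.

Lemma countable_preimage (A B : Type) (f : A -> B) (D : set B) : injective f ->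
  countable D -> countable [set x | D (f x)].
Proof.
move=> fi /countable_injP[g gi]; apply/countable_injP; exists (g \o f).
by move=> x y; rewrite !inE => Dx Dy /gi; rewrite !inE => /(_ Dx Dy) /fi.
Qed.

Lemma countable_setU (T : Type) (A B : set T) : countable A -> countable B ->
  countable (A `|` B).
Proof.
move=> cA cB; apply: (@sub_countable _ _ _ (\bigcup_k (if k is 0 then A else B))).
  by apply: subset_card_le => x [Ax|Bx]; [exists 0%N|exists 1%N].
by apply: bigcup_countable => // -[].
Qed.

Lemma seq_min_gt0 (A : eqType) (s : seq A) (r : A -> R) :
  (forall x, x \in s -> 0 < r x) -> exists2 d, 0 < d & forall x, x \in s -> d <= r x.
Proof.
elim: s => [|a s IH] H; first by exists 1.
have [x xs|d d0 Hd] := IH; first by apply: H; rewrite inE xs orbT.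
exists (Num.min d (r a)); first by rewrite lt_min d0 H// inE eqxx.
move=> x; rewrite inE => /orP[/eqP ->|/Hd]; first by rewrite ge_min lexx orbT.
by rewrite ge_min => ->.
Qed.

(* A set is slim when, coordinate by coordinate, it is empty after discarding
   countably many values of each variable in turn. *)
Fixpoint slim n : set 'rV[C]_n -> Prop :=
  match n with
  | 0 => fun A => ~ A 0
  | m.+1 => fun A => exists2 D : set C, countable D &
      forall x, ~ D x -> slim (fun v : 'rV_m => A (cns x v))
  end.

Lemma sub_slim n (A B : set 'rV[C]_n) : A `<=` B -> slim B -> slim A.
Proof.
elim: n A B => [|n IH] A B AB /=; first by move=> nB /AB.
by case=> D cD H; exists D => // x /H; apply: IH => v; exact: AB.
Qed.

Lemma slim_bigcup n (A : nat -> set 'rV[C]_n) : (forall k, slim (A k)) ->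
  slim (\bigcup_k A k).
Proof.
elim: n A => [|n IH] A sA /=; first by case=> k _; exact: sA.
have /choice[D HD] : forall k, exists D : set C, countable D /\
    forall x, ~ D x -> slim (fun v : 'rV_n => A k (cns x v)).
  by move=> k; have [D cD H] := sA k; exists D.
exists (\bigcup_k D k); first by apply: bigcup_countable => // k _; have [] := HD k.
move=> x nD; apply: (@sub_slim _ _ (\bigcup_k (fun v : 'rV_n => A k (cns x v)))).
  by move=> v [k _ Ak]; exists k.
by apply: IH => k; have [_] := HD k; apply => Dk; apply: nD; exists k.
Qed.

Lemma slimU n (A B : set 'rV[C]_n) : slim A -> slim B -> slim (A `|` B).
Proof.
move=> sA sB; apply: (@sub_slim _ _ (\bigcup_k (if k is 0 then A else B))).
  by move=> v [Av|Bv]; [exists 0%N|exists 1%N].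
by apply: slim_bigcup => -[].
Qed.

Lemma slim0 n : slim (set0 : set 'rV[C]_n).
Proof. by elim: n => [|n IH] /=; [case|exists set0]. Qed.

Lemma slim_bigcup_fin n (I : finType) (A : I -> set 'rV[C]_n) : (forall i, slim (A i)) ->
  slim [set v | exists i, A i v].
Proof.
move=> sA; apply: (@sub_slim _ _ (\bigcup_k (if insub k is Some j then A (enum_val (j : 'I_#|I|)) else set0))).
  by move=> v [i Ai]; exists (enum_rank i) => //; rewrite valK enum_rankK.
by apply: slim_bigcup => k; case: insubP => // _; exact: slim0.
Qed.

(** The definition of [slim] follows the iterated integral from the outside inwards: [cyc_countable]
    ignores the exceptional first coordinates, and induction deals with the other slices. As in one
    variable, [Phi] itself may be irregular. *)
Lemma mint_slim n Js Ts (A : set 'rV[C]_n) (Phi Psi : 'rV[C]_n -> C) :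
  (forall k, cyc (Ts k) (Js k)) -> slim A -> UC Ts Psi ->
  (forall z, inT Ts z -> ~ A z -> Phi z = Psi z) -> mint Js Phi = mint Js Psi.
Proof.
elim: n Js Ts A Phi Psi => [|n IH] Js Ts A Phi Psi cJ /=.
  by move=> nA _; apply=> // -[].
case=> D cD sA uQ PQ.
have mc := @mint_contT n (fun k => Js k.+1) Ts Psi (fun k => cJ k.+1) uQ.
apply: (cyc_countable (cJ 0%N) mc cD) => x Tx nDx.
apply: (IH _ (fun k => Ts k.+1)) (sA x nDx) _ _ => //; first exact: UC_cns.
by move=> v Tv nA; apply: PQ => //; exact: inT_cns.
Qed.

Lemma slim_map n (a : 'I_n -> C -> C) (A : set 'rV[C]_n) :
  (forall i, injective (a i)) -> slim A -> slim [set z | A (\row_i a i (z 0 i))].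
Proof.
elim: n a A => [|n IH] a A ia /=.
  by move=> nA; rewrite (_ : \row_i _ = 0)//; apply/rowP => -[].
case=> D cD sA; exists [set x | D (a ord0 x)].
  exact: countable_preimage.
move=> x /= nD; have := IH (fun i => a (lift ord0 i)) _ (fun i => ia _) (sA _ nD).
apply: sub_slim => v /=; congr A; apply/rowP => i.
case: (unliftP ord0 i) => [j|] ->; rewrite [LHS]mxE; last by rewrite !cns0.
by rewrite !cnsS mxE.
Qed.

(** The induction is over all [D]: once the first coordinate [x] is fixed, a condition on [x * y] or
    [x / y] concerns the later coordinate [y] alone, and its countably many solutions are added to
    [D]. *)
Lemma slim_coords n (D E : set C) : countable D -> countable E ->
  slim [set z : 'rV[C]_n | (exists i, D (z 0 i)) \/
    exists i j : 'I_n, (i < j)%N /\ z 0 i != 0 /\ (E (z 0 i * z 0 j) \/ E (z 0 i / z 0 j))].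
Proof.
move=> + cE; elim: n D => [|n IH] D cD; first by move=> /= [[[]]|[[]]].
exists D => // x nDx.
pose E1 := [set y | E (x * y)]; pose E2 := [set y | E (x / y)].
(* For [x = 0] multiplication by [x] is not injective; here the clause [z 0 i != 0] excludes the
   pairs that involve the first coordinate. *)
have [x0|x0] := eqVneq x 0.
  apply: sub_slim (IH D cD) => v [[i' ]|[i' [j [ij [i0 H]]]]].
    move: i' => i; by case: (unliftP ord0 i) => [k|] ->; rewrite ?cns0 ?cnsS//; left; exists k.
  move: i' ij i0 H => i ij i0 H.
  move: ij i0 H; case: (unliftP ord0 i) => [k|] ->; rewrite ?cns0 ?x0 ?eqxx// !cnsS.
  case: (unliftP ord0 j) => [l|] ->//; rewrite cnsS => kl k0 H; right; exists k, l.
  by [].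
have cE1 : countable E1.
  by apply: countable_preimage cE => y z; exact: mulfI.
have cE2 : countable E2.
  by apply: (@countable_preimage _ _ (fun y => x / y)) cE => y z /(mulfI x0) /invr_inj.
have cD' : countable (D `|` (E1 `|` E2)) by do 2 apply: countable_setU => //.
apply: sub_slim (IH _ cD') => v [[i' ]|[i' [j [ij [i0 H]]]]].
  move: i' => i; by case: (unliftP ord0 i) => [k|] ->; rewrite ?cns0 ?cnsS//; left; exists k; left.
move: i' ij i0 H => i; case: (unliftP ord0 i) => [k|] ->; last first.
  rewrite cns0; case: (unliftP ord0 j) => [l|] ->//; rewrite cnsS => _ _ H.
  by left; exists l; right.
rewrite !cnsS; case: (unliftP ord0 j) => [l|] ->//; rewrite cnsS => kl k0 H; right; exists k, l.
by [].
Qed.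

(** A Lebesgue number for a gauge on a product of compact sets, by induction on the coordinates as
    in the tube lemma: each value [x] of the first coordinate has a number [r x] valid on its slice,
    and finitely many [x] suffice. The radius [dl x - d] leaves room [d] around [z] itself. *)
Lemma tube m (Us : nat -> set C) (dl : 'rV[C]_m -> R) : (forall k, gcompact (Us k)) ->
  (forall z, inT Us z -> 0 < dl z) -> exists2 d, 0 < d & forall z, inT Us z ->
    exists2 x, inT Us x & rclose (dl x - d) z x /\ d < dl x.
Proof.
elim: m Us dl => [|m IH] Us dl gU d0.
  have dl0 := d0 0 (inT0 Us 0).
  exists (dl 0 / 2); first by rewrite divr_gt0.
  move=> z Tz; exists z => //; have -> : z = 0 by apply/rowP => -[].
  split; first by case.
  by rewrite ltr_pdivrMr// ltr_pMr ?ltr1n.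
have /choice[r Hr] : forall x, exists r, Us 0%N x -> 0 < r /\
    forall v, inT (fun k => Us k.+1) v -> exists2 w, inT (fun k => Us k.+1) w &
      rclose (dl (cns x w) - r) v w /\ r < dl (cns x w).
  move=> x; have [Ux|] := pselect (Us 0%N x); last by exists 1.
  have [|r r0 H] := IH (fun k => Us k.+1) (fun v => dl (cns x v)) (fun k => gU k.+1).
    by move=> v Uv; apply: d0; exact: inT_cns.
  by exists r => _; split.
have [s [sU scov]] := gU 0%N (fun x => r x / 2) (fun x Ux => divr_gt0 (Hr x Ux).1 (ltr0Sn _ _)).
have [d dgt dle] : exists2 d, 0 < d & forall x, x \in s -> d <= r x / 2.
  by apply: seq_min_gt0 => x xs; rewrite divr_gt0// (Hr x (sU x xs)).1.
exists d => // z Tz; have [x xs zx] := scov _ (Tz ord0).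
have [r0 H] := Hr x (sU x xs).
have Tz' : inT (fun k => Us k.+1) (\row_i z 0 (lift ord0 i)).
  by move=> i; rewrite mxE; exact: (Tz (lift ord0 i)).
have [w Uw [zw rw]] := H _ Tz'; exists (cns x w); first by apply: inT_cns => //; exact: sU.
have dr := dle x xs; split; last by lra.
move=> i; case: (unliftP ord0 i) => [j|] ->; last first.
  by rewrite cns0; lra.
by rewrite cnsS; have := zw j; rewrite mxE; lra.
Qed.

Lemma heine_cantor n Ts (Phi : 'rV[C]_n -> C) : (forall k, gcompact (Ts k)) ->
  contV Ts Phi -> UC Ts Phi.
Proof.
move=> gT cP e e0.
have /choice[dl Hdl] : forall z : 'rV[C]_n, exists d, inT Ts z -> 0 < d /\
    forall w, inT Ts w -> rclose d w z -> nm (Phi w - Phi z) < e / 2.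
  move=> z; have [Tz|] := pselect (inT Ts z); last by exists 1.
  have [d d0 H] := cP z Tz (e / 2) (divr_gt0 e0 (ltr0Sn _ _)).
  by exists d => _; split.
have [d d0 H] := tube gT (fun z Tz => (Hdl z Tz).1).
exists d => // z w Tz Tw zw; have [x Tx [zx dx]] := H z Tz.
have [_ Hx] := Hdl x Tx.
rewrite (le_lt_trans (nm_tri _ (Phi x) _))// (splitr e) ltrD//.
  by apply: Hx => // i; have := zx i; lra.
rewrite nm_sub; apply: Hx => // i; have := zx i; have := zw i.
by have := nm_tri (w 0 i) (z 0 i) (x 0 i); rewrite (nm_sub (w 0 i) (z 0 i)); lra.
Qed.

End IteratedIntegral.

(** * Complex differentiability in one variable *)

Section ComplexDifferentiability.
Variable R : realType.
Local Notation C := R[i].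
Implicit Types (F G : C -> C) (z w : C).

Definition cdiff F z := exists d, forall e, 0 < e -> exists2 r, 0 < r &
  forall w, nm (w - z) < r -> nm (F w - F z - d * (w - z)) <= e * nm (w - z).

Lemma cdiff_cont F z : cdiff F z -> forall e, 0 < e ->
  exists2 r, 0 < r & forall w, nm (w - z) < r -> nm (F w - F z) < e.
Proof.
move=> [d H] e e0; have [r r0 Hr] := H 1 ltr01.
have K0 : 0 < nm d + 2 by rewrite ltr_wpDl ?nm_ge0.
exists (Num.min r (e / (nm d + 2))); first by rewrite lt_min r0 divr_gt0.
move=> w; rewrite lt_min => /andP[/Hr h]; rewrite ltr_pdivlMr// => h2.
apply: le_lt_trans h2; rewrite mul1r in h.
have := nmD (F w - F z - d * (w - z)) (d * (w - z)); rewrite subrK nmM.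
by have := nm_ge0 (w - z); lra.
Qed.

Lemma cdiff_contT F (T : set C) : (forall z, T z -> cdiff F z) -> contT T F.
Proof.
move=> H z Tz e e0; have [r r0 Hr] := cdiff_cont (H z Tz) e0.
by exists r => // w _; exact: Hr.
Qed.

Lemma cdiff_cst k z : cdiff (fun=> k) z.
Proof.
exists 0 => e e0; exists 1 => // w _.
by rewrite subrr mul0r subrr nm0 mulr_ge0 ?nm_ge0// ltW.
Qed.

Lemma cdiff_id z : cdiff (fun w => w) z.
Proof.
exists 1 => e e0; exists 1 => // w _.
by rewrite mul1r subrr nm0 mulr_ge0 ?nm_ge0// ltW.
Qed.

Lemma cdiffD F G z : cdiff F z -> cdiff G z -> cdiff (fun w => F w + G w) z.
Proof.
move=> [d H] [d' H']; exists (d + d') => e e0.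
have e2 : 0 < e / 2 by rewrite divr_gt0.
have [r r0 Hr] := H _ e2; have [r' r'0 Hr'] := H' _ e2.
exists (Num.min r r'); first by rewrite lt_min r0.
move=> w; rewrite lt_min => /andP[/Hr h /Hr' h'].
have -> : F w + G w - (F z + G z) - (d + d') * (w - z) =
  (F w - F z - d * (w - z)) + (G w - G z - d' * (w - z)) by ring.
rewrite (le_trans (nmD _ _))//; lra.
Qed.

Lemma cdiff_comp F G z : cdiff G z -> cdiff F (G z) -> cdiff (fun w => F (G w)) z.
Proof.
move=> Gd [d H]; have [d' H'] := Gd; exists (d * d') => e e0.
have [e1 [e10 e1l e1K]] := small_tolerance e0 (addr_ge0 (nm_ge0 d) (nm_ge0 d')).
have [r r0 Hr] := H _ e10; have [r' r'0 Hr'] := H' _ e10.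
have [r2 r20 Hr2] := cdiff_cont Gd r0.
exists (Num.min r' r2); first by rewrite lt_min r'0.
move=> w; rewrite lt_min => /andP[/Hr' h' /Hr2 /Hr h].
have -> : F (G w) - F (G z) - d * d' * (w - z) =
  (F (G w) - F (G z) - d * (G w - G z)) + d * (G w - G z - d' * (w - z)) by ring.
rewrite (le_trans (nmD _ _))// nmM.
have hG : nm (G w - G z) <= (nm d' + 1) * nm (w - z).
  have := nmD (G w - G z - d' * (w - z)) (d' * (w - z)); rewrite subrK nmM => hh.
  have : e1 * nm (w - z) <= 1 * nm (w - z) by rewrite ler_wpM2r ?nm_ge0.
  by lra.
have h1 : e1 * nm (G w - G z) <= e1 * ((nm d' + 1) * nm (w - z)) by rewrite ler_pM2l.
have h2 : nm d * nm (G w - G z - d' * (w - z)) <= nm d * (e1 * nm (w - z)).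
  by rewrite ler_wpM2l ?nm_ge0.
have h3 := ler_wpM2r (nm_ge0 (w - z)) e1K.
have h4 : 0 <= e * nm (w - z) by rewrite mulr_ge0 ?nm_ge0// ltW.
lra.
Qed.

Lemma cdiffM F G z : cdiff F z -> cdiff G z -> cdiff (fun w => F w * G w) z.
Proof.
move=> Fd Gd; have [d H] := Fd; have [d' H'] := Gd.
exists (d * G z + F z * d') => e e0.
have [e1 [e10 e11 e1K]] :=
  small_tolerance e0 (addr_ge0 (addr_ge0 (nm_ge0 (F z)) (nm_ge0 (G z))) (nm_ge0 d)).
have [r r0 Hr] := H _ e10; have [r' r'0 Hr'] := H' _ e10.
have [r2 r20 Hr2] := cdiff_cont Gd e10.
exists (Num.min r (Num.min r' r2)); first by rewrite !lt_min r0 r'0.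
move=> w; rewrite !lt_min => /and3P[/Hr h /Hr' h' /Hr2 h2].
have -> : F w * G w - F z * G z - (d * G z + F z * d') * (w - z) =
  (F w - F z - d * (w - z)) * (G w - G z) + (F w - F z - d * (w - z)) * G z +
  F z * (G w - G z - d' * (w - z)) + d * (w - z) * (G w - G z) by ring.
move: h h' h2; set A := F w - F z - _; set B := G w - G z - _; set V := G w - G z => h h' h2.
set N := nm (w - z).
have N0 : 0 <= N := nm_ge0 _.
have := nmD (A * V + A * G z + F z * B) (d * (w - z) * V).
have := nmD (A * V + A * G z) (F z * B); have := nmD (A * V) (A * G z).
rewrite !nmM -/N => t1 t2 t3.
have b1 : nm A * nm V <= e1 * N * 1 by rewrite ler_pM ?nm_ge0//; lra.
have b2 : nm A * nm (G z) <= e1 * N * nm (G z) by rewrite ler_wpM2r ?nm_ge0.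
have b3 : nm (F z) * nm B <= nm (F z) * (e1 * N) by rewrite ler_wpM2l ?nm_ge0.
have b4 : nm d * N * nm V <= nm d * N * e1 by rewrite ler_wpM2l ?mulr_ge0 ?nm_ge0// ltW.
have h3 := ler_wpM2r N0 e1K.
have h4 : 0 <= e * N by rewrite mulr_ge0// ltW.
lra.
Qed.

Lemma cdiff_lin a z : cdiff (fun w => a * w) z.
Proof. by apply: cdiffM; [exact: cdiff_cst|exact: cdiff_id]. Qed.

Lemma cdiff_inv z : z != 0 -> cdiff (fun w => w^-1) z.
Proof.
move=> z0; have n0 : 0 < nm z by rewrite nm_gt0.
exists (- (z ^+ 2)^-1) => e e0.
exists (Num.min (nm z / 2) (e * nm z ^+ 3 / 2)).
  by rewrite lt_min !divr_gt0// mulr_gt0// exprn_gt0.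
move=> w; rewrite lt_min => /andP[h1 h2].
have wn : nm z / 2 <= nm w by have := nm_subge z w; rewrite nm_sub; lra.
have w0 : w != 0 by rewrite -nm_gt0; lra.
have -> : w^-1 - z^-1 - - (z ^+ 2)^-1 * (w - z) = (w - z) * (w - z) / (w * z ^+ 2).
  by field; rewrite w0 z0.
have -> : nm ((w - z) * (w - z) / (w * z ^+ 2)) = nm (w - z) / (nm w * nm z ^+ 2) * nm (w - z).
  by rewrite nmM nmV nmM (nmM w) nmX; ring.
rewrite ler_wpM2r ?nm_ge0// ler_pdivrMr; last by rewrite mulr_gt0 ?exprn_gt0 ?nm_gt0.
rewrite (le_trans (ltW h2))// -mulrA ler_pM2l// exprS mulrAC ler_wpM2r ?exprn_ge0// ltW//.
Qed.

Lemma cdiffV F z : F z != 0 -> cdiff F z -> cdiff (fun w => (F w)^-1) z.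
Proof. by move=> F0 Fd; apply: (@cdiff_comp (fun w => w^-1)) => //; exact: cdiff_inv. Qed.

Lemma cdiff_near F G z (r : R) : 0 < r -> (forall w, nm (w - z) < r -> F w = G w) ->
  cdiff F z -> cdiff G z.
Proof.
move=> r0 FG [d H]; exists d => e /H[r' r'0 Hr]; exists (Num.min r r').
  by rewrite lt_min r0.
move=> w; rewrite lt_min => /andP[h1 h2]; rewrite -!FG ?Hr//.
by rewrite subrr nm0.
Qed.

Lemma eq_cdiff F G z : (forall w, F w = G w) -> cdiff F z -> cdiff G z.
Proof. by move=> FG; apply: (cdiff_near ltr01) => w _. Qed.

Lemma cdiffN F z : cdiff F z -> cdiff (fun w => - F w) z.
Proof. by move=> /(cdiffM (cdiff_cst (-1) z)); apply: eq_cdiff => w; rewrite mulN1r. Qed.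

Lemma cdiffB F G z : cdiff F z -> cdiff G z -> cdiff (fun w => F w - G w) z.
Proof. by move=> Fd /cdiffN; exact: cdiffD. Qed.

Lemma cdiff_div F G z : G z != 0 -> cdiff F z -> cdiff G z -> cdiff (fun w => F w / G w) z.
Proof. by move=> G0 Fd Gd; apply: cdiffM => //; exact: cdiffV. Qed.

Lemma cdiff_prod (I : Type) (r : seq I) (P : pred I) (F : I -> C -> C) z :
  (forall i, P i -> cdiff (F i) z) -> cdiff (fun w => \prod_(i <- r | P i) F i w) z.
Proof.
move=> H; elim: r => [|i r IH].
  by apply: eq_cdiff (cdiff_cst 1 z) => w; rewrite big_nil.
have [Pi|nPi] := boolP (P i).
  by apply: eq_cdiff (cdiffM (H i Pi) IH) => w; rewrite big_cons Pi.
by apply: eq_cdiff IH => w; rewrite big_cons (negbTE nPi).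
Qed.

End ComplexDifferentiability.

(** * Integrals along paths, and operations on functionals *)

Section PathFunctionals.
Variable R : realType.
Local Notation C := R[i].
Implicit Types (T : set C) (J : (C -> C) -> C).

Definition path_set (a b : R) (c : R -> C) : set C := [set z | exists2 s, a <= s <= b & z = c s].

Lemma gcompact_path a b c : contR a b c -> gcompact (path_set a b c).
Proof.
move=> cc d d0.
have /choice[r Hr] : forall s, exists r, a <= s <= b -> 0 < r /\
    forall s', a <= s' <= b -> `|s' - s| < r -> nm (c s' - c s) < d (c s).
  move=> s; have [sab|] := boolP (a <= s <= b); last by exists 1.
  have ds : 0 < d (c s) by apply: d0; exists s.
  by have [r r0 H] := cc s sab _ ds; exists r => _; split.
have := @segment_compact R a b; rewrite compact_cover.
move=> /(_ R `[a, b]%classic (fun s => ball s (if a <= s <= b then r s else 1))).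
case.
- move=> s; rewrite /= in_itv/= => sab; rewrite sab; apply: ball_open; exact: (Hr s sab).1.
- move=> s; rewrite /= in_itv/= => sab; exists s; first by rewrite /= in_itv.
  by rewrite sab; apply: ballxx; exact: (Hr s sab).1.
move=> D' DD cov; exists [seq c s | s <- finmap.enum_fset D']; split.
  move=> x /mapP[s sD ->]; exists s => //.
  by have := DD s sD; rewrite inE /= in_itv.
move=> y [s sab ->]; have : `[a, b]%classic s by rewrite /= in_itv.
move=> /cov[s' /= s'D]; have s'ab : a <= s' <= b by have := DD s' s'D; rewrite inE /= in_itv.
rewrite s'ab => ss'; exists (c s'); first by apply/mapP; exists s'.
by apply: (Hr s' s'ab).2 => //; rewrite distrC.
Qed.

Lemma contT_path a b c f : contR a b c -> contT (path_set a b c) f -> contR a b (f \o c).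
Proof.
move=> cc fc s sab e e0; have [d d0 H] := fc (c s) (ex_intro2 _ _ s sab erefl) e e0.
have [d' d'0 H'] := cc s sab d d0; exists d' => // r rab rs.
by apply: H; [exists r|exact: H'].
Qed.

(** The weight [k] is kept apart from the derivative of [c], which need not exist everywhere. The
    last hypothesis turns countable sets of points into countable sets of parameters, as
    [cyc_countable] demands. *)
Lemma cyc_path a b c k : a <= b -> contR a b c -> bm a b k ->
  (forall D, countable D -> countable [set s | a <= s <= b /\ D (c s)]) ->
  cyc (path_set a b c) (fun f => ig a b (fun s => f (c s) * k s)).
Proof.
move=> ab cc kb cD; split.
- exact: gcompact_path.
- move=> l f g fc gc.
  have bf := bmM (contR_bm (contT_path cc fc)) kb.
  have bg := bmM (contR_bm (contT_path cc gc)) kb.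
  rewrite -igZ// -igD//; last exact: bmZ.
  by apply: eq_ig => s _ /=; ring.
- have [_ _ [K HK]] := kb.
  exists (2 * `|K| * (b - a)); first by rewrite !mulr_ge0// subr_ge0.
  move=> f B B0 fc fB.
  have bf := bmM (contR_bm (contT_path cc fc)) kb.
  have -> : 2 * `|K| * (b - a) * B = 2 * (B * `|K|) * (b - a) by ring.
  apply: ig_bound => // s sab; rewrite nmM ler_pM ?nm_ge0//.
    by apply: fB; exists s.
  by rewrite (le_trans (HK s sab))// ler_norm.
- by move=> f g fg; apply: eq_ig => s sab; rewrite fg//; exists s.
- move=> f g D gc cD' fg.
  apply: (@eq_countable_ig _ _ _ _ _ [set s | a <= s <= b /\ D (c s)]).
  + exact: bmM (contR_bm (contT_path cc gc)) kb.
  + exact: cD.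
  + by move=> s sab nD; rewrite fg//; [exists s|move=> Ds; apply: nD].
Qed.

Lemma gcompactU T1 T2 : gcompact T1 -> gcompact T2 -> gcompact (T1 `|` T2).
Proof.
move=> g1 g2 d d0.
have [s1 [s1T H1]] := g1 d (fun x h => d0 x (or_introl h)).
have [s2 [s2T H2]] := g2 d (fun x h => d0 x (or_intror h)).
exists (s1 ++ s2); split.
  by move=> x; rewrite mem_cat => /orP[/s1T|/s2T]; [left|right].
move=> y [/H1|/H2] [x xs yx]; exists x => //; by rewrite mem_cat xs ?orbT.
Qed.

Lemma cyc_zero : cyc set0 (fun _ : C -> C => 0 : C).
Proof.
split=> //.
- by move=> d _; exists [::].
- by move=> a f g _ _; rewrite mulr0 addr0.
- by exists 0 => // f B *; rewrite nm0 mul0r.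
Qed.

Lemma cyc_add T1 T2 J1 J2 : cyc T1 J1 -> cyc T2 J2 ->
  cyc (T1 `|` T2) (fun f => J1 f + J2 f).
Proof.
move=> c1 c2.
have s1 f : contT (T1 `|` T2) f -> contT T1 f by apply: sub_contT => x; left.
have s2 f : contT (T1 `|` T2) f -> contT T2 f by apply: sub_contT => x; right.
split.
- by apply: gcompactU; [exact: cyc_compact c1|exact: cyc_compact c2].
- move=> a f g fc gc; rewrite (cyc_lin c1 a (s1 _ fc) (s1 _ gc)).
  by rewrite (cyc_lin c2 a (s2 _ fc) (s2 _ gc)); ring.
- have [L1 L10 H1] := cyc_bound c1; have [L2 L20 H2] := cyc_bound c2.
  exists (L1 + L2); first exact: addr_ge0.
  move=> f B B0 fc fB; rewrite (le_trans (nmD _ _))// mulrDl lerD//.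
    by apply: H1 => //; [exact: s1|move=> z Tz; apply: fB; left].
  by apply: H2 => //; [exact: s2|move=> z Tz; apply: fB; right].
- move=> f g fg; congr (_ + _).
    by apply: (cyc_ext c1) => z Tz; apply: fg; left.
  by apply: (cyc_ext c2) => z Tz; apply: fg; right.
- move=> f g D gc cD fg; congr (_ + _).
    by apply: (cyc_countable c1) (s1 _ gc) cD _ => z Tz; apply: fg; left.
  by apply: (cyc_countable c2) (s2 _ gc) cD _ => z Tz; apply: fg; right.
Qed.

Lemma cyc_scale T J a : cyc T J -> cyc T (fun f => a * J f).
Proof.
move=> c; split.
- exact: cyc_compact c.
- by move=> b f g fc gc; rewrite (cyc_lin c b fc gc); ring.
- have [L L0 H] := cyc_bound c; exists (nm a * L); first by rewrite mulr_ge0 ?nm_ge0.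
  by move=> f B B0 fc fB; rewrite nmM -mulrA ler_wpM2l ?nm_ge0// H.
- by move=> f g fg; congr (_ * _); exact: (cyc_ext c).
- by move=> f g D gc cD fg; congr (_ * _); exact: (cyc_countable c) gc cD fg.
Qed.

Lemma cyc_big (I : eqType) (r : seq I) (T : I -> set C) (J : I -> (C -> C) -> C) :
  (forall i, i \in r -> cyc (T i) (J i)) ->
  cyc [set z | exists2 i, i \in r & T i z] (fun f => \sum_(i <- r) J i f).
Proof.
elim: r => [|i r IH] H.
  have -> : [set z | exists2 i, i \in [::] & T i z] = set0 :> set C by apply/seteqP; split=> z [].
  have -> : (fun f => \sum_(i <- [::]) J i f) = (fun _ : C -> C => 0 : C).
    by apply/funext => f; rewrite big_nil.
  exact: cyc_zero.
have -> : [set z | exists2 j, j \in i :: r & T j z] = T i `|` [set z | exists2 i, i \in r & T i z].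
  apply/seteqP; split=> z /=.
    by move=> [j]; rewrite inE => /orP[/eqP ->|jr] Tz; [left|right; exists j].
  by move=> [Tz|[j jr Tz]]; [exists i|exists j] => //; rewrite inE ?eqxx// jr orbT.
have -> : (fun f => \sum_(j <- i :: r) J j f) = (fun f => J i f + \sum_(j <- r) J j f).
  by apply/funext => f; rewrite big_cons.
apply: cyc_add; first by apply: H; rewrite inE eqxx.
by apply: IH => j jr; apply: H; rewrite inE jr orbT.
Qed.

(** Brings functionals with different supports onto a common one, so that they can be compared and
    subtracted. *)
Lemma cyc_sup T T' J : gcompact T' -> T `<=` T' -> cyc T J -> cyc T' J.
Proof.
move=> gT TT c.
have sT f : contT T' f -> contT T f by exact: sub_contT.
split=> //.
- by move=> a f g /sT fc /sT gc; exact: (cyc_lin c).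
- have [L L0 H] := cyc_bound c; exists L => // f B B0 /sT fc fB.
  by apply: H => // z /TT; exact: fB.
- by move=> f g fg; apply: (cyc_ext c) => z /TT; exact: fg.
- by move=> f g D /sT gc cD fg; apply: (cyc_countable c) gc cD _ => z /TT; exact: fg.
Qed.

(** A change of variables [h], with [k] in the place of its derivative. Injectivity serves to pull
    countable sets back. *)
Lemma cyc_map T J (h k : C -> C) : cyc T J -> contT T h -> contT T k ->
  (forall z w, T z -> T w -> h z = h w -> z = w) ->
  cyc (h @` T) (fun f => J (fun z => f (h z) * k z)).
Proof.
move=> c hc kc hi.
have fh f : contT (h @` T) f -> contT T (fun z => f (h z)).
  move=> fc z Tz e e0; have [d d0 H] := fc (h z) (ex_intro2 _ _ z Tz erefl) e e0.
  have [d' d'0 H'] := hc z Tz d d0; exists d' => // w Tw wz.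
  by apply: H; [exists w|exact: H'].
have fk f : contT (h @` T) f -> contT T (fun z => f (h z) * k z).
  by move=> fc; apply: contT_M => //; exact: fh.
split.
- move=> d d0.
  have /choice[r Hr] : forall z, exists r, T z -> 0 < r /\
      forall w, T w -> nm (w - z) < r -> nm (h w - h z) < d (h z).
    move=> z; have [Tz|] := pselect (T z); last by exists 1.
    have dz : 0 < d (h z) by apply: d0; exists z.
    by have [r r0 H] := hc z Tz _ dz; exists r => _; split.
  have [s [sT cov]] := cyc_compact c (fun x Tx => (Hr x Tx).1).
  exists (map h s); split; first by move=> x /mapP[y /sT Ty ->]; exists y.
  move=> _ [y Ty <-]; have [x xs xy] := cov y Ty; exists (h x); first by apply/mapP; exists x.
  by apply: (Hr x (sT x xs)).2.
- move=> a f g fc gc; rewrite -(cyc_lin c); [|exact: fk..].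
  by apply: (cyc_ext c) => z _; ring.
- have [L L0 H] := cyc_bound c.
  have [K K0 HK] : exists2 K, 0 <= K & forall z, T z -> nm (k z) <= K.
    have /choice[r Hr] : forall z, exists r, T z -> 0 < r /\
        forall w, T w -> nm (w - z) < r -> nm (k w - k z) < 1.
      move=> z; have [Tz|] := pselect (T z); last by exists 1.
      by have [r r0 Hk] := kc z Tz _ ltr01; exists r => _; split.
    have [s [sT cov]] := cyc_compact c (fun x Tx => (Hr x Tx).1).
    exists (\sum_(x <- s) nm (k x) + 1); first by rewrite addr_ge0// sumr_ge0// => *; exact: nm_ge0.
    move=> z Tz; have [x xs zx] := cov z Tz; have [_ Hx] := Hr x (sT x xs).
    have := Hx z Tz zx; have := nm_subge (k z) (k x).
    have : nm (k x) <= \sum_(x <- s) nm (k x).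
      elim: s xs {sT cov} => // a s IH; rewrite inE big_cons => /orP[/eqP ->|/IH h1].
        by rewrite lerDl sumr_ge0// => *; exact: nm_ge0.
      by rewrite (le_trans h1)// lerDr nm_ge0.
    by lra.
  exists (L * K); first exact: mulr_ge0.
  move=> f B B0 fc fB; rewrite -mulrA [K * B]mulrC; apply: H.
  + exact: mulr_ge0.
  + exact: fk.
  + by move=> z Tz; rewrite nmM ler_pM ?nm_ge0//; [apply: fB; exists z|exact: HK].
- by move=> f g fg; apply: (cyc_ext c) => z Tz; rewrite fg//; exists z.
- move=> f g D gc cD fg.
  have cD' : countable (T `&` [set z | D (h z)]).
    have /countable_injP[u ui] := cD; apply/countable_injP; exists (u \o h).
    move=> x y; rewrite !inE => -[Tx Dx] [Ty Dy] /ui; rewrite !inE => /(_ Dx Dy).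
    exact: hi.
  apply: (cyc_countable c) (fk _ gc) cD' _ => z Tz nD; rewrite fg// => Dz; exact: nD.
Qed.

Lemma cyc_weight T J k : cyc T J -> contT T k -> cyc T (fun f => J (fun z => f z * k z)).
Proof.
move=> c kc; have := cyc_map c (@contT_id _ T) kc (fun _ _ _ _ e => e).
by rewrite image_id.
Qed.

End PathFunctionals.

(** * Goursat's theorem on rectangles *)

Section Rectangles.
Variable R : realType.
Local Notation C := R[i].
Implicit Types (f F : C -> C) (z w : C) (x y : R).

(** The factors [1] here and ['i] in [vseg] are the velocities of the two parametrizations, written
    out so that both are instances of [cyc_path]. *)
Definition hseg x1 x2 y f : C := ig x1 x2 (fun x => f (x +i* y)%C * 1).
Definition vseg y1 y2 x f : C := ig y1 y2 (fun y => f (x +i* y)%C * 'i%C).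

Definition rint x1 x2 y1 y2 f : C :=
  hseg x1 x2 y1 f - hseg x1 x2 y2 f + (vseg y1 y2 x2 f - vseg y1 y2 x1 f).

Definition inR x1 x2 y1 y2 : set C :=
  [set z | x1 <= Re z <= x2 /\ y1 <= Im z <= y2].

Definition hset x1 x2 y := path_set x1 x2 (fun x => (x +i* y)%C).
Definition vset y1 y2 x := path_set y1 y2 (fun y => (x +i* y)%C).

Lemma contR_h a b y : contR a b (fun x => (x +i* y)%C).
Proof.
move=> s _ e e0; exists e => // r _; congr (_ < _).
by rewrite nmE /= subrr expr0n addr0 sqrtr_sqr.
Qed.

Lemma contR_v a b x : contR a b (fun y => (x +i* y)%C).
Proof.
move=> s _ e e0; exists e => // r _; congr (_ < _).
by rewrite nmE /= subrr expr0n add0r sqrtr_sqr.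
Qed.

Lemma cyc_hseg x1 x2 y : x1 <= x2 -> cyc (hset x1 x2 y) (hseg x1 x2 y).
Proof.
move=> x12; apply: (cyc_path x12 (@contR_h _ _ y) (bm_cst _ _ 1)) => D cD.
apply: sub_countable (countable_preimage (f := fun x => (x +i* y)%C) _ cD); last by move=> s r [].
by apply: subset_card_le => s [].
Qed.

Lemma cyc_vseg y1 y2 x : y1 <= y2 -> cyc (vset y1 y2 x) (vseg y1 y2 x).
Proof.
move=> y12; apply: (cyc_path y12 (@contR_v _ _ x) (bm_cst _ _ 'i%C)) => D cD.
apply: sub_countable (countable_preimage (f := fun y => (x +i* y)%C) _ cD); last by move=> s r [].
by apply: subset_card_le => s [].
Qed.

Definition bdR x1 x2 y1 y2 : set C :=
  hset x1 x2 y1 `|` hset x1 x2 y2 `|` (vset y1 y2 x2 `|` vset y1 y2 x1).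

Lemma cyc_rint x1 x2 y1 y2 : x1 <= x2 -> y1 <= y2 ->
  cyc (bdR x1 x2 y1 y2) (rint x1 x2 y1 y2).
Proof.
move=> x12 y12.
have E : rint x1 x2 y1 y2 = fun f => hseg x1 x2 y1 f + (-1) * hseg x1 x2 y2 f +
    (vseg y1 y2 x2 f + (-1) * vseg y1 y2 x1 f).
  by apply/funext => f; rewrite /rint; ring.
rewrite E; apply: cyc_add; apply: cyc_add; try apply: cyc_scale;
  solve [exact: cyc_hseg|exact: cyc_vseg].
Qed.

Lemma bdR_sub x1 x2 y1 y2 : x1 <= x2 -> y1 <= y2 -> bdR x1 x2 y1 y2 `<=` inR x1 x2 y1 y2.
Proof. by move=> x12 y12 z [[]|[]] [s sab ->]; split=> //=; rewrite ?lexx ?x12 ?y12. Qed.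

Lemma sub_inR x1 x2 y1 y2 x1' x2' y1' y2' : x1' <= x1 -> x2 <= x2' -> y1' <= y1 ->
  y2 <= y2' -> inR x1 x2 y1 y2 `<=` inR x1' x2' y1' y2'.
Proof. by move=> ? ? ? ? z [/andP[? ?] /andP[? ?]]; split; apply/andP; split; lra. Qed.

Lemma hseg_bm x1 x2 y1 y2 y f : y1 <= y <= y2 -> contT (inR x1 x2 y1 y2) f ->
  bm x1 x2 (fun x => f (x +i* y)%C * 1).
Proof.
move=> yb fc; apply: bmM; last exact: bm_cst.
apply: contR_bm; apply: (contT_path (@contR_h _ _ y)).
by apply: sub_contT fc => z [s sb ->].
Qed.

Lemma vseg_bm x1 x2 y1 y2 x f : x1 <= x <= x2 -> contT (inR x1 x2 y1 y2) f ->
  bm y1 y2 (fun y => f (x +i* y)%C * 'i%C).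
Proof.
move=> xb fc; apply: bmM; last exact: bm_cst.
apply: contR_bm; apply: (contT_path (@contR_v _ _ x)).
by apply: sub_contT fc => z [s sb ->].
Qed.

Lemma rint_splitx x1 u x2 y1 y2 f : x1 <= u -> u <= x2 -> y1 <= y2 ->
  contT (inR x1 x2 y1 y2) f ->
  rint x1 x2 y1 y2 f = rint x1 u y1 y2 f + rint u x2 y1 y2 f.
Proof.
move=> xu ux y12 fc; rewrite /rint /hseg !(ig_split xu ux); first by ring.
- by apply: hseg_bm fc; rewrite lexx y12.
- by apply: hseg_bm fc; rewrite lexx y12.
Qed.

Lemma rint_splity x1 x2 y1 u y2 f : x1 <= x2 -> y1 <= u -> u <= y2 ->
  contT (inR x1 x2 y1 y2) f ->
  rint x1 x2 y1 y2 f = rint x1 x2 y1 u f + rint x1 x2 u y2 f.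
Proof.
move=> x12 yu uy fc; rewrite /rint /vseg !(ig_split yu uy); first by ring.
- by apply: vseg_bm fc; rewrite lexx x12.
- by apply: vseg_bm fc; rewrite lexx x12.
Qed.

Lemma ig_cst (a b : R) (k : C) : a <= b -> ig a b (fun=> k) = k * (b - a)%:C%C.
Proof.
move=> ab; rewrite /ig !Rintegral_cst//= lebesgue_measure_itv/= lte_fin.
have -> : fine (if a < b then ((b)%:E - a%:E)%E else 0%E) = b - a.
  case: ltP => //= ba; suff -> : b = a by rewrite subrr.
  by apply/eqP; rewrite eq_le ab ba.
by apply: ceqP; rewrite ?ReM ?ImM /= ?mulr0 ?subr0 ?add0r.
Qed.

Lemma rint_bound x1 x2 y1 y2 f B : x1 <= x2 -> y1 <= y2 -> 0 <= B ->
  contT (bdR x1 x2 y1 y2) f -> (forall z, bdR x1 x2 y1 y2 z -> nm (f z) <= B) ->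
  nm (rint x1 x2 y1 y2 f) <= 4 * B * ((x2 - x1) + (y2 - y1)).
Proof.
move=> x12 y12 B0 fc fB.
have hb y : hset x1 x2 y `<=` bdR x1 x2 y1 y2 -> nm (hseg x1 x2 y f) <= 2 * B * (x2 - x1).
  move=> yb; apply: ig_bound => //.
    by apply: (@hseg_bm _ _ y y); rewrite ?lexx//; apply: sub_contT fc => z [? /andP[? ?]]; apply: yb;
      exists (Re z) => //; apply: ceqP => //=; lra.
  by move=> s sb; rewrite mulr1; apply/fB/yb; exists s.
have vb x : vset y1 y2 x `<=` bdR x1 x2 y1 y2 -> nm (vseg y1 y2 x f) <= 2 * B * (y2 - y1).
  move=> xb; apply: ig_bound => //.
    by apply: (@vseg_bm x x); rewrite ?lexx//; apply: sub_contT fc => z [/andP[? ?] ?]; apply: xb;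
      exists (Im z) => //; apply: ceqP => //=; lra.
  by move=> s sb; rewrite nmM nm_i mulr1; apply/fB/xb; exists s.
have h1 : nm (hseg x1 x2 y1 f) <= 2 * B * (x2 - x1) by apply: hb => z; left; left.
have h2 : nm (hseg x1 x2 y2 f) <= 2 * B * (x2 - x1) by apply: hb => z; left; right.
have v1 : nm (vseg y1 y2 x1 f) <= 2 * B * (y2 - y1) by apply: vb => z; right; right.
have v2 : nm (vseg y1 y2 x2 f) <= 2 * B * (y2 - y1) by apply: vb => z; right; left.
have := nmD (hseg x1 x2 y1 f - hseg x1 x2 y2 f) (vseg y1 y2 x2 f - vseg y1 y2 x1 f).
have := nmB (hseg x1 x2 y1 f) (hseg x1 x2 y2 f).
have := nmB (vseg y1 y2 x2 f) (vseg y1 y2 x1 f).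
rewrite -/(rint x1 x2 y1 y2 f); lra.
Qed.

Lemma rint_affine x1 x2 y1 y2 (a b : C) : x1 <= x2 -> y1 <= y2 ->
  rint x1 x2 y1 y2 (fun z => a * z + b) = 0.
Proof.
move=> x12 y12.
have afc (T : set C) : contT T (fun z => a * z + b).
  by apply: contT_D; [apply: contT_Z; exact: contT_id|exact: contT_cst].
have bh y : bm x1 x2 (fun x => (a * (x +i* y)%C + b) * 1).
  by apply: (@hseg_bm x1 x2 y y y (fun z => a * z + b)); rewrite ?lexx.
have bv x : bm y1 y2 (fun y => (a * (x +i* y)%C + b) * 'i%C).
  by apply: (@vseg_bm x x y1 y2 x (fun z => a * z + b)); rewrite ?lexx.
have hd : hseg x1 x2 y1 (fun z => a * z + b) - hseg x1 x2 y2 (fun z => a * z + b) =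
   a * (y1 - y2)%:C%C * 'i%C * (x2 - x1)%:C%C.
  rewrite /hseg -igN// -igD//; last exact: bmN.
  rewrite -ig_cst//; apply: eq_ig => s _.
  have -> : (s +i* y1)%C = (s +i* y2)%C + (y1 - y2)%:C%C * 'i%C :> C.
    by apply: ceqP; rewrite ?ReD ?ImD ?ReM ?ImM /=; ring.
  by ring.
have vd : vseg y1 y2 x2 (fun z => a * z + b) - vseg y1 y2 x1 (fun z => a * z + b) =
   a * (x2 - x1)%:C%C * 'i%C * (y2 - y1)%:C%C.
  rewrite /vseg -igN// -igD//; last exact: bmN.
  rewrite -ig_cst//; apply: eq_ig => s _.
  have -> : (x2 +i* s)%C = (x1 +i* s)%C + (x2 - x1)%:C%C :> C.
    by apply: ceqP; rewrite ?ReD ?ImD /=; ring.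
  by ring.
rewrite /rint hd vd -[y1 - y2]opprB rmorphN; ring.
Qed.

(** The bisection argument, separated from its use: a failure on the whole rectangle passes to one
    of its quarters at every scale, and the nested failures shrink to a point at which the local
    hypothesis is contradicted. A rectangle is given by its scale [n] and its lower left corner. *)
Lemma rectangle_bisection (P : nat -> R -> R -> Prop) (a b w h : R) : 0 <= w -> 0 <= h ->
  (forall n x y, a <= x -> x + w / 2 ^+ n <= a + w -> b <= y -> y + h / 2 ^+ n <= b + h ->
    (forall i j : bool, P n.+1 (x + i%:R * (w / 2 ^+ n.+1)) (y + j%:R * (h / 2 ^+ n.+1))) ->
    P n x y) ->
  (forall x y, a <= x <= a + w -> b <= y <= b + h -> exists N, forall n x' y', (N <= n)%N ->
     a <= x' -> x' + w / 2 ^+ n <= a + w -> b <= y' -> y' + h / 2 ^+ n <= b + h ->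
     x' <= x <= x' + w / 2 ^+ n -> y' <= y <= y' + h / 2 ^+ n -> P n x' y') ->
  P 0%N a b.
Proof.
move=> w0 h0 Hstep Hloc; apply: contrapT => nP.
pose inb n (v : R * R) := [/\ a <= v.1, v.1 + w / 2 ^+ n <= a + w, b <= v.2 &
  v.2 + h / 2 ^+ n <= b + h].
have half (c : R) n : c / 2 ^+ n = c / 2 ^+ n.+1 + c / 2 ^+ n.+1.
  by rewrite exprS invfM; field; rewrite expf_neq0.
have pos (c : R) n : 0 <= c -> 0 <= c / 2 ^+ n by move=> c0; rewrite divr_ge0// exprn_ge0.
have /choice[g Hg] : forall nv : nat * (R * R), exists v', inb nv.1 nv.2 /\ ~ P nv.1 nv.2.1 nv.2.2 ->
   [/\ inb nv.1.+1 v' , ~ P nv.1.+1 v'.1 v'.2,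
    nv.2.1 <= v'.1 /\ v'.1 + w / 2 ^+ nv.1.+1 <= nv.2.1 + w / 2 ^+ nv.1 &
    nv.2.2 <= v'.2 /\ v'.2 + h / 2 ^+ nv.1.+1 <= nv.2.2 + h / 2 ^+ nv.1].
  move=> [n [x y]] /=; have [[[/= xa xw yb yh] nPn]|] := pselect (inb n (x, y) /\ ~ P n x y); last by exists (0, 0).
  have [[i' [j nPij]]|H] := pselect (exists i j : bool,
      ~ P n.+1 (x + i%:R * (w / 2 ^+ n.+1)) (y + j%:R * (h / 2 ^+ n.+1))); last first.
    exfalso; apply: nPn; apply: Hstep => // i j; apply: contrapT => ?; apply: H.
    by exists i, j.
  exists (x + i'%:R * (w / 2 ^+ n.+1), y + j%:R * (h / 2 ^+ n.+1)) => _ /=.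
  have p1 := pos w n.+1 w0; have p2 := pos h n.+1 h0.
  rewrite (half w n) (half h n) in xw yh *.
  have bb (c : bool) (r : R) : 0 <= r -> 0 <= c%:R * r /\ c%:R * r <= r.
    by move=> r0; case: c; rewrite ?mul1r ?mul0r ?lexx.
  have [q1 q2] := bb i' _ p1; have [q3 q4] := bb j _ p2.
  by split; [split=> /=; lra|exact: nPij|lra|lra].
pose s := fix s n : R * R := if n is m.+1 then g (m, s m) else (a, b).
have Hs n : inb n (s n) /\ ~ P n (s n).1 (s n).2.
  elim: n => [|n IH]; first by split=> //; split=> //=; rewrite expr0 divr1.
  by have [? ? _ _] := Hg (n, s n) IH.
have Hs1 n : (s n).1 <= (s n.+1).1 /\ (s n.+1).1 + w / 2 ^+ n.+1 <= (s n).1 + w / 2 ^+ n.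
  by have [_ _ ? _] := Hg (n, s n) (Hs n).
have Hs2 n : (s n).2 <= (s n.+1).2 /\ (s n.+1).2 + h / 2 ^+ n.+1 <= (s n).2 + h / 2 ^+ n.
  by have [_ _ _ ?] := Hg (n, s n) (Hs n).
have lim (u : nat -> R) (c : R) : 0 <= c ->
    (forall n, u n <= u n.+1 /\ u n.+1 + c / 2 ^+ n.+1 <= u n + c / 2 ^+ n) ->
    exists l, forall n, u n <= l <= u n + c / 2 ^+ n.
  move=> c0 Hu; have mono n k : u n <= u (n + k)%N /\ u (n + k)%N + c / 2 ^+ (n + k) <= u n + c / 2 ^+ n.
    elim: k => [|k [IH1 IH2]]; first by rewrite addn0.
    by rewrite addnS; have [h1 h2] := Hu (n + k)%N; split; lra.
  have ub n m : u n <= u m + c / 2 ^+ m.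
    have [nm_|mn] := leqP n m.
      by have [h1 _] := mono n (m - n)%N; rewrite subnKC// in h1; have := pos c m c0; lra.
    by have [_ h1] := mono m (n - m)%N; rewrite subnKC 1?ltnW// in h1; have := pos c n c0; lra.
  have hs : has_sup (range u).
    split; first by exists (u 0%N); exists 0%N.
    by exists (u 0%N + c / 2 ^+ 0) => _ [n _ <-].
  exists (sup (range u)) => n; apply/andP; split.
    by apply: sup_upper_bound => //; exists n.
  by apply: sup_le_ub; [exact: hs.1|move=> _ [m _ <-]].
have [x Hx] := lim _ w w0 Hs1; have [y Hy] := lim _ h h0 Hs2.
have x0 := Hx 0%N; have y0 := Hy 0%N; rewrite /= expr0 !divr1 in x0 y0.
have [N HN] := Hloc x y x0 y0.
by have [[? ? ? ?] nPN] := Hs N; apply: nPN; apply: HN.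
Qed.

Lemma exp2_small (c d : R) : 0 < d -> exists N, forall n, (N <= n)%N -> c / 2 ^+ n < d.
Proof.
move=> d0; have [N HN] : exists N, c / d < N%:R.
  have := archi_boundP (normr_ge0 (c / d)); exists (Num.bound `|c / d|).
  by rewrite (le_lt_trans (ler_norm _)).
exists N => n Nn; rewrite ltr_pdivrMr ?exprn_gt0// mulrC -ltr_pdivrMr//.
rewrite (lt_le_trans HN)// -natrX ler_nat (leq_trans Nn)// ltnW// ltn_expl//.
Qed.

Lemma nm_inR x1 x2 y1 y2 z w : inR x1 x2 y1 y2 z -> inR x1 x2 y1 y2 w ->
  nm (z - w) <= (x2 - x1) + (y2 - y1).
Proof.
move=> [/andP[? ?] /andP[? ?]] [/andP[? ?] /andP[? ?]]; rewrite (le_trans (nm_le _))//.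
by rewrite ReD ImD ReN ImN lerD// ler_norml; apply/andP; split; lra.
Qed.

(** The bound 4 (w + h)^2 e is inherited from the four quarters, since the square of the half
    perimeter drops by a factor 4 in a bisection. At small scales it holds because [F] differs from
    an affine function by at most [e] times the distance, and affine functions integrate to zero. *)
Lemma goursat x1 x2 y1 y2 F : x1 <= x2 -> y1 <= y2 ->
  (forall z, inR x1 x2 y1 y2 z -> cdiff F z) -> rint x1 x2 y1 y2 F = 0.
Proof.
move=> x12 y12 Fd; have Fc := cdiff_contT Fd.
set w := x2 - x1; set h := y2 - y1.
have w0 : 0 <= w by rewrite subr_ge0.
have h0 : 0 <= h by rewrite subr_ge0.
have half (c : R) n : c / 2 ^+ n = c / 2 ^+ n.+1 + c / 2 ^+ n.+1.
  by rewrite exprS invfM; field; rewrite expf_neq0.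
have pos (c : R) n : 0 <= c -> 0 <= c / 2 ^+ n by move=> c0; rewrite divr_ge0// exprn_ge0.
apply: (@nm_eq0_le _ _ (4 * (w + h) ^+ 2)) => e e0.
pose P n x y : Prop := nm (rint x (x + w / 2 ^+ n) y (y + h / 2 ^+ n) F) <=
  4 * (w / 2 ^+ n + h / 2 ^+ n) ^+ 2 * e.
have : P 0%N x1 y1; last first.
  have ex : x1 + w = x2 by rewrite /w addrC subrK.
  have ey : y1 + h = y2 by rewrite /h addrC subrK.
  by rewrite /P !expr0 !divr1 ex ey.
apply: (@rectangle_bisection P x1 y1 w h w0 h0).
  move=> n x y xa xw ya yh Hij; rewrite /P.
  have p1 := pos w n.+1 w0; have p2 := pos h n.+1 h0.
  have H00 := Hij false false; have H01 := Hij false true.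
  have H10 := Hij true false; have H11 := Hij true true.
  rewrite /P !mul0r !addr0 !mul1r in H00 H01 H10 H11.
  rewrite (half w n) (half h n) in xw yh *.
  set w' := w / 2 ^+ n.+1 in p1 xw H00 H01 H10 H11 *.
  set h' := h / 2 ^+ n.+1 in p2 yh H00 H01 H10 H11 *.
  rewrite -!addrA in H10 H11 H01.
  have c1 : contT (inR x (x + (w' + w')) y (y + (h' + h'))) F.
    by apply: sub_contT Fc; apply: sub_inR; rewrite /w /h in xw yh; lra.
  have sx : x <= x + w' by lra.
  have sx2 : x + w' <= x + (w' + w') by lra.
  have sy : y <= y + h' by lra.
  have sy2 : y + h' <= y + (h' + h') by lra.
  rewrite (rint_splitx sx sx2)//; last by lra.
  rewrite (rint_splity _ sy sy2); [|by lra|by apply: sub_contT c1; apply: sub_inR; lra].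
  rewrite (rint_splity _ sy sy2); [|by lra|by apply: sub_contT c1; apply: sub_inR; lra].
  have := nmD (rint x (x + w') y (y + h') F + rint x (x + w') (y + h') (y + (h' + h')) F)
   (rint (x + w') (x + (w' + w')) y (y + h') F +
    rint (x + w') (x + (w' + w')) (y + h') (y + (h' + h')) F).
  have := nmD (rint x (x + w') y (y + h') F) (rint x (x + w') (y + h') (y + (h' + h')) F).
  have := nmD (rint (x + w') (x + (w' + w')) y (y + h') F)
    (rint (x + w') (x + (w' + w')) (y + h') (y + (h' + h')) F).
  rewrite (_ : w' + w' + (h' + h') = 2 * (w' + h')); last by ring.
  rewrite exprMn; move: H00 H01 H10 H11.
  set N := (w' + h') ^+ 2; lra.
move=> x y xb yb.
have zR : inR x1 x2 y1 y2 (x +i* y)%C by split=> /=; rewrite /w /h in xb yb; lra.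
have [d Hd] := Fd _ zR; have [r r0 Hr] := Hd e e0.
have [N HN] := exp2_small (w + h) r0; exists N => n x' y' Nn xa xw ya yh xx yy.
have {}HN := HN n Nn.
have p1 := pos w n w0; have p2 := pos h n h0; rewrite mulrDl in HN.
rewrite /P.
set w' := w / 2 ^+ n in p1 HN xw xx *.
set h' := h / 2 ^+ n in p2 HN yh yy *.
set z0 := (x +i* y)%C in zR Hr Hd.
have z0R : inR x' (x' + w') y' (y' + h') z0 by [].
have xx' : x' <= x' + w' by lra.
have yy' : y' <= y' + h' by lra.
have c1 : contT (inR x' (x' + w') y' (y' + h')) F.
  by apply: sub_contT Fc; apply: sub_inR; rewrite /w /h in xw yh; lra.
have cr := cyc_rint xx' yy'; have bs := bdR_sub xx' yy'.
have afc : contT (inR x' (x' + w') y' (y' + h')) (fun z => d * z + (F z0 - d * z0)).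
  by apply: contT_D; [apply: contT_Z; exact: contT_id|exact: contT_cst].
have -> : rint x' (x' + w') y' (y' + h') F =
    rint x' (x' + w') y' (y' + h') (fun z => F z - (d * z + (F z0 - d * z0))).
  by rewrite (cycB cr (sub_contT bs c1) (sub_contT bs afc)) rint_affine// subr0.
have -> : 4 * (w' + h') ^+ 2 * e = 4 * (e * (w' + h')) * ((x' + w' - x') + (y' + h' - y')).
  by ring.
apply: rint_bound => //; [by apply: mulr_ge0; [exact: ltW|lra]|exact: sub_contT bs (contT_B c1 afc)|].
move=> z /bs zR'; have zz := nm_inR zR' z0R.
have zl : nm (z - z0) <= w' + h' by lra.
rewrite (_ : F z - _ = F z - F z0 - d * (z - z0)); last by ring.
rewrite (le_trans (Hr z _))//; first by lra.
by rewrite ler_pM2l.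
Qed.

Definition inRo x1 x2 y1 y2 : set C :=
  [set z | x1 < Re z < x2 /\ y1 < Im z < y2].

(** What lies between the rectangles is cut into four rectangles to which [goursat] applies. As [F]
    may be discontinuous inside the inner one, [rint_splitx] and [rint_splity] do not apply, and the
    edges are split directly. *)
Lemma rint_shrink x1 u1 u2 x2 y1 v1 v2 y2 F : x1 <= u1 -> u1 <= u2 -> u2 <= x2 ->
  y1 <= v1 -> v1 <= v2 -> v2 <= y2 ->
  (forall z, inR x1 x2 y1 y2 z -> ~ inRo u1 u2 v1 v2 z -> cdiff F z) ->
  rint x1 x2 y1 y2 F = rint u1 u2 v1 v2 F.
Proof.
move=> xu u12 ux yv v12 vy Fd.
have E a b c d : a <= b -> c <= d -> x1 <= a -> b <= x2 -> y1 <= c -> d <= y2 ->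
    (b <= u1 \/ u2 <= a \/ d <= v1 \/ v2 <= c) -> rint a b c d F = 0.
  move=> ab cd xa bx yc dy Hs; apply: goursat => // z [/andP[z1 z2] /andP[z3 z4]].
  apply: Fd; first by split; lra.
  by move=> [/andP[? ?] /andP[? ?]]; lra.
have hb a b y : x1 <= a -> b <= x2 -> y1 <= y <= y2 -> (y <= v1 \/ v2 <= y) ->
    bm a b (fun x => F (x +i* y)%C * 1).
  move=> ax bx yb Hy; apply: (@hseg_bm a b y y); first by rewrite lexx.
  apply: cdiff_contT => z [/andP[z1 z2] /andP[z3 z4]]; apply: Fd; first by split; lra.
  by move=> [/andP[? ?] /andP[? ?]]; lra.
have vb c d x : y1 <= c -> d <= y2 -> x1 <= x <= x2 -> (x <= u1 \/ u2 <= x) ->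
    bm c d (fun y => F (x +i* y)%C * 'i%C).
  move=> cy dy xb Hx; apply: (@vseg_bm x x c d); first by rewrite lexx.
  apply: cdiff_contT => z [/andP[z1 z2] /andP[z3 z4]]; apply: Fd; first by split; lra.
  by move=> [/andP[? ?] /andP[? ?]]; lra.
have sx : rint x1 x2 y1 y2 F = rint x1 u1 y1 y2 F + (rint u1 u2 y1 y2 F + rint u2 x2 y1 y2 F).
  have h1 : bm x1 x2 (fun x => F (x +i* y1)%C * 1) by apply: hb; lra.
  have h2 : bm x1 x2 (fun x => F (x +i* y2)%C * 1) by apply: hb; lra.
  have b1 := bm_sub xu (lexx x2) h1; have b2 := bm_sub xu (lexx x2) h2.
  rewrite /rint /hseg (ig_split xu (le_trans u12 ux) h1) (ig_split u12 ux b1).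
  rewrite (ig_split xu (le_trans u12 ux) h2) (ig_split u12 ux b2); ring.
have sy : rint u1 u2 y1 y2 F = rint u1 u2 y1 v1 F + (rint u1 u2 v1 v2 F + rint u1 u2 v2 y2 F).
  have h1 : bm y1 y2 (fun y => F (u1 +i* y)%C * 'i%C) by apply: vb; lra.
  have h2 : bm y1 y2 (fun y => F (u2 +i* y)%C * 'i%C) by apply: vb; lra.
  have b1 := bm_sub yv (lexx y2) h1; have b2 := bm_sub yv (lexx y2) h2.
  rewrite /rint /vseg (ig_split yv (le_trans v12 vy) h1) (ig_split v12 vy b1).
  rewrite (ig_split yv (le_trans v12 vy) h2) (ig_split v12 vy b2); ring.
have e1 : rint x1 u1 y1 y2 F = 0 by apply: E; lra.
have e2 : rint u2 x2 y1 y2 F = 0 by apply: E; lra.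
have e3 : rint u1 u2 y1 v1 F = 0 by apply: E; lra.
have e4 : rint u1 u2 v2 y2 F = 0 by apply: E; lra.
by rewrite sx sy e1 e2 e3 e4 !addr0 !add0r.
Qed.

End Rectangles.

(** * Cauchy's integral formula on rectangles *)

Section CauchyFormula.
Variable R : realType.
Local Notation C := R[i].
Local Notation two_pi_i := (@two_pi_i R).
Implicit Types (f F : C -> C) (z w : C) (x y : R).

Lemma integral_atan_shift c : (\int[@lebesgue_measure R]_(x in `[(c - 1)%R, (c + 1)%R])
  (1 + (x - c) ^+ 2)^-1)%R = pi / 2.
Proof.
have p (x : R) : 0 < 1 + (x - c) ^+ 2 by rewrite ltr_pwDl// sqr_ge0.
have d (x : R) : is_derive x 1 (fun x => atan (x - c)) (1 + (x - c) ^+ 2)^-1.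
  have h1 : is_derive x 1 (fun x : R => x - c) 1.
    by rewrite -[X in is_derive _ _ _ X](subr0 1); apply: is_deriveB.
  have h2 := is_derive1_atan (x - c).
  by have := is_derive1_comp (f := atan) (g := fun x : R => x - c) h2 h1; rewrite mulr1.
have cc : {within `[c - 1, c + 1], continuous (fun x : R => (1 + (x - c) ^+ 2)^-1)}.
  apply: continuous_subspaceT => x; apply: cvgV; first by rewrite gt_eqF.
  by apply: cvgD; [exact: cvg_cst|apply: cvgM; apply: cvgB => //; exact: cvg_cst].
have dc x : derivable (fun x : R => atan (x - c)) x 1 by case: (d x).
have := @continuous_FTC2 R _ (fun x => atan (x - c)) (c - 1) (c + 1) _ cc.
rewrite /Rintegral => ->.
- rewrite -EFinB /=.
  have -> : c + 1 - c = 1 by ring.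
  have -> : c - 1 - c = - 1 by ring.
  by rewrite atanN atan1 opprK; field.
- by lra.
- split=> //.
  + by apply: cvg_at_right_filter; apply: differentiable_continuous; apply/derivable1_diffP.
  + by apply: cvg_at_left_filter; apply: differentiable_continuous; apply/derivable1_diffP.
- by move=> x _; rewrite derive1E; case: (d x).
Qed.

Lemma ig_real (a b : R) (g : R -> R) : ig a b (fun s => (g s)%:C%C) =
  (\int[@lebesgue_measure R]_(x in `[a, b]) g x)%R%:C%C.
Proof. by apply: ceqP => //=; rewrite Rintegral_cst// mul0r. Qed.

Lemma cdiff_pole z0 z : z != z0 -> cdiff (fun w => (w - z0)^-1) z.
Proof.
move=> zz; apply: cdiffV; first by rewrite subr_eq0.
by apply: cdiffB; [exact: cdiff_id|exact: cdiff_cst].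
Qed.

(** Opposite edges of the square are paired: with [s] measured from the centre, the two integrands
    differ by 2i / (1 + s^2), and [atan] gives i pi for each pair. This avoids branches of the
    logarithm. *)
Lemma rint_pole_unit z0 : rint (Re z0 - 1) (Re z0 + 1)
  (Im z0 - 1) (Im z0 + 1) (fun w => (w - z0)^-1) = two_pi_i.
Proof.
set a := Re z0; set b := Im z0.
have nb1 : b - 1 != b by apply/eqP => h; lra.
have nb2 : b + 1 != b by apply/eqP => h; lra.
have na1 : a - 1 != a by apply/eqP => h; lra.
have na2 : a + 1 != a by apply/eqP => h; lra.
have zE : z0 = (a +i* b)%C by apply: ceqP.
have p (u : R) : 1 + u ^+ 2 != 0 by rewrite gt_eqF// ltr_pwDl// sqr_ge0.
have hb y : y != b -> bm (a - 1) (a + 1) (fun x => (((x +i* y)%C : C) - z0)^-1 * 1).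
  move=> yb; apply: (@hseg_bm _ _ _ y y y (fun w => (w - z0)^-1)); rewrite ?lexx//.
  apply: cdiff_contT => z [_ zy]; apply: cdiff_pole; apply: contra yb => /eqP zz.
  by move: zy; rewrite zz -/b => /andP[? ?]; rewrite eq_le; apply/andP.
have vb x : x != a -> bm (b - 1) (b + 1) (fun y => (((x +i* y)%C : C) - z0)^-1 * 'i%C).
  move=> xa; apply: (@vseg_bm _ x x _ _ x (fun w => (w - z0)^-1)); rewrite ?lexx//.
  apply: cdiff_contT => z [zx _]; apply: cdiff_pole; apply: contra xa => /eqP zz.
  by move: zx; rewrite zz -/a => /andP[? ?]; rewrite eq_le; apply/andP.
have bc (c : R) : bm (c - 1) (c + 1) (fun x => ((1 + (x - c) ^+ 2)^-1)%:C%C).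
  apply: contR_bm => s _ e e0; exists e => // r _ rs.
  rewrite real_complexB nm_real.
  set u := s - c; set v := r - c.
  have uv : `|v - u| < e by rewrite (_ : v - u = r - s)// /u /v; ring.
  have -> : (1 + v ^+ 2)^-1 - (1 + u ^+ 2)^-1 = (u - v) * ((u + v) / ((1 + u ^+ 2) * (1 + v ^+ 2))).
    by field; rewrite !p.
  rewrite normrM distrC (le_lt_trans _ uv)// ler_piMr//.
  have q : 0 < (1 + u ^+ 2) * (1 + v ^+ 2) by rewrite mulr_gt0// ltr_pwDl// sqr_ge0.
  rewrite normrM normfV (gtr0_norm q) ler_pdivrMr// mul1r ler_norml.
  have := sqr_ge0 (u * v); have := sqr_ge0 (u - 1); have := sqr_ge0 (v - 1).
  have := sqr_ge0 (u + 1); have := sqr_ge0 (v + 1).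
  by rewrite exprMn; move=> *; apply/andP; split; nra.
rewrite /rint /hseg /vseg -(igN (hb _ nb2)) -(igN (vb _ na1)).
rewrite -(igD (hb _ nb1) (bmN (hb _ nb2))) -(igD (vb _ na2) (bmN (vb _ na1))).
have e1 : ig (a - 1) (a + 1) (fun s => (((s +i* (b - 1))%C : C) - z0)^-1 * 1 -
   (((s +i* (b + 1))%C : C) - z0)^-1 * 1) = (0 +i* pi)%C.
  transitivity (ig (a - 1) (a + 1) (fun x => (0 +i* 2)%C * ((1 + (x - a) ^+ 2)^-1)%:C%C)).
    apply: eq_ig => s _; rewrite zE; have q := p (s - a).
    have -> : ((s +i* (b - 1))%C : C) - (a +i* b)%C = ((s - a) +i* (-1))%C.
      by apply: ceqP; rewrite ?ReD ?ImD ?ReN ?ImN /=; ring.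
    have -> : ((s +i* (b + 1))%C : C) - (a +i* b)%C = ((s - a) +i* 1)%C.
      by apply: ceqP; rewrite ?ReD ?ImD ?ReN ?ImN /=; ring.
    by rewrite !mulr1; apply: ceqP; rewrite ?ReD ?ImD ?ReN ?ImN ?ReM ?ImM /=; field; rewrite ?sqrrN ?expr1n ?[_ + 1]addrC ?q.
  rewrite igZ// ig_real integral_atan_shift.
  by apply: ceqP; rewrite ?ReM ?ImM /=; field.
have e2 : ig (b - 1) (b + 1) (fun s => ((((a + 1) +i* s)%C : C) - z0)^-1 * 'i%C -
   ((((a - 1) +i* s)%C : C) - z0)^-1 * 'i%C) = (0 +i* pi)%C.
  transitivity (ig (b - 1) (b + 1) (fun x => (0 +i* 2)%C * ((1 + (x - b) ^+ 2)^-1)%:C%C)).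
    apply: eq_ig => s _; rewrite zE; have q := p (s - b).
    have -> : (((a - 1) +i* s)%C : C) - (a +i* b)%C = ((-1) +i* (s - b))%C.
      by apply: ceqP; rewrite ?ReD ?ImD ?ReN ?ImN /=; ring.
    have -> : (((a + 1) +i* s)%C : C) - (a +i* b)%C = (1 +i* (s - b))%C.
      by apply: ceqP; rewrite ?ReD ?ImD ?ReN ?ImN /=; ring.
    by apply: ceqP; rewrite ?ReD ?ImD ?ReN ?ImN ?ReM ?ImM /=; field; rewrite ?sqrrN ?expr1n ?q.
  rewrite igZ// ig_real integral_atan_shift.
  by apply: ceqP; rewrite ?ReM ?ImM /=; field.
rewrite e1 e2; apply: ceqP; rewrite ?ReD ?ImD /=; ring.
Qed.

(** The given rectangle and the square of side 2 are both obtained by shrinking one larger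
    rectangle. *)
Lemma rint_pole x1 x2 y1 y2 z0 : inRo x1 x2 y1 y2 z0 ->
  rint x1 x2 y1 y2 (fun w => (w - z0)^-1) = two_pi_i.
Proof.
move=> z0R; have [/andP[r1 r2] /andP[r3 r4]] := z0R.
set a := Re z0 in r1 r2; set b := Im z0 in r3 r4.
pose X1 := Num.min x1 (a - 1); pose X2 := Num.max x2 (a + 1).
pose Y1 := Num.min y1 (b - 1); pose Y2 := Num.max y2 (b + 1).
have h1 : X1 <= x1 /\ X1 <= a - 1 by rewrite !ge_min !lexx orbT.
have h2 : x2 <= X2 /\ a + 1 <= X2 by rewrite !le_max !lexx orbT.
have h3 : Y1 <= y1 /\ Y1 <= b - 1 by rewrite !ge_min !lexx orbT.
have h4 : y2 <= Y2 /\ b + 1 <= Y2 by rewrite !le_max !lexx orbT.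
transitivity (rint X1 X2 Y1 Y2 (fun w => (w - z0)^-1)).
  symmetry; apply: rint_shrink; try lra.
  move=> z _ nz; apply: cdiff_pole; apply/eqP => zz; apply: nz; rewrite zz.
  by split; rewrite -/a -/b; lra.
rewrite -[RHS](rint_pole_unit z0); apply: rint_shrink; rewrite -/a -/b; try lra.
move=> z _ nz; apply: cdiff_pole; apply/eqP => zz; apply: nz; rewrite zz.
by split; rewrite -/a -/b; lra.
Qed.

(** The difference quotient [G] at [z0] stays bounded near [z0], so its integral over a square of
    half side [dl] about [z0] is of order [dl]; by [rint_shrink] this is also its integral over the
    rectangle, which is therefore 0. The remaining part of the integrand is a multiple of the pole
    of [rint_pole]. *)
Lemma cauchy_formula x1 x2 y1 y2 F z0 : inRo x1 x2 y1 y2 z0 ->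
  (forall z, inR x1 x2 y1 y2 z -> cdiff F z) ->
  rint x1 x2 y1 y2 (fun w => F w / (w - z0)) = F z0 * two_pi_i.
Proof.
move=> z0R Fd; have [/andP[r1 r2] /andP[r3 r4]] := z0R.
set a := Re z0 in r1 r2; set b := Im z0 in r3 r4.
have x12 : x1 <= x2 by lra.
have y12 : y1 <= y2 by lra.
have off z : ~ inRo x1 x2 y1 y2 z -> z != z0 by move=> nz; apply/eqP => zz; apply: nz; rewrite zz.
have bdo u1 u2 v1 v2 z : bdR u1 u2 v1 v2 z -> ~ inRo u1 u2 v1 v2 z.
  by move=> [[]|[]] [s _ ->] [/= /andP[? ?] /andP[? ?]]; lra.
have cr := cyc_rint x12 y12; have bs := bdR_sub x12 y12.
have z0R' : inR x1 x2 y1 y2 z0 by split; rewrite -/a -/b; lra.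
have [d Hd] := Fd _ z0R'; have [r r0 Hr] := Hd 1 ltr01.
pose G w := (F w - F z0) / (w - z0).
have Gd z : inR x1 x2 y1 y2 z -> z != z0 -> cdiff G z.
  move=> zR zz; apply: cdiffM; last exact: cdiff_pole.
  by apply: cdiffB; [exact: Fd|exact: cdiff_cst].
have G0 : rint x1 x2 y1 y2 G = 0.
  (* Here [nm d + 1] bounds [G] near [z0], the first 4 is that of [rint_bound], and the last one
     comes from the edge lengths, [4 * dl] in all, with [dl <= e]. *)
  apply: (@nm_eq0_le _ _ (4 * (nm d + 1) * 4)) => e e0.
  pose m := Num.min (Num.min (a - x1) (x2 - a)) (Num.min (b - y1) (y2 - b)).
  pose dl := Num.min e (Num.min (r / 8) m).
  have dl0 : 0 < dl by rewrite !lt_min e0 divr_gt0// /=; lra.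
  have dle : dl <= e by rewrite ge_min lexx.
  have dlr : dl <= r / 8 by rewrite /dl 2!ge_min lexx !orbT.
  have dlm : dl <= m by rewrite /dl 2!ge_min lexx !orbT.
  have dl1 : dl <= a - x1 by rewrite (le_trans dlm)// /m !ge_min lexx.
  have dl2 : dl <= x2 - a by rewrite (le_trans dlm)// /m !ge_min lexx ?orbT.
  have dl3 : dl <= b - y1 by rewrite (le_trans dlm)// /m !ge_min lexx ?orbT.
  have dl4 : dl <= y2 - b by rewrite (le_trans dlm)// /m !ge_min lexx ?orbT.
  have -> : rint x1 x2 y1 y2 G = rint (a - dl) (a + dl) (b - dl) (b + dl) G.
    apply: rint_shrink; try lra.
    move=> z zR nz; apply: Gd => //; apply/eqP => zz; apply: nz; rewrite zz.
    by split; rewrite -/a -/b; lra.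
  have sx : a - dl <= a + dl by lra.
  have sy : b - dl <= b + dl by lra.
  have sub := bdR_sub sx sy.
  have z0s : inR (a - dl) (a + dl) (b - dl) (b + dl) z0 by split; rewrite -/a -/b; lra.
  have bd0 z : bdR (a - dl) (a + dl) (b - dl) (b + dl) z -> z != z0.
    move=> /bdo nz; apply/eqP => zz; apply: nz; rewrite zz; split; rewrite -/a -/b; lra.
  apply: (@le_trans _ _ (4 * (nm d + 1) * ((a + dl - (a - dl)) + (b + dl - (b - dl))))).
    apply: rint_bound => //; first by rewrite addr_ge0 ?nm_ge0.
      apply: cdiff_contT => z zb; apply: Gd; last exact: bd0.
      have [/andP[? ?] /andP[? ?]] := sub z zb; split; lra.
    move=> z zb; have zz := bd0 z zb.
    have zn : nm (z - z0) < r by have := nm_inR (sub z zb) z0s; lra.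
    have := Hr z zn; rewrite mul1r => H.
    rewrite /G nmM nmV ler_pdivrMr ?nm_gt0 ?subr_eq0//.
    have := nmD (F z - F z0 - d * (z - z0)) (d * (z - z0)); rewrite subrK nmM.
    by rewrite mulrDl mul1r; lra.
  rewrite (_ : a + dl - (a - dl) + _ = 4 * dl); last by ring.
  by rewrite mulrA ler_wpM2l ?mulr_ge0 ?addr_ge0 ?nm_ge0.
have Gc : contT (bdR x1 x2 y1 y2) G.
  by apply: cdiff_contT => z zb; apply: Gd; [exact: bs|exact: off (bdo _ _ _ _ _ zb)].
have pc : contT (bdR x1 x2 y1 y2) (fun w => (w - z0)^-1).
  by apply: cdiff_contT => z zb; apply: cdiff_pole; exact: off (bdo _ _ _ _ _ zb).
rewrite -(rint_pole z0R) -(cycZ cr)// -[LHS]subr0 -G0 -(cycB cr)//.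
  by apply: (cyc_ext cr) => z _; rewrite /G; ring.
apply: contT_M => //; apply: cdiff_contT => z /bs; exact: Fd.
Qed.

End CauchyFormula.

(** * Continuity of functions of several variables *)

Section RowContinuity.
Variable R : realType.
Local Notation C := R[i].
Variable n : nat.
Implicit Types (Phi Psi : 'rV[C]_n -> C) (z w : 'rV[C]_n).

Definition rcont Phi z := forall e, 0 < e ->
  exists2 d, 0 < d & forall w, rclose d w z -> nm (Phi w - Phi z) < e.

Lemma rclose_le (d d' : R) w z : d <= d' -> rclose d w z -> rclose d' w z.
Proof. by move=> dd H i; exact: lt_le_trans (H i) dd. Qed.

Lemma rcont_contV Ts Phi : (forall z, inT Ts z -> rcont Phi z) -> contV Ts Phi.
Proof. by move=> H z Tz e /(H z Tz)[d d0 Hd]; exists d => // w _; exact: Hd. Qed.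

Lemma rcont_cst k z : rcont (fun=> k) z.
Proof. by move=> e e0; exists 1 => // w _; rewrite subrr nm0. Qed.

Lemma rcont_coord i z : rcont (fun w => w 0 i) z.
Proof. by move=> e e0; exists e => // w; exact. Qed.

Lemma rcont_comp (g : C -> C) Phi z : rcont Phi z ->
  (forall e, 0 < e -> exists2 d, 0 < d & forall u : C, nm (u - Phi z) < d -> nm (g u - g (Phi z)) < e) ->
  rcont (fun w => g (Phi w)) z.
Proof.
move=> Pc gc e /gc[d d0 Hd]; have [d' d'0 H] := Pc d d0.
by exists d' => // w /H; exact: Hd.
Qed.

Lemma rcontD Phi Psi z : rcont Phi z -> rcont Psi z -> rcont (fun w => Phi w + Psi w) z.
Proof.
move=> Pc Qc e e0; have e2 : 0 < e / 2 by rewrite divr_gt0.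
have [d d0 H] := Pc _ e2; have [d' d'0 H'] := Qc _ e2.
exists (Num.min d d'); first by rewrite lt_min d0.
move=> w wz; rewrite opprD addrACA (le_lt_trans (nmD _ _))// (splitr e) ltrD//.
  by apply: H; apply: rclose_le wz; rewrite ge_min lexx.
by apply: H'; apply: rclose_le wz; rewrite ge_min lexx orbT.
Qed.

Lemma rcontM Phi Psi z : rcont Phi z -> rcont Psi z -> rcont (fun w => Phi w * Psi w) z.
Proof.
move=> Pc Qc e /(mul_close (Phi z) (Psi z))[r r0 Hr].
have [d d0 H] := Pc _ r0; have [d' d'0 H'] := Qc _ r0.
exists (Num.min d d'); first by rewrite lt_min d0.
move=> w wz; apply: Hr; first by apply: H; apply: rclose_le wz; rewrite ge_min lexx.
by apply: H'; apply: rclose_le wz; rewrite ge_min lexx orbT.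
Qed.

Lemma rcontV Phi z : Phi z != 0 -> rcont Phi z -> rcont (fun w => (Phi w)^-1) z.
Proof.
move=> P0 Pc; apply: rcont_comp Pc _ => e e0.
by have [d d0 H] := cdiff_cont (cdiff_inv P0) e0; exists d.
Qed.

End RowContinuity.

(** * Compactness, distances and Cauchy transforms *)

Section Compactness.
Variable R : realType.
Local Notation C := R[i].
Implicit Types T : set C.

Lemma lebesgue_number T (P : C -> Prop) : gcompact T ->
  (forall z, T z -> exists2 r, 0 < r & forall w, nm (w - z) < r -> P w) ->
  exists2 r, 0 < r & forall z w, T z -> nm (w - z) < r -> P w.
Proof.
move=> gT H.
have /choice[r Hr] : forall z, exists r, T z -> 0 < r /\ forall w, nm (w - z) < r -> P w.
  move=> z; have [Tz|] := pselect (T z); last by exists 1.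
  by have [r r0 Hr] := H z Tz; exists r.
have [s [sT cov]] := gT (fun z => r z / 2) (fun z Tz => divr_gt0 (Hr z Tz).1 (ltr0Sn _ 1)).
have [d d0 Hd] : exists2 d, 0 < d & forall x, x \in s -> d <= r x / 2.
  by apply: seq_min_gt0 => x /sT Tx; rewrite divr_gt0// (Hr x Tx).1.
exists d => // z w Tz wz; have [x xs zx] := cov z Tz.
apply: (Hr x (sT x xs)).2; have := nm_tri w z x; have := Hd x xs; lra.
Qed.

Lemma gcompact_dist T a : gcompact T -> ~ T a ->
  exists2 d, 0 < d & forall z, T z -> d <= nm (z - a).
Proof.
move=> gT nTa.
have [z Tz|d d0 H] := @lebesgue_number T (fun w => w <> a) gT.
  have za : 0 < nm (z - a) by rewrite nm_gt0 subr_eq0; apply/eqP => za; apply: nTa; rewrite -za.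
  exists (nm (z - a)) => // w wz wa; rewrite wa nm_sub ltxx in wz; exact: notF.
by exists d => // z Tz; rewrite leNgt nm_sub; apply/negP => /(H z a Tz).
Qed.

Lemma gcompact_bounded T : gcompact T -> exists2 B, 0 < B & forall z, T z -> nm z < B.
Proof.
move=> gT; have [s [sT cov]] := gT (fun=> 1) (fun _ _ => ltr01).
exists (\sum_(x <- s) nm x + 1).
  by rewrite ltr_wpDl// sumr_ge0// => *; exact: nm_ge0.
move=> z Tz; have [x xs zx] := cov z Tz; have := nm_subge z x.
have : nm x <= \sum_(x <- s) nm x.
  elim: s xs {sT cov} => // a s IH; rewrite inE big_cons => /orP[/eqP ->|/IH h1].
    by rewrite lerDl sumr_ge0// => *; exact: nm_ge0.
  by rewrite (le_trans h1)// lerDr nm_ge0.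
by lra.
Qed.

(** Pairs are encoded as rows of length 2, so that [heine_cantor] covers this case. *)
Lemma UC2_of_cont T1 T2 (h : C -> C -> C) : gcompact T1 -> gcompact T2 ->
  (forall z : 'rV[C]_2, T1 (z 0 0) -> T2 (z 0 1) -> rcont (fun z => h (z 0 0) (z 0 1)) z) ->
  UC2 T1 T2 h.
Proof.
move=> g1 g2 H; pose Ts k := if k is 0%N then T1 else T2.
have inTs (z : 'rV[C]_2) : inT Ts z -> T1 (z 0 0) /\ T2 (z 0 1).
  by move=> Tz; split; [exact: (Tz 0)|exact: (Tz 1)].
have uh : UC Ts (fun z : 'rV[C]_2 => h (z 0 0) (z 0 1)).
  apply: heine_cantor => [[|k] //|].
  by apply: rcont_contV => z /inTs[]; exact: H.
move=> e e0; have [d d0 Hd] := uh e e0; exists d => // x x' y y' Tx Tx' Ty Ty' xx yy.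
pose pr a b : 'rV[C]_2 := \row_i (if i == 0 then a else b).
have prT a b : T1 a -> T2 b -> inT Ts (pr a b).
  by move=> Ta Tb i; rewrite mxE; case: i => -[|[|]].
have := Hd (pr x y) (pr x' y') (prT _ _ Tx Ty) (prT _ _ Tx' Ty').
by rewrite !mxE /=; apply=> i; rewrite !mxE; case: ifP.
Qed.

Lemma pole_cont T (a b : C) (d : R) : 0 < d -> (forall z, T z -> d <= nm (z - a)) ->
  nm (b - a) <= d / 2 -> forall z, T z ->
  [/\ z != a, z != b & nm ((z - b)^-1 - (z - a)^-1) <= nm (b - a) * (2 / d ^+ 2)].
Proof.
move=> d0 Hd ba z Tz; have za := Hd z Tz.
have zb : d / 2 <= nm (z - b) by have := nm_tri z b a; lra.
have za0 : z - a != 0 by rewrite -nm_gt0; lra.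
have zb0 : z - b != 0 by rewrite -nm_gt0; lra.
split; [by rewrite -subr_eq0|by rewrite -subr_eq0|].
have -> : (z - b)^-1 - (z - a)^-1 = (b - a) / ((z - b) * (z - a)) by field; rewrite za0 zb0.
rewrite nmM ler_wpM2l ?nm_ge0// nmV nmM.
have -> : 2 / d ^+ 2 = (d / 2 * d)^-1 by field; rewrite gt_eqF.
rewrite lef_pV2 ?posrE ?mulr_gt0// ?nm_gt0//.
by rewrite ler_pM// ?divr_ge0// ltW.
Qed.

Lemma contT_pole T a : ~ T a -> contT T (fun z => (z - a)^-1).
Proof.
move=> nTa; apply: cdiff_contT => z Tz; apply: cdiff_pole; apply/eqP => za.
by apply: nTa; rewrite -za.
Qed.

(** Off the support, the kernel depends on its pole uniformly in [z]. With [f = 1] this makes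
    winding numbers locally constant; with general [f] it carries Cauchy's formula over to points on
    common edges of grid cells. *)
Lemma cauchy_transform_cont T J f a : cyc T J -> contT T f -> ~ T a ->
  forall e, 0 < e -> exists2 r, 0 < r & forall b, nm (b - a) < r ->
    ~ T b /\ nm (J (fun z => f z / (z - b)) - J (fun z => f z / (z - a))) < e.
Proof.
move=> c fc nTa e e0; have [d d0 Hd] := gcompact_dist (cyc_compact c) nTa.
have [L L0 HL] := cyc_bound c.
have [K K0 HK] : exists2 K, 0 <= K & forall z, T z -> nm (f z) <= K.
  have /choice[r Hr] : forall z, exists r, T z -> 0 < r /\
      forall w, T w -> nm (w - z) < r -> nm (f w - f z) < 1.
    move=> z; have [Tz|] := pselect (T z); last by exists 1.
    by have [r r0 Hk] := fc z Tz _ ltr01; exists r => _; split.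
  have [s [sT cov]] := cyc_compact c (fun x Tx => (Hr x Tx).1).
  exists (\sum_(x <- s) nm (f x) + 1); first by rewrite addr_ge0// sumr_ge0// => *; exact: nm_ge0.
  move=> z Tz; have [x xs zx] := cov z Tz; have [_ Hx] := Hr x (sT x xs).
  have := Hx z Tz zx; have := nm_subge (f z) (f x).
  have : nm (f x) <= \sum_(x <- s) nm (f x).
    elim: s xs {sT cov} => // u s IH; rewrite inE big_cons => /orP[/eqP ->|/IH h1].
      by rewrite lerDl sumr_ge0// => *; exact: nm_ge0.
    by rewrite (le_trans h1)// lerDr nm_ge0.
  by lra.
pose M := L * (K * (2 / d ^+ 2)) + 1.
have M0 : 0 < M by rewrite ltr_wpDl// !mulr_ge0// invr_ge0 exprn_ge0// ltW.
exists (Num.min (d / 2) (e / M)); first by rewrite lt_min !divr_gt0.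
move=> b; rewrite lt_min => /andP[/ltW b1 b2].
have P := pole_cont d0 Hd b1.
have nTb : ~ T b by move=> /P[_]; rewrite eqxx.
split=> //; rewrite -(cycB c); [|exact: contT_M fc (contT_pole _)..].
apply: (@le_lt_trans _ _ (L * (K * (nm (b - a) * (2 / d ^+ 2))))).
  apply: HL.
  - by rewrite !mulr_ge0 ?nm_ge0// invr_ge0 exprn_ge0// ltW.
  - by apply: contT_B; exact: contT_M fc (contT_pole _).
  - move=> z Tz; rewrite -mulrBr nmM; have [_ _ h] := P z Tz.
    by rewrite ler_pM ?nm_ge0// HK.
rewrite ltr_pdivlMr// in b2; apply: le_lt_trans b2.
have := nm_ge0 (b - a); rewrite /M; set t := 2 / d ^+ 2 => h.
by have : L * (K * (nm (b - a) * t)) = nm (b - a) * (L * (K * t)) by [ring]; lra.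
Qed.

End Compactness.

(** * Unions of grid cells and Cauchy's formula on their boundary *)

Section Grid.
Variable R : realType.
Local Notation C := R[i].
Local Notation two_pi_i := (@two_pi_i R).
Variables (X0 Y0 h : R) (N : nat).
Hypothesis h0 : 0 < h.
Implicit Types (f F : C -> C) (chi : nat -> nat -> bool).

Definition px (i : nat) : R := X0 + i%:R * h.
Definition py (j : nat) : R := Y0 + j%:R * h.
Definition cell i j := inR (px i) (px i.+1) (py j) (py j.+1).
Definition ocell i j := inRo (px i) (px i.+1) (py j) (py j.+1).
Definition cint i j f : C := rint (px i) (px i.+1) (py j) (py j.+1) f.

(* The cells of chi stay away from the rim of the grid, so that each of their
   edges lies between two cells of the grid. *)
Definition grid_region chi := forall i j, chi i j -> (0 < i /\ i.+1 < N /\ 0 < j /\ j.+1 < N)%N.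

Definition pred0 (c : nat -> bool) (j : nat) : bool := if j is k.+1 then c k else false.

(** The multiplicity of a horizontal edge in the boundary: 1 for the cell above it, -1 for the cell
    below. An edge between cells of the same kind gets 0 and drops out of [edgeset]. *)
Definition hcoef chi i j : C := (chi i j)%:R - (pred0 (chi i) j)%:R.
Definition vcoef chi i j : C := (pred0 (chi^~ j) i)%:R - (chi i j)%:R.

Definition bdG chi f : C :=
  \sum_(e : 'I_N * 'I_N.+1) hcoef chi e.1 e.2 * hseg (px e.1) (px e.1.+1) (py e.2) f +
  \sum_(e : 'I_N.+1 * 'I_N) vcoef chi e.1 e.2 * vseg (py e.2) (py e.2.+1) (px e.1) f.

Definition edgeset chi : set C :=
  [set z | exists2 e : 'I_N * 'I_N.+1, e \in index_enum _ &
     (if hcoef chi e.1 e.2 == 0 then set0 else hset (px e.1) (px e.1.+1) (py e.2)) z] `|`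
  [set z | exists2 e : 'I_N.+1 * 'I_N, e \in index_enum _ &
     (if vcoef chi e.1 e.2 == 0 then set0 else vset (py e.2) (py e.2.+1) (px e.1)) z].

Lemma pxS i : px i <= px i.+1.
Proof. by rewrite /px lerD2l ler_pM2r// ler_nat. Qed.
Lemma pyS i : py i <= py i.+1.
Proof. by rewrite /py lerD2l ler_pM2r// ler_nat. Qed.
Lemma px1 i : px i.+1 = px i + h. Proof. by rewrite /px -natr1; ring. Qed.
Lemma py1 i : py i.+1 = py i + h. Proof. by rewrite /py -natr1; ring. Qed.

Lemma cyc_bdG chi : cyc (edgeset chi) (bdG chi).
Proof.
have key T J (k : C) : cyc T J -> cyc (if k == 0 then set0 else T) (fun f => k * J f).
  move=> c; case: eqP => [->|_]; last exact: cyc_scale.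
  rewrite (_ : (fun f => 0 * J f) = fun _ : C -> C => 0 : C); first exact: cyc_zero.
  by apply/funext => f; rewrite mul0r.
apply: cyc_add; apply: cyc_big => e _; apply: key.
- exact: cyc_hseg (pxS _).
- exact: cyc_vseg (pyS _).
Qed.

Lemma abel_sum (c : nat -> bool) (H : nat -> C) (M : nat) : c M = false ->
  \sum_(j < M) (c j)%:R * (H j - H j.+1) = \sum_(j < M.+1) ((c j)%:R - (pred0 c j)%:R) * H j.
Proof.
move=> cM; under eq_bigr do rewrite mulrBr; rewrite sumrB.
under [RHS]eq_bigr do rewrite mulrBl; rewrite [RHS]sumrB; congr (_ - _).
  by rewrite big_ord_recr /= cM mul0r addr0.
by rewrite big_ord_recl /= mul0r add0r.
Qed.

(** Summation by parts. Both forms are needed: the sum over edges shows the true support of the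
    boundary, the sum over cells gives access to Cauchy's theorem. *)
Lemma bdGE chi f : grid_region chi ->
  bdG chi f = \sum_(i < N) \sum_(j < N) (chi i j)%:R * cint i j f.
Proof.
move=> gr; have out i j : (N <= i)%N || (N <= j)%N -> chi i j = false.
  move=> H; apply/negP => /gr[_ [iN [_ jN]]]; case/orP: H => H.
    by have := leq_trans (ltnW iN) H; rewrite ltnn.
  by have := leq_trans (ltnW jN) H; rewrite ltnn.
rewrite /bdG -(pair_bigA _ (fun (i : 'I_N) (j : 'I_N.+1) =>
  hcoef chi i j * hseg (px i) (px i.+1) (py j) f)) /=.
rewrite -(pair_bigA _ (fun (i : 'I_N.+1) (j : 'I_N) =>
  vcoef chi i j * vseg (py j) (py j.+1) (px i) f)) /=.
rewrite [X in _ + X]exchange_big /=.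
transitivity (\sum_(i < N) \sum_(j < N) (chi i j)%:R *
   (hseg (px i) (px i.+1) (py j) f - hseg (px i) (px i.+1) (py j.+1) f) +
   \sum_(j < N) \sum_(i < N) (chi i j)%:R *
   (- vseg (py j) (py j.+1) (px i) f - - vseg (py j) (py j.+1) (px i.+1) f)).
  congr (_ + _); apply: eq_bigr => i _.
    rewrite (@abel_sum (chi i) (fun j => hseg (px i) (px i.+1) (py j) f))//.
    by apply: out; rewrite leqnn orbT.
  rewrite (@abel_sum (fun k => chi k i) (fun k => - vseg (py i) (py i.+1) (px k) f)).
    by apply: eq_bigr => j _; rewrite /vcoef; ring.
  by apply: out; rewrite leqnn.
rewrite [X in _ + X]exchange_big -big_split; apply: eq_bigr => i _.
rewrite -big_split; apply: eq_bigr => j _ /=; rewrite /cint /rint; ring.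
Qed.

(** The reason for building the boundary from uncancelled edges: each of its points touches cells of
    both kinds. By [grid_region] no such edge lies on the left or lower rim, where the neighbouring
    cell would have a negative index. *)
Lemma edgeset_cells chi z : grid_region chi -> edgeset chi z ->
  exists i j i' j', [/\ chi i j, cell i j z, ~~ chi i' j' & cell i' j' z].
Proof.
move=> gr [[e _]|[e _]]; case: eqP => // + [s /andP[s1 s2] ->].
- rewrite /hcoef; case: e => [[i iN] [j jN]] /= in s1 s2 *.
  case: j jN => [|j] jN /= H.
    by have := @gr i 0%N; case: (chi i 0%N) H => [_ /(_ isT)[_ [_ []]]//|/=]; rewrite subr0.
  have c1 : cell i j.+1 (s +i* py j.+1)%C by split=> //=; rewrite ?s1 ?s2// lexx pyS.
  have c2 : cell i j (s +i* py j.+1)%C by split=> //=; rewrite ?s1 ?s2// lexx pyS.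
  case E1 : (chi i j.+1) H; case E2 : (chi i j); rewrite ?subrr// => _.
    by exists i, j.+1, i, j; rewrite E1 E2.
  by exists i, j, i, j.+1; rewrite E1 E2.
- rewrite /vcoef; case: e => [[i iN] [j jN]] /= in s1 s2 *.
  case: i iN => [|i] iN /= H.
    by have := @gr 0%N j; case: (chi 0%N j) H => [_ /(_ isT)[]//|/=]; rewrite subr0.
  have c1 : cell i.+1 j (px i.+1 +i* s)%C by split=> //=; rewrite ?s1 ?s2// lexx pxS.
  have c2 : cell i j (px i.+1 +i* s)%C by split=> //=; rewrite ?s1 ?s2// lexx pxS.
  case E1 : (chi i.+1 j) H; case E2 : (chi i j); rewrite ?subrr// => _.
    by exists i.+1, j, i, j; rewrite E1 E2.
  by exists i, j, i.+1, j; rewrite E1 E2.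
Qed.

Lemma cell_small i j z w : cell i j z -> cell i j w -> nm (z - w) <= 2 * h.
Proof. by move=> cz cw; have := nm_inR cz cw; rewrite px1 py1; lra. Qed.

Lemma ocell_uniq i j i' j' z : ocell i j z -> cell i' j' z -> i = i' /\ j = j'.
Proof.
move=> [/andP[a1 a2] /andP[a3 a4]] [/andP[b1 b2] /andP[b3 b4]].
have key (Z0 t : R) k l : Z0 + k%:R * h < t -> t < Z0 + k.+1%:R * h ->
   Z0 + l%:R * h <= t -> t <= Z0 + l.+1%:R * h -> k = l.
  move=> u1 u2 u3 u4; have h1 : (k < l.+1)%N.
    by have := lt_le_trans u1 u4; rewrite ltrD2l ltr_pM2r// ltr_nat.
  have h2 : (l < k.+1)%N by have := le_lt_trans u3 u2; rewrite ltrD2l ltr_pM2r// ltr_nat.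
  by apply/eqP; rewrite eqn_leq; apply/andP.
by split; [exact: key a1 a2 b1 b2|exact: key a3 a4 b3 b4].
Qed.

(** For a point in the interior of a cell only that cell contributes. A point [a] on an edge shared
    by cells of [chi] is approached by interior points [b] on the segment towards the centre [ct] of
    a cell; both sides are continuous at [a], which lies off [edgeset]. *)
Lemma bdG_cauchy_in chi F a : grid_region chi ->
  (forall i j z, chi i j -> cell i j z -> cdiff F z) ->
  (exists i j, cell i j a) -> (forall i j, cell i j a -> chi i j) ->
  bdG chi (fun z => F z / (z - a)) = F a * two_pi_i.
Proof.
move=> gr Fd [i0 [j0 ca]] Ha; have chi0 := Ha _ _ ca; have [_ [iN [_ jN]]] := gr _ _ chi0.
have opn b : ocell i0 j0 b -> bdG chi (fun z => F z / (z - b)) = F b * two_pi_i.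
  move=> ob; rewrite bdGE// (bigD1 (Ordinal (ltnW iN)))//= (bigD1 (Ordinal (ltnW jN)))//=.
  rewrite chi0 mul1r {1}/cint cauchy_formula//; last by move=> z; exact: Fd.
  have vanish i j : (i, j) != (i0, j0) -> (chi i j)%:R * cint i j (fun z => F z / (z - b)) = 0.
    move=> ij; case E : (chi i j); last by rewrite mul0r.
    rewrite mul1r; apply: goursat; [exact: pxS|exact: pyS|].
    move=> z cz; apply: cdiffM; first exact: Fd E cz.
    apply: cdiff_pole; apply/eqP => zb; rewrite zb in cz.
    by have [ii jj] := ocell_uniq ob cz; rewrite ii jj eqxx in ij.
  rewrite big1 ?addr0; last first.
    move=> j jj; apply: vanish; apply: contra jj => /eqP[jj]; apply/eqP; exact: val_inj.
  rewrite big1 ?addr0// => i ii; rewrite big1// => j _; apply: vanish.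
  by apply: contra ii => /eqP[ii _]; apply/eqP; exact: val_inj.
have nE : ~ edgeset chi a.
  by move=> /(edgeset_cells gr)[? [? [i' [j' [_ _ /negP nc /Ha]]]]].
have Fc : contT (edgeset chi) F.
  apply: cdiff_contT => z /(edgeset_cells gr)[i [j [? [? [cij cz _ _]]]]]; exact: Fd cij cz.
apply/eqP; rewrite -subr_eq0; apply/eqP.
apply: (@nm_eq0_le _ _ (1 + nm two_pi_i)) => e e0.
have [r r0 Hr] := cauchy_transform_cont (cyc_bdG chi) Fc nE e0.
have [r' r'0 Hr'] := cdiff_cont (Fd _ _ _ chi0 ca) e0.
pose m := Num.min r r'; have m0 : 0 < m by rewrite lt_min r0.
pose ct : C := ((px i0 + h / 2) +i* (py j0 + h / 2))%C.
pose la := Num.min 1 (m / (2 * h + 1)).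
have h21 : 0 < 2 * h + 1 by rewrite ltr_wpDl// mulr_ge0// ltW.
have la0 : 0 < la by rewrite lt_min ltr01 divr_gt0.
have la1 : la <= 1 by rewrite ge_min lexx.
have cct : cell i0 j0 ct by split=> /=; rewrite ?px1 ?py1; have := h0; lra.
pose b := a + la%:C%C * (ct - a).
have bE : b - a = la%:C%C * (ct - a) by rewrite /b; ring.
have bm_ : nm (b - a) < m.
  rewrite bE nmM nm_real gtr0_norm//.
  apply: (@le_lt_trans _ _ (la * (2 * h))); first by rewrite ler_pM2l// (cell_small cct ca).
  apply: (@lt_le_trans _ _ (la * (2 * h + 1))); first by rewrite ltr_pM2l// ltrDl.
  by rewrite -ler_pdivlMr// ge_min lexx orbT.
have ob : ocell i0 j0 b.
  have [/andP[a1 a2] /andP[a3 a4]] := ca; rewrite px1 py1 in a2 a4.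
  have RbE : Re b = (1 - la) * Re a + la * (px i0 + h / 2).
    by rewrite /b ReD ReM /= ReD ReN /=; ring.
  have IbE : Im b = (1 - la) * Im a + la * (py j0 + h / 2).
    by rewrite /b ImD ImM /= ImD ImN /=; ring.
  have la2 : 0 <= 1 - la by lra.
  have u1 := ler_wpM2l la2 a1; have u2 := ler_wpM2l la2 a2.
  have u3 := ler_wpM2l la2 a3; have u4 := ler_wpM2l la2 a4.
  have lh : 0 < la * (h / 2) by rewrite mulr_gt0// divr_gt0.
  by split; rewrite ?RbE ?IbE ?px1 ?py1; apply/andP; split; lra.
have br : nm (b - a) < r by rewrite (lt_le_trans bm_)// ge_min lexx.
have br' : nm (b - a) < r' by rewrite (lt_le_trans bm_)// ge_min lexx orbT.
have [_ E1] := Hr b br; have E2 := Hr' b br'; rewrite opn// in E1.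
set A := bdG chi _ in E1 *.
have -> : A - F a * two_pi_i = (F b - F a) * two_pi_i - (F b * two_pi_i - A) by ring.
rewrite (le_trans (nmB _ _))// nmM mulrDl mul1r addrC lerD//; first exact: ltW.
by rewrite mulrC ler_wpM2l ?nm_ge0// ltW.
Qed.

Lemma bdG_cauchy_out chi F a : grid_region chi ->
  (forall i j z, chi i j -> cell i j z -> cdiff F z) ->
  (forall i j, cell i j a -> ~~ chi i j) ->
  bdG chi (fun z => F z / (z - a)) = 0.
Proof.
move=> gr Fd Ha; rewrite bdGE//; apply: big1 => i _; apply: big1 => j _.
case E : (chi i j); last by rewrite mul0r.
rewrite mul1r; apply: goursat; [exact: pxS|exact: pyS|].
move=> z cz; apply: cdiffM; first exact: Fd E cz.
apply: cdiff_pole; apply/eqP => zb; rewrite zb in cz.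
by have := Ha _ _ cz; rewrite E.
Qed.

End Grid.

(** * The homological form of Cauchy's theorem *)

Section HomologyCauchy.
Variable R : realType.
Local Notation C := R[i].
Local Notation two_pi_i := (@two_pi_i R).

Lemma two_pi_i_neq0 : two_pi_i != 0.
Proof. by rewrite eq_complex /= negb_and (gt_eqF (_ : 0 < 2 * pi)) ?orbT// mulr_gt0// pi_gt0. Qed.

Lemma exists_cell (X0 Y0 h : R) (a : C) : 0 < h -> X0 <= Re a -> Y0 <= Im a ->
  exists i j, cell X0 Y0 h i j a.
Proof.
move=> h0 Xa Ya.
have key (Z0 t : R) : Z0 <= t -> exists k, Z0 + k%:R * h <= t <= Z0 + k.+1%:R * h.
  move=> Zt; exists (Num.truncn ((t - Z0) / h)).
  have p : 0 <= (t - Z0) / h by rewrite divr_ge0// ?subr_ge0// ltW.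
  have /andP[] := truncn_itv p; rewrite ler_pdivlMr// ltr_pdivrMr// => h1 h2.
  by apply/andP; split; lra.
have [i Hi] := key _ _ Xa; have [j Hj] := key _ _ Ya.
by exists i, j; split.
Qed.

(** The grid starts at [- (B + 3 * h)] in both directions. The length [2 * B + 6 * h] and two spare
    cells keep every cell that meets the disc of radius [B] away from the rim. *)
Definition box_size (B h : R) : nat := (Num.truncn ((2 * B + 6 * h) / h)).+2.

Lemma cell_inner (B h : R) i j (z : C) : 0 < h -> nm z < B ->
  cell (- (B + 3 * h)) (- (B + 3 * h)) h i j z ->
  (0 < i /\ i.+1 < box_size B h /\ 0 < j /\ j.+1 < box_size B h)%N.
Proof.
move=> h0 zB [Hi Hj]; set Z0 := - (B + 3 * h) in Hi Hj.
have B0 : 0 < B by rewrite (le_lt_trans (nm_ge0 z)).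
have key (t : R) k : `|t| < B -> Z0 + k%:R * h <= t <= Z0 + k.+1%:R * h ->
   (0 < k /\ k.+1 < box_size B h)%N.
  rewrite ltr_norml => /andP[t1 t2] /andP[k1 k2]; split.
    case: k k1 k2 => // _ k2; exfalso; rewrite mul1r /Z0 in k2; lra.
  rewrite /box_size !ltnS -(ler_nat R).
  have h1 : k%:R * h <= 2 * B + 6 * h by rewrite /Z0 in k1; lra.
  have k3 : k%:R <= (2 * B + 6 * h) / h by rewrite ler_pdivlMr.
  have p : 0 <= (2 * B + 6 * h) / h by apply: divr_ge0; lra.
  have /andP[_ h2] := truncn_itv p; rewrite ler_nat -ltnS -(ltr_nat R).
  exact: le_lt_trans k3 h2.
have [? ?] := key _ _ (le_lt_trans (nm_Re z) zB) Hi.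
by have [? ?] := key _ _ (le_lt_trans (nm_Im z) zB) Hj.
Qed.

Lemma box_cell (B h : R) (z : C) : 0 < h -> nm z < B ->
  exists i j, cell (- (B + 3 * h)) (- (B + 3 * h)) h i j z.
Proof.
move=> h0 zB; have B0 : 0 < B by rewrite (le_lt_trans (nm_ge0 z)).
apply: exists_cell => //.
  by have := le_lt_trans (nm_Re z) zB; rewrite ltr_norml => /andP[? _]; lra.
by have := le_lt_trans (nm_Im z) zB; rewrite ltr_norml => /andP[? _]; lra.
Qed.

(** On the support, [F] is a Cauchy integral over the boundary of the union of the grid cells
    contained in [Om]. Swapping the integrals leaves [J] applied to the kernel with a pole [w] on
    that boundary. Such a [w] lies in a cell outside the union, so it is beyond [B] or within [eta]
    of a point outside [Om], and the inner integral vanishes. *)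
Lemma homology_cauchy T J (Om : set C) F (eta B : R) : cyc T J -> 0 < eta ->
  (forall z, Om z -> cdiff F z) -> T `<=` Om ->
  (forall a, B <= nm a \/ (exists2 b, ~ Om b & nm (b - a) < eta) ->
     ~ T a /\ J (fun z => (z - a)^-1) = 0) ->
  J F = 0.
Proof.
move=> cJ eta0 Fd TO Hw.
have TB z : T z -> nm z < B.
  by move=> Tz; rewrite ltNge; apply/negP => Bz; have [] := Hw z (or_introl Bz).
pose h := eta / 4; have h0 : 0 < h by rewrite divr_gt0.
pose Z0 := - (B + 3 * h); pose N := box_size B h.
pose chi i j := `[< forall z, cell Z0 Z0 h i j z -> Om z >] &&
  [&& 0 < i, i.+1 < N, 0 < j & j.+1 < N]%N.
have gr : grid_region N chi by move=> i j /andP[_ /and4P[]].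
have Fd' i j z : chi i j -> cell Z0 Z0 h i j z -> cdiff F z.
  by move=> /andP[/asboolP H _] /H /Fd.
have notchi i j z : ~~ chi i j -> cell Z0 Z0 h i j z -> ~ T z /\ J (fun w => (w - z)^-1) = 0.
  move=> nc cz; apply: Hw; have [Bz|zB] := leP B (nm z); [by left|right].
  have [i0 [iN [j0 jN]]] := cell_inner h0 zB cz.
  move: nc; rewrite /chi i0 iN j0 jN /= andbT => /asboolPn /existsNP[b /not_implyP[cb nb]].
  by exists b => //; have := cell_small cb cz; rewrite /h; lra.
have formula z : T z -> bdG Z0 Z0 h N chi (fun w => F w / (w - z)) = F z * two_pi_i.
  move=> Tz; apply: bdG_cauchy_in => //; first exact: box_cell (TB z Tz).
  by move=> i j cz; apply/negP => /negP/notchi/(_ cz)[].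
have cb : cyc (edgeset Z0 Z0 h N chi) (bdG Z0 Z0 h N chi) by exact: cyc_bdG.
have edge w : edgeset Z0 Z0 h N chi w -> ~ T w /\ J (fun z => (z - w)^-1) = 0.
  by move=> /(edgeset_cells h0 gr)[_ [_ [i [j [_ _ /notchi H /H]]]]].
have edgeF w : edgeset Z0 Z0 h N chi w -> cdiff F w.
  by move=> /(edgeset_cells h0 gr)[i [j [? [? [H1 H2 _ _]]]]]; exact: Fd' H1 H2.
have Fc : contT T F by apply: cdiff_contT => z /TO /Fd.
have u2 : UC2 T (edgeset Z0 Z0 h N chi) (fun z w => F w / (w - z)).
  apply: UC2_of_cont; [exact: cyc_compact cJ|exact: cyc_compact cb|].
  move=> z T0 E1; apply: rcontM.
    by apply: rcont_comp (rcont_coord 1 z) _; exact: cdiff_cont (edgeF _ E1).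
  apply: (@rcont_comp _ _ (fun u => u^-1) (fun v : 'rV[C]_2 => v 0 1 - v 0 0)).
    apply: rcontD; first exact: rcont_coord.
    apply: (@rcont_comp _ _ (fun u => - u)); first exact: rcont_coord.
    by apply: cdiff_cont; apply: cdiffN; exact: cdiff_id.
  apply: cdiff_cont; apply: cdiff_inv; rewrite subr_eq0; apply/eqP => e.
  by have [] := edge _ E1; rewrite e.
have := cyc_swap cJ cb u2.
have -> : J (fun z => bdG Z0 Z0 h N chi (fun w => F w / (w - z))) = two_pi_i * J F.
  rewrite -(cycZ cJ)//; apply: (cyc_ext cJ) => z Tz; rewrite formula// mulrC//.
have -> : bdG Z0 Z0 h N chi (fun w => J (fun z => F w / (w - z))) = 0.
  rewrite -(cyc0 cb); apply: (cyc_ext cb) => w /edge[nTw J0].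
  transitivity (J (fun z => - F w * (z - w)^-1)).
    apply: (cyc_ext cJ) => z _; rewrite -[w - z]opprB invrN; ring.
  by rewrite (cycZ cJ) ?J0 ?mulr0//; exact: contT_pole.
by move/eqP; rewrite mulf_eq0 (negbTE two_pi_i_neq0) /= => /eqP.
Qed.

End HomologyCauchy.

(** * Adding or removing one cell without crossing a pole *)

Section CellFlips.
Variable R : realType.
Local Notation C := R[i].
Variables (M Sin Sout : set C) (kappa : C) (tau rho0 B2 : R).
Hypothesis Mtau : forall m, M m -> m != 0 /\ nm m <= tau.
Hypothesis tau0 : 0 < tau.
Hypothesis tau1 : tau < 1.
Hypothesis kappa1 : nm kappa <= 1.
Hypothesis rho0_gt0 : 0 < rho0.

(** With [M] the set of all t p^i q^j, the excluded relations are, in this order, the poles of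
    Gamma(t y/x), Gamma(t x/y), Gamma(t/(x y)) and Gamma(t kappa x y). Below, [kappa] is 1 for a
    symmetric density and q for a single term. *)
Definition pairfree (x y : C) := forall m, M m ->
  [/\ x <> m * y, y <> m * x, x * y <> m & kappa * m * x * y <> 1].

Definition holdom n (z : 'rV[C]_n) :=
  (forall i, [/\ z 0 i != 0, ~ Sin (z 0 i) & ~ Sout (z 0 i)]) /\
  (forall i j : 'I_n, i != j -> pairfree (z 0 i) (z 0 j)).

(** Continuity in all variables together serves the exchange of integrals; differentiability in each
    variable separately serves Cauchy's theorem, which is only ever applied to one variable. *)
Definition hol n (F : 'rV[C]_n -> C) (Om : set 'rV[C]_n) := forall z, Om z ->
  rcont F z /\ forall i, cdiff (fun x => F (set_coord i x z)) (z 0 i).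

Lemma set_coord_coord n (i j : 'I_n) x (z : 'rV[C]_n) :
  set_coord i x z 0 j = if j == i then x else z 0 j.
Proof. by rewrite mxE. Qed.

Lemma set_coord2 n (i : 'I_n) x y (z : 'rV[C]_n) : set_coord i x (set_coord i y z) = set_coord i x z.
Proof. by apply/rowP => j; rewrite !mxE; case: (j == i). Qed.

Lemma set_coord_id n (i : 'I_n) (z : 'rV[C]_n) : set_coord i (z 0 i) z = z.
Proof. by apply/rowP => j; rewrite !mxE; case: eqP => // ->. Qed.

Lemma hol_slice n (F : 'rV[C]_n -> C) Om (i : 'I_n) z x : hol F Om -> Om (set_coord i x z) ->
  cdiff (fun y => F (set_coord i y z)) x.
Proof.
move=> hF /hF[_ /(_ i)]; rewrite set_coord_coord eqxx; apply: eq_cdiff => y.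
by rewrite set_coord2.
Qed.

Definition wfun (J : (C -> C) -> C) : (C -> C) -> C := fun f => J (fun z => f z * (two_pi_i R * z)^-1).

Lemma cyc_wfun T J : cyc T J -> (forall z, T z -> z != 0) -> cyc T (wfun J).
Proof.
move=> c T0; apply: cyc_weight => //; apply: cdiff_contT => z Tz.
apply: cdiffV; first by rewrite mulf_neq0 ?two_pi_i_neq0 ?T0.
exact: cdiff_lin.
Qed.

Variables (Z0 h : R) (N : nat).
Hypothesis h0 : 0 < h.
(** The mesh is fine enough for corners to stand for points, at the price of [2 * h] in modulus. By
    [h1], multiplication by an element of [M] still decreases corners outside the disc of radius
    [rho0]; by [h2] and [h3], a product of two moduli that is off 1 by a factor [tau] is still
    recognized at the corners. *)
Hypothesis h1 : 8 * h <= rho0 * (1 - tau).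
Hypothesis h2 : 8 * h * (B2 + 1) <= 1 - tau.
Hypothesis h3 : 2 * h <= 1.

Local Notation cell := (cell Z0 Z0 h).
Local Notation bdG := (bdG Z0 Z0 h N).
Local Notation edgeset := (edgeset Z0 Z0 h N).
Implicit Types chi : nat -> nat -> bool.

Definition corner i j : R := nm (px Z0 h i +i* py Z0 h j)%C.

Lemma corner_cell i j z : cell i j z -> `|nm z - corner i j| <= 2 * h.
Proof.
move=> cz; have cc : cell i j (px Z0 h i +i* py Z0 h j)%C.
  by split=> /=; rewrite lexx ?pxS ?pyS.
rewrite ler_norml lerBrDr addrC lerBlDr -lerBlDr.
have k1 := cell_small cz cc; have k2 := nm_subge z (px Z0 h i +i* py Z0 h j)%C.
have k3 := nm_subge (px Z0 h i +i* py Z0 h j)%C z; rewrite nm_sub in k3.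
by rewrite /corner; apply/andP; split; lra.
Qed.

(** Each clause prevents a pole relation between two boundary points, in a form that a flip of one
    cell can preserve. The clauses [lg_div] and [lg_inv] stand in for the symmetry of a contour
    under inversion, which square cells do not respect. *)
Record legal chi : Prop := Legal {
  lg_grid : grid_region N chi;
  lg_mul : forall m i j z i' j', M m -> chi i j -> cell i j z -> cell i' j' (m * z) -> chi i' j';
  lg_div : forall m i j z i' j', M m -> ~~ chi i j -> cell i j z -> z != 0 ->
    cell i' j' (m / z) -> chi i' j';
  lg_inv : forall m i j z i' j' y, M m -> chi i j -> cell i j z -> cell i' j' y ->
    kappa * m * z * y = 1 -> ~~ chi i' j';
  lg_in : forall s i j, Sin s -> cell i j s -> chi i j;
  lg_out : forall s i j, Sout s -> cell i j s -> ~~ chi i j;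
  lg_zero : forall z i j, nm z < rho0 -> cell i j z -> chi i j;
  lg_bound : forall z i j, chi i j -> cell i j z -> nm z < B2 }.

(** The factor [m] costs at least [rho0 * (1 - tau) >= 8 * h] of modulus, more than the errors of
    [2 * h] at the two corners. *)
Lemma corner_mul m i j z i' j' y : M m -> cell i j z -> cell i' j' y -> z = m * y ->
  rho0 <= nm y -> corner i j < corner i' j'.
Proof.
move=> Mm /corner_cell cz /corner_cell cy zE yr; have [m0 mt] := Mtau Mm.
rewrite ler_norml in cz; rewrite ler_norml in cy.
have zy : nm z <= tau * nm y by rewrite zE nmM ler_wpM2r ?nm_ge0.
have k : rho0 * (1 - tau) <= nm y * (1 - tau) by rewrite ler_wpM2r// subr_ge0 ltW.
have hh := h0; have hh1 := h1; case/andP: cz => z1 z2; case/andP: cy => y1 y2; lra.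
Qed.

Section Flip.
Variables (chi chi1 : nat -> nat -> bool) (i0 j0 : nat) (eps : C).
Hypothesis gr : grid_region N chi.
Hypothesis gr1 : grid_region N chi1.
Hypothesis flipE : forall f, bdG chi f = bdG chi1 f + eps * cint Z0 Z0 h i0 j0 f.
Let E := edgeset chi `|` edgeset chi1.
Hypothesis E0 : forall x, E x \/ cell i0 j0 x -> [/\ x != 0, ~ Sin x & ~ Sout x].
Hypothesis Efree : forall x y, E x \/ cell i0 j0 x -> E y -> pairfree x y.

(** The coordinates are switched one at a time. The two boundaries differ by the boundary of one
    cell, and with the other coordinates on [E] the integrand is differentiable in the moving one on
    the whole closed cell, so that [goursat] applies. *)
Lemma mint_flip n (F : 'rV[C]_n -> C) : hol F (@holdom n) ->
  mint (fun=> wfun (bdG chi)) F = mint (fun=> wfun (bdG chi1)) F.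
Proof.
move=> hF.
have c : cyc (edgeset chi) (bdG chi) by exact: cyc_bdG.
have c1 : cyc (edgeset chi1) (bdG chi1) by exact: cyc_bdG.
have gE : gcompact E by apply: gcompactU; [exact: cyc_compact c|exact: cyc_compact c1].
have EE0 x : E x -> x != 0 by move=> Ex; have [] := E0 (or_introl Ex).
have cw : cyc E (wfun (bdG chi)).
  by apply: cyc_wfun => //; apply: cyc_sup c => // z; left.
have cw1 : cyc E (wfun (bdG chi1)).
  by apply: cyc_wfun => //; apply: cyc_sup c1 => // z; right.
have dom z : inT (fun=> E) z -> @holdom n z.
  move=> Tz; split=> [i|i j ij]; first by apply: E0; left; exact: Tz.
  by apply: Efree; [left; exact: Tz|exact: Tz].
have uF Ts : (forall k, Ts k = E) -> UC Ts F.
  move=> HT; apply: (@sub_UC _ _ (fun=> E)); first by move=> k x; rewrite HT.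
  by apply: heine_cantor => //; apply: rcont_contV => z /dom /hF[].
pose G k := fun j => if (j < k)%N then wfun (bdG chi1) else wfun (bdG chi).
have step k : (k < n)%N -> mint (G k) F = mint (G k.+1) F.
  move=> kn.
  have -> : G k.+1 = upd (G k) k (wfun (bdG chi1)).
    apply/funext => j; rewrite /G /upd; case: (ltngtP j k) => [jk|jk|->].
    - by rewrite ltnS ltnW.
    - by rewrite ltnS leqNgt jk.
    - by rewrite ltnSn.
  apply: (@mint_replace _ _ _ _ (fun=> E) _ E) => //.
  - by move=> j; rewrite /G; case: ifP.
  - exact: uF.
  - by apply: uF => j; rewrite /upd; case: ifP.
  - move=> i z ik Tz; rewrite /G ltnn.
    pose f x := F (set_coord i x z) * (two_pi_i R * x)^-1.
    have dz x : E x \/ cell i0 j0 x -> holdom (set_coord i x z).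
      move=> Ex; split=> [j|j l jl]; rewrite !set_coord_coord.
        by case: (eqVneq j i) => ji; [exact: E0|apply: E0; left; exact: Tz].
      case: (eqVneq j i) => [ji|ji]; case: (eqVneq l i) => [li|li].
      + by rewrite ji li eqxx in jl.
      + by apply: Efree => //; exact: Tz.
      + have := Efree Ex (Tz j ji) => H m Mm; have [? ? ? hk] := H m Mm.
        by split=> //; [rewrite mulrC|move=> e; apply: hk; rewrite -e; ring].
      + by apply: Efree; [left; exact: Tz|exact: Tz].
    rewrite /wfun flipE [X in _ + eps * X](_ : _ = 0) ?mulr0 ?addr0//.
    apply: goursat; [exact: pxS|exact: pyS|].
    move=> x cx; apply: cdiffM.
      by apply: hol_slice hF _; apply: dz; right.
    have [x0 _ _] := E0 (or_intror cx).
    apply: cdiffV; first by rewrite mulf_neq0 ?two_pi_i_neq0.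
    exact: cdiff_lin.
have all k : (k <= n)%N -> mint (G 0%N) F = mint (G k) F.
  elim: k => [//|k IH] kn; rewrite IH 1?ltnW//; exact: step.
have := all n (leqnn n); rewrite {1}/G /=.
move=> ->; rewrite /G.
(* The family reached after [n] switches is constant only on the first [n] indices, which is all
   that [mint] reads. *)
have : forall k m (Phi : 'rV[C]_m -> C), (k + m)%N = n ->
    mint (fun j => if (j + k < n)%N then wfun (bdG chi1) else wfun (bdG chi)) Phi =
    mint (fun=> wfun (bdG chi1)) Phi.
  move=> k m; elim: m k => [//|m IH] k Phi km /=.
  rewrite add0n -km -{1}[k]addn0 ltn_add2l /=; congr (wfun _ _); apply/funext => x.
  have := IH k.+1 (fun v => Phi (cns x v)); rewrite addSnnS => /(_ km) <-.
  by apply: (congr1 (fun Js => mint Js _)); apply/funext => j; rewrite addSnnS km.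
move=> /(_ 0%N n F erefl) <-; apply: (congr1 (fun Js => mint Js _)); apply/funext => j; by rewrite addn0.
Qed.

End Flip.

Lemma bdG_diff chi chi1 i0 j0 (eps : C) : grid_region N chi -> grid_region N chi1 ->
  (i0 < N)%N -> (j0 < N)%N ->
  (forall i j, (chi i j)%:R = (chi1 i j)%:R + eps * ((i == i0) && (j == j0))%:R :> C) ->
  forall f, bdG chi f = bdG chi1 f + eps * cint Z0 Z0 h i0 j0 f.
Proof.
move=> gr gr1 iN jN H f; rewrite !bdGE//.
under eq_bigr do under eq_bigr do rewrite H mulrDl.
under eq_bigr do rewrite big_split /=.
rewrite big_split /=; congr (_ + _).
rewrite (bigD1 (Ordinal iN))//= (bigD1 (Ordinal jN))//= !eqxx mulr1.
rewrite big1 ?addr0; last by move=> j; rewrite -val_eqE /= => /negbTE ->; rewrite /= mulr0 mul0r.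
rewrite big1 ?addr0// => i; rewrite -val_eqE /= => /negbTE ii; apply: big1 => j _.
by rewrite ii /= mulr0 mul0r.
Qed.

Definition cdel chi i0 j0 : nat -> nat -> bool := fun i j => chi i j && ~~ ((i == i0) && (j == j0)).
Definition cadd chi i0 j0 : nat -> nat -> bool := fun i j => chi i j || ((i == i0) && (j == j0)).

Section Remove.
Variables (chi chi' : nat -> nat -> bool) (i0 j0 : nat).
Hypothesis lg : legal chi.
Hypothesis lg' : legal chi'.
Hypothesis Q1 : chi i0 j0.
Hypothesis Q2 : ~~ chi' i0 j0.
Hypothesis hmax : forall i j, chi i j -> ~~ chi' i j -> corner i j <= corner i0 j0.
Hypothesis hprod : forall i j, chi' i j -> ~~ chi i j -> 1 <= corner i0 j0 * corner i j.

Let Qbig x : cell i0 j0 x -> rho0 <= nm x.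
Proof. by move=> cx; rewrite leNgt; apply/negP => /(lg_zero lg' )/(_ cx); rewrite (negbTE Q2). Qed.

Let big_neq0 x : rho0 <= nm x -> x != 0.
Proof. by move=> H; rewrite -nm_gt0; exact: lt_le_trans H. Qed.

(** The cell of [y] has a larger corner than the dropped one. If it were in [chi'], closure under
    [m] would put the dropped cell in [chi'] too; otherwise it contradicts [hmax]. *)
Let R1 m x y i j : M m -> cell i0 j0 x -> chi i j -> cell i j y -> x = m * y -> False.
Proof.
move=> Mm cx cij cy xE; have [m0 mt] := Mtau Mm; have xb := Qbig cx.
have yb : rho0 <= nm y.
  rewrite (le_trans xb)// xE nmM ger_pMl ?(le_trans mt) ?ltW//.
  by rewrite nm_gt0; apply/eqP => y0; move: (big_neq0 xb); rewrite xE y0 mulr0 eqxx.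
have lt1 := corner_mul Mm cx cy xE yb.
have [c'|nc'] := boolP (chi' i j).
  by have := lg_mul lg' Mm c' cy; rewrite -xE => /(_ _ _ cx); rewrite (negbTE Q2).
by have := hmax cij nc'; rewrite leNgt lt1.
Qed.

(** The case that [hprod] is made for: the corners multiply to at least 1, whereas [x * y = m] makes
    the moduli multiply to at most [tau]. *)
Let S2 m x y i j : M m -> cell i0 j0 x -> cell i j y -> chi' i j -> ~~ chi i j -> x * y = m -> False.
Proof.
move=> Mm cx cy c' nc xy; have [m0 mt] := Mtau Mm.
have := hprod c' nc; have := corner_cell cx; have := corner_cell cy.
have xB := lg_bound lg Q1 cx; have yB := lg_bound lg' c' cy.
have xyn : nm x * nm y <= tau by rewrite -nmM xy.
have hh := h0; have hh2 := h2; have hh3 := h3; have tt1 := tau1.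
rewrite !ler_norml => /andP[y1 y2] /andP[x1 x2] ab.
have n1 := nm_ge0 x; have n2 := nm_ge0 y; have a0 : 0 <= corner i j := nm_ge0 _.
have : corner i0 j0 * corner i j <= (nm x + 2 * h) * (nm y + 2 * h).
  by apply: ler_pM => //; [exact: nm_ge0|lra|lra].
have k1 : nm x * h <= B2 * h by rewrite ler_wpM2r// ltW.
have k2 : nm y * h <= B2 * h by rewrite ler_wpM2r// ltW.
have k3 : h * h <= 1 / 2 * h by apply: ler_wpM2r; lra.
lra.
Qed.

Let R3 m x y i j : M m -> cell i0 j0 x -> ~~ chi i j -> cell i j y -> x * y = m -> False.
Proof.
move=> Mm cx nc cy xy; have [c'|nc'] := boolP (chi' i j).
  exact: S2 Mm cx cy c' nc xy.
have y0 : y != 0 by apply/eqP => y0; have [] := Mtau Mm; rewrite -xy y0 mulr0 eqxx.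
have := lg_div lg' Mm nc' cy y0; rewrite -xy mulfK// => /(_ _ _ cx).
by rewrite (negbTE Q2).
Qed.

Let R3' m x y : M m -> cell i0 j0 x -> cell i0 j0 y -> x * y = m -> False.
Proof.
move=> Mm cx cy xy; have y0 := big_neq0 (Qbig cy).
by have := lg_div lg' Mm Q2 cy y0; rewrite -xy mulfK// => /(_ _ _ cx); rewrite (negbTE Q2).
Qed.

Let R4 m x y i j : M m -> cell i0 j0 x -> chi i j -> cell i j y -> kappa * m * x * y = 1 -> False.
Proof. by move=> Mm cx c cy e; have := lg_inv lg Mm Q1 cx cy e; rewrite c. Qed.

(** Only clauses that could have relied on the dropped cell need work, and there the legality of the
    target [chi'] is borrowed: it already does without that cell. *)
Lemma legal_cdel : legal (cdel chi i0 j0).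
Proof.
split.
- by move=> i j /andP[c _]; exact: lg_grid lg _ _ c.
- move=> m i j z i' j' Mm /andP[c _] cz cmz; apply/andP; split.
    exact: lg_mul lg _ _ _ _ _ _ Mm c cz cmz.
  by apply/negP => /andP[/eqP ei /eqP ej]; subst i' j'; exact: R1 Mm cmz c cz erefl.
- move=> m i j z i' j' Mm; rewrite negb_and negbK => /orP[nc|/andP[/eqP ei /eqP ej]] cz z0 cmz.
    apply/andP; split; first exact: lg_div lg _ _ _ _ _ _ Mm nc cz z0 cmz.
    apply/negP => /andP[/eqP ei /eqP ej]; subst i' j'.
    by apply: R3 Mm cmz nc cz _; rewrite divfK.
  subst i j; have c' := lg_div lg' Mm Q2 cz z0 cmz.
  apply/andP; split.
    apply/negPn/negP => nc; apply: S2 Mm cz cmz c' nc _; by rewrite mulrC divfK.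
  by apply/negP => /andP[/eqP ei /eqP ej]; subst i' j'; have := Q2; rewrite c'.
- move=> m i j z i' j' y Mm /andP[c _] cz cy e; rewrite negb_and.
  by rewrite (lg_inv lg Mm c cz cy e).
- move=> s i j Ss cs; apply/andP; split; first exact: lg_in lg _ _ _ Ss cs.
  by apply/negP => /andP[/eqP ei /eqP ej]; subst i j; have := lg_in lg' Ss cs; rewrite (negbTE Q2).
- by move=> s i j Ss cs; rewrite negb_and (lg_out lg Ss cs).
- move=> z i j zr cz; apply/andP; split; first exact: lg_zero lg _ _ _ zr cz.
  by apply/negP => /andP[/eqP ei /eqP ej]; subst i j; have := lg_zero lg' zr cz; rewrite (negbTE Q2).
- by move=> z i j /andP[c _]; exact: lg_bound lg _ _ _ c.
Qed.

(** For a point of the dropped cell, [R1], [R3], [R3'] and [R4] exclude the four pole relations with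
    any boundary point; two points that both touch a cell outside [chi] are handled by the legality
    of [chi]. *)
Lemma mint_cdel n (F : 'rV[C]_n -> C) : hol F (@holdom n) ->
  mint (fun=> wfun (bdG chi)) F = mint (fun=> wfun (bdG (cdel chi i0 j0))) F.
Proof.
have [i0p [iN [j0p jN]]] := lg_grid lg Q1.
have gr := lg_grid lg; have gr1 := lg_grid legal_cdel.
have Ecell x : (edgeset chi `|` edgeset (cdel chi i0 j0)) x ->
    (exists i j, chi i j /\ cell i j x) /\
    ((exists i j, ~~ chi i j /\ cell i j x) \/ cell i0 j0 x).
  move=> [/(edgeset_cells h0 gr)|/(edgeset_cells h0 gr1)] [i [j [i' [j' []]]]].
    by move=> c cx nc cx'; split; [exists i, j|left; exists i', j'].
  move=> /andP[c _] cx; rewrite negb_and negbK => /orP[nc|/andP[/eqP ei /eqP ej]] cx'.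
    by split; [exists i, j|left; exists i', j'].
  by subst i' j'; split; [exists i, j|right].
apply: (@mint_flip _ _ i0 j0 1) => //.
- apply: bdG_diff => //; [exact: ltnW|exact: ltnW|].
  move=> i j; rewrite /cdel; have [/andP[/eqP -> /eqP ->]|_] := boolP ((i == i0) && (j == j0)).
    by rewrite Q1 /= add0r mulr1.
  by rewrite andbT mulr0 addr0.
- move=> x Hx.
  have cc : exists i j, chi i j /\ cell i j x by case: Hx => [/Ecell[]//|cx]; exists i0, j0.
  have [i [j [c cx]]] := cc.
  have nc : exists i j, (~~ chi i j \/ ~~ chi' i j) /\ cell i j x.
    case: Hx => [/Ecell[_ [[i' [j' [nc cx']]]|cx']]|cx'].
    - by exists i', j'; split=> //; left.
    - by exists i0, j0; split=> //; right.
    - by exists i0, j0; split=> //; right.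
  have [i' [j' [nc' cx']]] := nc; split.
  + apply/eqP => x0; have xr : nm x < rho0 by rewrite x0 nm0.
    by case: nc' => /negP; apply; [exact: lg_zero lg _ _ _ xr cx'|exact: lg_zero lg' _ _ _ xr cx'].
  + by move=> Sx; case: nc' => /negP; apply; [exact: lg_in lg _ _ _ Sx cx'|exact: lg_in lg' _ _ _ Sx cx'].
  + by move=> Sx; have := lg_out lg Sx cx; rewrite c.
- have key x y : cell i0 j0 x -> (edgeset chi `|` edgeset (cdel chi i0 j0)) y -> pairfree x y.
    move=> cx /Ecell[[i [j [c cy]]] H] m Mm; split.
    + by move=> e; exact: R1 Mm cx c cy e.
    + move=> e; case: H => [[i' [j' [nc cy']]]|cy'].
        by have := lg_mul lg Mm Q1 cx; rewrite -e => /(_ _ _ cy'); rewrite (negbTE nc).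
      exact: R1 Mm cy' Q1 cx e.
    + move=> e; case: H => [[i' [j' [nc cy']]]|cy']; first exact: R3 Mm cx nc cy' e.
      exact: R3' Mm cx cy' e.
    + by move=> e; exact: R4 Mm cx c cy e.
  move=> x y [Ex|cx] Ey; last exact: key.
  have [[i [j [c cx]]] [[i' [j' [nc cx']]]|cx']] := Ecell x Ex; last exact: key.
  have [[k [l [d cy]]] [[k' [l' [nd cy']]]|cy']] := Ecell y Ey; last first.
    move=> m Mm; have [a1 a2 a3 a4] := key y x cy' Ex m Mm.
    by split=> //; [rewrite mulrC|move=> e; apply: a4; rewrite -e; ring].
  move=> m Mm; split=> e.
  + by have := lg_mul lg Mm d cy; rewrite -e => /(_ _ _ cx'); rewrite (negbTE nc).
  + by have := lg_mul lg Mm c cx; rewrite -e => /(_ _ _ cy'); rewrite (negbTE nd).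
  + have y0 : y != 0 by apply/eqP => y0; have [] := Mtau Mm; rewrite -e y0 mulr0 eqxx.
    by have := lg_div lg Mm nd cy' y0; rewrite -e mulfK// => /(_ _ _ cx'); rewrite (negbTE nc).
  + by have := lg_inv lg Mm c cx cy e; rewrite d.
Qed.

End Remove.

Section Add.
Variables (chi chi' : nat -> nat -> bool) (i0 j0 : nat).
Hypothesis lg : legal chi.
Hypothesis lg' : legal chi'.
Hypothesis Q1 : chi' i0 j0.
Hypothesis Q2 : ~~ chi i0 j0.
Hypothesis hmin : forall i j, chi' i j -> ~~ chi i j -> corner i0 j0 <= corner i j.
Hypothesis hprod : forall i j, chi i j -> ~~ chi' i j -> corner i j * corner i0 j0 <= 1.

Let Qbig x : cell i0 j0 x -> rho0 <= nm x.
Proof. by move=> cx; rewrite leNgt; apply/negP => /(lg_zero lg)/(_ cx); rewrite (negbTE Q2). Qed.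

Let A1 m x y i j : M m -> cell i0 j0 x -> chi i j -> cell i j y -> x = m * y -> False.
Proof. by move=> Mm cx c cy e; have := lg_mul lg Mm c cy; rewrite -e => /(_ _ _ cx); rewrite (negbTE Q2). Qed.

(** Closure of [chi'] under [m] makes the cell of [y] another candidate for addition, with a smaller
    corner, against [hmin]. *)
Let A2 m x y i j : M m -> cell i0 j0 x -> ~~ chi i j -> cell i j y -> y = m * x -> False.
Proof.
move=> Mm cx nc cy e; have c' : chi' i j by apply: lg_mul lg' _ _ _ _ _ _ Mm Q1 cx _; rewrite -e.
by have := hmin c' nc; rewrite leNgt (corner_mul Mm cy cx e (Qbig cx)).
Qed.

Let A3 m x y i j : M m -> cell i0 j0 x -> ~~ chi i j -> cell i j y -> x * y = m -> False.
Proof.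
move=> Mm cx nc cy xy.
have y0 : y != 0 by apply/eqP => y0; have [] := Mtau Mm; rewrite -xy y0 mulr0 eqxx.
by have := lg_div lg Mm nc cy y0; rewrite -xy mulfK// => /(_ _ _ cx); rewrite (negbTE Q2).
Qed.

(** The relation forces the moduli to multiply to at least [1 / tau], against the bound 1 for the
    product of the corners in [hprod]. This is where [nm kappa <= 1] enters. *)
Let A4 m x y i j : M m -> cell i0 j0 x -> chi i j || chi' i j -> cell i j y ->
  kappa * m * x * y = 1 -> False.
Proof.
move=> Mm cx c cy e; have nc' := lg_inv lg' Mm Q1 cx cy e; rewrite (negbTE nc') orbF in c.
have [m0 mt] := Mtau Mm.
have := hprod c nc'; have := corner_cell cx; have := corner_cell cy.
have xB := lg_bound lg' Q1 cx; have yB := lg_bound lg c cy.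
have xyn : 1 <= tau * (nm x * nm y).
  rewrite -(nm1 R) -e !nmM -!mulrA; have n12 : 0 <= nm x * nm y by rewrite mulr_ge0 ?nm_ge0.
  rewrite (@le_trans _ _ (nm m * (nm x * nm y)))//.
    by rewrite ler_piMl// mulr_ge0 ?nm_ge0.
  by rewrite ler_wpM2r.
have hh := h0; have hh2 := h2; have hh3 := h3; have tt1 := tau1.
rewrite !ler_norml => /andP[y1 y2] /andP[x1 x2] ab.
have n1 := nm_ge0 x; have n2 := nm_ge0 y.
have a0 : 0 <= corner i j := nm_ge0 _; have a1 : 0 <= corner i0 j0 := nm_ge0 _.
have k0 : nm x * nm y <= (corner i0 j0 + 2 * h) * (corner i j + 2 * h) by apply: ler_pM; lra.
have k1 : corner i0 j0 * h <= (B2 + 2 * h) * h by rewrite ler_wpM2r// ?ltW//; lra.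
have k2 : corner i j * h <= (B2 + 2 * h) * h by rewrite ler_wpM2r// ?ltW//; lra.
have k3 : h * h <= 1 / 2 * h by apply: ler_wpM2r; lra.
have k5 : 0 <= B2 * h by apply: mulr_ge0; lra.
have k4 : nm x * nm y <= 1 + (1 - tau) by lra.
have k7 : tau * (nm x * nm y) <= tau * (1 + (1 - tau)) by rewrite ler_wpM2l// ltW.
have k6 : 0 < (1 - tau) * (1 - tau) by rewrite mulr_gt0// subr_gt0.
clear e; lra.
Qed.

Lemma legal_cadd : legal (cadd chi i0 j0).
Proof.
split.
- by move=> i j /orP[c|/andP[/eqP -> /eqP ->]]; [exact: lg_grid lg _ _ c|exact: lg_grid lg' _ _ Q1].
- move=> m i j z i' j' Mm /orP[c|/andP[/eqP ei /eqP ej]] cz cmz; apply/orP; left.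
    exact: lg_mul lg _ _ _ _ _ _ Mm c cz cmz.
  by subst i j; apply/negPn/negP => nc; exact: A2 Mm cz nc cmz erefl.
- move=> m i j z i' j' Mm; rewrite negb_or => /andP[nc _] cz z0 cmz; apply/orP; left.
  exact: lg_div lg _ _ _ _ _ _ Mm nc cz z0 cmz.
- move=> m i j z i' j' y Mm c cz cy e; apply/negP => d.
  have e' : kappa * m * y * z = 1 by rewrite -e; ring.
  case/orP: c => [c|/andP[/eqP ei /eqP ej]]; case/orP: d => [d|/andP[/eqP ei' /eqP ej']].
  + by have := lg_inv lg Mm c cz cy e; rewrite d.
  + by subst i' j'; apply: A4 Mm cy _ cz e'; rewrite c.
  + by subst i j; apply: A4 Mm cz _ cy e; rewrite d.
  + by subst i j i' j'; have := lg_inv lg' Mm Q1 cz cy e; rewrite Q1.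
- by move=> s i j Ss cs; apply/orP; left; exact: lg_in lg _ _ _ Ss cs.
- move=> s i j Ss cs; rewrite negb_or (lg_out lg Ss cs) /=.
  by apply/negP => /andP[/eqP ei /eqP ej]; subst i j; have := lg_out lg' Ss cs; rewrite Q1.
- by move=> z i j zr cz; apply/orP; left; exact: lg_zero lg _ _ _ zr cz.
- move=> z i j /orP[c|/andP[/eqP -> /eqP ->]]; first exact: lg_bound lg _ _ _ c.
  exact: lg_bound lg' _ _ _ Q1.
Qed.

Lemma mint_cadd n (F : 'rV[C]_n -> C) : hol F (@holdom n) ->
  mint (fun=> wfun (bdG chi)) F = mint (fun=> wfun (bdG (cadd chi i0 j0))) F.
Proof.
have [i0p [iN [j0p jN]]] := lg_grid lg' Q1.
have gr := lg_grid lg; have gr1 := lg_grid legal_cadd.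
have Ecell x : (edgeset chi `|` edgeset (cadd chi i0 j0)) x ->
    (exists i j, ~~ chi i j /\ cell i j x) /\
    ((exists i j, chi i j /\ cell i j x) \/ cell i0 j0 x).
  move=> [/(edgeset_cells h0 gr)|/(edgeset_cells h0 gr1)] [i [j [i' [j' []]]]].
    by move=> c cx nc cx'; split; [exists i', j'|left; exists i, j].
  move=> c cx; rewrite negb_or => /andP[nc _] cx'.
  split; first by exists i', j'.
  by case/orP: c => [c|/andP[/eqP ei /eqP ej]]; [left; exists i, j|right; subst i j].
apply: (@mint_flip _ _ i0 j0 (-1)) => //.
- apply: bdG_diff => //; [exact: ltnW|exact: ltnW|].
  move=> i j; rewrite /cadd; have [/andP[/eqP -> /eqP ->]|_] := boolP ((i == i0) && (j == j0)).
    by rewrite (negbTE Q2) /= mulr1 addrN.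
  by rewrite orbF mulr0 addr0.
- move=> x Hx.
  have cc : exists i j, ~~ chi i j /\ cell i j x by case: Hx => [/Ecell[]//|cx]; exists i0, j0.
  have [i [j [nc cx]]] := cc.
  have c : exists i j, (chi i j \/ chi' i j) /\ cell i j x.
    case: Hx => [/Ecell[_ [[i' [j' [c cx']]]|cx']]|cx'].
    - by exists i', j'; split=> //; left.
    - by exists i0, j0; split=> //; right.
    - by exists i0, j0; split=> //; right.
  have [i' [j' [c' cx']]] := c; split.
  + apply/eqP => x0; have xr : nm x < rho0 by rewrite x0 nm0.
    by have := lg_zero lg xr cx; rewrite (negbTE nc).
  + by move=> Sx; have := lg_in lg Sx cx; rewrite (negbTE nc).
  + by move=> Sx; case: c' => d; [have := lg_out lg Sx cx'|have := lg_out lg' Sx cx']; rewrite d.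
- have key x y : cell i0 j0 x -> (edgeset chi `|` edgeset (cadd chi i0 j0)) y -> pairfree x y.
    move=> cx /Ecell[[i [j [nc cy]]] H] m Mm; split.
    + move=> e; case: H => [[i' [j' [c cy']]]|cy']; first exact: A1 Mm cx c cy' e.
      exact: A2 Mm cy' Q2 cx e.
    + by move=> e; exact: A2 Mm cx nc cy e.
    + by move=> e; exact: A3 Mm cx nc cy e.
    + move=> e; case: H => [[i' [j' [c cy']]]|cy'].
        by apply: A4 Mm cx _ cy' e; rewrite c.
      by apply: A4 Mm cx _ cy' e; rewrite Q1 orbT.
  move=> x y [Ex|cx] Ey; last exact: key.
  have [[i' [j' [nc cx']]] [[i [j [c cx]]]|cx]] := Ecell x Ex; last exact: key.
  have [[k' [l' [nd cy']]] [[k [l [d cy]]]|cy]] := Ecell y Ey; last first.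
    move=> m Mm; have [a1 a2 a3 a4] := key y x cy Ex m Mm.
    by split=> //; [rewrite mulrC|move=> e; apply: a4; rewrite -e; ring].
  move=> m Mm; split=> e.
  + by have := lg_mul lg Mm d cy; rewrite -e => /(_ _ _ cx'); rewrite (negbTE nc).
  + by have := lg_mul lg Mm c cx; rewrite -e => /(_ _ _ cy'); rewrite (negbTE nd).
  + have y0 : y != 0 by apply/eqP => y0; have [] := Mtau Mm; rewrite -e y0 mulr0 eqxx.
    by have := lg_div lg Mm nd cy' y0; rewrite -e mulfK// => /(_ _ _ cx'); rewrite (negbTE nc).
  + by have := lg_inv lg Mm c cx cy e; rewrite d.
Qed.

End Add.

Definition cdiffs chi chi' : {set 'I_N * 'I_N} := [set e : 'I_N * 'I_N | chi e.1 e.2 != chi' e.1 e.2]%SET.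

(* Legal regions are connected by flips: drop the cell of largest modulus in
   chi - chi', or add the cell of smallest modulus in chi' - chi, according to
   whether the product of these two moduli is at least 1. *)
Lemma legal_mint n (F : 'rV[C]_n -> C) chi chi' : hol F (@holdom n) ->
  legal chi -> legal chi' ->
  mint (fun=> wfun (bdG chi)) F = mint (fun=> wfun (bdG chi')) F.
Proof.
move=> hF; move: {2}#|_| (leqnn #|cdiffs chi chi'|) => k.
elim: k chi chi' => [|k IH] chi chi' + lg lg'.
  rewrite leqn0 cards_eq0 => /eqP D0.
  have -> : chi = chi' => //; apply/funext => i; apply/funext => j.
  have [ij|] := boolP ((i < N) && (j < N))%N.
    case/andP: ij => iN jN; have : (Ordinal iN, Ordinal jN) \notin cdiffs chi chi' by rewrite D0 inE.
    by rewrite inE /= negbK => /eqP.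
  have out c : legal c -> ~~ ((i < N) && (j < N))%N -> c i j = false.
    move=> lc H; apply/negP => /(lg_grid lc)[_ [iN [_ jN]]].
    by move: H; rewrite (ltnW iN) (ltnW jN).
  by move=> H; rewrite !out.
move=> Dk; pose D := cdiffs chi chi'.
pose rho (e : 'I_N * 'I_N) := corner e.1 e.2.
have inN c i j : legal c -> c i j -> ((i < N) /\ (j < N))%N.
  by move=> lc /(lg_grid lc)[_ [iN [_ jN]]]; split; exact: ltnW.
have [D0|[e0 e0D]] := set_0Vmem D; first by apply: (IH chi chi') => //; rewrite -/D D0 cards0.
have remove (e : 'I_N * 'I_N) : chi e.1 e.2 -> ~~ chi' e.1 e.2 ->
    (forall i j, chi i j -> ~~ chi' i j -> corner i j <= corner e.1 e.2) ->
    (forall i j, chi' i j -> ~~ chi i j -> 1 <= corner e.1 e.2 * corner i j) ->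
    mint (fun=> wfun (bdG chi)) F = mint (fun=> wfun (bdG chi')) F.
  move=> c nc' H1 H2; rewrite (mint_cdel lg lg' c nc' H1 H2 hF).
  apply: IH (legal_cdel lg lg' c nc' H1 H2) lg'; rewrite -ltnS (leq_trans _ Dk)//.
  apply: proper_card; apply/properP; split.
    apply/fintype.subsetP => d; rewrite !inE /cdel; case: (boolP ((d.1 == e.1 :> nat) && (d.2 == e.2 :> nat))) => [/andP[/eqP d1 /eqP d2]|_].
      by rewrite d1 d2 c (negbTE nc').
    by rewrite andbT.
  exists e.
    by rewrite inE /= c (negbTE nc').
  by rewrite inE /= /cdel !eqxx andbF (negbTE nc') eqxx.
have add (e : 'I_N * 'I_N) : chi' e.1 e.2 -> ~~ chi e.1 e.2 ->
    (forall i j, chi' i j -> ~~ chi i j -> corner e.1 e.2 <= corner i j) ->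
    (forall i j, chi i j -> ~~ chi' i j -> corner i j * corner e.1 e.2 <= 1) ->
    mint (fun=> wfun (bdG chi)) F = mint (fun=> wfun (bdG chi')) F.
  move=> c nc' H1 H2; rewrite (mint_cadd lg lg' c nc' H1 H2 hF).
  apply: (IH _ _ _ (legal_cadd lg lg' c nc' H1 H2) lg'); rewrite -ltnS (leq_trans _ Dk)//.
  apply: proper_card; apply/properP; split.
    apply/fintype.subsetP => d; rewrite !inE /cadd; case: (boolP ((d.1 == e.1 :> nat) && (d.2 == e.2 :> nat))) => [/andP[/eqP d1 /eqP d2]|_].
      by rewrite d1 d2 c orbT eqxx.
    by rewrite orbF.
  exists e.
    by rewrite inE /= c (negbTE nc').
  by rewrite inE /= /cadd !eqxx orbT c eqxx.
pose A := [set e : 'I_N * 'I_N in D | chi e.1 e.2]%SET; pose A' := [set e : 'I_N * 'I_N in D | chi' e.1 e.2]%SET.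
have AP i j : chi i j -> ~~ chi' i j -> exists2 e, e \in A & (i = e.1 /\ j = e.2).
  move=> c nc'; have [iN jN] := inN _ _ _ lg c; exists (Ordinal iN, Ordinal jN) => //.
  by rewrite !inE /= c (negbTE nc').
have AP' i j : chi' i j -> ~~ chi i j -> exists2 e, e \in A' & (i = e.1 /\ j = e.2).
  move=> c nc'; have [iN jN] := inN _ _ _ lg' c; exists (Ordinal iN, Ordinal jN) => //.
  by rewrite !inE /= c (negbTE nc').
have Ain e : e \in A -> chi e.1 e.2 /\ ~~ chi' e.1 e.2.
  by rewrite !inE => /andP[+ c]; rewrite c; case: (chi' _ _).
have Ain' e : e \in A' -> chi' e.1 e.2 /\ ~~ chi e.1 e.2.
  by rewrite !inE => /andP[+ c]; rewrite c; case: (chi _ _).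
have minA' : A' != finset.set0 -> exists2 e, e \in A' & forall d, d \in A' -> rho e <= rho d.
  case/set0Pn => e eA; case: (arg_minP rho eA) => d dA dmin.
  by exists d => // d' d'A; exact: dmin.
have maxA : A != finset.set0 -> exists2 e, e \in A & forall d, d \in A -> rho d <= rho e.
  case/set0Pn => e eA; case: (arg_maxP rho eA) => d dA dmax.
  by exists d => // d' d'A; exact: dmax.
have [A0|A0] := eqVneq A finset.set0.
  have [A'0|/minA'[e eA' emin]] := eqVneq A' finset.set0.
    exfalso; have := e0D; rewrite inE.
    case E1 : (chi e0.1 e0.2); case E2 : (chi' e0.1 e0.2) => // _.
      by have [e] := AP _ _ E1 (negbT E2); rewrite A0 inE.
    by have [e] := AP' _ _ E2 (negbT E1); rewrite A'0 inE.
  have [c nc] := Ain' _ eA'; apply: (add e) => //.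
    by move=> i j c' nc'; have [d dA' [-> ->]] := AP' _ _ c' nc'; exact: emin.
  by move=> i j c' nc'; have [d] := AP _ _ c' nc'; rewrite A0 inE.
have [a aA amax] := maxA A0; have [ca nca] := Ain _ aA.
have [A'0|/minA'[b bA' bmin]] := eqVneq A' finset.set0.
  apply: (remove a) => //.
    by move=> i j c nc; have [d dA [-> ->]] := AP _ _ c nc; exact: amax.
  by move=> i j c nc; have [d] := AP' _ _ c nc; rewrite A'0 inE.
have [cb ncb] := Ain' _ bA'.
have [ab|ab] := leP 1 (rho a * rho b).
  apply: (remove a) => //.
    by move=> i j c nc; have [d dA [-> ->]] := AP _ _ c nc; exact: amax.
  move=> i j c nc; have [d dA' [-> ->]] := AP' _ _ c nc; rewrite (le_trans ab)//.
  by rewrite ler_wpM2l ?nm_ge0// bmin.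
apply: (add b) => //.
  by move=> i j c nc; have [d dA' [-> ->]] := AP' _ _ c nc; exact: bmin.
move=> i j c nc; have [d dA [-> ->]] := AP _ _ c nc; rewrite (le_trans _ (ltW ab))//.
by rewrite ler_wpM2r ?nm_ge0// amax.
Qed.

End CellFlips.

(** * Regions, their margins, and independence of the contour *)

Section Regions.
Variable R : realType.
Local Notation C := R[i].

(** Compactness of a square from that of segments: finitely many gauge discs cover a strip around
    each horizontal segment, and compactness of the vertical segment selects finitely many
    strips. *)
Lemma gcompact_box (B : R) : 0 <= B -> gcompact [set z : C | `|Re z| <= B /\ `|Im z| <= B].
Proof.
move=> B0 d d0.
have BB : - B <= B by lra.
have hc y : contR (- B) B (fun s : R => (s +i* y)%C).
  move=> s _ e e0; exists e => // s' _ ss'.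
  by rewrite (le_lt_trans (nm_le _))//= subrr normr0 addr0.
have vc : contR (- B) B (fun s : R => (0 +i* s)%C).
  move=> s _ e e0; exists e => // s' _ ss'.
  by rewrite (le_lt_trans (nm_le _))//= subrr normr0 add0r.
have /choice[sr Hsr] : forall y, exists sr : seq C * R, `|y| <= B -> [/\ 0 < sr.2,
    forall x, x \in sr.1 -> `|Re x| <= B /\ `|Im x| <= B &
    forall x y', `|x| <= B -> `|y' - y| < sr.2 -> exists2 u, u \in sr.1 & nm ((x +i* y')%C - u) < d u].
  move=> y; have [yB|] := boolP (`|y| <= B); last by exists ([::], 1).
  have inb u : path_set (- B) B (fun s : R => (s +i* y)%C) u -> `|Re u| <= B /\ `|Im u| <= B.
    by move=> [s sB ->] /=; rewrite ler_norml.
  have [//|s [sT cov]] := (gcompact_path (hc y)) (fun u => d u / 2).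
    by move=> u /inb uB; rewrite divr_gt0// d0.
  have [r r0 Hr] : exists2 r, 0 < r & forall u, u \in s -> r <= d u / 2.
    by apply: seq_min_gt0 => u /sT/inb uB; rewrite divr_gt0// d0.
  exists (s, r) => _; split=> //; first by move=> u /sT /inb.
  move=> x y' xB yy; have [|u us xu] := cov (x +i* y)%C; first by exists x; rewrite // -ler_norml.
  exists u => //; rewrite (le_lt_trans (nm_tri _ (x +i* y)%C _))//.
  have : nm ((x +i* y')%C - (x +i* y)%C) <= `|y' - y|.
    by rewrite (le_trans (nm_le _))//= subrr normr0 add0r.
  by move: yy => /=; have := Hr u us; lra.
have [|s [sT cov]] := (gcompact_path vc) (fun u => (sr (Im u)).2).
  by move=> u [t tB ->] /=; have [] := Hsr t; rewrite ?ler_norml.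
exists (flatten [seq (sr (Im u)).1 | u <- s]); split.
  move=> x /flatten_mapP[u /sT[t tB ->] /= xs]; have [|_ H _] := Hsr t; first by rewrite ler_norml.
  exact: H.
move=> y [y1 y2]; have [|u us yu] := cov (0 +i* Im y)%C.
  by exists (Im y); rewrite // -ler_norml.
have [t tB ut] := sT u us; have [|_ _ H] := Hsr t; first by rewrite ler_norml.
have [||v vs yv] := H (Re y) (Im y) => //.
  by move: yu; rewrite ut; apply: le_lt_trans; exact: (nm_Im ((0 +i* Im y)%C - (0 +i* t)%C)).
exists v; last by case: y {y1 y2 yu} yv.
by apply/flatten_mapP; exists u => //; rewrite ut.
Qed.

Lemma gcompact_closed (T : set C) (B : R) : (forall z, T z -> nm z <= B) ->
  (forall z, ~ T z -> exists2 r, 0 < r & forall w, nm (w - z) < r -> ~ T w) -> gcompact T.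
Proof.
move=> TB cT d d0.
have [Z|TZ] := pselect (forall z, ~ T z); first by exists [::]; split=> // y /Z.
have B0 : 0 <= B.
  by move: TZ => /existsNP[z /contrapT/TB]; exact: le_trans (nm_ge0 z).
have /choice[r Hr] : forall z, exists r, 0 < r /\ ((T z -> r = d z) /\ (~ T z -> forall w, nm (w - z) < r -> ~ T w)).
  move=> z; have [Tz|nT] := pselect (T z); first by exists (d z); split; [exact: d0|split].
  by have [r r0 H] := cT z nT; exists r; split=> //; split.
have [s [sT cov]] := gcompact_box B0 (fun z _ => (Hr z).1).
exists [seq z <- s | `[< T z >]]; split; first by move=> x; rewrite mem_filter => /andP[/asboolP].
move=> y Ty; have [|x xs yx] := cov y.
  by split; apply: le_trans (TB _ Ty); [exact: nm_Re|exact: nm_Im].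
have Tx : T x by apply: contrapT => nT; exact: ((Hr x).2.2 nT y yx Ty).
by exists x; [rewrite mem_filter asboolT|rewrite -((Hr x).2.1 Tx)].
Qed.

Lemma gcompact1 (a : C) : gcompact [set a].
Proof.
move=> d d0; exists [:: a]; split; first by move=> x; rewrite inE => /eqP ->.
by move=> y ->; exists a; rewrite ?inE// subrr nm0 d0.
Qed.

Lemma lebesgue_numberV n (Ts : nat -> set C) (P : 'rV[C]_n -> Prop) : (forall k, gcompact (Ts k)) ->
  (forall z, inT Ts z -> exists2 r, 0 < r & forall w, rclose r w z -> P w) ->
  exists2 r, 0 < r & forall z w, inT Ts z -> rclose r w z -> P w.
Proof.
move=> gT H.
have /choice[dl Hdl] : forall z : 'rV[C]_n, exists d, inT Ts z -> 0 < d /\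
    forall w, rclose d w z -> P w.
  move=> z; have [Tz|] := pselect (inT Ts z); last by exists 1.
  by have [d d0 Hd] := H z Tz; exists d => _; split.
have [d d0 Hd] := tube gT (fun z Tz => (Hdl z Tz).1).
exists d => // z w Tz wz; have [x Tx [zx dx]] := Hd z Tz.
apply: (Hdl x Tx).2 => i; have := zx i; have := wz i.
by have := nm_tri (w 0 i) (z 0 i) (x 0 i); lra.
Qed.

Lemma mint_prefix n Js Js' (Phi : 'rV[C]_n -> C) : (forall k, (k < n)%N -> Js k = Js' k) ->
  mint Js Phi = mint Js' Phi.
Proof.
elim: n Js Js' Phi => [//|n IH] Js Js' Phi JJ /=; rewrite JJ//.
by congr (Js' 0%N _); apply/funext => x; apply: IH => k kn; exact: JJ.
Qed.

Variables (M Sin Sout : set C) (kappa : C) (tau : R).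
Hypothesis Mtau : forall m, M m -> m != 0 /\ nm m <= tau.
Hypothesis tau0 : 0 < tau.
Hypothesis tau1 : tau < 1.
Hypothesis kappa1 : nm kappa <= 1.
Hypothesis Mcompact : gcompact (M `|` [set 0]).
Hypothesis Sin_compact : gcompact (Sin `|` [set 0]).
Hypothesis Sout_closed : forall z, ~ Sout z -> exists2 r, 0 < r & forall w, nm (w - z) < r -> ~ Sout w.

Implicit Types K I : set C.

Definition open_set I := forall z, I z -> exists2 r, 0 < r & forall w, nm (w - z) < r -> I w.

(** The model is a contour together with its inside for [K], and the inside alone for [I]. The
    clauses lead from the closed set [K] into the open set [I], and this strictness is what produces
    a positive margin. *)
Record region K I : Prop := Region {
  rg_bound : exists B, forall z, K z -> nm z < B;
  rg_closed : open_set [set z | ~ K z];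
  rg_open : open_set I;
  rg_sub : I `<=` K;
  rg_zero : I 0;
  rg_mul : forall m z, M m -> K z -> I (m * z);
  rg_div : forall m z, M m -> ~ I z -> I (m / z);
  rg_inv : forall m z y, M m -> K z -> K y -> kappa * m * z * y <> 1;
  rg_in : Sin `<=` I;
  rg_out : forall s, Sout s -> ~ K s }.

Definition inball I (eta : R) z := forall w, nm (w - z) < eta -> I w.
Definition near K (eta : R) z := exists2 b, K b & nm (b - z) < eta.

Lemma inball_le I (e e' : R) z : e <= e' -> inball I e' z -> inball I e z.
Proof. by move=> ee H w we; apply: H; exact: lt_le_trans ee. Qed.

Lemma near_le K (e e' : R) z : e <= e' -> near K e z -> near K e' z.
Proof. by move=> ee [b Kb bz]; exists b => //; exact: lt_le_trans ee. Qed.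

Lemma inball_in I (e : R) z : 0 < e -> inball I e z -> I z.
Proof. by move=> e0; apply; rewrite subrr nm0. Qed.

Lemma in_near K (e : R) z : 0 < e -> K z -> near K e z.
Proof. by move=> e0 Kz; exists z; rewrite ?subrr ?nm0. Qed.

Record margined K I (eta B : R) : Prop := Margined {
  mg_sub : I `<=` K;
  mg_bound : forall z, near K eta z -> nm z < B;
  mg_zero : inball I eta 0;
  mg_mul : forall m z, M m -> near K eta z -> inball I eta (m * z);
  mg_div : forall m z, M m -> ~ inball I eta z -> inball I eta (m / z);
  mg_inv : forall m z y, M m -> near K eta z -> near K eta y -> kappa * m * z * y <> 1;
  mg_in : forall s, Sin s -> inball I eta s;
  mg_out : forall s, Sout s -> ~ near K eta s }.

Lemma margined_le K I (e e' B B' : R) : e <= e' -> B' <= B -> margined K I e' B' -> margined K I e B.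
Proof.
move=> ee BB h; have nr := near_le ee; have ib := inball_le ee.
split.
- exact: mg_sub h.
- by move=> z /nr /(mg_bound h) zB; exact: lt_le_trans BB.
- exact: ib (mg_zero h).
- by move=> m z Mm /nr Kz; have := mg_mul h Mm Kz; exact: ib.
- by move=> m z Mm nz; apply: (ib _ _) (mg_div h Mm _) => H; exact: nz (ib _ _ H).
- by move=> m z y Mm /nr Kz /nr Ky; exact: mg_inv h _ _ _ _ _ _.
- by move=> s Ss; exact: ib (mg_in h Ss).
- by move=> s Ss /nr; exact: mg_out h _ _.
Qed.

Lemma rcont_open n (Phi : 'rV[C]_n -> C) I z : rcont Phi z -> open_set I -> I (Phi z) ->
  exists2 r, 0 < r & forall w, rclose r w z -> I (Phi w).
Proof.
move=> cP oI /oI[e e0 H]; have [d d0 Hd] := cP e e0.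
by exists d => // w /Hd; exact: H.
Qed.

Let row3 (x y z : C) : 'rV[C]_3 := \row_i (if i == 0 :> nat then x else if i == 1 :> nat then y else z).
Let Ts3 (T0 T1 T2 : set C) : nat -> set C := fun k => if k == 0%N then T0 else if k == 1%N then T1 else T2.

(** A factor reduced to 0 carries a perturbation: the conclusion for [m * z + e] with [e] small
    describes a whole disc about [m * z]. *)
Let tube3 T0 T1 T2 (P : C -> C -> C -> Prop) : gcompact T0 -> gcompact T1 -> gcompact T2 ->
  (forall x y z, T0 x -> T1 y -> T2 z -> exists2 r, 0 < r & forall w : 'rV[C]_3, rclose r w (row3 x y z) ->
    P (w 0 0) (w 0 1) (w 0 (1 + 1))) ->
  exists2 r, 0 < r & forall x y z x' y' z', T0 x -> T1 y -> T2 z ->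
    nm (x' - x) < r -> nm (y' - y) < r -> nm (z' - z) < r -> P x' y' z'.
Proof.
move=> g0 g1 g2 H.
have [||r r0 Hr] := @lebesgue_numberV 3 (Ts3 T0 T1 T2) (fun w => P (w 0 0) (w 0 1) (w 0 (1 + 1))).
- by move=> [|[|k]].
- move=> z Tz; have [|||r r0 Hr] := H (z 0 0) (z 0 1) (z 0 (1 + 1)).
  + exact: (Tz 0).
  + exact: (Tz 1).
  + exact: (Tz (1 + 1)).
  exists r => // w wz; apply: Hr => i; have := wz i; rewrite !mxE.
  by case: i => [[|[|[|i]]] Hi] //=; congr (nm (_ - z _ _) < _); exact/val_inj.
exists r => // x y z x' y' z' Tx Ty Tz xx yy zz.
have := Hr (row3 x y z) (row3 x' y' z'); rewrite !mxE /=; apply.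
  by move=> i; rewrite mxE; case: i => [[|[|[|i]]] Hi].
by move=> i; rewrite !mxE; case: i => [[|[|[|i]]] Hi].
Qed.

(** Compactness makes each pointwise clause uniform; [M] and [Sin] enter through their unions with
    0, which are compact. The complement of [I], which occurs in [rg_div], is unbounded, so large
    [z] are treated apart: for them [m / z] falls into a disc about 0 contained in [I]. *)
Lemma region_margined K I : region K I -> exists eta B, 0 < eta /\ margined K I eta B.
Proof.
move=> g; have [B0 KB] := rg_bound g.
have gK : gcompact K.
  by apply: (@gcompact_closed K B0) => [z /KB /ltW//|]; exact: rg_closed g.
have [r0 r00 Hr0] := rg_open g (rg_zero g).
(* Beyond [B'], and even after a displacement by less than 1, one has [nm (m / z) < r0 / 2]. *)
pose B' := 1 + 2 * tau / r0.
have B'1 : 1 <= B' by rewrite lerDl divr_ge0// ltW// mulr_gt0.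
have gK2 : gcompact [set z | ~ I z /\ nm z <= B'].
  apply: (@gcompact_closed _ B') => [z []//|z /not_andP H].
  have [/(rg_open g)[r rp Hr]|nI] := pselect (I z).
    by exists r => // w /Hr Iw [].
  have zB : B' < nm z by case: H => [//|/negP]; rewrite -ltNge.
  exists (nm z - B'); first by rewrite subr_gt0.
  by move=> w wz [_]; have := nm_subge z w; rewrite nm_sub; lra.
have g0 : gcompact [set 0 : C] by exact: gcompact1.
have [|e1 e10 H1] := @tube3 _ _ _ (fun m z e => I (m * z + e)) Mcompact gK g0.
  move=> m z e Mm Kz ->; apply: (rcont_open (Phi := fun w : 'rV[C]_3 => w 0 0 * w 0 1 + w 0 (1 + 1))).
  - by apply: rcontD; [apply: rcontM|]; exact: rcont_coord.
  - exact: rg_open g.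
  rewrite !mxE /= addr0; case: Mm => [Mm|->]; [exact: rg_mul g _ _ Mm Kz|by rewrite mul0r; exact: rg_zero g].
have [|e2 e20 H2] := @tube3 _ _ _ (fun m z e => I (m / z + e)) Mcompact gK2 g0.
  move=> m z e Mm [nI zB] ->; apply: (rcont_open (Phi := fun w : 'rV[C]_3 => w 0 0 / w 0 1 + w 0 (1 + 1))).
  - apply: rcontD; [apply: rcontM|]; try exact: rcont_coord.
    apply: rcontV; last exact: rcont_coord.
    by rewrite !mxE /=; apply/eqP => z0; apply: nI; rewrite z0; exact: rg_zero g.
  - exact: rg_open g.
  rewrite !mxE /= addr0; case: Mm => [Mm|->]; [exact: rg_div g _ _ Mm nI|by rewrite mul0r; exact: rg_zero g].
have [|e3 e30 H3] := @tube3 _ _ _ (fun m z y => kappa * m * z * y <> 1) Mcompact gK gK.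
  move=> m z y Mm Kz Ky.
  apply: (rcont_open (Phi := fun w : 'rV[C]_3 => kappa * w 0 0 * w 0 1 * w 0 (1 + 1)) (I := [set u | u <> 1])).
  - by do 3 ?apply: rcontM; first exact: rcont_cst; exact: rcont_coord.
  - move=> u u1; exists (nm (u - 1)); first by rewrite nm_gt0 subr_eq0; exact/eqP.
    by move=> w wu w1; rewrite w1 nm_sub ltxx in wu.
  rewrite !mxE /=; case: Mm => [Mm|->]; first exact: rg_inv g _ _ _ Mm Kz Ky.
  by rewrite mulr0 !mul0r => /esym/eqP; rewrite oner_eq0.
have [|e4 e40 H4] := @tube3 _ _ _ (fun s e _ => I (s + e)) Sin_compact g0 g0.
  move=> s e e' Ss -> _; apply: (rcont_open (Phi := fun w : 'rV[C]_3 => w 0 0 + w 0 1)).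
  - by apply: rcontD; exact: rcont_coord.
  - exact: rg_open g.
  by rewrite !mxE /= addr0; case: Ss => [/(rg_in g)//|->]; exact: rg_zero g.
have [e5 e50 H5] := @lebesgue_number R K (fun w => ~ Sout w) gK
  (fun z Kz => Sout_closed (fun Ss => rg_out g Ss Kz)).
pose eta := Num.min 1 (Num.min (r0 / 2) (Num.min e1 (Num.min e2 (Num.min e3 (Num.min e4 e5))))).
have eta0 : 0 < eta by rewrite /eta !lt_min ltr01 divr_gt0// e10 e20 e30 e40 e50.
have E : [/\ eta <= 1, eta <= r0 / 2 & [/\ eta <= e1, eta <= e2, eta <= e3, eta <= e4 & eta <= e5]].
  by repeat split; rewrite /eta !ge_min lexx ?orbT.
case: E => E1 Er [Ee1 Ee2 Ee3 Ee4 Ee5].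
have z0 (e : R) : 0 < e -> nm (0 - 0 : C) < e by rewrite subrr nm0.
have xx (x : C) (e : R) : 0 < e -> nm (x - x) < e by rewrite subrr nm0.
exists eta, (B0 + 1); split=> //; split.
- exact: rg_sub g.
- by move=> z [b /KB bB bz]; have := nm_subge z b; rewrite nm_sub; lra.
- by move=> w w0; apply: Hr0; lra.
- move=> m z Mm [b Kb bz] w wz; rewrite -(subrKC (m * z) w).
  apply: (H1 m b 0) => //; [by left|exact: xx|rewrite nm_sub; lra|rewrite subr0; lra].
- move=> m z Mm /existsNP[b /not_implyP[bz nI]] w wz.
  have [bB|bB] := leP (nm b) B'.
    rewrite -(subrKC (m / z) w); apply: (H2 m b 0) => //; [by left|exact: xx|rewrite nm_sub; lra|rewrite subr0; lra].
  apply: Hr0; rewrite subr0.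
  have [m0 mt] := Mtau Mm.
  have zB : 2 * tau / r0 < nm z by have := nm_subge b z; rewrite /B' in bB; lra.
  have z_gt : 0 < nm z by apply: le_lt_trans zB; rewrite divr_ge0// ltW// mulr_gt0.
  have : nm (m / z) < r0 / 2.
    rewrite nmM nmV ltr_pdivrMr// (le_lt_trans mt)//.
    by move: zB; rewrite ltr_pdivrMr//; lra.
  by have := nm_subge w (m / z); lra.
- move=> m z y Mm [b Kb bz] [c Kc cy]; apply: (H3 m b c) => //; [by left|exact: xx|rewrite nm_sub; lra|rewrite nm_sub; lra].
- move=> s Ss w ws; rewrite -(subrKC s w).
  by apply: (H4 s 0 0 _ _ 0) => //; [left|exact: xx|rewrite subr0; lra|exact: z0].
- by move=> s Ss [b Kb bs]; apply: H5 Kb _ Ss; rewrite nm_sub; lra.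
Qed.

(** Winding numbers are left open in the collar between [I] and the complement of [K], up to the
    width [eta]. Hence a contour and its approximations by grid cells are instances of the same
    notion. *)
Record adapted K I (eta : R) (T : set C) (J : (C -> C) -> C) : Prop := Adapted {
  ad_cyc : cyc T J;
  ad_in : forall a, inball I eta a -> ~ T a /\ J (fun z => (z - a)^-1) = two_pi_i R;
  ad_out : forall a, ~ near K eta a -> ~ T a /\ J (fun z => (z - a)^-1) = 0 }.

Lemma adapted_le K I (e e' : R) T J : e' <= e -> adapted K I e' T J -> adapted K I e T J.
Proof.
move=> ee [c ci co]; split=> // a.
  by move=> /(inball_le ee)/ci.
by move=> na; apply: co => /(near_le ee).
Qed.

Section Margin.
Variables (K I : set C) (eta B : R).
Hypothesis eta0 : 0 < eta.
Hypothesis mg : margined K I eta B.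

Let Om := [set z | ~ inball I eta z /\ near K eta z].

Lemma margin_pairfree x y : Om x -> Om y -> pairfree M kappa x y.
Proof.
move=> [nx kx] [ny ky] m Mm; split.
- by move=> e; apply: nx; rewrite e; exact: mg_mul mg _ _ Mm ky.
- by move=> e; apply: ny; rewrite e; exact: mg_mul mg _ _ Mm kx.
- have y0 : y != 0 by apply/eqP => y0; apply: ny; rewrite y0; exact: mg_zero mg.
  by move=> e; apply: nx; rewrite -(mulfK y0 x) e; exact: mg_div mg _ _ Mm ny.
- exact: mg_inv mg _ _ _ Mm kx ky.
Qed.

Lemma margin_dom x : Om x -> [/\ x != 0, ~ Sin x & ~ Sout x].
Proof.
move=> [nx kx]; split.
- by apply/eqP => x0; apply: nx; rewrite x0; exact: mg_zero mg.
- by move=> Sx; apply: nx; exact: mg_in mg _ Sx.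
- by move=> Sx; exact: mg_out mg _ Sx kx.
Qed.

Lemma adapted_margin T J : adapted K I eta T J -> T `<=` Om.
Proof.
move=> ad a Ta; split; first by move=> /(ad_in ad)[].
by apply: contrapT => nk; have [] := ad_out ad nk.
Qed.

Lemma adapted_cyc T J : adapted K I eta T J -> cyc T (wfun J).
Proof. by move=> ad; apply: cyc_wfun (ad_cyc ad) _ => x /(adapted_margin ad)/margin_dom[]. Qed.

Lemma margin_holdom n Us (z : 'rV[C]_n) : (forall k, Us k `<=` Om) -> inT Us z ->
  @holdom R M Sin Sout kappa n z.
Proof.
move=> UO Uz; split=> [i|i j ij]; first by apply: margin_dom; exact/UO/Uz.
by apply: margin_pairfree; exact/UO/Uz.
Qed.

(** In one coordinate, the difference of two adapted functionals has winding number 0 around all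
    points outside the collar [Om], and [homology_cauchy] makes it vanish on functions
    differentiable in [Om]. Adaptation to [eta / 2] rather than [eta] leaves the neighbourhood of
    the complement that this theorem demands. *)
Lemma adapted_mint n (F : 'rV[C]_n -> C) Ts Js Ts' Js' :
  hol F (@holdom R M Sin Sout kappa n) ->
  (forall k, adapted K I (eta / 2) (Ts k) (Js k)) ->
  (forall k, adapted K I (eta / 2) (Ts' k) (Js' k)) ->
  mint (fun k => wfun (Js k)) F = mint (fun k => wfun (Js' k)) F.
Proof.
move=> hF ad ad'.
have ee0 := eta0.
have TOm T J : adapted K I (eta / 2) T J -> T `<=` Om.
  have ee : eta / 2 <= eta by lra.
  by move=> /(adapted_le ee)/adapted_margin.
have Om0 x : Om x -> x != 0 by case/margin_dom.
have cw T J : adapted K I (eta / 2) T J -> cyc T (wfun J).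
  by move=> ad0; apply: adapted_cyc (adapted_le _ ad0); lra.
have uF Us : (forall k, gcompact (Us k)) -> (forall k, Us k `<=` Om) -> UC Us F.
  move=> gU UO; apply: heine_cantor => //; apply: rcont_contV => z /(margin_holdom UO)/hF[]//.
have replace k T' J' Us Js0 : (forall j, adapted K I (eta / 2) (Us j) (Js0 j)) ->
    adapted K I (eta / 2) T' J' -> (k < n)%N ->
    mint (fun j => wfun (Js0 j)) F = mint (upd (fun j => wfun (Js0 j)) k (wfun J')) F.
  move=> aU a' kn; apply: (@mint_replace _ _ _ _ Us _ T') => //.
  - by move=> j; exact: cw.
  - exact: cw.
  - apply: uF => j; [exact: cyc_compact (ad_cyc (aU j))|exact: TOm (aU j)].
  - by apply: uF => j; rewrite /upd; case: ifP => _;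
      [exact: cyc_compact (ad_cyc a')|exact: cyc_compact (ad_cyc (aU j))
      |exact: TOm a'|exact: TOm (aU j)].
  move=> i z ik Tz; rewrite /wfun.
  pose f x := F (set_coord i x z) * (two_pi_i R * x)^-1; rewrite -!/(f _).
  have fd x : Om x -> cdiff f x.
    move=> Ox; apply: cdiffM.
      apply: hol_slice hF _; split=> [j|j l jl]; rewrite !set_coord_coord.
        by apply: margin_dom; case: eqVneq => // ji; exact: TOm (aU j) _ (Tz j ji).
      by apply: margin_pairfree; case: eqVneq => // ji; exact: TOm (aU _) _ (Tz _ ji).
    apply: cdiffV; first by rewrite mulf_neq0 ?two_pi_i_neq0 ?Om0.
    exact: cdiff_lin.
  have c1 := ad_cyc (aU k); have c2 := ad_cyc a'.
  have gc : gcompact (Us k `|` T') by apply: gcompactU; [exact: cyc_compact c1|exact: cyc_compact c2].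
  have s1 : cyc (Us k `|` T') (Js0 k) by apply: cyc_sup c1 => // x; left.
  have s2 : cyc (Us k `|` T') J' by apply: cyc_sup c2 => // x; right.
  have cc : cyc (Us k `|` T' `|` (Us k `|` T')) (fun g => Js0 k g + (-1) * J' g).
    by apply: cyc_add => //; exact: cyc_scale.
  have := homology_cauchy cc (divr_gt0 eta0 (ltr0Sn _ 1)) fd (B := B); rewrite mulN1r.
  move=> H; apply/eqP; rewrite -subr_eq0; apply/eqP; apply: H.
    by move=> x [[]|[]] Hx; [exact: TOm (aU k) _ Hx|exact: TOm a' _ Hx|exact: TOm (aU k) _ Hx|exact: TOm a' _ Hx].
  move=> a Ha; rewrite mulN1r.
  suff : inball I (eta / 2) a \/ ~ near K (eta / 2) a.
    case=> [Ia|na].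
      have [n1 ->] := ad_in (aU k) Ia; have [n2 ->] := ad_in a' Ia.
      by rewrite subrr; split=> // -[[]|[]].
    have [n1 ->] := ad_out (aU k) na; have [n2 ->] := ad_out a' na.
    by rewrite subrr; split=> // -[[]|[]].
  case: Ha => [aB|[b /not_andP nb ba]].
    right=> na; have : near K eta a by apply: near_le na; lra.
    by move=> /(mg_bound mg); rewrite ltNge aB.
  case: nb => [/contrapT Ib|nb].
    left=> w wa; apply: Ib; rewrite (le_lt_trans (nm_tri _ a _))//.
    by rewrite (nm_sub a b); lra.
  right=> -[c Kc ca]; apply: nb; exists c => //.
  by rewrite (le_lt_trans (nm_tri _ a _))// (nm_sub a b); lra.
have all k : (k <= n)%N -> mint (fun j => wfun (Js j)) F =
    mint (fun j => wfun (if (j < k)%N then Js' j else Js j)) F.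
  elim: k => [|k IH] kn; first by [].
  rewrite IH 1?ltnW// (replace k (Ts' k) (Js' k) (fun j => if (j < k)%N then Ts' j else Ts j))//.
    apply: (congr1 (fun Js => mint Js F)); apply/funext => j; rewrite /upd ltnS.
    by case: (ltngtP j k) => [||->].
  by move=> j; case: ifP.
rewrite (all n (leqnn n)).
by apply: mint_prefix => k ->.
Qed.

(** Cells that meet [K], not those contained in it: their union contains [K] and stays within
    [2 * h] of it. *)
Definition cover_cells (h : R) : nat -> nat -> bool :=
  fun i j => `[< exists2 z, cell (- (B + 3 * h)) (- (B + 3 * h)) h i j z & K z >].

Variable h : R.
Hypothesis h0 : 0 < h.
Hypothesis h_eta : 4 * h < eta.
Local Notation Z0 := (- (B + 3 * h)).
Local Notation N := (box_size B h).
Local Notation chi := (cover_cells h).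

Let chi_near i j z : chi i j -> cell Z0 Z0 h i j z -> near K (eta / 2) z.
Proof.
move=> /asboolP[w cw Kw] cz; exists w => //.
by have := cell_small cw cz; have := h_eta; lra.
Qed.

Let nchi i j z : ~~ chi i j -> cell Z0 Z0 h i j z -> ~ K z.
Proof. by move=> /asboolPn H cz Kz; apply: H; exists z. Qed.

Let near_half z : near K (eta / 2) z -> near K eta z.
Proof. by apply: near_le; have := eta0; lra. Qed.

Let inball_half z : inball I eta z -> I z.
Proof. exact: inball_in. Qed.

Lemma cover_cells_legal rho0 B2 : 0 < rho0 <= eta -> B <= B2 ->
  legal M Sin Sout kappa rho0 B2 Z0 h N chi.
Proof.
move=> /andP[r0 re] BB; have nI i j z : ~~ chi i j -> cell Z0 Z0 h i j z -> ~ I z.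
  by move=> nc cz /(mg_sub mg); exact: nchi nc cz.
have up i j z : I z -> cell Z0 Z0 h i j z -> chi i j.
  by move=> Iz cz; apply/negPn/negP => /nI/(_ cz).
split.
- move=> i j /asboolP[z cz Kz]; apply: cell_inner cz => //.
  by apply: mg_bound mg _ _; exact: in_near.
- move=> m i j z i' j' Mm c cz; apply: up; apply/inball_half/(mg_mul mg) => //.
  by apply: near_half; exact: chi_near c cz.
- move=> m i j z i' j' Mm c cz z0; apply: up; apply/inball_half/(mg_div mg) => //.
  by move=> /inball_half; exact: nI c cz.
- move=> m i j z i' j' y Mm c cz cy e; apply/negP => c'.
  apply: mg_inv mg _ _ _ Mm _ _ e; apply: near_half; [exact: chi_near c cz|exact: chi_near c' cy].
- by move=> s i j Ss; apply: up; exact/inball_half/(mg_in mg).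
- move=> s i j Ss cs; apply/negP => c.
  by apply: mg_out mg _ Ss _; apply: near_half; exact: chi_near c cs.
- move=> z i j zr; apply: up; apply: (mg_zero mg); rewrite subr0; exact: lt_le_trans re.
- move=> z i j c cz; apply: lt_le_trans BB; apply: mg_bound mg _ _.
  by apply: near_half; exact: chi_near c cz.
Qed.

Lemma cover_cells_adapted :
  adapted K I (eta / 2) (edgeset Z0 Z0 h N chi) (bdG Z0 Z0 h N chi).
Proof.
have ee0 := eta0.
have gr : grid_region N chi.
  move=> i j /asboolP[z cz Kz]; apply: cell_inner cz => //.
  by apply: mg_bound mg _ _; exact: in_near.
have one a (J : (C -> C) -> C) : J (fun z => (z - a)^-1) = J (fun z => 1 / (z - a)).
  by congr J; apply/funext => z; rewrite mul1r.
split.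
- by exact: cyc_bdG.
- move=> a Ia; have all i j : cell Z0 Z0 h i j a -> chi i j.
    move=> ca; apply/asboolP; exists a => //; apply: mg_sub mg _ _.
    by apply: inball_in Ia; lra.
  have Ka : K a by apply: mg_sub mg _ _; apply: inball_in Ia; lra.
  split.
    by move=> /(edgeset_cells h0 gr)[_ [_ [i [j [_ _ nc /all]]]]]; rewrite (negbTE nc).
  rewrite one (bdG_cauchy_in h0 (F := fun=> 1) gr) ?mul1r//.
    by move=> *; exact: cdiff_cst.
  by apply: box_cell => //; apply: mg_bound mg _ _; exact: in_near.
- move=> a na; have all i j : cell Z0 Z0 h i j a -> ~~ chi i j.
    by move=> ca; apply/negP => c; apply: na; exact: chi_near c ca.
  split.
    by move=> /(edgeset_cells h0 gr)[i [j [_ [_ [c /all nc _ _]]]]]; rewrite c in nc.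
  by rewrite one (bdG_cauchy_out h0 (F := fun=> 1) gr)// => *; exact: cdiff_cst.
Qed.

End Margin.

(** Each family of functionals is exchanged for the boundary of the cells that cover its own region.
    Both unions of cells are made on the same grid, where [legal_mint] joins them. *)
Theorem region_invariance K I K' I' n : region K I -> region K' I' ->
  exists2 eta, 0 < eta & forall (F : 'rV[C]_n -> C) Ts Js Ts' Js',
    hol F (@holdom R M Sin Sout kappa n) ->
    (forall k, adapted K I eta (Ts k) (Js k)) ->
    (forall k, adapted K' I' eta (Ts' k) (Js' k)) ->
    mint (fun k => wfun (Js k)) F = mint (fun k => wfun (Js' k)) F.
Proof.
move=> /region_margined[e1 [B1 [e10 m1]]] /region_margined[e2 [B2 [e20 m2]]].
pose eta := Num.min e1 e2; have eta0 : 0 < eta by rewrite lt_min e10.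
pose B := Num.max 1 (Num.max B1 B2); have B1' : 1 <= B by rewrite le_max lexx.
have m1' : margined K I eta B.
  by apply: margined_le m1; rewrite ?ge_min ?le_max lexx ?orbT.
have m2' : margined K' I' eta B.
  by apply: margined_le m2; rewrite ?ge_min ?le_max lexx ?orbT.
pose rho := Num.min eta 1; have rho0 : 0 < rho by rewrite lt_min eta0 ltr01.
have rho1 : rho <= 1 by rewrite ge_min lexx orbT.
have rhoe : rho <= eta by rewrite ge_min lexx.
have tt0 := tau0; have tt1 := tau1.
(* Chosen to make [8 * h * (B + 1)] equal to [rho * (1 - tau)]. Since [B >= 1] and [rho <= 1], all
   mesh conditions of the flips follow, as does [4 * h < eta]. *)
pose h := rho * (1 - tau) / (8 * (B + 1)).
have B8 : 0 < 8 * (B + 1) by lra.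
have t1 : 0 < 1 - tau by rewrite subr_gt0.
have rt : 0 < rho * (1 - tau) by rewrite mulr_gt0.
have rt1 : rho * (1 - tau) <= 1 - tau by rewrite ler_piMl// ltW.
have rt2 : rho * (1 - tau) <= rho by rewrite ler_piMr ?ltW// ; have := tau0; lra.
have h0 : 0 < h by rewrite divr_gt0.
have hE : 8 * h * (B + 1) = rho * (1 - tau) by rewrite /h; field; lra.
have hB : h <= h * B by rewrite ler_peMr// ltW.
have h16 : 16 * h <= rho * (1 - tau) by lra.
exists (eta / 2); first by rewrite divr_gt0.
move=> F Ts Js Ts' Js' hF a1 a2.
pose Z0 := - (B + 3 * h); pose N := box_size B h.
have A1 := cover_cells_adapted eta0 m1' h0; have A2 := cover_cells_adapted eta0 m2' h0.
have h4 : 4 * h < eta by lra.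
rewrite (adapted_mint eta0 m1' hF a1 (fun=> A1 h4)).
rewrite -(adapted_mint eta0 m2' hF (fun=> A2 h4) a2).
have L1 := cover_cells_legal eta0 m1' h0 h4 (rho0 := rho) (B2 := B).
have L2 := cover_cells_legal eta0 m2' h0 h4 (rho0 := rho) (B2 := B).
apply: (legal_mint Mtau tau0 tau1 kappa1 rho0 h0 _ _ _ hF (L1 _ _) (L2 _ _)); rewrite ?rho0//; lra.
Qed.

End Regions.

(** * Piecewise smooth curves and their velocities *)

Section Curves.
Variable R : realType.
Local Notation C := R[i].
Local Notation mu := (@lebesgue_measure R).

Lemma C1_ftc (x : R -> R) (s s' : R) : C1 x -> s <= s' ->
  \int[mu]_(r in `[s, s']) derive1 x r = x s' - x s.
Proof.
move=> [dx cx]; rewrite le_eqVlt => /predU1P[<-|ss].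
  by rewrite set_itv1 Rintegral_set1 subrr.
rewrite /Rintegral (@continuous_FTC2 _ _ x)//.
- by apply: continuous_subspaceT => r; exact: cx.
- have cx' r : {for r, continuous x} by exact/differentiable_continuous/derivable1_diffP/dx.
  by split=> [r _//||]; [apply: cvg_at_right_filter; exact: cx'|apply: cvg_at_left_filter; exact: cx'].
Qed.

Lemma continuous_contR a b (x y : R -> R) : continuous x -> continuous y ->
  contR a b (fun s => (x s +i* y s)%C).
Proof.
move=> cx cy s _ e e0.
have e2 : 0 < e / 2 by rewrite divr_gt0.
have /cvgrPdist_lt /(_ _ e2) := cx s; rewrite near_simpl => /nbhs_ballP[d1 /= d10 H1].
have /cvgrPdist_lt /(_ _ e2) := cy s; rewrite near_simpl => /nbhs_ballP[d2 /= d20 H2].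
exists (Num.min d1 d2); first by rewrite lt_min d10.
move=> r _; rewrite lt_min => /andP[r1 r2].
have h1 : `|x s - x r| < e / 2 by apply: H1; rewrite /ball /= distrC.
have h2 : `|y s - y r| < e / 2 by apply: H2; rewrite /ball /= distrC.
change (nm ((x r +i* y r)%C - (x s +i* y s)%C) < e).
apply: le_lt_trans (nm_le _) _; rewrite /= (distrC (x r)) (distrC (y r)) (splitr e).
exact: ltrD.
Qed.

(** At break points and end points [curve_derive] carries no information. It is traded for a bounded
    measurable [k] that agrees with it off a countable set and integrates to the increments of the
    curve. *)
Record velocity (a b : R) (c k : R -> C) : Prop := Velocity {
  vel_cont : contR a b c;
  vel_bm : bm a b k;
  vel_derive : exists2 D : set R, countable D &
    forall s, a <= s <= b -> ~ D s -> curve_derive c s = k s;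
  vel_ftc : forall s s', a <= s -> s <= s' -> s' <= b -> ig s s' k = c s' - c s }.

Lemma velocity_piece a b c (x y : R -> R) : C1 x -> C1 y ->
  (forall s, a <= s <= b -> c s = (x s +i* y s)%C) ->
  velocity a b c (fun s => (derive1 x s +i* derive1 y s)%C).
Proof.
move=> Cx Cy cE; have [dx cx] := Cx; have [dy cy] := Cy.
have cont (z : R -> R) (r : R) : derivable z r 1 -> {for r, continuous z}.
  by move=> d; exact/differentiable_continuous/derivable1_diffP.
split.
- have := @continuous_contR a b x y (fun r => cont x r (dx r)) (fun r => cont y r (dy r)).
  move=> H s sab e e0; have [d d0 Hd] := H s sab e e0; exists d => // r rab rs.
  by rewrite !cE// Hd.
- exact/contR_bm/continuous_contR.
- exists [set a; b]; first exact/finite_set_countable/finite_set2.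
  move=> s /andP[sa sb] nD.
  have as_ : a < s by rewrite lt_neqAle sa andbT; apply/eqP => e; apply: nD; left.
  have bs_ : s < b by rewrite lt_neqAle sb andbT; apply/eqP => e; apply: nD; right.
  have nr : \forall r \near s, c r = (x r +i* y r)%C.
    near=> r; apply: cE; apply/andP; split; apply/ltW; near: r.
      exact: lt_nbhsr.
    exact: lt_nbhsl.
  by rewrite /curve_derive; congr (_ +i* _)%C; rewrite !derive1E; apply: near_eq_derive; apply: filterS nr => r ->.
- move=> s s' as_ ss sb.
  rewrite !cE ?(le_trans as_)// ?sb ?(le_trans ss)// ?as_//.
  by rewrite /ig /= !C1_ftc.
Unshelve. all: by end_near. Qed.

Lemma velocity_glue a b d c k1 k2 : a <= b -> b <= d -> velocity a b c k1 -> velocity b d c k2 ->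
  velocity a d c (fun s => if s <= b then k1 s else k2 s).
Proof.
move=> ab bd [c1 m1 [D1 cD1 E1] F1] [c2 m2 [D2 cD2 E2] F2].
pose k s := if s <= b then k1 s else k2 s.
have k1E s : a <= s <= b -> k s = k1 s by move=> /andP[_ sb]; rewrite /k sb.
have k2E s : b <= s <= d -> ~ [set b] s -> k s = k2 s.
  move=> /andP[bs _] nb; rewrite /k leNgt lt_neqAle bs andbT; case: eqP => //= e.
  by case: nb.
have mk : bm a d k.
  have [r1 i1 [B1 H1]] := m1; have [r2 i2 [B2 H2]] := m2.
  have split_ : `[a, d]%classic = `[a, b]%classic `|` `]b, d]%classic.
    by rewrite -itv_bndbnd_setU// bnd_simp.
  have glue (u1 u2 u : R -> R) : measurable_fun `[a, b] u1 -> measurable_fun `[b, d] u2 ->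
      (forall s, a <= s <= b -> u s = u1 s) -> (forall s, b < s <= d -> u s = u2 s) ->
      measurable_fun `[a, d] u.
    move=> mu1 mu2 e1 e2; rewrite split_; apply/measurable_funU => //; split.
      by apply: eq_measurable_fun mu1 => s; rewrite inE/= in_itv/= => /e1.
    apply: (@eq_measurable_fun _ _ _ _ _ u2); last first.
      apply: measurable_funS mu2 => // s /=; rewrite !in_itv/= => /andP[/ltW -> ->]//.
    by move=> s; rewrite inE/= in_itv/= => /e2.
  have e2 s : b < s <= d -> k s = k2 s by move=> /andP[bs _]; rewrite /k leNgt bs.
  split.
  - by apply: glue r1 r2 _ _ => s; [move/k1E ->|move/e2 ->].
  - by apply: glue i1 i2 _ _ => s; [move/k1E ->|move/e2 ->].
  - exists (Num.max B1 B2) => s /andP[as_ sd]; rewrite le_max; have [sb|sb] := leP s b.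
      by rewrite k1E ?H1 ?as_.
    by rewrite e2 ?sb// (H2 s) ?orbT// sd ltW.
split.
- move=> s /andP[as_ sd] e e0; case: (ltgtP s b) => sb.
  + have [|r r0 H] := c1 s _ e e0; first by rewrite as_ ltW.
    exists (Num.min r (b - s)); first by rewrite lt_min r0 subr_gt0.
    move=> s' /andP[as' sd']; rewrite lt_min => /andP[h1 h2]; apply: H => //.
    by rewrite as' /=; move: h2; rewrite ltr_norml; lra.
  + have [|r r0 H] := c2 s _ e e0; first by rewrite sd ltW.
    exists (Num.min r (s - b)); first by rewrite lt_min r0 subr_gt0.
    move=> s' /andP[as' sd']; rewrite lt_min => /andP[h1 h2]; apply: H => //.
    by rewrite sd' andbT; move: h2; rewrite ltr_norml; lra.
  + rewrite sb; have [|r1 r10 H1] := c1 b _ e e0; first by rewrite ab lexx.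
    have [|r2 r20 H2] := c2 b _ e e0; first by rewrite bd lexx.
    exists (Num.min r1 r2); first by rewrite lt_min r10.
    move=> s' /andP[as' sd']; rewrite lt_min => /andP[h1 h2].
    by case: (leP s' b) => s'b; [apply: H1|apply: H2]; rewrite ?as' ?sd' ?(ltW s'b)//.
- by [].
- exists (D1 `|` (D2 `|` [set b])).
    by apply: countable_setU => //; apply: countable_setU => //; exact: countable1.
  move=> s /andP[as_ sd] nD; case: leP => sb; first by apply: E1; [rewrite as_|move=> ?; apply: nD; left].
  by apply: E2; [rewrite sd ltW|move=> ?; apply: nD; right; left].
have F1' s s' : a <= s -> s <= s' -> s' <= b -> ig s s' k = c s' - c s.
  move=> as_ ss sb; rewrite -F1//; apply: eq_ig => r /andP[r1 r2].
  by apply: k1E; rewrite (le_trans as_)// (le_trans r2).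
have F2' s s' : b <= s -> s <= s' -> s' <= d -> ig s s' k = c s' - c s.
  move=> as_ ss sb; rewrite -F2//; apply: (eq_countable_ig (D := [set b])).
  - exact: bm_sub m2.
  - exact: countable1.
  - by move=> r /andP[r1 r2]; apply: k2E; rewrite (le_trans as_)// (le_trans r2).
move=> s s' as_ ss sd; rewrite -/k; have [sb|sb] := leP s' b; first exact: F1'.
have [bs|bs] := leP b s; first exact: F2'.
rewrite (@ig_split _ s b s') ?ltW//; last exact: bm_sub mk.
by rewrite F1' ?(ltW bs)// F2' ?(ltW sb)//; ring.
Qed.

Lemma piecewise_velocity c : piecewise_C1 c -> exists k, velocity 0 1 c k.
Proof.
move=> [b [pb lb H]].
suff key a : path <%R a b -> (forall k, (k < size b)%N -> exists x y : R -> R,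
    [/\ C1 x, C1 y & forall s, nth 0 (a :: b) k <= s <= nth 0 b k -> c s = (x s +i* y s)%C]) ->
    exists k, velocity a (last a b) c k by rewrite -lb; exact: key.
elim: b a {pb lb H} => [|b0 b IH] a /=.
  move=> _ _; exists (fun=> 0); split.
  - move=> s /le_anti <- e e0; exists 1 => // r /le_anti <- _; rewrite subrr nm0//.
  - exact: bm_cst.
  - exists [set a]; first exact: countable1.
    by move=> s /le_anti <- [].
  - move=> s s' as_ ss sb; have sa : s = a by apply/le_anti; rewrite as_ (le_trans ss).
    have s'a : s' = a by apply/le_anti; rewrite sb -sa ss.
    by rewrite sa s'a subrr ig_point.
move=> /andP[ab pb] H.
have [|k2 V2] := IH b0 pb; first by move=> k kb; have := H k.+1; rewrite ltnS => /(_ kb).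
have [x [y [Cx Cy cE]]] := H 0%N isT.
have V1 := velocity_piece Cx Cy cE.
exists (fun s => if s <= b0 then (derive1 x s +i* derive1 y s)%C else k2 s).
apply: velocity_glue => //; first exact: ltW.
have : path <=%R b0 b by apply: sub_path pb => u v; exact: ltW.
by move=> /(order_path_min le_trans)/allP ha; have := mem_last b0 b; rewrite inE => /orP[/eqP ->|/ha]; rewrite ?lexx.
Qed.

(** A mean value inequality without derivatives: the supremum of the points up to which the bound
    holds must be [b], because the local hypothesis carries the bound to that supremum and then past
    it. For constant [g] it says that a locally constant function is constant. *)
Lemma local_to_global (a b : R) (Phi : R -> C) (g : R -> R) : a <= b ->
  (forall r, a <= r <= b -> exists2 d, 0 < d & forall r', a <= r' <= b -> `|r' - r| < d ->
     nm (Phi r' - Phi r) <= `|g r' - g r|) ->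
  (forall r r', a <= r -> r <= r' -> r' <= b -> g r <= g r') ->
  nm (Phi b - Phi a) <= g b - g a.
Proof.
move=> ab H mg.
pose S := [set r | a <= r <= b /\ nm (Phi r - Phi a) <= g r - g a].
have Sa : S a by split; [rewrite lexx|rewrite !subrr nm0].
have hs : has_sup S by split; [exists a|exists b => r [/andP[]]].
pose s := sup S; have sab : a <= s <= b.
  apply/andP; split; first exact: ub_le_sup (proj2 hs) _ Sa.
  by apply: sup_le_ub => //; [exists a|move=> r [/andP[]]].
have [d d0 Hd] := H s sab; have [as_ sb] := andP sab.
have [r [/andP[ra rb] Sr] rs] := sup_adherent d0 hs; rewrite -/s in rs.
have rs' : r <= s by apply: ub_le_sup (proj2 hs) _ _; split=> //; rewrite ra.
have k1 : nm (Phi r - Phi s) <= g s - g r.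
  rewrite (le_trans (Hd r _ _)) ?ra//; first by rewrite distrC ger0_norm; lra.
  by rewrite distrC ger0_norm ?subr_ge0 ?mg.
have Ss : nm (Phi s - Phi a) <= g s - g a.
  rewrite nm_sub in k1; rewrite (le_trans (nm_tri _ (Phi r) _))//; lra.
have [bs|sb'] := leP b s; first by rewrite (_ : b = s)//; apply/le_anti; rewrite bs.
pose r' := Num.min b (s + d / 2).
have r'b : r' <= b by rewrite ge_min lexx.
have sr' : s < r' by rewrite lt_min sb'; lra.
have r'd : r' <= s + d / 2 by rewrite ge_min lexx orbT.
have : S r'.
  have ar' : a <= r' by lra.
  split; first by rewrite ar'.
  have := Hd r'; rewrite ar' r'b => /(_ isT); rewrite ger0_norm; last by lra.
  have mm : g s <= g r' by apply: mg => //; lra.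
  move=> h; have := h ltac:(lra); rewrite ger0_norm ?subr_ge0// => h2.
  by rewrite (le_trans (nm_tri _ (Phi s) _))//; lra.
by move=> /(ub_le_sup (proj2 hs)); rewrite -/s leNgt sr'.
Qed.

End Curves.

(** * Arcs and winding numbers of a contour *)

Section ContourGeometry.
Variable R : realType.
Local Notation C := R[i].
Variable Ct : contour R.
Hypothesis isC : is_contour Ct.
Local Notation T := (trace Ct).
Local Notation N := (ncurves Ct).
Local Notation gam := (curve_of (c := Ct)).
Variable kap : 'I_N -> R -> C.
Hypothesis vel : forall k, velocity 0 1 (gam k) (kap k).

Definition arc k a b f : C := ig a b (fun s => f (gam k s) * kap k s).

Lemma curve_closed k : gam k 0 = gam k 1.
Proof. by case: isC => /(_ k)[]. Qed.

Lemma trace_neq0 z : T z -> z != 0.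
Proof. by case: isC => _ _ + _; apply. Qed.

Lemma curve_trace k s : 0 <= s <= 1 -> T (gam k s).
Proof. by move=> s01; exists k, s. Qed.

Lemma curve_inj k k' s s' : 0 <= s <= 1 -> 0 <= s' <= 1 -> gam k s = gam k' s' ->
  k = k' /\ (s = s' \/ s \in [:: 0; 1] /\ s' \in [:: 0; 1]).
Proof.
move=> /andP[s0 s1] /andP[s'0 s'1] e; have [_ inj _ _] := isC.
move: s1 s'1; rewrite le_eqVlt => /predU1P[s1|s1]; rewrite le_eqVlt => /predU1P[s'1|s'1].
- have [|||kk _] := inj k k' 0 0; rewrite ?lexx ?ltr01//; first by rewrite !curve_closed -{1}s1 -s'1.
  by rewrite s1 s'1; split=> //; left.
- have [|||kk ss] := inj k k' 0 s'; rewrite ?lexx ?ltr01 ?s'0//; first by rewrite curve_closed -s1.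
  by split=> //; right; rewrite s1 -ss !inE !eqxx ?orbT.
- have [|||kk ss] := inj k k' s 0; rewrite ?lexx ?ltr01 ?s0//; first by rewrite curve_closed -s'1.
  by split=> //; right; rewrite s'1 ss !inE !eqxx ?orbT.
- have [|||kk ss] := inj k k' s s'; rewrite ?s0 ?s'0//.
  by split=> //; left.
Qed.

Lemma curve_cont k : contR 0 1 (gam k). Proof. exact: vel_cont (vel k). Qed.

Lemma curve_cont_sub k a b : 0 <= a -> b <= 1 -> contR a b (gam k).
Proof.
move=> a0 b1 s /andP[as_ sb] e e0.
have [|d d0 H] := curve_cont k (s := s) _ e0; first by rewrite (le_trans a0) ?(le_trans sb).
by exists d => // r /andP[ar rb]; apply: H; rewrite (le_trans a0) ?(le_trans rb).
Qed.

Lemma curve_countable k a b D : 0 <= a -> b <= 1 -> countable D ->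
  countable [set s | a <= s <= b /\ D (gam k s)].
Proof.
move=> a0 b1 /countable_injP[g gi].
apply: (@sub_countable _ _ _ ([set 1] `|` [set s | 0 <= s < 1 /\ D (gam k s)])).
  apply: subset_card_le => s [/andP[as_ sb] Ds].
  have := le_trans sb b1; rewrite le_eqVlt => /predU1P[->|s1]; [by left|right].
  by rewrite /= (le_trans a0 as_) s1.
apply: countable_setU; first exact: countable1.
apply/countable_injP; exists (g \o gam k) => s s'; rewrite !inE => -[s01 Ds] [s'01 Ds'] /gi.
rewrite !inE => /(_ Ds Ds') e; have [_ inj _ _] := isC.
by have [] := inj k k s s' s01 s'01 e.
Qed.

Lemma cyc_arc k a b : 0 <= a -> a <= b -> b <= 1 -> cyc (path_set a b (gam k)) (arc k a b).
Proof.
move=> a0 ab b1; apply: cyc_path => //.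
- exact: curve_cont_sub.
- exact: bm_sub (vel_bm (vel k)).
- by move=> D; exact: curve_countable.
Qed.

Lemma arc_set_trace k a b : 0 <= a -> b <= 1 -> path_set a b (gam k) `<=` T.
Proof.
move=> a0 b1 _ [s /andP[as_ sb] ->]; apply: curve_trace.
by rewrite (le_trans a0) ?(le_trans sb).
Qed.

Lemma arc_split k a b c f : contT T f -> 0 <= a -> a <= b -> b <= c -> c <= 1 ->
  arc k a c f = arc k a b f + arc k b c f.
Proof.
move=> fc a0 ab bc c1; apply: ig_split => //; apply: bmM; last exact: bm_sub (vel_bm (vel k)).
apply: contR_bm; apply: contT_path; first exact: curve_cont_sub.
by apply: sub_contT fc; exact: arc_set_trace.
Qed.

Let J := contour_integral Ct.

Lemma curve_integralE k f : contT T f -> curve_integral (gam k) f = arc k 0 1 f.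
Proof.
move=> fc; have [D cD H] := vel_derive (vel k).
apply: (eq_countable_ig (D := D)) => //; last by move=> s s01 nD; rewrite H.
apply: bmM (vel_bm (vel k)); apply: contR_bm; apply: contT_path; first exact: curve_cont.
by apply: sub_contT fc => z; exact: arc_set_trace.
Qed.

Lemma contour_integralE f : contT T f -> J f = \sum_k arc k 0 1 f.
Proof. by move=> fc; apply: eq_bigr => k _; exact: curve_integralE. Qed.

Let T_big : T = [set z | exists2 k, k \in index_enum 'I_N & path_set 0 1 (gam k) z].
Proof.
apply/seteqP; split=> z.
  by move=> [k [s [s01 ->]]]; exists k; rewrite ?mem_index_enum//; exists s.
by move=> [k _ [s s01 ->]]; exact: curve_trace.
Qed.

Lemma cyc_contour : cyc T J.
Proof.
have c : cyc T (fun f => \sum_k arc k 0 1 f).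
  by rewrite {1}T_big; apply: cyc_big => k _; exact: cyc_arc.
split.
- exact: cyc_compact c.
- move=> a f g fc gc; rewrite !contour_integralE//; first exact: (cyc_lin c).
  by apply: contT_D => //; exact: contT_Z.
- have [L L0 H] := cyc_bound c; exists L => // f B B0 fc fB.
  by rewrite contour_integralE// H.
- move=> f g fg; apply: eq_bigr => k _; apply: eq_ig => s s01.
  by rewrite fg//; exact: curve_trace.
- move=> f g D gc cD fg; apply: eq_bigr => k _; rewrite (curve_integralE _ gc).
  have [D' cD' H] := vel_derive (vel k).
  apply: (eq_countable_ig (D := D' `|` [set s | 0 <= s <= 1 /\ D (gam k s)])).
  + apply: bmM (vel_bm (vel k)); apply: contR_bm; apply: contT_path; first exact: curve_cont.
    by apply: sub_contT gc => z; exact: arc_set_trace.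
  + by apply: countable_setU => //; exact: curve_countable.
  + move=> s s01 nD; rewrite H ?fg//; [exact: curve_trace|by move=> Ds; apply: nD; right|].
    by move=> Ds; apply: nD; left.
Qed.

Lemma winding_arc a : winding Ct a = J (fun z => (z - a)^-1) / two_pi_i R.
Proof. by []. Qed.

Lemma winding_01 a : ~ T a -> winding Ct a = 1 \/ winding Ct a = 0.
Proof. by case: isC => _ _ _ /(_ a)[//|[_ ->]|[_ ->]] _; [left|right]. Qed.

Lemma insideP a : ~ T a -> inside Ct a \/ outside Ct a.
Proof. by case: isC => _ _ _ /(_ a)[//||]; [left|right]. Qed.

Lemma nm_two_pi_i : 2 <= nm (two_pi_i R).
Proof.
rewrite nmE /= expr0n add0r sqrtr_sqr ger0_norm; last by rewrite mulr_ge0// pi_ge0.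
by have := @pi_ge2 R; lra.
Qed.

Lemma int_close (x y : C) (m n : int) : x = m%:~R -> y = n%:~R -> nm (x - y) < 1 -> x = y.
Proof.
move=> -> ->; rewrite -rmorphB /= => h; apply/eqP; rewrite eqr_int.
apply/negPn/negP => mn; move: h; rewrite ltNge => /negP; apply.
have : (1 <= `|m - n|)%R by rewrite -gtz0_ge1 normr_gt0 subr_eq0.
have -> : ((m - n)%:~R : C) = ((m - n)%:~R : R)%:C%C by rewrite rmorph_int.
by rewrite nm_real -intr_norm -(ler_int R).
Qed.

Lemma winding_close a b : ~ T a -> ~ T b -> nm (winding Ct a - winding Ct b) < 1 ->
  winding Ct a = winding Ct b.
Proof.
move=> na nb; apply: (@int_close _ _ (winding Ct a == 1)%:Z (winding Ct b == 1)%:Z).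
  by case: (winding_01 na) => ->; rewrite ?eqxx// eq_sym oner_eq0.
by case: (winding_01 nb) => ->; rewrite ?eqxx// eq_sym oner_eq0.
Qed.

Lemma pole_as_div (F : (C -> C) -> C) a :
  F (fun z => (z - a)^-1) = F (fun z => 1 / (z - a)).
Proof. by congr F; apply/funext => z; rewrite mul1r. Qed.

Lemma winding_local a : ~ T a -> exists2 r, 0 < r &
  forall b, nm (b - a) < r -> ~ T b /\ winding Ct b = winding Ct a.
Proof.
move=> nTa; have [r r0 H] := cauchy_transform_cont cyc_contour (@contT_cst R T 1) nTa ltr01.
exists r => // b /H[nTb h]; split=> //; apply: winding_close => //.
rewrite !winding_arc !pole_as_div -mulrBl nmM nmV.
rewrite ltr_pdivrMr ?mul1r; last by have := nm_two_pi_i; lra.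
by have := nm_two_pi_i; lra.
Qed.

Lemma winding_far : exists B, forall a, B <= nm a -> outside Ct a.
Proof.
have [B B0 TB] := gcompact_bounded (cyc_compact cyc_contour).
have [L L0 HL] := cyc_bound cyc_contour.
exists (B + L + 1) => a Ba.
have nTa : ~ T a by move=> /TB; lra.
split=> //; rewrite -(_ : winding Ct a - 0 = winding Ct a) ?subr0//.
have : nm (winding Ct a) < 1.
  rewrite winding_arc nmM nmV ltr_pdivrMr ?mul1r; last by have := nm_two_pi_i; lra.
  apply: le_lt_trans (_ : L * (L + 1)^-1 < _).
    apply: HL; [by rewrite invr_ge0; lra|exact: contT_pole|].
    move=> z Tz; rewrite nmV lef_pV2 ?posrE; last 2 first.
    + by rewrite nm_gt0 subr_eq0; apply/eqP => za; apply: nTa; rewrite -za.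
    + by lra.
    by have := nm_subge a z; rewrite nm_sub; have := TB z Tz; lra.
  have : L / (L + 1) <= 1 by rewrite ler_pdivrMr; lra.
  by have := nm_two_pi_i; lra.
by case: (winding_01 nTa) => [->|//]; rewrite nm1 ltxx.
Qed.

(** The contour without the open arc between the parameters [a] and [b]. This compact set misses the
    points of that arc, so Cauchy integrals over it vary continuously across the arc. *)
Definition arc_rest k a b : set C :=
  [set z | exists2 l, l \in [seq l <- index_enum 'I_N | l != k] & path_set 0 1 (gam l) z] `|`
  (path_set 0 a (gam k) `|` path_set b 1 (gam k)).

Definition arc_restJ k a b f : C :=
  \sum_(l <- [seq l <- index_enum 'I_N | l != k]) arc l 0 1 f + (arc k 0 a f + arc k b 1 f).

Lemma cyc_arc_rest k a b : 0 <= a -> a <= b -> b <= 1 -> cyc (arc_rest k a b) (arc_restJ k a b).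
Proof.
move=> a0 ab b1; apply: cyc_add.
  by apply: cyc_big => l _; exact: cyc_arc.
by apply: cyc_add; apply: cyc_arc; rewrite ?lexx//; [exact: le_trans b1|exact: le_trans ab].
Qed.

Lemma arc_rest_split k a b f : contT T f -> 0 <= a -> a <= b -> b <= 1 ->
  J f = arc_restJ k a b f + arc k a b f.
Proof.
move=> fc a0 ab b1; rewrite contour_integralE// (bigD1 k)//= /arc_restJ big_filter.
rewrite (@arc_split k 0 a 1)// ?(le_trans ab)// (@arc_split k a b 1)//.
by rewrite addrC; set S := \sum_(_ | _) _; ring.
Qed.

Lemma arc_rest_sub k a b : 0 <= a -> a <= b -> b <= 1 -> arc_rest k a b `<=` T.
Proof.
move=> a0 ab b1 z [[l _]|[|]]; apply: arc_set_trace => //; rewrite ?lexx//.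
  exact: le_trans b1.
exact: le_trans ab.
Qed.

Lemma arc_rest_notin k a b s : 0 <= a -> a < s -> s < b -> b <= 1 -> ~ arc_rest k a b (gam k s).
Proof.
move=> a0 as_ sb b1.
have s0 : 0 < s := le_lt_trans a0 as_; have s1 : s < 1 := lt_le_trans sb b1.
have s01 : 0 <= s <= 1 by rewrite !ltW.
have nend : s \notin [:: 0; 1] by rewrite !inE !negb_or gt_eqF//= lt_eqF.
have key l s' : 0 <= s' <= 1 -> gam k s = gam l s' -> k = l /\ s = s'.
  by move=> s'01 e; have [kl [//|[]]] := curve_inj s01 s'01 e; rewrite (negbTE nend).
case=> [[l]|[|]].
- by rewrite mem_filter => /andP[lk _] [s' s'01 /key[//|kl _]]; rewrite kl eqxx in lk.
- move=> [s' /andP[s'0 s'a] /key[|_ ss]]; first by rewrite s'0; lra.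
  by rewrite -ss in s'a; lra.
- move=> [s' /andP[s'0 s'a] /key[|_ ss]]; first by rewrite s'a andbT; lra.
  by rewrite -ss in s'0; lra.
Qed.

Lemma arc_rest_trace k a b z : T z -> ~ arc_rest k a b z ->
  exists2 s, a < s < b & z = gam k s.
Proof.
move=> [l [s [s01 ->]]] nr; have [lk|lk] := eqVneq l k; last first.
  by exfalso; apply: nr; left; exists l; [rewrite mem_filter lk mem_index_enum|exists s].
subst l; exists s => //; case/andP: s01 => s0 s1.
rewrite !ltNge; apply/andP; split; apply/negP => h; apply: nr; right.
  by left; exists s; rewrite ?s0.
by right; exists s; rewrite ?s1 ?andbT.
Qed.

(** The integral along the curve is a primitive of [f] with respect to increments of the curve
    itself. This form can be compared across parametrizations that are merely continuous. *)
Lemma primitive_est k f s e : contT T f -> 0 <= s <= 1 -> 0 < e ->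
  exists2 d, 0 < d & forall a s', 0 <= a -> a <= s -> a <= s' -> s' <= 1 -> `|s' - s| < d ->
    nm (arc k a s' f - arc k a s f - f (gam k s) * (gam k s' - gam k s)) <= e * `|s' - s|.
Proof.
move=> fc s01 e0; have [_ _ [B0 HB]] := vel_bm (vel k).
pose B := `|B0| + 1; have B1 : 0 < B by rewrite ltr_wpDl.
have {}HB r : 0 <= r <= 1 -> nm (kap k r) <= B.
  by move=> /HB /le_trans; apply; rewrite (le_trans (ler_norm _))// lerDl.
have fg : contR 0 1 (f \o gam k).
  by apply: contT_path (curve_cont k) _; apply: sub_contT fc => z; exact: arc_set_trace.
have e4 : 0 < e / (4 * B) by rewrite divr_gt0// mulr_gt0.
have [d d0 Hd] := fg s s01 _ e4; exists d => // a s' a0 as_ as' s'1 ss.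
case/andP: s01 => s0 s1.
have bfk x y : 0 <= x -> y <= 1 -> bm x y (fun r => f (gam k r) * kap k r).
  move=> x0 y1; apply: bmM; last exact: bm_sub (vel_bm (vel k)).
  by apply: contR_bm => r /andP[xr ry] u u0; have [|dd dd0 H] := fg r _ u u0;
    [rewrite (le_trans x0)//= (le_trans ry)|exists dd => // r' /andP[xr' r'y]; apply: H;
     rewrite (le_trans x0)//= (le_trans r'y)].
have main x y : 0 <= x -> x <= y -> y <= 1 -> (forall r, x <= r <= y -> `|r - s| < d) ->
    nm (arc k x y f - f (gam k s) * (gam k y - gam k x)) <= e * (y - x).
  move=> x0 xy y1 near.
  have bk : bm x y (kap k) by exact: bm_sub (vel_bm (vel k)).
  rewrite -(vel_ftc (vel k) x0 xy y1) -igZ// -[X in _ + X]mulN1r -igZ; last exact: bmZ.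
  rewrite -igD; [|exact: bfk|exact/bmZ/bmZ].
  apply: le_trans (_ : 2 * (e / (4 * B) * B) * (y - x) <= _).
    apply: ig_bound => //.
      by apply: bmD; [exact: bfk|exact/bmZ/bmZ].
    move=> r rxy; have r01 : 0 <= r <= 1 by case/andP: rxy => h1 h2; rewrite (le_trans x0)//= (le_trans h2).
    rewrite mulN1r -mulrBl nmM ler_pM ?nm_ge0//; last exact: HB.
    by apply/ltW/Hd => //; exact: near.
  rewrite ler_wpM2r ?subr_ge0// (_ : 2 * _ = e / 2); last by field; lra.
  lra.
have [le1|le1] := leP s s'.
  rewrite (@arc_split k a s s')// [arc k a s f + _]addrC addrK ger0_norm ?subr_ge0//.
  apply: main => // r /andP[sr rs]; rewrite ger0_norm ?subr_ge0//.
  by move: ss; rewrite ger0_norm ?subr_ge0//; lra.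
rewrite (@arc_split k a s' s)// ?(ltW le1)// nm_sub.
rewrite (_ : _ - _ = arc k s' s f - f (gam k s) * (gam k s - gam k s')); last by ring.
rewrite distrC ger0_norm ?subr_ge0 ?(ltW le1)//; apply: main; rewrite ?(ltW le1)//.
  exact: le_trans as'.
move=> r /andP[sr rs]; rewrite distrC ger0_norm ?subr_ge0//.
by move: ss; rewrite distrC ger0_norm ?subr_ge0 ?(ltW le1)//; lra.
Qed.

End ContourGeometry.

(** * Contours invariant under inversion *)

Section ContourInversion.
Variable R : realType.
Local Notation C := R[i].
Variable Ct : contour R.
Hypothesis isC : is_contour Ct.
Local Notation T := (trace Ct).
Local Notation N := (ncurves Ct).
Local Notation gam := (curve_of (c := Ct)).
Variable kap : 'I_N -> R -> C.
Hypothesis vel : forall k, velocity 0 1 (gam k) (kap k).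
Hypothesis Tinv : forall z, T z -> T z^-1.
Local Notation arc := (arc kap).
Local Notation J := (contour_integral Ct).

Let T_neq0 z : T z -> z != 0 := @trace_neq0 _ _ isC z.
Let cJ : cyc T J := cyc_contour isC vel.

(** The pullback of the form f(z) dz under inversion. *)
Definition hinv (f : C -> C) (z : C) : C := f z^-1 * - (z ^+ 2)^-1.

Let kinv (z : C) : C := - (z ^+ 2)^-1.

Let contT_inv : contT T (fun z => z^-1).
Proof. by apply: contT_V => [z /T_neq0|]//; exact: contT_id. Qed.

Let contT_kinv : contT T kinv.
Proof.
apply: contT_N; apply: contT_V => [z /T_neq0 z0|]; first by rewrite expf_neq0.
by apply: contT_M; exact: contT_id.
Qed.

Lemma contT_hinv f : contT T f -> contT T (hinv f).
Proof.
move=> fc; apply: contT_M => //; move=> z Tz e e0.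
have [d d0 H] := fc _ (Tinv Tz) e e0; have [d' d'0 H'] := contT_inv Tz d0.
by exists d' => // w Tw wz; apply: H; [exact: Tinv|exact: H'].
Qed.

Lemma curve_inv_cont k : contR 0 1 (fun r => (gam k r)^-1).
Proof.
have := contT_path (curve_cont vel k) (f := fun z => z^-1); apply.
by apply: sub_contT contT_inv => z; exact: arc_set_trace.
Qed.

(** Invariance of the trace puts every [(gam k' r)^-1] on some curve. Near [s1] the curve is [gam k]
    and its parameter is continuous in [r]: by injectivity the trace without a short arc about a
    point stays at a positive distance from that point, so closeness in the plane implies closeness
    of parameters. *)
Lemma reparametrization k k' s0 s1 : 0 < s0 < 1 -> 0 < s1 < 1 -> gam k' s1 = (gam k s0)^-1 ->
  exists a b (tau : R -> R), [/\ 0 < a < s1, s1 < b < 1,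
    forall r, a <= r <= b -> 0 < tau r < 1 /\ gam k (tau r) = (gam k' r)^-1,
    contR a b (fun r => (tau r)%:C%C) & tau s1 = s0].
Proof.
move=> /andP[s00 s01] /andP[s10 s11] e01.
have iso s al be : 0 <= al -> al < s -> s < be -> be <= 1 -> exists2 d, 0 < d &
    forall z, T z -> nm (z - gam k s) < d -> exists2 s', al < s' < be & z = gam k s'.
  move=> a0 as_ sb b1; have c := cyc_arc_rest isC vel k a0 (ltW (lt_trans as_ sb)) b1.
  have [d d0 Hd] := gcompact_dist (cyc_compact c) (arc_rest_notin isC a0 as_ sb b1).
  exists d => // z Tz zd; apply: arc_rest_trace => // /Hd; lra.
have [||||d d0 Hd] := iso s0 (s0 / 2) ((s0 + 1) / 2); try lra.
have [|d' d'0 Hd'] := curve_inv_cont k' (s := s1) _ d0; first by rewrite !ltW.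
pose eps := Num.min (d' / 2) (Num.min (s1 / 2) ((1 - s1) / 2)).
have eps0 : 0 < eps by rewrite !lt_min !divr_gt0//= subr_gt0.
have [e1 e2 e3] : [/\ eps <= d' / 2, eps <= s1 / 2 & eps <= (1 - s1) / 2].
  by split; rewrite !ge_min lexx ?orbT.
have in01 r : s1 - eps <= r <= s1 + eps -> 0 <= r <= 1 by move=> /andP[? ?]; apply/andP; split; lra.
have ex r : exists s, s1 - eps <= r <= s1 + eps -> s0 / 2 < s < (s0 + 1) / 2 /\ (gam k' r)^-1 = gam k s.
  have [h|] := boolP (s1 - eps <= r <= s1 + eps); last by exists 0.
  have [||s ss sE] := Hd (gam k' r)^-1.
  - by apply: Tinv; apply: curve_trace; exact: in01.
  - rewrite (_ : gam k s0 = (gam k' s1)^-1); last by rewrite e01 invrK.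
    by apply: Hd'; [exact: in01|case/andP: h => ? ?; rewrite ltr_norml; lra].
  by exists s.
have /choice[tau Htau] := ex.
exists (s1 - eps), (s1 + eps), tau; split.
- by apply/andP; split; lra.
- by apply/andP; split; lra.
- move=> r /Htau[/andP[h1 h2] ->]; split=> //; apply/andP; split; lra.
- move=> r rab e e0; have [/andP[t1 t2] tE] := Htau r rab.
  pose e' := Num.min e (Num.min (tau r) (1 - tau r)).
  have e'0 : 0 < e' by rewrite !lt_min e0 /=; apply/andP; split; lra.
  have [h1 h2 h3] : [/\ e' <= e, e' <= tau r & e' <= 1 - tau r].
    by split; rewrite !ge_min lexx ?orbT.
  have [||||dd dd0 Hdd] := iso (tau r) (tau r - e') (tau r + e'); try lra.
  have [|d2 d20 H2] := curve_inv_cont k' (s := r) _ dd0; first exact: in01.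
  exists d2 => // r' r'ab rr.
  have [/andP[t1' t2'] tE'] := Htau r' r'ab.
  have [||s /andP[sa sb] sE] := Hdd (gam k' r')^-1.
  + by apply: Tinv; apply: curve_trace; exact: in01.
  + by rewrite -tE; apply: H2 => //; exact: in01.
  rewrite tE' in sE; have [||_ [ss|[]]] := curve_inj isC _ _ sE.
  + by apply/andP; split; lra.
  + by apply/andP; split; lra.
  + by rewrite real_complexB nm_real ss ltr_norml; apply/andP; split; lra.
  + by rewrite !inE => /orP[/eqP|/eqP]; lra.
- have s1ab : s1 - eps <= s1 <= s1 + eps by apply/andP; split; lra.
  have [/andP[t1 t2] tE] := Htau s1 s1ab.
  have e : gam k s0 = gam k (tau s1) by rewrite -tE e01 invrK.
  have [||_ [//|[]]] := curve_inj isC _ _ e; try by apply/andP; split; lra.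
  by rewrite !inE => /orP[/eqP|/eqP]; lra.
Qed.

Section Reparam.
Variables (k k' : 'I_N) (a b : R) (tau : R -> R) (sigma : R).
Hypothesis a0 : 0 < a.
Hypothesis ab : a <= b.
Hypothesis b1 : b < 1.
Hypothesis tauP : forall r, a <= r <= b -> 0 < tau r < 1 /\ gam k (tau r) = (gam k' r)^-1.
Hypothesis tau_cont : contR a b (fun r => (tau r)%:C%C).
Hypothesis sigma1 : `|sigma| = 1.
Hypothesis tau_mono : forall r r', a <= r -> r <= r' -> r' <= b -> sigma * tau r <= sigma * tau r'.

Let in01 r : a <= r <= b -> 0 <= r <= 1.
Proof. by have := a0; have := b1; move=> h1 h2 /andP[h3 h4]; apply/andP; split; lra. Qed.

Let tau01 r : a <= r <= b -> 0 <= tau r <= 1.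
Proof. by move=> /tauP[/andP[h1 h2] _]; rewrite !ltW. Qed.

Lemma arc_reparam_est f e : contT T f -> 0 < e ->
  forall r, a <= r <= b -> exists2 d, 0 < d & forall r', a <= r' <= b -> `|r' - r| < d ->
    nm ((arc k' a r' (hinv f) - arc k 0 (tau r') f) - (arc k' a r (hinv f) - arc k 0 (tau r) f))
    <= 2 * e * `|r' - r| + e * `|tau r' - tau r|.
Proof.
move=> fc e0 r rab; have fh := contT_hinv fc.
have [d1 d10 H1] := primitive_est vel k' fh (in01 rab) e0.
have [d2 d20 H2] := primitive_est vel k fc (tau01 rab) e0.
have [d3 d30 H3] := tau_cont rab d20.
have [_ _ [B0 HB]] := vel_bm (vel k').
set zi := (gam k' r)^-1.
pose L := 2 * (`|B0| + 1) * nm (f zi) * nm zi + 1.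
have L0 : 0 < L by rewrite ltr_wpDl// !mulr_ge0 ?nm_ge0// addr_ge0.
have [d4 d40 H4] := curve_inv_cont k' (s := r) (in01 rab) (divr_gt0 e0 L0).
exists (Num.min d1 (Num.min d3 d4)); first by rewrite !lt_min d10 d30.
move=> r' r'ab; rewrite !lt_min => /and3P[rr1 rr3 rr4].
have tt : `|tau r' - tau r| < d2 by have := H3 r' r'ab rr3; rewrite real_complexB nm_real.
have [_ tE] := tauP rab; have [_ tE'] := tauP r'ab.
have E2 := H2 0 (tau r') (lexx 0) (proj1 (andP (tau01 rab))) (proj1 (andP (tau01 r'ab)))
   (proj2 (andP (tau01 r'ab))) tt.
have [ar rb] := andP rab; have [ar' rb'] := andP r'ab.
have E1 := H1 a r' (ltW a0) ar ar' (le_trans rb' (ltW b1)) rr1.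
have g0 : gam k' r != 0 by apply: T_neq0; apply: curve_trace; exact: in01.
have g0' : gam k' r' != 0 by apply: T_neq0; apply: curve_trace; exact: in01.
rewrite tE tE' -/zi in E2.
have E3 : nm (hinv f (gam k' r) * (gam k' r' - gam k' r) - f zi * ((gam k' r')^-1 - zi)) <= e * `|r' - r|.
  have -> : hinv f (gam k' r) * (gam k' r' - gam k' r) - f zi * ((gam k' r')^-1 - zi) =
      f zi * zi * (gam k' r' - gam k' r) * ((gam k' r')^-1 - zi).
    by rewrite /hinv /zi; field; rewrite g0 g0'.
  have kb x y : 0 <= x -> x <= y -> y <= 1 -> nm (gam k' y - gam k' x) <= 2 * (`|B0| + 1) * (y - x).
    move=> x0 xy y1; rewrite -(vel_ftc (vel k') x0 xy y1); apply: ig_bound => //.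
      exact: bm_sub (vel_bm (vel k')).
    move=> s /andP[s1 s2]; rewrite (le_trans (HB s _)) ?(le_trans x0)//=; first exact: le_trans y1.
    by rewrite (le_trans (ler_norm _))// lerDl.
  have kL : nm (gam k' r' - gam k' r) <= 2 * (`|B0| + 1) * `|r' - r|.
    have [rr|rr] := leP r r'.
      by rewrite (ger0_norm (_ : 0 <= r' - r)) ?subr_ge0//; have := a0; have := b1; move=> ? ?; apply: kb; lra.
    rewrite (nm_sub (gam k' r')) (distrC r') (ger0_norm (_ : 0 <= r - r')); last by rewrite subr_ge0 ltW.
    by have := a0; have := b1; move=> ? ?; apply: kb; lra.
  have k4 : nm ((gam k' r')^-1 - zi) <= e / L by apply/ltW/H4 => //; exact: in01.
  have LE : nm (f zi) * nm zi * (2 * (`|B0| + 1)) = L - 1 by rewrite /L; ring.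
  rewrite !nmM; apply: (@le_trans _ _ (nm (f zi) * nm zi * (2 * (`|B0| + 1) * `|r' - r|) * (e / L))).
    by rewrite ler_pM ?mulr_ge0 ?nm_ge0// ler_wpM2l// mulr_ge0 ?nm_ge0.
  have -> : nm (f zi) * nm zi * (2 * (`|B0| + 1) * `|r' - r|) * (e / L) = e * `|r' - r| * ((L - 1) / L).
    by rewrite -LE; ring.
  by rewrite ler_piMr ?(mulr_ge0 (ltW e0))// ler_pdivrMr//; lra.
set X1 := nm _ in E1; set X2 := nm _ in E2; set X3 := nm _ in E3.
apply: (@le_trans _ _ (X1 + X2 + X3)); last by lra.
rewrite /X1 /X2 /X3 -(nmN (arc k 0 (tau r') f - _ - _)).
apply: le_trans (lerD (nmD _ _) (lexx _)); apply: le_trans (nmD _ _).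
by rewrite le_eqVlt; apply/predU1P; left; congr nm; ring.
Qed.

(** As [tau] is only continuous and monotone, no substitution rule applies. Instead, the difference
    [Phi] of the two integrals has increments bounded by those of [e * (2 * r + sigma * tau r)] for
    every positive [e], and [local_to_global] makes it constant. The sign [sigma] is the direction
    of [tau]. *)
Lemma arc_reparam f : contT T f ->
  arc k' a b (hinv f) = arc k 0 (tau b) f - arc k 0 (tau a) f.
Proof.
move=> fc; pose Phi r := arc k' a r (hinv f) - arc k 0 (tau r) f.
suff : nm (Phi b - Phi a) = 0.
  move=> /eqP; rewrite nm_eq0 subr_eq0 => /eqP; rewrite /Phi.
  have -> : arc k' a a (hinv f) = 0 by exact: ig_point.
  rewrite sub0r => /(congr1 (fun z => z + arc k 0 (tau b) f)); rewrite subrK => ->.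
  by rewrite addrC.
apply/eqP; rewrite nm_eq0; apply/eqP.
pose B := 2 * (b - a) + sigma * (tau b - tau a).
apply: (@nm_eq0_le _ _ B) => e e0.
have := @local_to_global R a b Phi (fun r => e * (2 * r + sigma * tau r)) ab.
have -> : e * (2 * b + sigma * tau b) - e * (2 * a + sigma * tau a) = B * e by rewrite /B; ring.
have tm r r' : a <= r -> r <= r' -> r' <= b -> sigma * tau r <= sigma * tau r' by exact: tau_mono.
apply.
- move=> r rab; have [d d0 H] := arc_reparam_est fc e0 rab; exists d => // r' r'ab rr.
  apply: le_trans (H r' r'ab rr) _.
  have key x y : a <= x -> x <= y -> y <= b ->
     2 * e * `|y - x| + e * `|tau y - tau x| <= `|e * (2 * y + sigma * tau y) - e * (2 * x + sigma * tau x)|.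
    move=> ax xy yb; have m := tm x y ax xy yb.
    have -> : `|tau y - tau x| = sigma * tau y - sigma * tau x.
      rewrite -[LHS]mul1r -sigma1 -normrM mulrBr ger0_norm// subr_ge0//.
    rewrite (ger0_norm (_ : 0 <= y - x)) ?subr_ge0//.
    have -> : e * (2 * y + sigma * tau y) - e * (2 * x + sigma * tau x) =
      2 * e * (y - x) + e * (sigma * tau y - sigma * tau x) by ring.
    exact: ler_norm.
  have [ar rb] := andP rab; have [ar' rb'] := andP r'ab.
  have [rr'|rr'] := leP r r'; first exact: key.
  by rewrite (distrC r') (distrC (tau r')) (distrC (e * _)); apply: key => //; exact: ltW.
- move=> r r' ar rr rb; rewrite ler_wpM2l ?(ltW e0)//; apply: lerD; last exact: tau_mono.
  by rewrite ler_wpM2l.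
Qed.

End Reparam.

Lemma curve_lipschitz : exists2 L, 0 < L & forall k s s', 0 <= s <= 1 -> 0 <= s' <= 1 ->
  nm (gam k s - gam k s') <= L * `|s - s'|.
Proof.
have /choice[B HB] : forall k, exists B, forall s, 0 <= s <= 1 -> nm (kap k s) <= B.
  by move=> k; have [_ _ ] := vel_bm (vel k).
exists (\sum_k 2 * `|B k| + 1); first by rewrite ltr_wpDl// sumr_ge0// => k _; rewrite mulr_ge0.
move=> k s s' s01 s'01; wlog ss : s s' s01 s'01 / s' <= s.
  move=> H; have [h|h] := leP s' s; first exact: H.
  by rewrite nm_sub distrC; apply: H => //; exact: ltW.
have [s'0 s'1] := andP s'01; have [s0 s1] := andP s01.
rewrite ger0_norm ?subr_ge0// -(vel_ftc (vel k) s'0 ss s1).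
apply: le_trans (_ : 2 * `|B k| * (s - s') <= _).
  apply: ig_bound => //; first exact: bm_sub (vel_bm (vel k)).
  move=> r /andP[r1 r2]; apply: le_trans (ler_norm _); apply: HB.
  by rewrite (le_trans s'0 r1) (le_trans r2 s1).
rewrite ler_wpM2r ?subr_ge0// (bigD1 k)//= -addrA lerDl addr_ge0// sumr_ge0// => l _; rewrite mulr_ge0//.
Qed.

Let nat_close (i j : nat) : `|i%:R - j%:R : R| < 1 -> i = j.
Proof.
rewrite ltr_norml => /andP[h1 h2]; have [ij|ij|//] := ltngtP i j.
  by exfalso; have : i%:R + 1 <= j%:R :> R by [rewrite natr1 ler_nat]; lra.
by exfalso; have : j%:R + 1 <= i%:R :> R by [rewrite natr1 ler_nat]; lra.
Qed.

(* A Lipschitz curve cannot visit all the points of a fine square grid. *)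
Lemma trace_nowhere_dense z (rho : R) : 0 < rho -> exists2 w, nm (w - z) < rho & ~ T w.
Proof.
move=> rho0; apply: contrapT => H.
have [L L0 HL] := curve_lipschitz.
pose A := N%:R * (2 * L / rho + 2) : R.
have A0 : 0 <= A by rewrite mulr_ge0// addr_ge0// divr_ge0// ?mulr_ge0// ltW.
pose M := (Num.truncn A).+1.
have MA : A < M%:R by have /andP[] := truncn_itv A0.
pose dl := rho / (2 * M%:R).
have M0 : 0 < M%:R :> R by rewrite ltr0n.
have dl0 : 0 < dl by rewrite divr_gt0// mulr_gt0.
have dlM : M%:R * dl = rho / 2 by rewrite /dl; field; lra.
pose m := (Num.truncn (L / dl)).+1.
have Ldl : 0 <= L / dl by rewrite divr_ge0// ltW.
have [m1 m2] : L / dl < m%:R /\ m%:R <= L / dl + 1.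
  by have /andP[h1 h2] := truncn_itv Ldl; split=> //; rewrite /m -natr1 lerD2r.
have m0 : 0 < m%:R :> R by rewrite ltr0n.
pose pt (e : 'I_M * 'I_M) : C := z + ((e.1%:R * dl) +i* (e.2%:R * dl))%C.
have ptT e : T (pt e).
  apply: contrapT => nT; apply: H; exists (pt e) => //.
  rewrite /pt addrC addKr; apply: le_lt_trans (nm_le _) _.
  have p (i : 'I_M) : 0 <= i%:R * dl by rewrite mulr_ge0 ?ler0n ?(ltW dl0).
  rewrite /= !ger0_norm ?p//.
  have h (i : 'I_M) : i%:R * dl < M%:R * dl by rewrite ltr_pM2r// ltr_nat.
  by have := h e.1; have := h e.2; lra.
have /choice[ks Hks] : forall e, exists ks : 'I_N * R, 0 <= ks.2 <= 1 /\ pt e = gam ks.1 ks.2.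
  by move=> e; have [k [s [s01 E]]] := ptT e; exists (k, s).
pose F e : 'I_N * 'I_m.+1 := ((ks e).1, inord (Num.truncn ((ks e).2 * m%:R))).
have Finj : injective F.
  move=> e e' [k12 /(congr1 val)/=].
  have tr d : (Num.truncn ((ks d).2 * m%:R) < m.+1)%N.
    have [/andP[s0 s1] _] := Hks d; rewrite ltnS -(ler_nat R).
    have p : 0 <= (ks d).2 * m%:R by rewrite mulr_ge0.
    have /andP[h _] := truncn_itv p; apply: le_trans h _.
    by rewrite ger_pMl.
  rewrite !inordK// => tt.
  have [s01 E] := Hks e; have [s01' E'] := Hks e'.
  have close : nm (pt e - pt e') < dl.
    rewrite E E' k12; apply: le_lt_trans (HL _ _ _ s01 s01') _.
    rewrite -ltr_pdivlMl// (lt_le_trans (_ : _ < m%:R^-1))//; last first.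
      have -> : L^-1 * dl = (L / dl)^-1 by rewrite invf_div mulrC.
      by rewrite lef_pV2 ?posrE; [exact: ltW m1|exact: m0|exact: divr_gt0].
    have p : 0 <= (ks e).2 * m%:R by rewrite mulr_ge0//; case/andP: s01.
    have p' : 0 <= (ks e').2 * m%:R by rewrite mulr_ge0//; case/andP: s01'.
    have /andP[h1 h2] := truncn_itv p; have /andP[h1' h2'] := truncn_itv p'.
    rewrite tt in h1 h2; rewrite -natr1 in h2 h2'.
    rewrite -(ltr_pM2r m0) mulVf ?gt_eqF// -(ger0_norm (ltW m0)) -normrM mulrBl ltr_norml.
    by apply/andP; split; lra.
  have coord (i j : 'I_M) : `|i%:R * dl - j%:R * dl| < dl -> i = j.
    rewrite -mulrBl normrM (ger0_norm (ltW dl0)) gtr_pMl// => h.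
    exact/val_inj/nat_close.
  have := le_lt_trans (nm_Re _) close; have := le_lt_trans (nm_Im _) close.
  rewrite /pt !(ReD, ImD, ReN, ImN) /= => h2 h1.
  have e1 : e.1 = e'.1 by apply: coord; apply: le_lt_trans h1; rewrite le_eqVlt; apply/predU1P; left; congr `|_|; ring.
  have e2 : e.2 = e'.2 by apply: coord; apply: le_lt_trans h2; rewrite le_eqVlt; apply/predU1P; left; congr `|_|; ring.
  by case: e e' e1 e2 {close h1 h2 E E' s01 s01' tt k12} => [? ?] [? ?] /= -> ->.
have := leq_card F Finj; rewrite !card_prod !card_ord leqNgt => /negP; apply.
rewrite -(ltr_nat R) !natrM -natr1.
apply: le_lt_trans (_ : N%:R * (L / dl + 2) < _).
  by rewrite ler_wpM2l//; lra.
have -> : L / dl = 2 * L / rho * M%:R by rewrite /dl; field; lra.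
apply: le_lt_trans (_ : A * M%:R < _); last by rewrite ltr_pM2r.
have -> : A * M%:R = N%:R * ((2 * L / rho + 2) * M%:R) by rewrite /A mulrA.
apply: ler_wpM2l => //; rewrite [leRHS]mulrDl lerD2l.
by rewrite ler_peMr// ler1n.
Qed.

Hypothesis in0 : inside Ct 0.

(** Off the trace this is -1, 0 or 1, and it is 0 when exactly one of [a] and [a^-1] is enclosed. *)
Definition inv_defect a : C := winding Ct a + winding Ct a^-1 - 1.

(** Partial fractions: the pullback of 1/(z - a) is 1/(z - 1/a) - 1/z, and the contour winds once
    around 0. *)
Lemma hinv_pole a : a != 0 -> ~ T a ->
  J (hinv (fun z => (z - a)^-1)) = two_pi_i R * (winding Ct a^-1 - 1).
Proof.
move=> a0 nTa; have nTa' : ~ T a^-1 by move=> /Tinv; rewrite invrK.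
have [nT0 w0] := in0.
transitivity (J (fun z => (z - a^-1)^-1 - (z - 0)^-1)).
  apply: (cyc_ext cJ) => z Tz; have z0 := T_neq0 Tz; rewrite /hinv subr0.
  have za : z - a^-1 != 0 by rewrite subr_eq0; apply/eqP => e; apply: nTa'; rewrite -e.
  have za' : a * z - 1 != 0 by rewrite -(mulfV a0) -mulrBr mulf_neq0.
  have za2 : z^-1 - a != 0 by rewrite subr_eq0; apply/eqP => e; apply: nTa; rewrite -e; exact: Tinv.
  have za3 : 1 - a * z != 0 by rewrite -oppr_eq0 opprB.
  have E1 : z^-1 - a = (1 - a * z) / z by field.
  have E2 : z - a^-1 = - (1 - a * z) / a by field.
  by rewrite E1 E2; field; rewrite ?z0 ?a0 ?za' ?za3.
rewrite (cycB cJ); [|exact: contT_pole..].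
rewrite /winding in w0 *; rewrite mulrBr mulr1 mulrC divfK ?two_pi_i_neq0//.
by congr (_ - _); rewrite -[LHS](divfK (two_pi_i_neq0 R)) w0 mul1r.
Qed.

Let w_int a : ~ T a -> exists2 m : int, (m = 0) \/ (m = 1) & winding Ct a = m%:~R.
Proof.
by move=> /(winding_01 isC)[->|->]; [exists 1; [right|]|exists 0; [left|]].
Qed.

Lemma arc_sign k a b f : contT T f -> 0 <= a <= 1 -> 0 <= b <= 1 ->
  arc k 0 b f - arc k 0 a f = if a <= b then arc k a b f else - arc k b a f.
Proof.
move=> fc /andP[a0 a1] /andP[b0 b1]; case: leP => ab.
  by rewrite (arc_split vel k fc (lexx 0) a0 ab b1); ring.
by rewrite (arc_split vel k fc (lexx 0) b0 (ltW ab) a1); ring.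
Qed.

(** The factor [1 + s] is even, while the left-hand side is -1, 0 or 1. *)
Let parity_arith (s x y y' : int) : s = 1 \/ s = -1 -> x = 0 \/ x = 1 -> y = 0 \/ y = 1 ->
  y' = 0 \/ y' = 1 -> y + y' - 1 = (1 + s) * (y - x) -> y + y' - 1 = 0.
Proof. by case=> ->; case=> ->; case=> ->; case=> ->. Qed.

(* Crossing the contour changes inv_defect by 0 or by 2: near a point of the
   trace the inverted contour runs along the contour itself, in the same or in
   the opposite direction. *)
Lemma inv_defect_parity k k' s0 s1 : 0 < s0 < 1 -> 0 < s1 < 1 -> gam k' s1 = (gam k s0)^-1 ->
  exists2 rho, 0 < rho & forall x y, nm (x - gam k s0) < rho -> nm (y - gam k s0) < rho ->
    x != 0 -> y != 0 -> ~ T x -> ~ T y -> inv_defect x = 0 -> inv_defect y = 0.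
Proof.
move=> h0 h1 e01; have [a [b [tau [/andP[a0 as1] /andP[s1b b1] tP tc ts]]]] := reparametrization h0 h1 e01.
set z0 := gam k s0.
have ab : a <= b by rewrite ltW// (lt_trans as1).
have tinj r r' : a <= r <= b -> a <= r' <= b -> tau r = tau r' -> r = r'.
  move=> rab r'ab e; have [_ E] := tP r rab; have [_ E'] := tP r' r'ab.
  have : gam k' r = gam k' r' by apply: invr_inj; rewrite -E -E' e.
  have [ar rb] := andP rab; have [ar' rb'] := andP r'ab.
  move=> /(curve_inj isC)[||_ [//|[]]]; try by apply/andP; split; lra.
  by rewrite !inE => /orP[/eqP|/eqP]; lra.
have mc : {within [set` `[a, b]], continuous tau}.
  by apply: (contR_within (h := fun z : C => Re z)) tc; exact: Re_lip.
have mi : {in `[a, b] &, injective tau} by move=> r r'; rewrite !in_itv/=; exact: tinj.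
have := itv_continuous_inj_mono mc mi.
have sab : a <= s1 <= b by rewrite !ltW.
have [aab bab] : a <= a <= b /\ a <= b <= b by rewrite !lexx ab.
have [ta1 ta2] := andP (proj1 (tP a aab)); have [tb1 tb2] := andP (proj1 (tP b bab)).
have t01 r : a <= r <= b -> 0 <= tau r <= 1 by move=> /tP[/andP[? ?] _]; rewrite !ltW.
move=> mono.
pose al := Num.min (tau a) (tau b); pose be := Num.max (tau a) (tau b).
have [sg_ [sgE albe sgarc]] : exists sg_ : int, [/\ sg_ = 1 \/ sg_ = -1, al < s0 < be &
    forall f, contT T f -> arc k' a b (hinv f) = sg_%:~R * arc k al be f].
  rewrite -ts; case: mono => mono.
    have t1 : tau a < tau s1 by apply: mono; rewrite ?in_itv/= ?lexx ?ab//.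
    have t2 : tau s1 < tau b by apply: mono; rewrite ?in_itv/= ?lexx ?ab//.
    exists 1; rewrite /al /be; have tab : tau a <= tau b by rewrite ltW// (lt_trans t1).
    rewrite min_l// max_r// t1 t2; split=> //; [by left|move=> f fc].
    rewrite (@arc_reparam k k' a b tau 1)//; try exact: normr1.
      by rewrite arc_sign ?t01// tab mul1r.
    move=> r r' ar rr rb; rewrite !mul1r; move: rr; rewrite le_eqVlt => /predU1P[->//|rr].
    by apply/ltW/mono => //; rewrite in_itv/= ?ar ?rb ?andbT/= ?(le_trans ar (ltW rr))// ?(le_trans (ltW rr)).
  have t1 : tau s1 < tau a by apply: mono; rewrite ?in_itv/= ?lexx ?ab//.
  have t2 : tau b < tau s1 by apply: mono; rewrite ?in_itv/= ?lexx ?ab//.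
  exists (-1); rewrite /al /be; have tab : tau b < tau a by rewrite (lt_trans t2).
  rewrite min_r ?ltW// max_l ?ltW// t1 t2; split=> //; [by right|move=> f fc].
  rewrite (@arc_reparam k k' a b tau (-1))//; try exact: normrN1.
    by rewrite arc_sign ?t01// leNgt tab /= mulN1r.
  move=> r r' ar rr rb; rewrite !mulN1r lerN2; move: rr; rewrite le_eqVlt => /predU1P[->//|rr].
  by apply/ltW/mono => //; rewrite in_itv/= ?ar ?rb ?andbT/= ?(le_trans ar (ltW rr))// ?(le_trans (ltW rr)).
have [al0 be1] : 0 <= al /\ be <= 1 by rewrite /al /be le_min ge_max !ltW.
have [als sbe] := andP albe; have albe' : al <= be by rewrite ltW// (lt_trans als).
have c1 := cyc_arc_rest isC vel k al0 albe' be1.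
have c2 := cyc_arc_rest isC vel k' (ltW a0) ab (ltW b1).
have sub2 := @arc_rest_sub _ Ct k' a b (ltW a0) ab (ltW b1).
have c2' : cyc ((fun z => z^-1) @` arc_rest k' a b) (fun f => arc_restJ kap k' a b (hinv f)).
  apply: cyc_map c2 _ _ _; [exact: sub_contT contT_inv|exact: sub_contT contT_kinv|].
  by move=> z w _ _; exact: invr_inj.
have n1 : ~ arc_rest k al be z0 by exact: arc_rest_notin.
have n2 : ~ ((fun z => z^-1) @` arc_rest k' a b) z0.
  move=> [w rw wz]; have := arc_rest_notin isC (k := k') (ltW a0) as1 s1b (ltW b1).
  by apply; rewrite e01 -/z0 -wz invrK.
have e4 : 0 < 1 / 4 :> R by lra.
have [r1 r10 H1] := cauchy_transform_cont c1 (@contT_cst R _ 1) n1 e4.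
have [r2 r20 H2] := cauchy_transform_cont c2' (@contT_cst R _ 1) n2 e4.
exists (Num.min r1 r2); first by rewrite lt_min r10.
move=> x y; rewrite !lt_min => /andP[x1 x2] /andP[y1 y2] x0 y0 nTx nTy dx.
pose P1 u := arc_restJ kap k al be (fun z => (z - u)^-1).
pose P2 u := arc_restJ kap k' a b (hinv (fun z => (z - u)^-1)).
(* The arc through [z0] and the inverted arc are split off. Together they account for [1 + sg_]
   times the winding number, while the remainders [P1] and [P2] are continuous across [z0]; so the
   change of the defect is within 1 of an even integer. *)
have key u : u != 0 -> ~ T u ->
    two_pi_i R * inv_defect u = (1 + sg_%:~R) * (two_pi_i R * winding Ct u) - sg_%:~R * P1 u + P2 u.
  move=> u0 nTu.
  have fc : contT T (fun z => (z - u)^-1) := contT_pole nTu.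
  have E1 := arc_rest_split vel k fc al0 albe' be1.
  have E2 := arc_rest_split vel k' (contT_hinv fc) (ltW a0) ab (ltW b1).
  have wE : two_pi_i R * winding Ct u = J (fun z => (z - u)^-1).
    by rewrite /winding mulrC divfK ?two_pi_i_neq0.
  rewrite hinv_pole// sgarc// in E2.
  have -> : two_pi_i R * inv_defect u = two_pi_i R * winding Ct u + two_pi_i R * (winding Ct u^-1 - 1).
    by rewrite /inv_defect; ring.
  rewrite E2 wE E1 /P1 /P2; set A := arc _ _ _ _; set B := arc_restJ _ _ _ _ _; set D := arc_restJ _ _ _ _ _.
  by case: sgE => ->; rewrite ?mulN1r; [ring|rewrite mulrN1z; ring].
have oneP (F : (C -> C) -> C) u : F (fun z => 1 / (z - u)) = F (fun z => (z - u)^-1).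
  by rewrite (pole_as_div F).
have P1xy : nm (P1 x - P1 y) < 1 / 2.
  have [_ hx] := H1 x x1; have [_ hy] := H1 y y1; rewrite !oneP in hx hy.
  by rewrite (le_lt_trans (nm_tri _ (P1 z0) _))//; rewrite nm_sub in hy; rewrite /P1; lra.
have P2xy : nm (P2 x - P2 y) < 1 / 2.
  have [_ hx] := H2 x x2; have [_ hy] := H2 y y2.
  rewrite !(oneP (fun f => arc_restJ kap k' a b (hinv f))) in hx hy.
  by rewrite (le_lt_trans (nm_tri _ (P2 z0) _))//; rewrite nm_sub in hy; rewrite /P2; lra.
have [mx mx01 wx] := w_int nTx; have [my my01 wy] := w_int nTy.
have [mx' mx'01 wx'] : exists2 m : int, (m = 0) \/ (m = 1) & winding Ct x^-1 = m%:~R.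
  by apply: w_int => /Tinv; rewrite invrK.
have [my' my'01 wy'] : exists2 m : int, (m = 0) \/ (m = 1) & winding Ct y^-1 = m%:~R.
  by apply: w_int => /Tinv; rewrite invrK.
have := key x x0 nTx; rewrite dx mulr0 => kx; have ky := key y y0 nTy.
have E : two_pi_i R * (inv_defect y - (1 + sg_%:~R) * (winding Ct y - winding Ct x)) =
    sg_%:~R * (P1 x - P1 y) - (P2 x - P2 y).
  transitivity (two_pi_i R * inv_defect y - (1 + sg_%:~R) * (two_pi_i R * winding Ct y) +
     (1 + sg_%:~R) * (two_pi_i R * winding Ct x)); first by ring.
  rewrite ky; transitivity (((1 + sg_%:~R) * (two_pi_i R * winding Ct x) - sg_%:~R * P1 x + P2 x)
    + (sg_%:~R * (P1 x - P1 y) - (P2 x - P2 y))); first by ring.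
  by rewrite -kx add0r.
have small : nm (inv_defect y - (1 + sg_%:~R) * (winding Ct y - winding Ct x)) < 1.
  rewrite -(ltr_pM2l (_ : 0 < nm (two_pi_i R))); last by have := nm_two_pi_i R; lra.
  rewrite -nmM E mulr1.
  have s1' : nm (sg_%:~R * (P1 x - P1 y)) = nm (P1 x - P1 y).
    by case: sgE => ->; rewrite ?mul1r// mulrN1z mulN1r nmN.
  by have := nmB (sg_%:~R * (P1 x - P1 y)) (P2 x - P2 y); have := nm_two_pi_i R; lra.
have := @int_close R (inv_defect y) ((1 + sg_%:~R) * (winding Ct y - winding Ct x))
  (my + my' - 1) ((1 + sg_) * (my - mx)).
rewrite /inv_defect wy wy' wx => /(_ _ _ _).
have Ey : my%:~R + my'%:~R - 1 = (my + my' - 1)%:~R :> C by rewrite !rmorphB !rmorphD.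
have Exy : (1 + sg_%:~R) * (my%:~R - mx%:~R) = ((1 + sg_) * (my - mx))%:~R :> C.
  by rewrite rmorphM !rmorphB !rmorphD.
have sm : nm (my%:~R + my'%:~R - 1 - (1 + sg_%:~R) * (my%:~R - mx%:~R) : C) < 1.
  by move: small; rewrite /inv_defect wy wy' wx.
move=> /(_ Ey Exy sm); rewrite Ey Exy => /eqP; rewrite eqr_int => /eqP e.
suff : my + my' - 1 = 0 by move=> ->.
exact: parity_arith sgE mx01 my01 my'01 e.
Qed.

Lemma inv_defect_local z : z != 0 ->
  (forall k, z <> gam k 0) -> (forall k, z <> (gam k 0)^-1) ->
  exists2 rho, 0 < rho & forall x y, nm (x - z) < rho -> nm (y - z) < rho ->
    x != 0 -> y != 0 -> ~ T x -> ~ T y -> inv_defect x = 0 -> inv_defect y = 0.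
Proof.
move=> z0 zk zk'; have [Tz|nTz] := pselect (T z).
  have [k [s [s01 zE]]] := Tz; have [k' [s' [s'01 zE']]] := Tinv Tz.
  have open01 l r : 0 <= r <= 1 -> gam l r <> gam l 0 -> 0 < r < 1.
    move=> /andP[r0 r1] ne; rewrite !lt_neqAle r0 r1 !andbT; apply/andP; split; apply/eqP => e.
      by apply: ne; rewrite -e.
    by apply: ne; rewrite e (curve_closed isC).
  rewrite zE in z0 *; apply: (@inv_defect_parity k k' s s').
  - by apply: (open01 k) => //; rewrite -zE; exact: zk.
  - by apply: (open01 k') => // e; apply: (zk' k'); rewrite -e -zE' invrK.
  - by rewrite -zE' zE.
have nTz' : ~ T z^-1 by move=> /Tinv; rewrite invrK.
have [r1 r10 H1] := winding_local isC vel nTz; have [r2 r20 H2] := winding_local isC vel nTz'.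
have cV : cdiff (fun w : C => w^-1) z by exact: cdiff_inv.
have [r3 r30 H3] := cdiff_cont cV r20.
exists (Num.min r1 r3); first by rewrite lt_min r10.
move=> x y; rewrite !lt_min => /andP[x1 x3] /andP[y1 y3] _ _ _ _.
rewrite /inv_defect (H1 x x1).2 (H1 y y1).2.
have k3 := H3 x x3; have k4 := H3 y y3.
by rewrite (H2 _ k3).2 (H2 _ k4).2.
Qed.

(** On the trace the defect means nothing, so its vanishing is followed along a path in the form of
    vanishing at all nearby points off the trace. Such points exist since the trace is nowhere
    dense. *)
Let zero_near z : Prop := exists2 rho, 0 < rho &
  forall x, nm (x - z) < rho -> x != 0 -> ~ T x -> inv_defect x = 0.

Let dense z (rho : R) : 0 < rho -> exists x, [/\ nm (x - z) < rho, x != 0 & ~ T x].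
Proof.
move=> rho0; have rho4 : 0 < rho / 4 by rewrite divr_gt0.
pose z' := if nm z < rho / 4 then z + (rho / 2)%:C%C else z.
have [w wz nTw] := trace_nowhere_dense z' rho4; exists w; split=> //.
  have zz : nm (z' - z) <= rho / 2.
    rewrite /z'; case: ifP => _; last by rewrite subrr nm0; lra.
    by rewrite addrC addKr nm_real gtr0_norm ?divr_gt0.
  by have := nm_tri w z' z; lra.
apply/eqP => w0; move: wz; rewrite w0 nm_sub subr0 /z'.
case: (ltP (nm z) (rho / 4)) => zr h; last by move: h; rewrite ltNge zr.
have := nm_addge ((rho / 2)%:C%C) z; rewrite nm_real gtr0_norm ?divr_gt0//.
by move: h; rewrite [z + _]addrC; lra.
Qed.

Lemma zero_near_local z : z != 0 ->
  (forall k, z <> gam k 0) -> (forall k, z <> (gam k 0)^-1) ->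
  exists2 rho, 0 < rho & forall z', nm (z' - z) < rho -> zero_near z' <-> zero_near z.
Proof.
move=> z0 h1 h2; have [rho rho0 H] := inv_defect_local z0 h1 h2.
have r2 : 0 < rho / 2 by rewrite divr_gt0.
have all x : nm (x - z) < rho -> x != 0 -> ~ T x -> inv_defect x = 0 ->
    forall y, nm (y - z) < rho -> y != 0 -> ~ T y -> inv_defect y = 0.
  by move=> xz x0 nTx dx y yz y0 nTy; exact: H dx.
exists (rho / 2) => // z' zz; split=> -[r r0 Hr].
  have [|x [xz x0 nTx]] := dense z' (rho := Num.min r (rho / 2)); first by rewrite lt_min r0.
  rewrite lt_min in xz; case/andP: xz => xr xr2.
  exists rho => // y yz y0 nTy; apply: (all x) => //; last exact: Hr.
  by have := nm_tri x z' z; lra.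
have [|x [xz x0 nTx]] := dense z (rho := Num.min r rho); first by rewrite lt_min r0.
rewrite lt_min in xz; case/andP: xz => xr xr2.
exists (rho / 2) => // y yz y0 nTy; apply: (all x) => //; first exact: Hr.
by have := nm_tri y z' z; lra.
Qed.

(** Far away the defect is 0, because large points are outside and their inverses are close to 0,
    which is inside. This value is carried back to [a] along a ray that avoids 0, the base points of
    the curves and their inverses, where [inv_defect_local] says nothing. *)
Lemma inv_defect0 a : a != 0 -> ~ T a -> inv_defect a = 0.
Proof.
move=> a0 nTa.
pose P : seq C := 0 :: [seq gam k 0 | k <- enum 'I_N] ++ [seq (gam k 0)^-1 | k <- enum 'I_N].
have TP k : T (gam k 0) by apply: curve_trace; rewrite lexx ler01.
have aP : a \notin P.
  rewrite inE negb_or a0 mem_cat negb_or /=; apply/andP; split; apply/mapP => -[k _ e]; apply: nTa; rewrite e//.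
  exact: Tinv.
(* Larger than every slope from [a] to a point of the finite set [P]. A vertical slope is read as 0,
   which is harmless because the ray moves to the right. *)
pose m := (Num.truncn (\sum_(x <- P) `|Im (x - a) / Re (x - a)|)).+1.
pose ray (r : R) : C := a + (r +i* (r * m%:R))%C.
have rayP r : 0 <= r -> ray r \notin P.
  move=> r0; have [->|rn0] := eqVneq r 0.
    by rewrite /ray mul0r (_ : (0 +i* 0)%C = 0 :> C) ?addr0.
  apply/negP => rP.
  have sum0 : 0 <= \sum_(x <- P) `|Im (x - a) / Re (x - a)| by exact: sumr_ge0.
  have /andP[_] := truncn_itv sum0; rewrite -/m ltNge => /negP; apply.
  rewrite (big_rem _ rP)/= -[m%:R]addr0 lerD//; last exact: sumr_ge0.
  by rewrite /ray [a + _]addrC addrK /= mulrAC divff// mul1r normr_nat.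
have far : exists2 b, 0 <= b & zero_near (ray b).
  have [B HB] := winding_far isC vel; have [nT0 w0] := in0.
  have [r r0 Hr] := winding_local isC vel nT0.
  pose b := Num.max 0 (nm a + Num.max B (r^-1 + 1) + 1).
  exists b; first by rewrite le_max lexx.
  exists 1 => // x xb x0 nTx.
  have bb : nm a + Num.max B (r^-1 + 1) + 1 <= b by rewrite le_max lexx orbT.
  have rb : b <= nm (ray b - a).
    rewrite /ray addrC addKr; apply: le_trans (nm_Re _); exact: ler_norm.
  have xn : Num.max B (r^-1 + 1) <= nm x.
    have := nm_tri (ray b) x a; rewrite (nm_sub (ray b) x); have := nmB x a; lra.
  move: xn; rewrite ge_max => /andP[xB xr].
  have [_ wx] := HB x xB.
  have wx' : winding Ct x^-1 = 1.
    rewrite (Hr _ _).2 ?w0// subr0 nmV -[ltRHS]invrK ltf_pV2 ?posrE ?invr_gt0//.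
      by have : 0 < r^-1 by [rewrite invr_gt0]; lra.
    by rewrite nm_gt0.
  by rewrite /inv_defect wx wx' add0r subrr.
have [b b0 Zb] := far.
pose Phi (r : R) : C := (`[< zero_near (ray r) >])%:R.
have E : nm (Phi b - Phi 0) <= 0 - 0.
  apply: (@local_to_global R 0 b Phi (fun=> 0) b0) => // r /andP[r0 rb].
  have nP := rayP r r0.
  have [||| rho rho0 H] := @zero_near_local (ray r).
  - by move: nP; rewrite inE negb_or => /andP[].
  - move=> k e; move: nP; rewrite inE mem_cat negb_or negb_or => /and3P[_ /negP + _]; apply.
    by apply/mapP; exists k; rewrite ?mem_enum.
  - move=> k e; move: nP; rewrite inE mem_cat negb_or negb_or => /and3P[_ _ /negP]; apply.
    by apply/mapP; exists k; rewrite ?mem_enum.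
  have m1 : 0 < 1 + m%:R :> R by rewrite ltr_pwDl.
  exists (rho / (1 + m%:R)); first by rewrite divr_gt0.
  move=> r' _ rr; rewrite subrr normr0 /Phi.
  suff -> : `[< zero_near (ray r') >] = `[< zero_near (ray r) >] by rewrite subrr nm0.
  apply: asbool_equiv_eq; apply: H.
  have -> : ray r' - ray r = ((r' - r) +i* ((r' - r) * m%:R))%C.
    by apply: ceqP; rewrite /ray !(ReD, ImD, ReN, ImN) /=; ring.
  apply: le_lt_trans (nm_le _) _; rewrite /= normrM normr_nat.
  by move: rr; rewrite ltr_pdivlMr// mulrDr mulr1.
have : Phi 0 = 1.
  have Pb : Phi b = 1 by rewrite /Phi asboolT.
  have := nm_ge0 (Phi b - Phi 0); rewrite Pb in E *; rewrite subrr in E => E0.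
  by apply/eqP; rewrite eq_sym -subr_eq0 -nm_eq0 eq_le E E0.
rewrite /Phi /ray mul0r (_ : (0 +i* 0)%C = 0 :> C)// addr0.
case: asboolP => [[rho rho0 H] _|_ /eqP]; last by rewrite eq_sym oner_eq0.
by apply: H => //; rewrite subrr nm0.
Qed.

End ContourInversion.

(** * From contours to regions, and an explicit symmetric region *)

Section StarRegion.
Variable R : realType.
Local Notation C := R[i].

(** The clauses [rg_div] and [rg_inv] express that the contour encloses exactly one of a point and
    its inverse. That 0 is inside follows by multiplying an inside point by a sufficiently small
    element of [M] and using local constancy of the winding number. *)
Lemma contour_region (Ct : contour R) (M Sin Sout : set C) : is_contour Ct ->
  (forall z, trace Ct z -> trace Ct z^-1) ->
  (forall m z, M m -> trace Ct z \/ inside Ct z -> inside Ct (m * z)) ->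
  (forall m, M m -> m != 0) ->
  (forall e : R, 0 < e -> exists2 m, M m & nm m < e) -> (exists z, inside Ct z) ->
  Sin `<=` inside Ct -> Sout `<=` outside Ct ->
  region M Sin Sout 1 (trace Ct `|` inside Ct) (inside Ct).
Proof.
move=> isC Tinv Min M0 Msmall [z1 z1in] Sin_in Sout_out.
have /choice[kap vel] : forall k, exists kap, velocity 0 1 (curve_of (c := Ct) k) kap.
  by move=> k; apply: piecewise_velocity; case: isC => /(_ k)[].
have wl := winding_local isC vel; have [B HB] := winding_far isC vel.
have w01 a : inside Ct a -> outside Ct a -> False.
  by move=> [_ w1] [_]; rewrite w1 => /eqP; rewrite oner_eq0.
have in0 : inside Ct 0.
  have nT0 : ~ trace Ct 0 by move=> /(trace_neq0 isC); rewrite eqxx.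
  split=> //; have [r r0 Hr] := wl 0 nT0.
  have z1p : 0 < nm z1 + 1 by rewrite ltr_wpDl ?nm_ge0.
  have [m Mm mr] := Msmall _ (divr_gt0 r0 z1p).
  have [_ <-] := Min m z1 Mm (or_intror z1in); apply/esym; apply: (Hr _ _).2.
  rewrite subr0 nmM; rewrite ltr_pdivlMr// in mr; apply: le_lt_trans mr.
  by rewrite ler_wpM2l ?nm_ge0// lerDl.
have def := inv_defect0 isC vel Tinv in0.
have inv_out a : a != 0 -> ~ trace Ct a -> (inside Ct a <-> outside Ct a^-1).
  move=> a0 nTa; have nTa' : ~ trace Ct a^-1 by move=> /Tinv; rewrite invrK.
  have := def a a0 nTa; rewrite /inv_defect => e; split=> -[_ w]; split=> //.
    by move: e; rewrite w addrC addKr.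
  by move: e; rewrite w addr0 => /eqP; rewrite subr_eq0 => /eqP.
have inK a : a != 0 -> ~ inside Ct a -> trace Ct a^-1 \/ inside Ct a^-1.
  move=> a0 na; have [Ta|nTa] := pselect (trace Ct a); first by left; exact: Tinv.
  right; have nTa' : ~ trace Ct a^-1 by move=> /Tinv; rewrite invrK.
  by apply/(inv_out _ _ nTa'); rewrite ?invr_eq0// invrK; case: (insideP isC nTa).
split.
- exists B => z Kz; rewrite ltNge; apply/negP => /HB oz.
  by case: Kz => [Tz|Iz]; [case: oz|exact: w01 Iz oz].
- move=> z /not_orP[nTz nIz]; have [r r0 Hr] := wl z nTz; exists r => // w /Hr[nTw ww].
  by move=> [//|[_]]; rewrite ww => w1; apply: nIz.
- by move=> z [nTz wz]; have [r r0 Hr] := wl z nTz; exists r => // w /Hr[nTw ww]; split; rewrite // ww.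
- by move=> z; right.
- exact: in0.
- by move=> m z Mm; exact: Min.
- move=> m z Mm nz; have z0 : z != 0 by apply/eqP => z0; apply: nz; rewrite z0.
  exact/Min/inK.
- move=> m z y Mm Kz Ky; rewrite mul1r => e.
  have Imz := Min m z Mm Kz; have [nT _] := Imz.
  have mz0 : m * z != 0 by apply/eqP => e0; move/eqP: e; rewrite e0 mul0r eq_sym oner_eq0.
  have yE : y = (m * z)^-1 by rewrite -[RHS]mulr1 -e mulKf.
  have := (inv_out _ mz0 nT).1 Imz; rewrite -yE => oy.
  by case: Ky => [Ty|Iy]; [case: oy|exact: w01 Iy oy].
- exact: Sin_in.
- by move=> s /Sout_out os [Ts|Is]; [case: os|exact: w01 Is os].
Qed.

Lemma contour_adapted (Ct : contour R) (eta : R) : is_contour Ct -> 0 < eta ->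
  adapted (trace Ct `|` inside Ct) (inside Ct) eta (trace Ct) (contour_integral Ct).
Proof.
move=> isC eta0.
have /choice[kap vel] : forall k, exists kap, velocity 0 1 (curve_of (c := Ct) k) kap.
  by move=> k; apply: piecewise_velocity; case: isC => /(_ k)[].
have cJ := cyc_contour isC vel.
split; first exact: cJ.
- move=> a /(inball_in eta0)[nTa wa]; split=> //.
  by rewrite -[LHS](divfK (two_pi_i_neq0 R)) -[_ / _]/(winding Ct a) wa mul1r.
- move=> a na; have nTa : ~ trace Ct a by move=> Ta; apply: na; apply: in_near => //; left.
  split=> //; rewrite -[LHS](divfK (two_pi_i_neq0 R)) -[_ / _]/(winding Ct a).
  case: (insideP isC nTa) => [Ia|[_ ->]]; last by rewrite mul0r.
  by case: na; apply: in_near => //; right.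
Qed.

Lemma torus_integralE (Ct : contour R) n (Phi : 'rV[C]_n -> C) :
  torus_integral Ct Phi = mint (fun=> wfun (contour_integral Ct)) Phi.
Proof.
elim: n Phi => [//|n IH] Phi /=; rewrite /wfun; congr contour_integral.
by apply/funext => z; rewrite IH.
Qed.

Lemma pow_small (rho B e : R) : 0 <= rho < 1 -> 0 <= B -> 0 < e ->
  exists N, forall n, (N <= n)%N -> B * rho ^+ n < e.
Proof.
move=> /andP[r0 r1] B0 e0.
have /cvgrPdist_lt H : (fun n => rho ^+ n) @ \oo --> (0 : R) by apply: cvg_expr; rewrite ger0_norm.
have e1 : 0 < e / (B + 1) by rewrite divr_gt0// ltr_wpDl.
have [N _ HN] := H _ e1; exists N => n /HN /=.
rewrite sub0r normrN ger0_norm ?exprn_ge0// ltr_pdivlMr ?ltr_wpDl// mulrC.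
by apply: le_lt_trans; rewrite ler_wpM2r ?exprn_ge0// lerDl.
Qed.

Variables p q t : C.
Hypothesis hp : 0 < nm p < 1.
Hypothesis hq : 0 < nm q < 1.
Hypothesis ht : 0 < nm t < 1.
Let p0 := unit_neq0 hp.
Let q0 := unit_neq0 hq.
Let t0 := unit_neq0 ht.

Definition monom (as_ : seq C) : set C :=
  [set x | exists a i j k, a \in as_ /\ x = a * p ^+ i * q ^+ j * t ^+ k].

(** All three bases have modulus below 1, so all but finitely many exponents give points in any
    given disc about 0. *)
Lemma gcompact_monom as_ (X : set C) : X `<=` monom as_ -> gcompact (X `|` [set 0]).
Proof.
move=> XS d d0; have d00 : 0 < d 0 by apply: d0; right.
pose B := \sum_(a <- as_) nm a; have B0 : 0 <= B by apply: sumr_ge0 => a _; exact: nm_ge0.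
have sm (x : C) : 0 < nm x < 1 -> exists N, forall n, (N <= n)%N -> B * nm x ^+ n < d 0.
  by move=> /andP[x0 x1]; apply: pow_small => //; rewrite ltW.
have [Np HNp] := sm p hp; have [Nq HNq] := sm q hq; have [Nt HNt] := sm t ht.
pose N := maxn Np (maxn Nq Nt).
pose L := [seq a * p ^+ e.1.1 * q ^+ e.1.2 * t ^+ e.2 | a <- as_, e : 'I_N * 'I_N * 'I_N <- enum {: 'I_N * 'I_N * 'I_N}].
exists (0 :: [seq x <- L | `[< X x >]]); split.
  by move=> x; rewrite inE => /orP[/eqP ->|]; [right|rewrite mem_filter => /andP[/asboolP ? _]; left].
move=> y [Xy|->]; last by exists 0; rewrite ?mem_head// subrr nm0.
have [a [i' [j [k [aas yE]]]]] := XS y Xy.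
have aB : nm a <= B.
  by rewrite /B (big_rem _ aas) /= lerDl sumr_ge0// => *; exact: nm_ge0.
have [/and3P[iN jN kN]|big] := boolP [&& (i' < N)%N, (j < N)%N & (k < N)%N].
  exists y; last by rewrite subrr nm0 d0//; left.
  rewrite inE mem_filter (asboolT Xy) /=; apply/orP; right; apply/allpairsP.
  by exists (a, (Ordinal iN, Ordinal jN, Ordinal kN)); rewrite /= mem_enum.
exists 0; first by rewrite mem_head.
rewrite subr0 yE !nmM !nmX.
have le1 (x : C) n : 0 < nm x < 1 -> 0 <= nm x ^+ n <= 1.
  by move=> /andP[x0 x1]; rewrite exprn_ge0 ?exprn_ile1 ?ltW.
have [/andP[P0 P1] /andP[Q0 Q1] /andP[U0 U1]] := And3 (le1 p i' hp) (le1 q j hq) (le1 t k ht).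
have A0 := nm_ge0 a.
move: big; rewrite !negb_and -!leqNgt => /or3P[h|h|h].
- apply: le_lt_trans (HNp i' _); last by apply: leq_trans h; rewrite leq_maxl.
  rewrite -[leRHS]mulr1 ler_pM ?mulr_ge0// -[leRHS]mulr1 ler_pM ?mulr_ge0// ler_wpM2r//.
- apply: le_lt_trans (HNq j _); last by apply: leq_trans h; rewrite /N !leq_max leqnn orbT.
  rewrite -[leRHS]mulr1 ler_pM ?mulr_ge0// ler_pM ?mulr_ge0// -[leRHS]mulr1 ler_pM//.
- apply: le_lt_trans (HNt k _); last by apply: leq_trans h; rewrite /N !leq_max leqnn !orbT.
  by rewrite ler_pM ?mulr_ge0// -[leRHS]mulr1 ler_pM ?mulr_ge0// -[leRHS]mulr1 ler_pM.
Qed.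

(** Points of [S] can accumulate outside [S] only at 0, which inversion sends to infinity. *)
Lemma inv_closed (S : set C) : gcompact (S `|` [set 0]) -> ~ S 0 ->
  forall z, ~ [set s^-1 | s in S] z ->
  exists2 r, 0 < r & forall w, nm (w - z) < r -> ~ [set s^-1 | s in S] w.
Proof.
move=> gS nS0 z nz; have [B B0 HB] := gcompact_bounded gS.
have [->|z0] := eqVneq z 0.
  exists B^-1; first by rewrite invr_gt0.
  move=> w; rewrite subr0 => wB [s Ss sw]; have := HB s (or_introl Ss).
  have s0 : 0 < nm s by rewrite nm_gt0; apply/eqP => s0; apply: nS0; rewrite -s0.
  by rewrite ltNge -lef_pV2 ?posrE// -nmV sw => /negP; apply; exact: ltW.
have n1 : ~ (S `|` [set 0]) z^-1.
  move=> [Sz|/eqP]; last by rewrite invr_eq0 (negbTE z0).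
  by apply: nz; exists z^-1; rewrite ?invrK.
have [d d0 Hd] := gcompact_dist gS n1.
have [r r0 Hr] := cdiff_cont (cdiff_inv z0) d0.
exists r => // w /Hr wz [s Ss sw]; have := Hd s (or_introl Ss).
by rewrite leNgt -{1}(invrK s) sw wz.
Qed.

Definition mset : set C := [set m | exists i j, m = t * p ^+ i * q ^+ j].

Section Discs.
Variable as_ : seq C.
Hypothesis as0 : forall a, a \in as_ -> a != 0.
Hypothesis generic : forall a b (i j k : int), a \in as_ -> b \in as_ -> a * b != p ^ i * q ^ j * t ^ k.
Let S := monom as_.

Let Sne s : S s -> s != 0.
Proof. by move=> [a [i' [j [k [/as0 a0 ->]]]]]; rewrite !mulf_neq0 ?expf_neq0. Qed.

Let Smul m s : mset m -> S s -> S (m * s).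
Proof.
move=> [i1 [j1 ->]] [a [i2 [j2 [k [aas ->]]]]].
exists a, (i1 + i2)%N, (j1 + j2)%N, k.+1; split=> //.
by rewrite !exprD exprS; ring.
Qed.

Let gS : gcompact (S `|` [set 0]).
Proof. exact: (@gcompact_monom as_). Qed.

(** Products of two monomials are monomials over the products [a * b]. By genericity none equals 1,
    and together with 0 they form a compact set. *)
Lemma monom_gap : exists2 c, 0 < c & forall s s', S s -> S s' -> c <= nm (s * s' - 1).
Proof.
pose P := [seq a * b | a <- as_, b <- as_].
have gP : gcompact (monom P `|` [set 0]) by exact: (@gcompact_monom P).
have n1 : ~ (monom P `|` [set 0]) 1.
  move=> [[x [i' [j [k [/allpairsP[[a b] /= [aas bas ->]] e]]]]]|/eqP]; last by rewrite oner_eq0.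
  have := generic (- i'%:Z) (- j%:Z) (- k%:Z) aas bas; rewrite -!exprnN => /negP; apply; apply/eqP.
  have P0 : p ^+ i' * q ^+ j * t ^+ k != 0 by rewrite !mulf_neq0 ?expf_neq0.
  by apply: (mulIf P0); rewrite -!invfM mulVf// e !mulrA.
have [c c0 Hc] := gcompact_dist gP n1; exists c => // s s'.
move=> [a [i1 [j1 [k1 [aas ->]]]]] [b [i2 [j2 [k2 [bas ->]]]]]; apply: Hc; left.
exists (a * b), (i1 + i2)%N, (j1 + j2)%N, (k1 + k2)%N; split.
  by apply/allpairsP; exists (a, b).
by rewrite !exprD; ring.
Qed.

(* Discs around the points of S whose relative radius increases as the point
   approaches 0, so that multiplication by a contraction maps a closed disc
   into the corresponding open one. *)
Let rad (eps : R) s : R := eps * (nm s / (1 + nm s)).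

Lemma separating_discs : exists Sle Slt : set C,
  [/\ S `<=` Slt, Slt `<=` Sle & ~ Sle 0] /\
  [/\ exists B, forall z, Sle z -> nm z <= B, open_set Slt,
      forall z, z != 0 -> ~ Sle z -> exists2 r, 0 < r & forall w, nm (w - z) < r -> ~ Sle w,
      forall m z, mset m -> Sle z -> Slt (m * z) &
      forall z, Sle z -> Sle z^-1 -> False].
Proof.
have [c c0 Hc] := monom_gap.
(* If [z] and [z^-1] were in discs about [s] and [s'], then [nm (s * s' - 1)] would be at most
   [3 * eps * nm (s * s')]. The bound 1/4 gives [nm (s * s') <= 4] and keeps 0 out of the discs; the
   bound [c / 16] then contradicts the gap [c]. *)
pose eps := Num.min (1 / 4) (c / 16).
have eps0 : 0 < eps by rewrite lt_min !divr_gt0.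
have [e4 e16] : eps <= 1 / 4 /\ eps <= c / 16 by split; rewrite ge_min lexx ?orbT.
have den (s : C) : 0 < 1 + nm s by rewrite ltr_pwDl ?nm_ge0.
have rad_le s : rad eps s <= eps * nm s.
  rewrite ler_wpM2l ?(ltW eps0)// ler_pdivrMr// ler_peMr ?nm_ge0//.
  by rewrite lerDl nm_ge0.
have rad_gt0 s : S s -> 0 < rad eps s.
  by move=> /Sne s0; rewrite mulr_gt0// divr_gt0// nm_gt0.
have rad0 : rad eps 0 = 0 by rewrite /rad nm0 mul0r mulr0.
have rad_lip s s' : rad eps s' <= rad eps s + nm (s' - s).
  have k : nm s' / (1 + nm s') <= nm s / (1 + nm s) + nm (s' - s).
    rewrite -lerBlDl.
    have -> : nm s' / (1 + nm s') - nm s / (1 + nm s) = (nm s' - nm s) / ((1 + nm s') * (1 + nm s)).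
      by field; rewrite !gt_eqF.
    rewrite ler_pdivrMr ?mulr_gt0//; apply: le_trans (nm_subge _ _) _.
    rewrite ler_peMr ?nm_ge0//; have := nm_ge0 s; have := nm_ge0 s'.
    have : 0 <= nm s' * nm s by rewrite mulr_ge0 ?nm_ge0.
    by lra.
  rewrite /rad; apply: le_trans (ler_wpM2l (ltW eps0) k) _.
  by rewrite mulrDr lerD2l ler_piMl ?nm_ge0//; lra.
exists [set z | exists2 s, S s & nm (z - s) <= rad eps s],
       [set z | exists2 s, S s & nm (z - s) < rad eps s].
split; split.
- by move=> s Ss; exists s => //; rewrite subrr nm0 rad_gt0.
- by move=> z [s Ss zs]; exists s => //; exact: ltW.
- move=> [s Ss]; rewrite sub0r nmN => h; have := rad_le s; have := Sne Ss; rewrite -nm_gt0 => s0.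
  have : eps * nm s <= 1 / 4 * nm s by rewrite ler_wpM2r ?nm_ge0.
  by lra.
- have [B B0 HB] := gcompact_bounded gS; exists (2 * B) => z [s Ss zs].
  have := HB s (or_introl Ss); have := nm_subge z s; have := rad_le s.
  have : eps * nm s <= 1 / 4 * nm s by rewrite ler_wpM2r ?nm_ge0.
  by have := nm_ge0 s; lra.
- move=> z [s Ss zs]; exists (rad eps s - nm (z - s)); first by rewrite subr_gt0.
  by move=> w wz; exists s => //; have := nm_tri w z s; lra.
- move=> z z0 nz; pose phi s := nm (z - s) - rad eps s.
  have phi0 s : (S `|` [set 0]) s -> 0 < phi s.
    move=> [Ss|->]; last by rewrite /phi rad0 !subr0 nm_gt0.
    by rewrite subr_gt0 ltNge; apply/negP => h; apply: nz; exists s.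
  have [l [lS cov]] := gS (fun s Ss => divr_gt0 (phi0 s Ss) (ltr0Sn R 3)).
  have [d d0 Hd] : exists2 d, 0 < d & forall x, x \in l -> d <= phi x / 2.
    by apply: seq_min_gt0 => x /lS /phi0 h; rewrite divr_gt0.
  exists d => // w wz [s Ss ws]; have [x xl sx] := cov s (or_introl Ss).
  have := Hd x xl; have := rad_lip x s; have := nm_tri z s x; have := nm_tri z w s.
  by rewrite (nm_sub z w); move: sx; rewrite /phi; lra.
- move=> m z Mm [s Ss zs]; exists (m * s); first exact: Smul.
  rewrite -mulrBr nmM; have [i1 [j1 mE]] := Mm.
  have m1 : nm m < 1.
    rewrite mE !nmM !nmX; have [/andP[_ a1] /andP[/ltW b0 /ltW b1] /andP[/ltW c0' /ltW c1]] := And3 ht hp hq.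
    apply: le_lt_trans a1; rewrite -[leRHS]mulr1 ler_pM ?mulr_ge0 ?exprn_ge0 ?nm_ge0 ?exprn_ile1//.
    by rewrite -[leRHS]mulr1 ler_pM ?exprn_ge0 ?nm_ge0 ?exprn_ile1.
  have m0 : 0 < nm m by rewrite nm_gt0 mE !mulf_neq0 ?expf_neq0.
  have s0 : 0 < nm s by rewrite nm_gt0; exact: Sne.
  apply: le_lt_trans (ler_wpM2l (ltW m0) zs) _.
  rewrite /rad mulrCA ltr_pM2l// nmM mulrA ltr_pM2l ?mulr_gt0// ltf_pV2 ?posrE//.
    by rewrite ltrD2l gtr_pMl.
  by rewrite -nmM.
- move=> z [s Ss zs] [s' Ss' zs'].
  have z0 : z != 0.
    apply/eqP => z0; move: zs; rewrite z0 sub0r nmN => h; have := rad_le s; have := Sne Ss.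
    rewrite -nm_gt0 => s0; have : eps * nm s <= 1 / 4 * nm s by rewrite ler_wpM2r ?nm_ge0.
    by lra.
  pose a := z - s; pose b := z^-1 - s'.
  have E : s * s' - 1 = - (s * b + a * s' + a * b) by rewrite -(mulfV z0) /a /b; ring.
  have a1 : nm a <= eps * nm s by exact: le_trans (rad_le s).
  have b1 : nm b <= eps * nm s' by exact: le_trans (rad_le s').
  have P0 : 0 <= nm s * nm s' by rewrite mulr_ge0 ?nm_ge0.
  have k : nm (s * s' - 1) <= 3 * eps * (nm s * nm s').
    rewrite E nmN; apply: le_trans (nmD _ _) _.
    have k1 : nm (s * b) <= nm s * (eps * nm s') by rewrite nmM ler_wpM2l ?nm_ge0.
    have k2 : nm (a * s') <= eps * nm s * nm s' by rewrite nmM ler_wpM2r ?nm_ge0.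
    have k3 : nm (a * b) <= (eps * nm s) * (eps * nm s') by rewrite nmM ler_pM ?nm_ge0.
    have k4 : eps * (eps * (nm s * nm s')) <= 1 * (eps * (nm s * nm s')).
      by apply: ler_wpM2r; [rewrite mulr_ge0 ?(ltW eps0)|lra].
    by have := nmD (s * b) (a * s'); lra.
  have k5 : nm s * nm s' <= 4.
    have h1 := nm_subge (s * s') 1; rewrite nmM nm1 in h1.
    have : 3 * eps * (nm s * nm s') <= 3 / 4 * (nm s * nm s') by rewrite ler_wpM2r//; lra.
    by lra.
  have k6 : 3 * eps * (nm s * nm s') <= 3 * eps * 4 by rewrite ler_wpM2l// mulr_ge0// ltW.
  by have := Hc s s' Ss Ss'; lra.
Qed.

(** The unit disc, with the discs about the points of [S] added and the inverses of these discs
    removed. The closed set [K] adds closed discs and removes inverses of open ones, the open set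
    [I] does the opposite; inversion therefore takes [I] exactly to the complement of [K]. *)
Lemma star_region : exists K I : set C,
  [/\ forall Sin Sout, Sin `<=` S -> (forall s, Sout s -> exists2 x, S x & s = x^-1) ->
        region mset Sin Sout 1 K I,
      forall z, z != 0 -> (I z^-1 <-> ~ K z) & I 0].
Proof.
have [Sle [Slt [[Sin_lt lt_le nle0] [[B HB] lt_open le_closed le_mul disj]]]] := separating_discs.
have nlt0 : ~ Slt 0 by move=> /lt_le.
pose K := [set z | Sle z \/ (nm z <= 1 /\ ~ Slt z^-1)].
pose I := [set z | Slt z \/ (nm z < 1 /\ ~ Sle z^-1)].
have KI z : z != 0 -> (I z^-1 <-> ~ K z).
  move=> z0; have zz : (nm z^-1 < 1) = ~~ (nm z <= 1).
    by rewrite nmV invf_lt1 ?nm_gt0// ltNge.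
  rewrite /I /K /= invrK zz; split.
    move=> [lt|[/negP n1 nle]] [le|[n2 nlt]] //; exact: disj le (lt_le _ lt).
  move=> /not_orP[nle /not_andP[/negP n1|/contrapT lt]]; [right; split=> //|by left].
have I0 : I 0 by right; rewrite invr0 nm0.
exists K, I; split=> // Sin Sout Sin_S Sout_S.
have mulKI m z : mset m -> K z -> I (m * z).
  move=> Mm; have [i1 [j1 mE]] := Mm.
  have m1 : nm m < 1.
    rewrite mE !nmM !nmX; have [/andP[_ a1] /andP[/ltW b0 /ltW b1] /andP[/ltW c0' /ltW c1]] := And3 ht hp hq.
    apply: le_lt_trans a1; rewrite -[leRHS]mulr1 ler_pM ?mulr_ge0 ?exprn_ge0 ?nm_ge0 ?exprn_ile1//.
    by rewrite -[leRHS]mulr1 ler_pM ?exprn_ge0 ?nm_ge0 ?exprn_ile1.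
  have m0 : m != 0 by rewrite mE !mulf_neq0 ?expf_neq0.
  move=> [le|[z1 nlt]]; [by left; exact: le_mul|right; split].
    by rewrite nmM; apply: le_lt_trans m1; rewrite ler_piMr ?nm_ge0.
  have [->|z0] := eqVneq z 0; first by rewrite mulr0 invr0.
  by move=> /(le_mul m _ Mm); rewrite invfM mulVKf.
split.
- exists (Num.max B 1 + 1) => z [/HB zB|[z1 _]]; first by rewrite (le_lt_trans zB)// ltr_pwDr// le_max lexx.
  by rewrite (le_lt_trans z1)// ltr_pwDr// le_max lexx orbT.
- move=> z /not_orP[nle /not_andP h].
  have z0 : z != 0.
    by apply/eqP => z0; case: h; rewrite z0 ?nm0 ?invr0//; exact.
  have [r r0 Hr] := le_closed z z0 nle.
  case: h => [/negP n1|/contrapT lt].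
    exists (Num.min r (nm z - 1)); first by rewrite lt_min r0 subr_gt0 ltNge.
    move=> w; rewrite lt_min => /andP[/Hr nw w1] [//|[w2 _]].
    by have := nm_subge z w; rewrite nm_sub; lra.
  have [d d0 Hd] := lt_open _ lt; have [r' r'0 Hr'] := cdiff_cont (cdiff_inv z0) d0.
  exists (Num.min r r'); first by rewrite lt_min r0.
  by move=> w; rewrite lt_min => /andP[/Hr nw /Hr'/Hd lw] [//|[_]].
- move=> z [lt|[z1 nle]].
    by have [d d0 Hd] := lt_open _ lt; exists d => // w /Hd ?; left.
  have [->|z0] := eqVneq z 0.
    pose B1 := `|B| + 1; have B10 : 0 < B1 by rewrite ltr_wpDl.
    exists (Num.min 1 B1^-1); first by rewrite lt_min ltr01 invr_gt0.
    move=> w; rewrite subr0 lt_min => /andP[w1 wB]; right; split=> //.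
    have [->|w0] := eqVneq w 0; first by rewrite invr0.
    move=> /HB; rewrite nmV => wB'.
    have := ler_norm B; move: wB; rewrite -[nm w]invrK ltf_pV2 ?posrE ?invr_gt0 ?nm_gt0//.
    by rewrite /B1; lra.
  have [||d d0 Hd] := le_closed z^-1 => //; first by rewrite invr_eq0.
  have [r' r'0 Hr'] := cdiff_cont (cdiff_inv z0) d0.
  exists (Num.min r' (1 - nm z)); first by rewrite lt_min r'0 subr_gt0.
  move=> w; rewrite lt_min => /andP[/Hr'/Hd nw w1]; right; split=> //.
  by have := nm_subge w z; lra.
- move=> z [lt|[z1 nle]]; [by left; exact: lt_le|right; split; [exact: ltW|by move=> /lt_le]].
- exact: I0.
- exact: mulKI.
- move=> m z Mm nI; have z0 : z != 0 by apply/eqP => z0; apply: nI; rewrite z0.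
  apply: mulKI => //; apply: contrapT => nK; apply: nI.
  by rewrite -[z]invrK; apply/KI => //; rewrite invr_eq0.
- move=> m z y Mm Kz Ky; rewrite mul1r => e.
  have y0 : y != 0 by apply/eqP => y0; move/eqP: e; rewrite y0 mulr0 eq_sym oner_eq0.
  have : I y^-1 by rewrite (_ : y^-1 = m * z) ?[RHS]mulr1; [exact: mulKI|rewrite -[LHS]mul1r -e mulfK].
  by move=> /KI; apply.
- by move=> s /Sin_S /Sin_lt; left.
- move=> s /Sout_S[x Sx ->] [le|[_]]; rewrite ?invrK; last by apply; exact: Sin_lt.
  by apply: disj le _; rewrite invrK; exact/lt_le/Sin_lt.
Qed.

End Discs.

End StarRegion.

(** * Infinite products of linear factors *)

Section InfiniteProducts.
Variable R : realType.
Local Notation C := R[i].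
Implicit Types (u v : nat -> C) (l : seq C).

Definition cv u (a : C) := forall e : R, 0 < e -> exists N, forall n, (N <= n)%N -> nm (u n - a) < e.

Lemma cv_cst a : cv (fun=> a) a.
Proof. by move=> e e0; exists 0%N => n _; rewrite subrr nm0. Qed.

Lemma cv_near u v a N : (forall n, (N <= n)%N -> u n = v n) -> cv u a -> cv v a.
Proof.
move=> uv cu e /cu[M HM]; exists (maxn N M) => n; rewrite geq_max => /andP[nN nM].
by rewrite -uv// HM.
Qed.

Lemma cv_uniq u a b : cv u a -> cv u b -> a = b.
Proof.
move=> ca cb; apply/eqP; rewrite -subr_eq0; apply/eqP/nm_eq0_all => e e0.
have e2 : 0 < e / 2 by rewrite divr_gt0.
have [N HN] := ca _ e2; have [M HM] := cb _ e2.
have := HN (maxn N M) (leq_maxl _ _); have := HM (maxn N M) (leq_maxr _ _).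
by have := nm_tri a (u (maxn N M)) b; rewrite (nm_sub a (u _)); lra.
Qed.

Lemma cv_rcont2 u v a b (Phi : 'rV[C]_2 -> C) :
  rcont Phi (\row_i (if i == 0 then a else b)) -> cv u a -> cv v b ->
  cv (fun n => Phi (\row_i (if i == 0 then u n else v n))) (Phi (\row_i (if i == 0 then a else b))).
Proof.
move=> cP cu cb e /cP[d d0 Hd]; have [N HN] := cu _ d0; have [M HM] := cb _ d0.
exists (maxn N M) => n; rewrite geq_max => /andP[nN nM]; apply: Hd => i; rewrite !mxE.
by case: ifP => _; [exact: HN|exact: HM].
Qed.

Lemma cvM u v a b : cv u a -> cv v b -> cv (fun n => u n * v n) (a * b).
Proof.
move=> cu cb; have := @cv_rcont2 u v a b (fun z => z 0 0 * z 0 1) _ cu cb.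
rewrite !mxE /= => H; apply: cv_near (H _) => [n _|]; first by rewrite !mxE.
by apply: rcontM; exact: rcont_coord.
Unshelve. exact: 0%N.
Qed.

Lemma cvD u v a b : cv u a -> cv v b -> cv (fun n => u n + v n) (a + b).
Proof.
move=> cu cb; have := @cv_rcont2 u v a b (fun z => z 0 0 + z 0 1) _ cu cb.
rewrite !mxE /= => H; apply: cv_near (H _) => [n _|]; first by rewrite !mxE.
by apply: rcontD; exact: rcont_coord.
Unshelve. exact: 0%N.
Qed.

Lemma cvB u v a b : cv u a -> cv v b -> cv (fun n => u n - v n) (a - b).
Proof.
move=> cu cb; have := cvD cu (cvM (cv_cst (-1)) cb); rewrite mulN1r.
by apply: cv_near => n _; rewrite mulN1r.
Unshelve. exact: 0%N.
Qed.

Lemma cvV u a : a != 0 -> cv u a -> cv (fun n => (u n)^-1) a^-1.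
Proof.
move=> a0 cu e e0; have [r r0 Hr] := cdiff_cont (cdiff_inv a0) e0.
by have [N HN] := cu r r0; exists N => n /HN /Hr.
Qed.

Lemma cv_lim u a : cv u a -> limn (u : nat -> R[i]^o) = a.
Proof.
move=> cu; apply: cvg_lim; first exact: norm_hausdorff.
apply/cvgrPdist_lt => e; rewrite ltcE /= => /andP[/eqP eI e0].
have [N HN] := cu _ e0; exists N => // n /= /HN h.
by rewrite normE ltcE /= eI eqxx nm_sub.
Qed.

Lemma cv_le u a (B : R) : cv u a -> (forall n, nm (u n) <= B) -> nm a <= B.
Proof.
move=> cu uB; rewrite leNgt; apply/negP => Ba.
have [|N HN] := cu (nm a - B); first by rewrite subr_gt0.
by have := HN N (leqnn N); have := nm_subge a (u N); have := uB N; rewrite nm_sub; lra.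
Qed.

Lemma cv_cauchy u : (forall e : R, 0 < e -> exists N, forall m n, (N <= n)%N -> (n <= m)%N ->
  nm (u m - u n) < e) -> exists a, cv u a.
Proof.
move=> cu.
have key (f : C -> R) : (forall z w, `|f z - f w| <= nm (z - w)) -> exists x : R, forall e, 0 < e ->
    exists N, forall n, (N <= n)%N -> `|f (u n) - x| < e.
  move=> fl; have /cauchy_cvgP cF : cauchy ((fun n => f (u n)) @ \oo).
    apply: cauchy_exP => e e0; have [N HN] := cu _ e0; exists (f (u N)).
    exists N => // n /= Nn; rewrite /ball /= (le_lt_trans (fl _ _))// nm_sub.
    exact: HN.
  exists (lim ((fun n => f (u n)) @ \oo)) => e e0.
  have /cvgrPdist_lt /(_ e e0)[N _ HN] := cF.
  by exists N => n /HN; rewrite distrC.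
have [x Hx] := key _ (@Re_lip R); have [y Hy] := key _ (@Im_lip R).
exists (x +i* y)%C => e e0; have e2 : 0 < e / 2 by rewrite divr_gt0.
have [N HN] := Hx _ e2; have [M HM] := Hy _ e2.
exists (maxn N M) => n; rewrite geq_max => /andP[/HN h1 /HM h2].
rewrite (le_lt_trans (nm_le _))// ReD ImD ReN ImN /=; lra.
Qed.

(** Products over a list of coefficients treat the single product in theta and the double product in
    Gamma alike. The function [dpl] below is the derivative of [pl]. *)
Definition pl l (x : C) : C := \prod_(c <- l) (1 - c * x).
Definition wt l : R := \sum_(c <- l) nm c.
Fixpoint dpl l (x : C) : C :=
  if l is c :: l' then - c * pl l' x + (1 - c * x) * dpl l' x else 0.

Lemma wt_ge0 l : 0 <= wt l. Proof. by apply: sumr_ge0 => c _; exact: nm_ge0. Qed.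
Lemma wt_cat l l' : wt (l ++ l') = wt l + wt l'. Proof. exact: big_cat. Qed.
Lemma wt_cons c l : wt (c :: l) = nm c + wt l. Proof. exact: big_cons. Qed.
Lemma pl_cat l l' x : pl (l ++ l') x = pl l x * pl l' x. Proof. exact: big_cat. Qed.
Lemma pl_cons c l x : pl (c :: l) x = (1 - c * x) * pl l x. Proof. exact: big_cons. Qed.
Lemma pl_nil x : pl [::] x = 1. Proof. exact: big_nil. Qed.

Lemma dpl_cat l l' x : dpl (l ++ l') x = dpl l x * pl l' x + pl l x * dpl l' x.
Proof.
elim: l => [|c l IH] /=; first by rewrite pl_nil mul0r add0r mul1r.
by rewrite IH pl_cat pl_cons; ring.
Qed.

Section Bounds.
Variable rho : R.
Hypothesis rho0 : 0 <= rho.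
Let e l : R := expR (wt l * rho).

Let e_cons c l : (1 + nm c * rho) * e l <= e (c :: l).
Proof.
have -> : e (c :: l) = expR (nm c * rho) * e l by rewrite /e wt_cons mulrDl expRD.
by rewrite ler_wpM2r ?expR_ge0// expR_ge1Dx.
Qed.

Let e_ge1 l : 1 <= e l.
Proof. by rewrite /e -expR0 ler_expR mulr_ge0 ?wt_ge0. Qed.

Let fac c x : nm x <= rho -> nm (1 - c * x) <= 1 + nm c * rho.
Proof.
move=> xr; apply: le_trans (nmB _ _) _; rewrite nm1 nmM lerD2l.
by rewrite ler_wpM2l ?nm_ge0.
Qed.

Lemma pl_bound l x : nm x <= rho -> nm (pl l x) <= e l.
Proof.
move=> xr; elim: l => [|c l IH]; first by rewrite pl_nil nm1 e_ge1.
rewrite pl_cons nmM (le_trans _ (e_cons c l))// ler_pM ?nm_ge0//; exact: fac.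
Qed.

Lemma dpl_bound l x : nm x <= rho -> nm (dpl l x) <= wt l * e l.
Proof.
move=> xr; elim: l => [|c l IH]; first by rewrite nm0 mulr_ge0 ?wt_ge0// (le_trans _ (e_ge1 _)).
rewrite /= (le_trans (nmD _ _))// !nmM nmN.
have k1 : nm c * nm (pl l x) <= nm c * ((1 + nm c * rho) * e l).
  rewrite ler_wpM2l ?nm_ge0// (le_trans (pl_bound l xr))// ler_peMl ?expR_ge0//.
  by rewrite lerDl mulr_ge0 ?nm_ge0.
have k2 : nm (1 - c * x) * nm (dpl l x) <= (1 + nm c * rho) * (wt l * e l).
  by rewrite ler_pM ?nm_ge0//; exact: fac.
apply: le_trans (lerD k1 k2) _.
have -> : nm c * ((1 + nm c * rho) * e l) + (1 + nm c * rho) * (wt l * e l) =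
    wt (c :: l) * ((1 + nm c * rho) * e l) by rewrite wt_cons; ring.
by rewrite ler_wpM2l ?wt_ge0.
Qed.

Lemma pl_lip l x y : nm x <= rho -> nm y <= rho ->
  nm (pl l y - pl l x) <= nm (y - x) * (wt l * e l).
Proof.
move=> xr yr; elim: l => [|c l IH].
  by rewrite !pl_nil subrr nm0 !mulr_ge0 ?nm_ge0 ?wt_ge0// (le_trans _ (e_ge1 _)).
rewrite !pl_cons.
have -> : (1 - c * y) * pl l y - (1 - c * x) * pl l x =
  (1 - c * x) * (pl l y - pl l x) - c * (y - x) * pl l y by ring.
rewrite (le_trans (nmB _ _))// !nmM.
have k1 : nm (1 - c * x) * nm (pl l y - pl l x) <= (1 + nm c * rho) * (nm (y - x) * (wt l * e l)).
  by rewrite ler_pM ?nm_ge0//; exact: fac.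
have k2 : nm c * nm (y - x) * nm (pl l y) <= nm c * nm (y - x) * ((1 + nm c * rho) * e l).
  rewrite ler_wpM2l ?mulr_ge0 ?nm_ge0// (le_trans (pl_bound l yr))// ler_peMl ?expR_ge0//.
  by rewrite lerDl mulr_ge0 ?nm_ge0.
apply: le_trans (lerD k1 k2) _.
have -> : (1 + nm c * rho) * (nm (y - x) * (wt l * e l)) + nm c * nm (y - x) * ((1 + nm c * rho) * e l) =
    nm (y - x) * (wt (c :: l) * ((1 + nm c * rho) * e l)) by rewrite wt_cons; ring.
by rewrite ler_wpM2l ?nm_ge0// ler_wpM2l ?wt_ge0.
Qed.

(** A second-order estimate whose constant involves the list only through its weight. It therefore
    passes to the limit and yields differentiability of the infinite product directly
    ([cdiff_plim]). *)
Lemma pl_taylor l x y : nm x <= rho -> nm y <= rho ->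
  nm (pl l y - pl l x - (y - x) * dpl l x) <= nm (y - x) ^+ 2 * (wt l ^+ 2 * e l).
Proof.
move=> xr yr; elim: l => [|c l IH].
  by rewrite !pl_nil /= mulr0 subrr subr0 nm0 !mulr_ge0 ?exprn_ge0 ?nm_ge0 ?wt_ge0// (le_trans _ (e_ge1 _)).
rewrite !pl_cons /=.
have -> : (1 - c * y) * pl l y - (1 - c * x) * pl l x - (y - x) * (- c * pl l x + (1 - c * x) * dpl l x) =
  (1 - c * x) * (pl l y - pl l x - (y - x) * dpl l x) - c * (y - x) * (pl l y - pl l x) by ring.
rewrite (le_trans (nmB _ _))// !nmM.
set h := nm (y - x); set E := (1 + nm c * rho) * e l.
have c0 := nm_ge0 c; have h0 : 0 <= h := nm_ge0 _; have w0 := wt_ge0 l.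
have eE : e l <= E by rewrite ler_peMl ?expR_ge0// lerDl mulr_ge0.
have E0 : 0 <= E by rewrite (le_trans _ eE)// expR_ge0.
have k1 : nm (1 - c * x) * nm (pl l y - pl l x - (y - x) * dpl l x) <=
    (1 + nm c * rho) * (h ^+ 2 * (wt l ^+ 2 * e l)).
  by rewrite ler_pM ?nm_ge0//; exact: fac.
have k2 : nm c * h * nm (pl l y - pl l x) <= nm c * h * (h * (wt l * E)).
  rewrite ler_wpM2l ?mulr_ge0// (le_trans (pl_lip l xr yr))// ler_wpM2l// ler_wpM2l//.
apply: le_trans (lerD k1 k2) _.
have -> : (1 + nm c * rho) * (h ^+ 2 * (wt l ^+ 2 * e l)) + nm c * h * (h * (wt l * E)) =
   h ^+ 2 * ((wt l ^+ 2 + nm c * wt l) * E) by rewrite /E; ring.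
rewrite ler_wpM2l ?exprn_ge0//; apply: ler_pM => //; last exact: e_cons.
  by rewrite addr_ge0 ?exprn_ge0 ?mulr_ge0.
rewrite wt_cons sqrrD (_ : nm c * wt l *+ 2 = nm c * wt l + nm c * wt l) ?mulr2n//.
have : 0 <= nm c * wt l by rewrite mulr_ge0.
by have := exprn_ge0 2 c0; lra.
Qed.

End Bounds.

Section Limit.
Variable s : nat -> seq C.
Variable sigma : R.
Fixpoint partial n : seq C := if n is m.+1 then s m ++ partial m else [::].
Hypothesis wt_le : forall n, wt (partial n) <= sigma.

Definition plim (x : C) : C := limn (fun n => (pl (partial n) x : R[i]^o)).

Let partial_tail n m : (n <= m)%N -> exists T, partial m = T ++ partial n.
Proof.
elim: m => [|m IH]; first by rewrite leqn0 => /eqP ->; exists [::].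
rewrite leq_eqVlt => /predU1P[->|]; first by exists [::].
by rewrite ltnS => /IH[T ET]; exists (s m ++ T); rewrite /= ET catA.
Qed.

Let sigma0 : 0 <= sigma. Proof. exact: le_trans (wt_ge0 _) (wt_le 0). Qed.

Lemma tail_small (e : R) : 0 < e -> exists N, forall n m, (N <= n)%N -> (n <= m)%N ->
  exists2 T, partial m = T ++ partial n & wt T < e /\ wt T <= sigma.
Proof.
move=> e0; pose W n : R := wt (partial n).
have nd : nondecreasing_seq W.
  by move=> n m /partial_tail[T ET]; rewrite /W ET wt_cat lerDr wt_ge0.
have cW : cvgn W.
  apply: nondecreasing_is_cvgn => //; exists sigma => _ [n _ <-]; exact: wt_le.
have /cvgrPdist_lt /(_ e e0)[N _ HN] := cW.
have Wlim n : W n <= limn W by exact: nondecreasing_cvgn_le.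
exists N => n m Nn nm_; have [T ET] := partial_tail nm_; exists T => //.
have WT : W m = wt T + W n by rewrite /W ET wt_cat.
have := HN n Nn; rewrite ger0_norm ?subr_ge0// => h; have := Wlim m.
have := wt_ge0 (partial n); have := wt_le m; rewrite -!/(W _) WT; lra.
Qed.

Section Point.
Variable x : C.
Let rho := nm x.
Let rho0 : 0 <= rho. Proof. exact: nm_ge0. Qed.
Let K := expR (sigma * rho).
Let K0 : 0 < K. Proof. exact: expR_gt0. Qed.

Let eK l : wt l <= sigma -> expR (wt l * rho) <= K.
Proof. by move=> ls; rewrite ler_expR ler_wpM2r. Qed.

Let tail_one T : wt T <= sigma -> nm (pl T x - 1) <= rho * (wt T * K).
Proof.
move=> Ts; have := @pl_lip rho rho0 T 0 x _ _; rewrite nm0 subr0.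
have -> : pl T 0 = 1 by rewrite /pl; apply: big1 => c _; rewrite mulr0 subr0.
move=> /(_ rho0 (lexx _)) /le_trans; apply.
by rewrite ler_wpM2l// ler_wpM2l ?wt_ge0// eK.
Qed.

Let cauchyP : exists a, cv (fun n => pl (partial n) x) a.
Proof.
apply: cv_cauchy => e e0; have k0 := ltW K0; have D0 : 0 < K * (rho * K) + 1 by rewrite ltr_wpDl// !mulr_ge0.
have [N HN] := tail_small (divr_gt0 e0 D0); exists N => m n Nn nm_.
have [T ET [Te Ts]] := HN n m Nn nm_; rewrite ET pl_cat.
have -> : pl T x * pl (partial n) x - pl (partial n) x = pl (partial n) x * (pl T x - 1) by ring.
rewrite nmM (@le_lt_trans _ _ (K * (rho * (wt T * K))))//.
  rewrite ler_pM ?nm_ge0//; last exact: tail_one.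
  by apply: le_trans (eK (wt_le n)); exact: pl_bound.
rewrite ltr_pdivlMr// in Te; apply: le_lt_trans Te.
by rewrite (_ : K * (rho * (wt T * K)) = wt T * (K * (rho * K))) ?ler_wpM2l ?wt_ge0 ?lerDl//; ring.
Qed.

Lemma cv_plim : cv (fun n => pl (partial n) x) (plim x).
Proof. by have [a ca] := cauchyP; rewrite /plim (cv_lim ca). Qed.

Lemma cv_dpl : exists a, cv (fun n => dpl (partial n) x) a.
Proof.
apply: cv_cauchy => e e0.
pose D := K * K + sigma * K * (rho * K) + 1.
have k0 := ltW K0; have D0 : 0 < D by rewrite ltr_wpDl// addr_ge0// !mulr_ge0.
have [N HN] := tail_small (divr_gt0 e0 D0); exists N => m n Nn nm_.
have [T ET [Te Ts]] := HN n m Nn nm_; rewrite ET dpl_cat.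
have -> : dpl T x * pl (partial n) x + pl T x * dpl (partial n) x - dpl (partial n) x =
   dpl T x * pl (partial n) x + dpl (partial n) x * (pl T x - 1) by ring.
rewrite (le_lt_trans (nmD _ _))// !nmM.
have k1 : nm (dpl T x) <= wt T * K.
  by apply: le_trans (dpl_bound rho0 T (lexx _)) _; rewrite ler_wpM2l ?wt_ge0// eK.
have k2 : nm (dpl (partial n) x) <= sigma * K.
  apply: le_trans (dpl_bound rho0 _ (lexx _)) _.
  by rewrite ler_pM ?wt_ge0 ?expR_ge0// eK.
have k3 : nm (pl (partial n) x) <= K by apply: le_trans (eK (wt_le n)); exact: pl_bound.
have k4 := tail_one Ts.
rewrite ltr_pdivlMr// in Te; apply: le_lt_trans Te.
apply: (@le_trans _ _ (wt T * K * K + sigma * K * (rho * (wt T * K)))).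
  by rewrite lerD ?ler_pM ?nm_ge0.
rewrite (_ : _ + _ = wt T * (K * K + sigma * K * (rho * K))); last by ring.
by rewrite ler_wpM2l ?wt_ge0// lerDl.
Qed.

(** Some tail of the product stays within 1/2 of 1, and the finite head has no zero factor. *)
Lemma plim_neq0 : (forall n c, c \in s n -> 1 - c * x != 0) -> plim x != 0.
Proof.
move=> nz; have k0 := ltW K0; have D0 : 0 < 2 * (rho * K) + 1 by rewrite ltr_wpDl// !mulr_ge0.
have [N HN] := tail_small (divr_gt0 ltr01 D0).
have PN0 : pl (partial N) x != 0.
  rewrite /pl prodf_seq_neq0; apply/allP => c; elim: (N) => [//|n IH] /=.
  by rewrite mem_cat => /orP[/nz ->|/IH].
apply/eqP => P0; have h0 : 0 < nm (pl (partial N) x) / 2 by rewrite divr_gt0// nm_gt0.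
have [M HM] := cv_plim h0.
have := HM (maxn N M) (leq_maxr _ _); rewrite P0 subr0.
have [T -> [Te Ts]] := HN N (maxn N M) (leqnn N) (leq_maxl _ _); rewrite pl_cat nmM.
have k : nm (pl T x - 1) <= 1 / 2.
  apply: le_trans (tail_one Ts) _; rewrite ltr_pdivlMr// in Te.
  have := wt_ge0 T; lra.
have k2 : 1 / 2 <= nm (pl T x) by have := nm_subge 1 (pl T x); rewrite nm1 nm_sub; lra.
rewrite ltNge => /negP; apply; rewrite mulrC ler_wpM2r ?nm_ge0//; lra.
Qed.

Lemma plim_eq0 n c : c \in s n -> 1 - c * x = 0 -> plim x = 0.
Proof.
move=> cs c0; apply: cv_uniq cv_plim _; apply: (@cv_near (fun=> 0) _ _ n.+1); last exact: cv_cst.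
move=> m; case: m => // m; rewrite ltnS => nm_; apply/esym/eqP; rewrite /pl prodf_seq_eq0.
apply/hasP; exists c; last by rewrite c0 eqxx.
elim: m nm_ => [|m IH]; first by rewrite leqn0 => /eqP <-; rewrite /= mem_cat cs.
rewrite leq_eqVlt => /predU1P[<-|]; first by rewrite /= mem_cat cs.
by rewrite ltnS => /IH h; rewrite [partial _]/= mem_cat h orbT.
Qed.

End Point.

Lemma plim_taylor x : exists d, forall y, nm y <= nm x + 1 ->
  nm (plim y - plim x - (y - x) * d) <= nm (y - x) ^+ 2 * (sigma ^+ 2 * expR (sigma * (nm x + 1))).
Proof.
have [d cd] := cv_dpl x; exists d => y yr.
have xr : nm x <= nm x + 1 by rewrite lerDl.
have r1 : 0 <= nm x + 1 by rewrite addr_ge0 ?nm_ge0.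
apply: (@cv_le (fun n => pl (partial n) y - pl (partial n) x - (y - x) * dpl (partial n) x)).
  by apply: cvB; [apply: cvB; [exact: cv_plim|exact: cv_plim]|apply: cvM => //; exact: cv_cst].
move=> n; apply: le_trans (pl_taylor r1 (partial n) xr yr) _.
rewrite ler_wpM2l ?exprn_ge0 ?nm_ge0//; apply: ler_pM; rewrite ?exprn_ge0 ?wt_ge0 ?expR_ge0//.
  by rewrite lerXn2r ?nnegrE ?wt_ge0.
by rewrite ler_expR ler_wpM2r.
Qed.

Lemma cdiff_plim x : cdiff plim x.
Proof.
have [d Hd] := plim_taylor x; exists d => e e0.
set B := sigma ^+ 2 * expR (sigma * (nm x + 1)) in Hd.
have B0 : 0 <= B by rewrite mulr_ge0 ?exprn_ge0 ?expR_ge0.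
have B1 : 0 < B + 1 by rewrite ltr_wpDl.
exists (Num.min 1 (e / (B + 1))); first by rewrite lt_min ltr01 divr_gt0.
move=> y; rewrite lt_min => /andP[y1 ye].
have := Hd y; have -> : nm y <= nm x + 1 by have := nm_subge y x; lra.
rewrite [d * _]mulrC => /(_ isT) /le_trans; apply.
rewrite expr2 -mulrA [leRHS]mulrC ler_wpM2l ?nm_ge0//.
rewrite ltr_pdivlMr// in ye; apply: le_trans (ltW ye).
by rewrite ler_wpM2l ?nm_ge0// lerDl.
Qed.

End Limit.

End InfiniteProducts.

(** * Theta functions and the elliptic Gamma function *)

Section EllipticFunctions.
Variable R : realType.
Local Notation C := R[i].

Lemma geometric_bound (r : R) n : 0 <= r < 1 -> \sum_(k < n) r ^+ k <= (1 - r)^-1.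
Proof.
move=> /andP[r0 r1]; have d0 : 0 < 1 - r by rewrite subr_gt0.
rewrite -[leRHS]mul1r ler_pdivlMr// mulrC.
have -> : (1 - r) * \sum_(k < n) r ^+ k = 1 - r ^+ n.
  elim: n => [|n IH]; first by rewrite big_ord0 mulr0 expr0 subrr.
  by rewrite big_ord_recr /= mulrDr IH exprS; ring.
by rewrite lerBlDr lerDl exprn_ge0.
Qed.

Section OneBase.
Variable p : C.
Hypothesis p1 : nm p < 1.

Definition qprod (x : C) : C := infprod (fun k => 1 - p ^+ k * x).

Let shell n : seq C := [:: p ^+ n].

Let pl_shell n x : pl (partial shell n) x = \prod_(k < n) (1 - p ^+ k * x).
Proof.
elim: n => [|n IH]; first by rewrite pl_nil big_ord0.
by rewrite [partial _ _]/= pl_cons IH big_ord_recr /= mulrC.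
Qed.

Let wt_shell n : wt (partial shell n) <= (1 - nm p)^-1.
Proof.
apply: le_trans (geometric_bound n _); last by rewrite nm_ge0.
rewrite le_eqVlt; apply/predU1P; left; elim: n => [|n IH]; first by rewrite /wt big_nil big_ord0.
by rewrite [partial _ _]/= wt_cons IH big_ord_recr /= nmX addrC.
Qed.

Let qprodE x : qprod x = plim shell x.
Proof.
apply: (congr1 (fun u : nat -> R[i]^o => limn u)); apply/funext => n.
by rewrite pl_shell.
Qed.

Lemma cv_qprod x : cv (fun n => \prod_(k < n) (1 - p ^+ k * x)) (qprod x).
Proof.
rewrite qprodE; apply: cv_near (cv_plim wt_shell x) => n _; exact: pl_shell.
Unshelve. exact: 0%N.
Qed.

Lemma cdiff_qprod x : cdiff qprod x.
Proof. by apply: eq_cdiff (cdiff_plim wt_shell x) => y; rewrite qprodE. Qed.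

Lemma qprod_neq0 x : (forall k : nat, p ^+ k * x != 1) -> qprod x != 0.
Proof.
move=> H; rewrite qprodE; apply: (plim_neq0 wt_shell) => n c; rewrite inE => /eqP ->.
by rewrite subr_eq0 eq_sym.
Qed.

Lemma qprod_shift x : qprod x = (1 - x) * qprod (p * x).
Proof.
apply: cv_uniq (cv_qprod x) _.
have c := cvM (cv_cst (1 - x)) (cv_qprod (p * x)).
move=> e /c[N HN]; exists N.+1; case=> // n; rewrite ltnS => /HN.
rewrite big_ord_recl expr0 mul1r; congr (nm (_ * _ - _) < e).
by apply: eq_bigr => k _; rewrite /= /bump /= add1n exprSr mulrA.
Qed.

Lemma thetaE x : theta x p = qprod x * qprod (p / x).
Proof.
apply: cv_lim; have := cvM (cv_qprod x) (cv_qprod (p / x)).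
apply: cv_near => n _; rewrite -big_split; apply: eq_bigr => k _.
by rewrite exprSr mulrA.
Unshelve. exact: 0%N.
Qed.

Lemma theta_inv x : x != 0 -> p != 0 -> theta (p / x) p = theta x p.
Proof.
move=> x0 p0; rewrite !thetaE mulrC; congr (qprod _ * _).
by field; rewrite x0 p0.
Qed.

Lemma theta_shift x : x != 0 -> p != 0 -> theta (p * x) p = - x^-1 * theta x p.
Proof.
move=> x0 p0; rewrite !thetaE (qprod_shift x) (qprod_shift (p / (p * x))).
rewrite (_ : p / (p * x) = x^-1); last by rewrite invfM mulrA mulfV// mul1r.
by field.
Qed.

Lemma cdiff_theta c x : c * x != 0 -> cdiff (fun y => theta (c * y) p) x.
Proof.
move=> cx0; apply: (@eq_cdiff _ (fun y => qprod (c * y) * qprod (p / (c * y)))).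
  by move=> y; rewrite thetaE.
have cc : cdiff (fun y => c * y) x by exact: cdiff_lin.
apply: cdiffM; first by apply: (cdiff_comp cc); exact: cdiff_qprod.
apply: (@cdiff_comp _ qprod); last exact: cdiff_qprod.
by apply: cdiff_div => //; exact: cdiff_cst.
Qed.

End OneBase.

Section TwoBases.
Variables p q : C.
Hypothesis p1 : nm p < 1.
Hypothesis q1 : nm q < 1.

Definition dprod (x : C) : C :=
  limn (fun N => (\prod_(j < N) \prod_(k < N) (1 - p ^+ j * q ^+ k * x) : R[i]^o)).

(** The coefficients by which the square of side [n.+1] exceeds that of side [n]: [ellGamma] is a
    limit over squares. *)
Let shell n : seq C := [seq p ^+ n * q ^+ k | k <- index_iota 0 n.+1] ++ [seq p ^+ j * q ^+ n | j <- index_iota 0 n].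

Let square_recr (T : Type) (idx : T) (op : Monoid.com_law idx) (F : nat -> nat -> T) n :
  \big[op/idx]_(j < n.+1) \big[op/idx]_(k < n.+1) F j k =
  op (op (\big[op/idx]_(k < n.+1) F n k) (\big[op/idx]_(j < n) F j n)) (\big[op/idx]_(j < n) \big[op/idx]_(k < n) F j k).
Proof.
rewrite big_ord_recr /=; under eq_bigr do rewrite big_ord_recr /=.
by rewrite big_split /= Monoid.mulmC Monoid.mulmA [in RHS]Monoid.mulmAC.
Qed.

Let pl_shell n x : pl (partial shell n) x = \prod_(j < n) \prod_(k < n) (1 - p ^+ j * q ^+ k * x).
Proof.
elim: n => [|n IH]; first by rewrite pl_nil big_ord0.
rewrite -[partial shell n.+1]/(shell n ++ partial shell n) pl_cat IH (square_recr _ (fun j k => 1 - p ^+ j * q ^+ k * x)).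
by rewrite /shell pl_cat /pl !big_map !big_mkord.
Qed.

Let wt_shell n : wt (partial shell n) <= (1 - nm p)^-1 * (1 - nm q)^-1.
Proof.
have -> : wt (partial shell n) = \sum_(j < n) \sum_(k < n) (nm p ^+ j * nm q ^+ k).
  elim: n => [|n IH]; first by rewrite /wt big_nil big_ord0.
  rewrite -[partial shell n.+1]/(shell n ++ partial shell n) wt_cat IH (square_recr _ (fun j k => nm p ^+ j * nm q ^+ k)).
  rewrite /shell wt_cat /wt !big_map !big_mkord.
  by congr (_ + _ + _); apply: eq_bigr => k _; rewrite nmM !nmX.
have -> : \sum_(j < n) \sum_(k < n) (nm p ^+ j * nm q ^+ k) = (\sum_(j < n) nm p ^+ j) * \sum_(k < n) nm q ^+ k.
  by rewrite big_distrl; apply: eq_bigr => j _; rewrite big_distrr.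
by apply: ler_pM; rewrite ?sumr_ge0// => *; rewrite ?exprn_ge0 ?nm_ge0 ?geometric_bound ?nm_ge0.
Qed.

Let dprodE x : dprod x = plim shell x.
Proof.
apply: (congr1 (fun u : nat -> R[i]^o => limn u)); apply/funext => n.
by rewrite pl_shell.
Qed.

Lemma cv_dprod x : cv (fun n => \prod_(j < n) \prod_(k < n) (1 - p ^+ j * q ^+ k * x)) (dprod x).
Proof.
rewrite dprodE; apply: cv_near (cv_plim wt_shell x) => n _; exact: pl_shell.
Unshelve. exact: 0%N.
Qed.

Lemma cdiff_dprod x : cdiff dprod x.
Proof. by apply: eq_cdiff (cdiff_plim wt_shell x) => y; rewrite dprodE. Qed.

Lemma dprod_neq0 x : (forall j k : nat, p ^+ j * q ^+ k * x != 1) -> dprod x != 0.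
Proof.
move=> H; rewrite dprodE; apply: (plim_neq0 wt_shell) => n c.
by rewrite mem_cat => /orP[|] /mapP[k _ ->]; rewrite subr_eq0 eq_sym.
Qed.

Lemma dprod_eq0 x j k : p ^+ j * q ^+ k * x = 1 -> dprod x = 0.
Proof.
move=> H; rewrite dprodE; apply: (plim_eq0 wt_shell (n := maxn j k) (c := p ^+ j * q ^+ k)); last by rewrite H subrr.
rewrite mem_cat; have [jk|kj] := ltnP j k.
  by apply/orP; right; apply/mapP; exists j; rewrite ?mem_index_iota//= (maxn_idPr (ltnW jk)).
by apply/orP; left; apply/mapP; exists k; rewrite ?mem_index_iota//= (maxn_idPl kj).
Qed.

(** At a zero of the denominator the partial products are eventually 0 because [0^-1 = 0], and the
    right-hand side is 0 by the same convention. *)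
Lemma ellGammaE x : ellGamma x p q = dprod (p * q / x) / dprod x.
Proof.
pose P n y := \prod_(j < n) \prod_(k < n) (1 - p ^+ j * q ^+ k * y).
have E n : \prod_(j < n) \prod_(k < n) ((1 - p ^+ j.+1 * q ^+ k.+1 / x) / (1 - p ^+ j * q ^+ k * x)) =
    P n (p * q / x) / P n x.
  rewrite /P -prodf_div; apply: eq_bigr => j _; rewrite -prodf_div; apply: eq_bigr => k _.
  by congr ((1 - _) / _); rewrite !exprSr; ring.
apply: cv_lim; have [[j [k H]]|H] := pselect (exists j k, p ^+ j * q ^+ k * x = 1).
  rewrite (dprod_eq0 H) invr0 mulr0; apply: (@cv_near _ (fun=> 0) _ _ (maxn j k).+1); last exact: cv_cst.
  move=> n nj; rewrite E [P n x](_ : _ = 0) ?invr0 ?mulr0//.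
  have jn : (j < n)%N by apply: leq_trans nj; rewrite ltnS leq_maxl.
  have kn : (k < n)%N by apply: leq_trans nj; rewrite ltnS leq_maxr.
  by rewrite /P (bigD1 (Ordinal jn))//= (bigD1 (Ordinal kn))//= H subrr !mul0r.
apply: (@cv_near _ (fun n => P n (p * q / x) / P n x) _ _ 0%N) => [n _|]; first by rewrite E.
apply: cvM; first exact: cv_dprod.
apply: cvV; last exact: cv_dprod.
by apply: dprod_neq0 => j k; apply/eqP => e; apply: H; exists j, k.
Qed.

(** Square partial products are not stable under multiplication of the argument by [q]: the two
    sides differ by the factors with exponent [n] of [q], and their product tends to 1. *)
Lemma dprod_shift x : dprod x = qprod p x * dprod (q * x).
Proof.
have c := cvM (cv_qprod p1 x) (cv_dprod (q * x)).
apply/esym; apply: cv_uniq c _.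
have c0 : cv (fun n => \prod_(j < n) (1 - p ^+ j * q ^+ n * x)) 1.
  move=> e e0; pose sg := (1 - nm p)^-1.
  have sg0 : 0 <= sg by rewrite invr_ge0 subr_ge0 ltW.
  have [N HN] : exists N, forall n, (N <= n)%N -> (nm x * sg * expR (sg * nm x)) * nm q ^+ n < e.
    apply: pow_small => //; first by rewrite nm_ge0.
    by rewrite !mulr_ge0 ?nm_ge0 ?expR_ge0.
  exists N => n /HN; apply: le_lt_trans.
  pose l := [seq p ^+ j * q ^+ n | j <- index_iota 0 n].
  have -> : \prod_(j < n) (1 - p ^+ j * q ^+ n * x) = pl l x.
    by rewrite /pl big_map big_mkord.
  have wl : wt l <= sg * nm q ^+ n.
    rewrite /wt big_map big_mkord.
    under eq_bigr do rewrite nmM !nmX.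
    by rewrite -mulr_suml ler_wpM2r ?exprn_ge0 ?nm_ge0// geometric_bound// nm_ge0.
  have wl' : wt l <= sg.
    by apply: le_trans wl _; rewrite ler_piMr// exprn_ile1 ?nm_ge0// ltW.
  have := @pl_lip R (nm x) (nm_ge0 x) l 0 x; rewrite nm0 subr0 => /(_ (nm_ge0 x) (lexx _)).
  have -> : pl l 0 = 1 by rewrite /pl; apply: big1 => c' _; rewrite mulr0 subr0.
  move=> /le_trans; apply.
  have -> : nm x * sg * expR (sg * nm x) * nm q ^+ n = nm x * (sg * nm q ^+ n * expR (sg * nm x)) by ring.
  rewrite ler_wpM2l ?nm_ge0// ler_pM ?expR_ge0 ?wt_ge0//.
  by rewrite ler_expR ler_wpM2r ?nm_ge0.
have := cvM (cv_dprod x) c0; rewrite mulr1; apply: cv_near => n _.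
rewrite -!big_split; apply: eq_bigr => j _ /=.
rewrite -[RHS](_ : \prod_(k < n.+1) (1 - p ^+ j * q ^+ k * x) = _); first by rewrite big_ord_recr.
rewrite big_ord_recl expr0 mulr1; congr (_ * _); apply: eq_bigr => k _.
by rewrite /= /bump /= add1n exprSr; congr (1 - _); ring.
Unshelve. exact: 0%N.
Qed.

End TwoBases.

Implicit Types p q x : C.

Lemma dprodC p q x : dprod p q x = dprod q p x.
Proof.
apply: (congr1 (fun u : nat -> R[i]^o => limn u)); apply/funext => n.
rewrite exchange_big; apply: eq_bigr => j _.
by apply: eq_bigr => k _; rewrite [p ^+ _ * _]mulrC.
Qed.

Lemma ellGammaC p q x : nm p < 1 -> nm q < 1 -> ellGamma x p q = ellGamma x q p.
Proof. by move=> p1 q1; rewrite (ellGammaE p1 q1) (ellGammaE q1 p1) !(dprodC q p) (mulrC q). Qed.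

Lemma ellGamma_shift p q x : nm p < 1 -> nm q < 1 -> p != 0 -> q != 0 -> x != 0 ->
  (forall k : nat, p ^+ k * x != 1) ->
  ellGamma (q * x) p q = theta x p * ellGamma x p q.
Proof.
move=> p1 q1 p0 q0 x0 nx; rewrite !ellGammaE// thetaE//.
have -> : p * q / (q * x) = p / x by field; rewrite x0 q0.
rewrite (dprod_shift p1 q1 (p / x)) (dprod_shift p1 q1 x).
have -> : q * (p / x) = p * q / x by field.
rewrite invfM; have a0 := qprod_neq0 p1 nx.
by rewrite [qprod p x * _]mulrC -!mulrA [qprod p x * _]mulrCA [qprod p x * (_ * _)]mulrA mulfV// mul1r; ring.
Qed.

(* The zeros of the numerator are poles of Gamma(1/x), where Rocq's division
   gives 0: the identity holds off the countable set of bad points only. *)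
Lemma ellGamma_reflection p q x : nm p < 1 -> nm q < 1 -> p != 0 -> q != 0 -> x != 0 ->
  (forall j k : int, x != p ^ j * q ^ k) ->
  (ellGamma x p q * ellGamma x^-1 p q)^-1 = theta x p * theta x^-1 q.
Proof.
move=> p1 q1 p0 q0 x0 nx; rewrite !ellGammaE// !thetaE// invrK.
have nz (y : C) : y = x \/ y = x^-1 -> forall j k a b : nat, p ^+ j * q ^+ k * (p ^+ a * q ^+ b * y) != 1.
  move=> yx j k a b; apply/eqP => e.
  have E : p ^ (j + a)%:Z * q ^ (k + b)%:Z * y = 1.
    by rewrite -!exprnP !exprD -[RHS]e; ring.
  case: yx E => -> E.
    have := nx (- (j + a)%:Z) (- (k + b)%:Z); rewrite -!exprnN -invfM => /negP; apply; apply/eqP.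
    apply: (mulfI (_ : p ^+ (j + a) * q ^+ (k + b) != 0)); first by rewrite mulf_neq0 ?expf_neq0.
    by rewrite mulfV ?mulf_neq0 ?expf_neq0.
  have := nx (j + a)%:Z (k + b)%:Z => /negP; apply; apply/eqP.
  by rewrite -[LHS]mul1r -E divfK.
have dn (y : C) : y = x \/ y = x^-1 -> forall a b : nat, dprod p q (p ^+ a * q ^+ b * y) != 0.
  by move=> yx a b; apply: dprod_neq0 => // j k; exact: nz.
have X a b := dn x (or_introl erefl) a b; have Y a b := dn x^-1 (or_intror erefl) a b.
have E (y : C) : dprod p q y = qprod p y * qprod q (q * y) * dprod p q (p * q * y).
  by rewrite (dprod_shift p1 q1 y) dprodC (dprod_shift q1 p1 (q * y)) dprodC mulrA mulrA.
have Xpq : dprod p q (p * q * x) != 0 by have := X 1%N 1%N; rewrite !expr1.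
have Ypq : dprod p q (p * q * x^-1) != 0 by have := Y 1%N 1%N; rewrite !expr1.
have X0 : dprod p q x != 0 by have := X 0%N 0%N; rewrite !expr0 !mul1r.
have Y0 : dprod p q x^-1 != 0 by have := Y 0%N 0%N; rewrite !expr0 !mul1r.
rewrite !invfM !invrK.
transitivity (dprod p q x / dprod p q (p * q * x) * (dprod p q x^-1 / dprod p q (p * q * x^-1))).
  by rewrite mulrACA mulrC [RHS]mulrACA; congr (_ * _); rewrite mulrC.
rewrite [dprod p q x]E [dprod p q x^-1]E !mulfK//.
by rewrite (qprod_shift p1 x^-1) (qprod_shift q1 x^-1); ring.
Qed.

End EllipticFunctions.

(** * Thin analytic sets are slim *)

Section ThinSets.
Variable R : realType.
Local Notation C := R[i].

Lemma nbhs_rclose n (z : 'rV[R[i]^o]_n) (A : set 'rV[R[i]^o]_n) :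
  nbhs z A <-> exists2 r : R, 0 < r & forall w, @rclose R n r w z -> A w.
Proof.
split.
  move=> /nbhs_ballP[e /=]; rewrite ltcE /= => /andP[/eqP eI e0] H.
  exists (Re e) => // w wz; apply: H; rewrite /ball /= /mx_ball; split.
    by rewrite ltcE /= eI eqxx.
  by move=> i j; rewrite ord1 /ball /= normE ltcE /= eI eqxx nm_sub; exact: wz.
move=> [r r0 H]; apply/nbhs_ballP; exists r%:C%C => /=; first by rewrite ltcR.
move=> w [_ wz]; apply: H => i; have := wz ord0 i.
by rewrite /ball /= normE ltcR nm_sub.
Qed.

Lemma holomorphic_hol n (U : set 'rV[C]_n) (f : 'rV[C]_n -> C) : holomorphic_on U f -> hol f U.
Proof.
move=> Uf z Uz; have df := Uf z Uz; split.
  have := differentiable_continuous df => /cvgrPdist_lt cf e e0.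
  have e1 : 0 < e%:C%C :> R[i]^o by rewrite ltcR.
  have /nbhs_rclose[d d0 Hd] := cf _ e1; exists d => // w /Hd.
  by rewrite normE ltcR nm_sub.
move=> i; pose v : 'rV[R[i]^o]_n := \row_j (if j == i then 1 else 0).
have /cvg_ex[d /cvgrPdist_lt cd] := @diff_derivable _ _ _ _ z v df.
exists (d : C) => e e0; have e1 : 0 < e%:C%C :> R[i]^o by rewrite ltcR.
have /nbhs_ballP[b /=] := cd _ e1; rewrite ltcE /= => /andP[/eqP bI b0] H.
exists (Re b) => // x xz; have [->|xz0] := eqVneq x (z 0 i).
  by rewrite set_coord_id !subrr mulr0 subr0 nm0 mulr0.
pose k : C := x - z 0 i; have k0 : k != 0 by rewrite subr_eq0.
have /= := H k; rewrite /ball /= sub0r normrN normE ltcE /= bI eqxx => /(_ xz k0).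
rewrite normE ltcR.
have -> : k *: v + z = set_coord i x z.
  apply/rowP => j; rewrite !mxE; case: eqP => [->|_]; first by rewrite /k /GRing.scale /= mulr1 subrK.
  by rewrite /GRing.scale /= mulr0 add0r.
move=> h; have E : f (set_coord i x z) - f (set_coord i (z 0 i) z) - d * k =
   - (k * (d - k^-1 * (f (set_coord i x z) - f z))).
  by rewrite set_coord_id; field.
by rewrite E nmN nmM mulrC ler_wpM2r ?nm_ge0// ltW.
Qed.

Lemma open_rclose n (r : R) (z : 'rV[C]_n) : open_rV [set w | rclose r w z].
Proof.
rewrite /open_rV openE => w wz; apply/nbhs_rclose.
have [d d0 Hd] : exists2 d, 0 < d & forall i, i \in enum 'I_n -> d <= r - nm (w 0 i - z 0 i).
  by apply: seq_min_gt0 => i _; rewrite subr_gt0; exact: wz.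
exists d => // u uw i; have := Hd i; rewrite mem_enum => /(_ isT).
by have := uw i; have := nm_tri (u 0 i) (w 0 i) (z 0 i); lra.
Qed.

Definition polydisc_nonnull n (U : set 'rV[C]_n) (h : 'rV[C]_n -> C) := forall z (r : R), 0 < r ->
  (forall w, rclose r w z -> U w) -> exists2 w, rclose r w z & h w != 0.

Definition vanishing n (S U : set 'rV[C]_n) (h : 'rV[C]_n -> C) :=
  [/\ hol h U, polydisc_nonnull U h & forall w, U w -> S w -> h w = 0].

Lemma sub_vanishing n (S U U' : set 'rV[C]_n) h : U' `<=` U -> vanishing S U h -> vanishing S U' h.
Proof.
move=> UU [hh nn v]; split.
- by move=> z /UU; exact: hh.
- by move=> z r r0 H; apply: nn => // w /H /UU.
- by move=> w /UU; exact: v.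
Qed.

Definition analytically_thin n (S : set 'rV[C]_n) := forall z, torus z ->
  exists r h, 0 < r /\ vanishing S [set w | rclose r w z] h.

Lemma thin_analytically n (S : set 'rV[C]_n) : thin S -> analytically_thin S.
Proof.
move=> tS z /tS[U [h [[oU Uz UT hU nU] v]]].
have : nbhs (z : 'rV[R[i]^o]_n) (U : set 'rV[R[i]^o]_n) by apply: open_nbhs_nbhs.
move=> /nbhs_rclose[r r0 Hr]; exists r, h; split=> //; split.
- by move=> w /Hr; exact: holomorphic_hol hU w.
- move=> z' r' r'0 sub; have [|||w] := nU [set w | rclose r' w z'].
  + exact: open_rclose.
  + by move=> w /sub /Hr.
  + by exists z'; exact: rclosexx.
  by exists w.
- by move=> w /Hr; exact: v.
Qed.

Section OneVariable.
Variables (h : C -> C) (x0 : C) (r : R).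
Hypothesis r0 : 0 < r.
Hypothesis hd : forall x, nm (x - x0) < r -> cdiff h x.
Let s := r / 3.
Let a1 := Re x0 - s.
Let a2 := Re x0 + s.
Let b1 := Im x0 - s.
Let b2 := Im x0 + s.
Let s0 : 0 < s. Proof. by rewrite divr_gt0. Qed.
Let a12 : a1 <= a2. Proof. by have := s0; rewrite /a1 /a2; lra. Qed.
Let b12 : b1 <= b2. Proof. by have := s0; rewrite /b1 /b2; lra. Qed.

Let inR_hd z : inR a1 a2 b1 b2 z -> cdiff h z.
Proof.
move=> [/andP[h1 h2] /andP[h3 h4]]; apply: hd; apply: le_lt_trans (nm_le _) _.
have : `|Re (z - x0)| <= s by rewrite ReD ReN ler_norml; rewrite /a1 /a2 in h1 h2; lra.
have : `|Im (z - x0)| <= s by rewrite ImD ImN ler_norml; rewrite /b1 /b2 in h3 h4; lra.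
by rewrite /s; have := r0; lra.
Qed.

Let bd_inR z : bdR a1 a2 b1 b2 z -> inR a1 a2 b1 b2 z.
Proof. by move=> [[|]|[|]] [u uab ->]; split=> //=; rewrite ?lexx ?a12 ?b12. Qed.

Let bd_far z : bdR a1 a2 b1 b2 z -> s <= nm (z - x0).
Proof.
have key (u : R) : u = s \/ u = - s -> s <= `|u|.
  by case=> ->; rewrite ?normrN ger0_norm// ltW.
by move=> [[|]|[|]] [u _ ->]; [apply: le_trans (nm_Im _)|apply: le_trans (nm_Im _)
  |apply: le_trans (nm_Re _)|apply: le_trans (nm_Re _)]; rewrite ?ReD ?ImD ?ReN ?ImN /=;
  apply: key; rewrite /a1 /a2 /b1 /b2; [right|left|left|right]; ring.
Qed.

Let close c := nm (c - x0) < s / 8.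

Let bd_sep z c : bdR a1 a2 b1 b2 z -> close c -> s * (7 / 8) <= nm (z - c).
Proof.
move=> /bd_far h1 cc; have := nm_tri z c x0; rewrite /close in cc; lra.
Qed.

Let close_inRo c : close c -> inRo a1 a2 b1 b2 c.
Proof.
move=> cc; have h1 := le_lt_trans (nm_Re _) cc; have h2 := le_lt_trans (nm_Im _) cc.
move: h1 h2; rewrite !(ReD, ImD, ReN, ImN) !ltr_norml => /andP[? ?] /andP[? ?].
by have := s0; move=> ?; rewrite /a1 /a2 /b1 /b2; split; apply/andP; split; lra.
Qed.

Let sep_neq0 z c : bdR a1 a2 b1 b2 z -> close c -> z - c != 0.
Proof.
by move=> bz cc; rewrite -nm_gt0; apply: lt_le_trans (bd_sep bz cc); rewrite mulr_gt0// s0.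
Qed.

(** The Cauchy kernel divided further by the distances to known zeros of [h]. *)
Let Kf l x z := h z / ((z - x) * \prod_(c <- l) (z - c)).

Let prod_neq0 l z : bdR a1 a2 b1 b2 z -> (forall c, c \in l -> close c) ->
  \prod_(c <- l) (z - c) != 0.
Proof.
move=> bz cl; rewrite prodf_seq_neq0; apply/allP => c cin /=.
by apply: sep_neq0 => //; exact: cl.
Qed.

Let Kf_cont l x : (forall c, c \in l -> close c) -> close x -> contT (bdR a1 a2 b1 b2) (Kf l x).
Proof.
move=> cl cx; apply: cdiff_contT => z bz; apply: cdiff_div.
- by rewrite mulf_neq0 ?sep_neq0 ?prod_neq0.
- exact/inR_hd/bd_inR.
apply: cdiffM; first by apply: cdiffB; [exact: cdiff_id|exact: cdiff_cst].
by apply: cdiff_prod => c _; apply: cdiffB; [exact: cdiff_id|exact: cdiff_cst].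
Qed.

(** Each zero [c] is introduced by partial fractions in 1/((z - x)(z - c)); the term with its pole
    at [c] contributes nothing because [h c = 0]. *)
Let cauchy_zeros l x : uniq l -> (forall c, c \in l -> close c /\ h c = 0) -> close x -> x \notin l ->
  rint a1 a2 b1 b2 (Kf l x) = two_pi_i R * (h x / \prod_(c <- l) (x - c)).
Proof.
have cR := cyc_rint a12 b12.
elim: l x => [|c l IH] x ul cl cx xl.
  rewrite big_nil divr1 mulrC; have <- := cauchy_formula (close_inRo cx) (fun z => @inR_hd z).
  by apply: (cyc_ext cR) => z _; rewrite /Kf big_nil mulr1.
move: ul xl; rewrite /= inE negb_or => /andP[cnl ul] /andP[xc xl].
have [cc hc] := cl c (mem_head _ _).
have cl' d : d \in l -> close d /\ h d = 0 by move=> dl; apply: cl; rewrite inE dl orbT.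
have cl1 d : d \in l -> close d by case/cl'.
have xc0 : x - c != 0 by rewrite subr_eq0.
have -> : rint a1 a2 b1 b2 (Kf (c :: l) x) = rint a1 a2 b1 b2 (fun z => (x - c)^-1 * (Kf l x z - Kf l c z)).
  apply: (cyc_ext cR) => z bz; rewrite /Kf big_cons.
  have z1 := sep_neq0 bz cx; have z2 := sep_neq0 bz cc; have z3 := prod_neq0 bz cl1.
  by field; rewrite z1 z2 z3 xc0.
rewrite (cycZ cR); last by apply: contT_B; exact: Kf_cont.
rewrite (cycB cR); [|exact: Kf_cont..].
by rewrite !IH// hc mul0r mulr0 subr0 big_cons invfM; ring.
Qed.

(** The identity theorem without power series. Dividing by [m] zeros within [s / 8] of [x0],
    Cauchy's formula gains for each of them the factor 2/7, the quotient of [s / 4], a bound for the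
    distance from [x] to the zero, by [7 s / 8], a lower bound for that from the boundary. Let [m]
    grow. *)
Lemma clustered_zeros : (forall e : R, 0 < e -> exists x, [/\ x != x0, nm (x - x0) < e & h x = 0]) ->
  forall x, nm (x - x0) < r / 24 -> h x = 0.
Proof.
move=> acc.
have cR := cyc_rint a12 b12.
have [H H0 HH] : exists2 H : R, 0 < H & forall z, bdR a1 a2 b1 b2 z -> nm (h z) <= H.
  have hc : contT (bdR a1 a2 b1 b2) h by apply: cdiff_contT => z /bd_inR; exact: inR_hd.
  have /choice[d Hd] : forall z, exists d, bdR a1 a2 b1 b2 z -> 0 < d /\
      forall w, bdR a1 a2 b1 b2 w -> nm (w - z) < d -> nm (h w - h z) < 1.
    move=> z; have [bz|] := pselect (bdR a1 a2 b1 b2 z); last by exists 1.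
    by have [d d0 Hd] := hc z bz 1 ltr01; exists d => _; split.
  have [l [lb cov]] := cyc_compact cR (fun z bz => (Hd z bz).1).
  exists (\sum_(z <- l) nm (h z) + 1); first by rewrite ltr_wpDl// sumr_ge0// => *; exact: nm_ge0.
  move=> z bz; have [w wl zw] := cov z bz; have := (Hd w (lb w wl)).2 z bz zw.
  have : nm (h w) <= \sum_(z <- l) nm (h z).
    by rewrite (big_rem _ wl) /= lerDl sumr_ge0// => *; exact: nm_ge0.
  by have := nm_subge (h z) (h w); lra.
have rs : r / 24 = s / 8 by rewrite /s; field.
rewrite rs => x cx; have ss := s0.
(* Each new zero is chosen closer to [x0] than the earlier ones and, unless [x = x0], than [x]; so
   it differs from all of them. *)
have zeros m : exists l, [/\ uniq l, size l = m, forall c, c \in l -> close c /\ h c = 0 & x \notin l] /\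
     forall c, c \in l -> c != x0.
  elim: m => [|m [l [[ul sl cl xl] l0]]]; first by exists [::].
  have [e e0 He] : exists2 e, 0 < e & forall c, c \in (if x == x0 then l else x :: l) -> e <= nm (c - x0).
    apply: seq_min_gt0 => c; rewrite nm_gt0 subr_eq0; case: eqVneq => [_ /l0//|xx].
    by rewrite inE => /orP[/eqP ->|/l0].
  have [|c [c0 cc hc]] := acc (Num.min (s / 8) e); first by rewrite lt_min e0 divr_gt0.
  rewrite lt_min in cc; case/andP: cc => cs ce.
  exists (c :: l); split; last by move=> d; rewrite inE => /orP[/eqP ->|/l0].
  split.
  - rewrite /= ul andbT; apply/negP => cl'; have := He c; rewrite leNgt ce.
    by case: ifP => _; rewrite ?inE cl' ?orbT => /(_ isT).
  - by rewrite /= sl.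
  - by move=> d; rewrite inE => /orP[/eqP ->|/cl].
  - rewrite inE negb_or xl andbT; apply/eqP => xc; have := He c; rewrite leNgt ce.
    by rewrite -xc in c0 *; rewrite (negbTE c0) mem_head => /(_ isT).
pose D := 4 * (H / (s * (7 / 8))) * ((a2 - a1) + (b2 - b1)).
have D0 : 0 <= D.
  apply: mulr_ge0; last by rewrite addr_ge0 ?subr_ge0.
  by rewrite mulr_ge0// divr_ge0 ?mulr_ge0 ?ltW.
have bound m : nm (h x) <= D * (2 / 7) ^+ m.
  have [l [[ul sl cl xl] _]] := zeros m.
  have cl1 d : d \in l -> close d by case/cl.
  have P0 : \prod_(c <- l) (x - c) != 0.
    rewrite prodf_seq_neq0; apply/allP => c cin /=; rewrite subr_eq0.
    by apply/eqP => e; rewrite e cin in xl.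
  have E := cauchy_zeros ul cl cx xl.
  have s78 : 0 < s * (7 / 8) by rewrite mulr_gt0.
  have k1 : nm (rint a1 a2 b1 b2 (Kf l x)) <= 4 * (H / (s * (7 / 8)) / (s * (7 / 8)) ^+ m) * ((a2 - a1) + (b2 - b1)).
    apply: rint_bound => //; [by rewrite !divr_ge0 ?exprn_ge0//; exact: ltW|exact: Kf_cont|].
    move=> z bz; rewrite /Kf nmM nmV nmM invfM mulrA.
    rewrite ler_pM ?mulr_ge0 ?invr_ge0 ?nm_ge0//.
      rewrite ler_pM ?invr_ge0 ?nm_ge0 ?HH// lef_pV2 ?posrE ?bd_sep//.
      by apply: lt_le_trans (bd_sep bz cx).
    rewrite lef_pV2 ?posrE ?exprn_gt0// ?nm_gt0 ?prod_neq0//.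
    rewrite nm_prod -sl; elim: (l) cl1 {ul cl xl P0 E sl} => [|c l' IH] cl1; first by rewrite big_nil expr0.
    rewrite big_cons [size _]/= exprS; apply: ler_pM; [exact: ltW|by rewrite exprn_ge0 ?ltW| |].
      by apply: bd_sep bz (cl1 c (mem_head _ _)).
    by apply: IH => d dl; apply: cl1; rewrite inE dl orbT.
  have k2 : nm (\prod_(c <- l) (x - c)) <= (s / 4) ^+ m.
    rewrite nm_prod -sl; elim: (l) cl1 {ul cl xl P0 E sl k1} => [|c l' IH] cl1; first by rewrite big_nil expr0.
    rewrite big_cons [size _]/= exprS; apply: ler_pM; [exact: nm_ge0| | |].
    + by apply: prodr_ge0 => *; exact: nm_ge0.
    + have := cl1 c (mem_head _ _); rewrite /close in cx * => cc.
      by have := nm_tri x x0 c; rewrite (nm_sub x0); lra.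
    + by apply: IH => d dl; apply: cl1; rewrite inE dl orbT.
  have hE : nm (h x) * nm (two_pi_i R) = nm (rint a1 a2 b1 b2 (Kf l x)) * nm (\prod_(c <- l) (x - c)).
    by rewrite E !nmM nmV mulrA divfK ?nm_eq0// mulrC.
  have k3 : nm (h x) * 1 <= nm (h x) * nm (two_pi_i R).
    by rewrite ler_wpM2l ?nm_ge0//; have := nm_two_pi_i R; lra.
  rewrite mulr1 hE in k3; apply: le_trans k3 _.
  apply: le_trans (ler_pM (nm_ge0 _) (nm_ge0 _) k1 k2) _.
  rewrite /D le_eqVlt; apply/predU1P; left.
  have -> : (2 / 7 : R) ^+ m = (s / 4) ^+ m / (s * (7 / 8)) ^+ m.
    by rewrite -expr_div_n; congr (_ ^+ m); field; rewrite gt_eqF.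
  by field; rewrite !gt_eqF ?exprn_gt0.
apply: nm_eq0_all => e e0.
have [|N HN] := @pow_small R (2 / 7) D e _ D0 e0; first by lra.
exact: le_lt_trans (bound N) (HN N (leqnn N)).
Qed.

End OneVariable.

Definition ratc (a : rat * rat) : C := (ratr a.1 +i* ratr a.2)%C.

Lemma ratc_approx z (e : R) : 0 < e -> exists a, nm (z - ratc a) < e.
Proof.
move=> e0; have key (x : R) : exists b : rat, `|x - ratr b| < e / 2.
  have [|b] := @rat_in_itvoo R (x - e / 2) (x + e / 2); first by lra.
  rewrite in_itv/= => /andP[h1 h2]; exists b; rewrite ltr_norml; lra.
have [b1 h1] := key (Re z); have [b2 h2] := key (Im z).
exists (b1, b2); rewrite (le_lt_trans (nm_le _))// !(ReD, ImD, ReN, ImN) /=; lra.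
Qed.

Definition rad (k : nat) : R := k.+1%:R^-1.

Lemma rad_gt0 k : 0 < rad k.
Proof. by rewrite invr_gt0 ltr0Sn. Qed.

Lemma inv_nat_small (e : R) : 0 < e -> exists k : nat, rad k < e.
Proof.
move=> e0; exists (Num.truncn e^-1); rewrite /rad; have p : 0 <= e^-1 by rewrite invr_ge0 ltW.
have /andP[_ h] := truncn_itv p.
by rewrite -[ltRHS]invrK ltf_pV2 ?posrE ?invr_gt0 ?ltr0Sn.
Qed.

(** A countable base of polydiscs. One vanishing function is chosen for each member, so that only
    countably many functions describe a thin set. *)
Definition rdisc n (e : {ffun 'I_n -> rat * rat} * nat) : set 'rV[C]_n :=
  [set z | forall i, nm (z 0 i - ratc (e.1 i)) < rad e.2].

Lemma rdisc_nbhd n (z : 'rV[C]_n) (r : R) : 0 < r ->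
  exists e, rdisc e z /\ forall w, rdisc e w -> rclose r w z.
Proof.
move=> r0; have [k kr] := inv_nat_small (divr_gt0 r0 (ltr0Sn R 1)).
have k0 := rad_gt0 k.
have /choice[a Ha] : forall i, exists a, nm (z 0 i - ratc a) < rad k.
  by move=> i; exact: ratc_approx.
exists ([ffun i => a i], k); split=> [i|w H i]; first by rewrite ffunE.
have := H i; have := Ha i; rewrite /= ffunE; set x := ratc _ => h1 h2.
by have := nm_tri (w 0 i) x (z 0 i); rewrite (nm_sub x); lra.
Qed.

Lemma rdisc_open n e (z : 'rV[C]_n) : rdisc e z -> exists2 r, 0 < r & forall w, rclose r w z -> rdisc e w.
Proof.
move=> ez; have [d d0 Hd] : exists2 d, 0 < d & forall i, i \in enum 'I_n ->
    d <= rad e.2 - nm (z 0 i - ratc (e.1 i)).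
  by apply: seq_min_gt0 => i _; rewrite subr_gt0; exact: ez.
exists d => // w wz i; have := Hd i; rewrite mem_enum => /(_ isT).
by have := wz i; have := nm_tri (w 0 i) (z 0 i) (ratc (e.1 i)); move=> h1 h2 h3; lra.
Qed.

Lemma discrete_countable (Z : set C) :
  (forall z, Z z -> exists2 r, 0 < r & forall w, Z w -> nm (w - z) < r -> w = z) -> countable Z.
Proof.
move=> dZ.
have /choice[e He] : forall z, exists e : (rat * rat) * nat, Z z ->
    nm (z - ratc e.1) < rad e.2 /\ forall w, Z w -> nm (w - ratc e.1) < rad e.2 -> w = z.
  move=> z; have [Zz|] := pselect (Z z); last by exists ((0, 0), 0%N).
  have [r r0 Hr] := dZ z Zz; have [k kr] := inv_nat_small (divr_gt0 r0 (ltr0Sn R 1)).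
  have k0 := rad_gt0 k.
  have [a Ha] := ratc_approx z k0; exists (a, k) => _; split=> // w Zw wa; apply: Hr => //.
  by have := nm_tri w (ratc a) z; rewrite (nm_sub (ratc a)); rewrite /= in wa; lra.
apply/countable_injP; exists (pickle \o e) => z w; rewrite !inE => Zz Zw /= /(pcan_inj pickleK) ezw.
by apply: (He w Zw).2 => //; rewrite -ezw; exact: (He z Zz).1.
Qed.

Lemma set_coord_cns n (i : 'I_n) y x (v : 'rV[C]_n) :
  cns x (set_coord i y v) = set_coord (lift ord0 i) y (cns x v).
Proof.
apply/rowP => j; case: (unliftP ord0 j) => [k|] ->; rewrite set_coord_coord.
  by rewrite !cnsS set_coord_coord (inj_eq lift_inj).
by rewrite !cns0.
Qed.

Lemma set_coord_cns0 n y x (v : 'rV[C]_n) : set_coord ord0 y (cns x v) = cns y v.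
Proof.
by apply/rowP => j; case: (unliftP ord0 j) => [k|] ->; rewrite set_coord_coord ?cnsS ?cns0.
Qed.

Lemma hol_cns n (h : 'rV[C]_n.+1 -> C) U x : hol h U -> hol (fun v => h (cns x v)) [set v | U (cns x v)].
Proof.
move=> hU v /hU[cv dv]; split.
  move=> e /cv[d d0 Hd]; exists d => // w wv; apply: Hd.
  by apply: rclose_cns => //; rewrite subrr nm0.
by move=> i; have := dv (lift ord0 i); rewrite cnsS; apply: eq_cdiff => y; rewrite set_coord_cns.
Qed.

Section ThinSlim.
Variables (n : nat) (S : set 'rV[C]_n.+1).
Variable H : {ffun 'I_n.+1 -> rat * rat} * nat -> 'rV[C]_n.+1 -> C.

Let Z e (e' : {ffun 'I_n -> rat * rat} * nat) : set C :=
  [set x | [/\ vanishing S (rdisc e) (H e), rdisc e' !=set0,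
     forall v, rdisc e' v -> rdisc e (cns x v) & forall v, rdisc e' v -> H e (cns x v) = 0]].

(** These are the first coordinates for which the chosen function vanishes on the whole slice over
    [e']. If they accumulated at one of their points, [clustered_zeros] in the first variable would
    make the function vanish on an open set, which [polydisc_nonnull] forbids. *)
Lemma countable_bad e e' : countable (Z e e').
Proof.
apply: discrete_countable => x0 [[hH nn _] [v0 v0in] sub _].
apply: contrapT => acc.
pose rho := rad e.2 - nm (x0 - ratc (e.1 ord0)).
have rho0 : 0 < rho by have := sub _ v0in ord0; rewrite cns0 subr_gt0.
have disc x v : nm (x - x0) < rho -> rdisc e' v -> rdisc e (cns x v).
  move=> xx vin i; case: (unliftP ord0 i) => [j|] ->; rewrite ?cns0 ?cnsS.
    by have := sub v vin (lift ord0 j); rewrite cnsS.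
  by have := nm_tri x x0 (ratc (e.1 ord0)); rewrite /rho in xx; lra.
have zero v x : rdisc e' v -> nm (x - x0) < rho / 24 -> H e (cns x v) = 0.
  move=> vin; apply: (@clustered_zeros (fun x => H e (cns x v)) x0 rho rho0).
    move=> y yx; have [_ /(_ ord0)] := hH _ (disc y v yx vin).
    by rewrite cns0; apply: eq_cdiff => u; rewrite set_coord_cns0.
  move=> d d0; apply: contrapT => none; apply: acc; exists d => // w [_ _ _ Zw] wx.
  apply: contrapT => wx0; apply: none; exists w; split=> //; first exact/eqP.
  exact: Zw.
have [r r0 Hr] := rdisc_open v0in.
have [||w] := nn (cns x0 v0) (Num.min (rho / 24) r).
- by rewrite lt_min r0 divr_gt0.
- move=> w ww; rewrite [w]cnsE; apply: disc.
    by have := ww ord0; rewrite cns0 lt_min => /andP[h _]; apply: lt_trans h _; rewrite ltr_pdivrMr//; lra.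
  apply: Hr => i; have := ww (lift ord0 i); rewrite cnsS !mxE lt_min => /andP[_]; exact.
move=> ww; rewrite [w]cnsE zero ?eqxx//.
  apply: Hr => i; have := ww (lift ord0 i); rewrite cnsS !mxE lt_min => /andP[_]; exact.
by have := ww ord0; rewrite cns0 lt_min => /andP[].
Qed.

Definition bad_values : set C := [set 0] `|` \bigcup_(ee in [set: _ * _]) Z ee.1 ee.2.

Lemma countable_bad_values : countable bad_values.
Proof.
apply: countable_setU; first exact: countable1.
by apply: bigcup_countable => // -[e e'] _; exact: countable_bad.
Qed.

Hypothesis HP : forall e h, vanishing S (rdisc e) h -> vanishing S (rdisc e) (H e).

Lemma thin_slice x : analytically_thin S -> ~ bad_values x ->
  analytically_thin [set v | S (cns x v)].
Proof.
move=> tS nx v Tv; have x0 : x != 0 by apply/eqP => x0; apply: nx; left.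
have Tz : torus (cns x v).
  by move=> i; case: (unliftP ord0 i) => [j|] ->; rewrite ?cns0// cnsS.
have [r [h [r0 vh]]] := tS _ Tz; have [e [ein esub]] := rdisc_nbhd (cns x v) r0.
have vH : vanishing S (rdisc e) (H e) by apply: (HP (h := h)); apply: sub_vanishing vh.
have [hH nn v0] := vH; have [r1 r10 Hr1] := rdisc_open ein.
have sub w : rclose r1 w v -> rdisc e (cns x w).
  by move=> wv; apply: Hr1; apply: rclose_cns => //; rewrite subrr nm0.
exists r1, (fun w => H e (cns x w)); split=> //; split.
- by move=> w /sub; exact: hol_cns hH w.
- move=> z' r' r'0 zsub; have [e' [e'in e'sub]] := rdisc_nbhd z' r'0.
  apply: contrapT => none; apply: nx; right; exists (e, e') => //; split=> //.
  + by exists z'.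
  + by move=> w /e'sub /zsub /sub.
  + by move=> w /e'sub wz; apply/eqP/negPn/negP => Hw; apply: none; exists w.
- by move=> w /sub rw Sw; exact: v0.
Qed.

End ThinSlim.

(** Over all pairs of rational polydiscs the exceptional first coordinates remain countable. For
    every other value the slice is thin again, in one dimension less. *)
Lemma analytically_thin_slim n (S : set 'rV[C]_n) : S `<=` @torus R n -> analytically_thin S -> slim S.
Proof.
elim: n S => [|n IH] S ST tS /=.
  move=> S0; have [|r [h [r0 [_ nn v]]]] := tS 0; first by case.
  have [|w ww] := nn 0 r r0; first by [].
  rewrite (_ : w = 0); last by apply/rowP => -[].
  by rewrite (v 0)// ?eqxx//; exact: rclosexx.
have /choice[H HP] : forall e, exists H : 'rV[C]_n.+1 -> C,
    forall h, vanishing S (rdisc e) h -> vanishing S (rdisc e) H.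
  move=> e; have [[h vh]|none] := pselect (exists h, vanishing S (rdisc e) h); first by exists h.
  by exists (fun=> 0) => h vh; case: none; exists h.
exists (bad_values S H); first exact: countable_bad_values.
move=> x nx; apply: IH; last exact: thin_slice HP _ tS nx.
by move=> v /ST Tv i; have := Tv (lift ord0 i); rewrite cnsS.
Qed.

Lemma mero_eq_slim n (f g : 'rV[C]_n -> C) : mero_eq f g -> slim [set z | torus z /\ f z <> g z].
Proof.
by move=> fg; apply: analytically_thin_slim; [move=> z []|exact: thin_analytically].
Qed.

End ThinSets.

(** * Gamma identities at generic points *)

Section GammaIdentities.
Variable R : realType.
Local Notation C := R[i].
Variables p q t : C.
Hypothesis hp : 0 < nm p < 1.
Hypothesis hq : 0 < nm q < 1.
Let p0 := unit_neq0 hp.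
Let q0 := unit_neq0 hq.
Let p1 := unit_lt1 hp.
Let q1 := unit_lt1 hq.
Local Notation Gam x := (ellGamma x p q).

(** A countable multiplicative group that contains all zeros and poles of theta and Gamma in their
    argument. Identities are claimed for arguments outside it, where no default value of a division
    interferes. *)
Definition lattice : set C := [set x | exists i j k : int, x = p ^ i * q ^ j * t ^ k].

Lemma lattice_pq (i j : int) : lattice (p ^ i * q ^ j).
Proof. by exists i, j, 0; rewrite expr0z mulr1. Qed.

Lemma lattice_mulpq (i j : int) x : lattice x -> lattice (p ^ i * q ^ j * x).
Proof.
move=> [a [b [c ->]]]; exists (i + a), (j + b), c.
by rewrite !expfzDr//; ring.
Qed.

Lemma lattice_inv x : lattice x -> lattice x^-1.
Proof.
by move=> [a [b [c ->]]]; exists (- a), (- b), (- c); rewrite !invfM -!invr_expz.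
Qed.

Lemma nlattice_inv x : ~ lattice x -> ~ lattice x^-1.
Proof. by move=> h /lattice_inv; rewrite invrK. Qed.

Lemma nlattice_pq (i j : int) x : ~ lattice x -> ~ lattice (p ^ i * q ^ j * x).
Proof.
move=> h /(lattice_mulpq (- i) (- j)); rewrite (_ : _ * _ = x)//.
by rewrite -!invr_expz; field; rewrite !expfz_neq0.
Qed.

Lemma nlattice_neq x (i j : int) : ~ lattice x -> x != p ^ i * q ^ j.
Proof. by move=> h; apply/eqP => e; apply: h; rewrite e; exact: lattice_pq. Qed.

Lemma nlattice_shift x (i j : nat) : ~ lattice x -> p ^+ i * q ^+ j * x != 1.
Proof.
by move=> /(@nlattice_pq i j) h; apply/eqP => e; apply: h; rewrite e; exists 0, 0, 0; rewrite !expr0z !mulr1.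
Qed.

Lemma nlattice_shiftp x (i : nat) : ~ lattice x -> p ^+ i * x != 1.
Proof. by move=> /(@nlattice_shift _ i 0); rewrite mulr1. Qed.

Lemma nlattice_shiftq x (i : nat) : ~ lattice x -> q ^+ i * x != 1.
Proof. by move=> /(@nlattice_shift _ 0 i); rewrite mul1r. Qed.

Lemma theta_neq0 x : ~ lattice x -> theta x p != 0.
Proof.
move=> h; rewrite (thetaE p1) mulf_neq0 ?qprod_neq0// => k; first exact: nlattice_shiftp.
rewrite mulrA -exprSr; apply: nlattice_shiftp; exact: nlattice_inv.
Qed.

Lemma gamma_shiftq x : x != 0 -> ~ lattice x -> Gam (q * x) = theta x p * Gam x.
Proof. by move=> x0 h; apply: ellGamma_shift => // k; exact: nlattice_shiftp. Qed.

Lemma gamma_shiftp x : x != 0 -> ~ lattice x -> Gam (p * x) = theta x q * Gam x.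
Proof.
move=> x0 h; rewrite (ellGammaC _ p1 q1) (ellGammaC x p1 q1); apply: ellGamma_shift => // k.
exact: nlattice_shiftq.
Qed.

(** The reciprocal of Gamma(x) Gamma(1/x) in a form differentiable at every nonzero [x]; the
    denominators of the density are represented by it. *)
Definition Vpq x : C := theta x p * theta x^-1 q.

Lemma gamma_reflect x : x != 0 -> ~ lattice x -> (Gam x * Gam x^-1)^-1 = Vpq x.
Proof. by move=> x0 h; apply: ellGamma_reflection => // j k; exact: nlattice_neq. Qed.

Lemma theta_invx (b x : C) : nm b < 1 -> b != 0 -> x != 0 -> theta x^-1 b = - x^-1 * theta x b.
Proof.
move=> b1 b0 x0; rewrite -(theta_inv (x := x^-1) b1) ?invr_eq0// invrK.
exact: theta_shift.
Qed.

Lemma Vpq_inv x : x != 0 -> Vpq x^-1 = Vpq x.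
Proof.
move=> x0; rewrite /Vpq invrK (theta_invx p1)//.
have -> : theta x q = - x * theta x^-1 q by rewrite (theta_invx q1)// ; field.
by field.
Qed.

Lemma theta_shiftn (b : C) m : nm b < 1 -> b != 0 -> exists c, forall x, x != 0 ->
  theta (x / b ^+ m) b = c * x ^+ m * theta x b.
Proof.
move=> b1 b0; elim: m => [|m [c IH]]; first by exists 1 => x _; rewrite !expr0 divr1 !mulr1 mul1r.
exists (- c / b ^+ m.+1) => x x0.
have bm : b ^+ m != 0 by rewrite expf_neq0.
have y0 : x / b ^+ m.+1 != 0 by rewrite mulf_neq0// invr_eq0 expf_neq0.
have E := theta_shift b1 y0 b0.
rewrite (_ : b * _ = x / b ^+ m) in E; last by rewrite exprS; field; rewrite b0 bm.
have -> : theta (x / b ^+ m.+1) b = - (x / b ^+ m.+1) * theta (x / b ^+ m) b.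
  by rewrite E mulrA mulrNN mulfV// mul1r.
by rewrite IH// !exprS; field; rewrite b0 bm.
Qed.

(** Iterated shift relations. The theta factors are those of [pole_factor], so the poles of [f] and
    [g] are absorbed into Gamma functions whose parameters are divided by p^l q^m. *)
Lemma gamma_pole l m : exists c, forall x, x != 0 -> ~ lattice x ->
  Gam x = theta2 (p * q / x) p q l m * (c * x ^+ (l * m) * Gam (x / (p ^+ l * q ^+ m))).
Proof.
have pn n : p ^+ n != 0 by rewrite expf_neq0.
have qn n : q ^+ n != 0 by rewrite expf_neq0.
elim: l => [|l [c IH]].
  exists 1 => x x0 xl; rewrite /theta2 big_ord0 mul1r (_ : x ^+ (0 * m) = 1)// mulr1 mul1r expr0 mul1r.
  elim: m => [|m IH]; first by rewrite big_ord0 expr0 mul1r divr1.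
  rewrite IH big_ord_recr /= -(mulrA (\prod_(k < m) _)); congr (_ * _).
  have y0 : x / q ^+ m.+1 != 0 by rewrite mulf_neq0// invr_eq0.
  have yl : ~ lattice (x / q ^+ m.+1).
    have := @nlattice_pq 0 (- m.+1%:Z) x xl; rewrite expr0z mul1r mulrC.
    by rewrite -[q ^ - _]invr_expz.
  rewrite -(theta_inv p1 _ p0); last by rewrite !mulf_neq0 ?invr_eq0.
  rewrite (_ : p / _ = x / q ^+ m.+1); last by rewrite !exprS; field; rewrite !(p0, q0, x0, qn).
  rewrite -(gamma_shiftq y0 yl) (_ : q * _ = x / q ^+ m)//.
  by rewrite !exprS; field; rewrite q0 qn.
have [d Hd] := theta_shiftn m q1 q0.
exists (c * d / (p ^+ l.+1) ^+ m) => x x0 xl; rewrite IH//.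
have y0 : x / (p ^+ l.+1 * q ^+ m) != 0 by rewrite !mulf_neq0 ?invr_eq0 ?mulf_neq0.
have yl : ~ lattice (x / (p ^+ l.+1 * q ^+ m)).
  have := @nlattice_pq (- l.+1%:Z) (- m%:Z) x xl; rewrite mulrC.
  by rewrite -[p ^ - _]invr_expz -[q ^ - _]invr_expz invfM.
have z0 : x / p ^+ l.+1 != 0 by rewrite mulf_neq0// invr_eq0.
have -> : Gam (x / (p ^+ l * q ^+ m)) =
    d * (x / p ^+ l.+1) ^+ m * theta (p ^+ l * (p * q / x)) q * Gam (x / (p ^+ l.+1 * q ^+ m)).
  rewrite -(theta_inv q1 _ q0); last by rewrite !mulf_neq0 ?invr_eq0.
  rewrite (_ : q / _ = x / p ^+ l.+1); last by rewrite exprS; field; rewrite !(p0, q0, x0, pn).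
  rewrite -Hd//; have := gamma_shiftp y0 yl.
  rewrite (_ : p * _ = x / (p ^+ l * q ^+ m)); last by rewrite exprS; field; rewrite p0 pn qn.
  by rewrite -[x / p ^+ l.+1 / q ^+ m]mulrA -invfM.
rewrite /theta2 big_ord_recr /= expr_div_n mulSn exprD -!mulrA.
by field; rewrite expf_neq0.
Qed.

Definition Gpole (c : C) l m x : C := c * x ^+ (l * m) * Gam (x / (p ^+ l * q ^+ m)).

Lemma sg_true (x : C) : x ^ sg true = x^-1. Proof. by []. Qed.
Lemma sg_false (x : C) : x ^ sg false = x. Proof. by rewrite /sg expr0 expr1z. Qed.
Lemma sg2 (x : C) e : x ^ (2 * sg e) = (x ^ sg e) ^+ 2.
Proof. by case: e; rewrite ?sg_true ?sg_false ?exprVn. Qed.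

Lemma prod_sg (F : C -> C) z : \prod_(e : bool) F (z ^ sg e) = F z^-1 * F z.
Proof. by rewrite big_bool sg_true sg_false. Qed.

Lemma prod_sg_sg (F : C -> C) z e : \prod_(e' : bool) F ((z ^ sg e) ^ sg e') = \prod_(e' : bool) F (z ^ sg e').
Proof. by rewrite !prod_sg; case: e; rewrite ?sg_true ?sg_false// invrK mulrC. Qed.

Section Density.
Variables (T : 6.-tuple C).

Definition dvar1 z : C := (\prod_(r < 6) Gam (tnth T r * z)) / Gam (z ^+ 2).
Definition dvar z : C := \prod_(e : bool) dvar1 (z ^ sg e).
Definition dpair1 x y : C := Gam (t * x * y) / Gam (x * y).
Definition dpairl y x : C := \prod_(e' : bool) dpair1 x (y ^ sg e').
Definition dpair x y : C := \prod_(e : bool) dpairl y (x ^ sg e).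

Lemma dvar_sg z e : dvar (z ^ sg e) = dvar z.
Proof. exact: prod_sg_sg. Qed.

Lemma dpair_sg x y e e' : dpair (x ^ sg e) (y ^ sg e') = dpair x y.
Proof.
apply: etrans (@prod_sg_sg (dpairl (y ^ sg e')) x e) _.
by apply: eq_bigr => b _; exact: (@prod_sg_sg (dpair1 (x ^ sg b)) y e').
Qed.

Lemma selberg_densityE n (z : 'rV[C]_n) : selberg_density T t p q z =
  (\prod_(i < n) dvar (z 0 i)) * \prod_(i < n) \prod_(j < n | (i < j)%N) dpair (z 0 i) (z 0 j).
Proof.
rewrite /selberg_density mulrC; congr (_ * _); apply: eq_bigr => i _.
by apply: eq_bigr => e _; rewrite sg2.
Qed.

End Density.

Definition cvar (us : seq C) z : C := (\prod_(u <- us) theta (u * z) p) / theta (z ^+ 2) p.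
Definition cpair x y : C := theta (t * x * y) p / theta (x * y) p.

Lemma diff_opE n (sq a b c d : C) (f : 'rV[C]_n -> C) z :
  diff_op sq a b c d t p f z = \sum_(s : {ffun 'I_n -> bool})
    (\prod_(i < n) cvar [:: a; b; c; d] (z 0 i ^ sg (s i))) *
    (\prod_(i < n) \prod_(j < n | (i < j)%N) cpair (z 0 i ^ sg (s i)) (z 0 j ^ sg (s j))) *
    f (\row_i (sq ^ sg (s i) * z 0 i)).
Proof.
apply: eq_bigr => s _; congr (_ * _ * _); apply: eq_bigr => i _.
by rewrite /cvar sg2.
Qed.

(** The one-variable coefficient with sign +1 times the density, after cancellation: the thetas of
    the first three parameters turn Gamma(a z) into Gamma(q a z), and 1/theta(z^2; p) cancels one of
    the two thetas of the reflection factor. The theta of the fourth parameter [a3] remains. *)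
Definition tvar (a0 a1 a2 a3 b0 b1 b2 z : C) : C :=
  \prod_(a <- [:: a0; a1; a2]) (Gam (q * a * z) * Gam (a / z)) *
  \prod_(b <- [:: b0; b1; b2]) (Gam (b * z) * Gam (b / z)) *
  (theta (a3 * z) p * theta (z ^+ 2)^-1 q).

Definition tpair x y : C :=
  Gam (t * q * x * y) * Gam (t / (x * y)) * (Gam (t * (x / y)) * Gam (t / (x / y))) *
  (theta (x * y)^-1 q * Vpq (x / y)).

Let theta_reflect x : x != 0 -> ~ lattice x ->
  (theta x p)^-1 * ((Gam x)^-1 * (Gam x^-1)^-1) = theta x^-1 q.
Proof.
move=> x0 xl; rewrite -invfM gamma_reflect// /Vpq mulrA mulVf ?mul1r//.
exact: theta_neq0.
Qed.

Lemma tvarE (T : 6.-tuple C) (a0 a1 a2 a3 b0 b1 b2 z : C) :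
  (forall F : C -> C, \prod_(r < 6) F (tnth T r) = F a0 * F a1 * F a2 * (F b0 * F b1 * F b2)) ->
  z != 0 -> (forall a, a \in [:: a0; a1; a2] -> a != 0 /\ ~ lattice (a * z)) -> ~ lattice (z ^+ 2) ->
  cvar [:: a0; a1; a2; a3] z * dvar T z = tvar a0 a1 a2 a3 b0 b1 b2 z.
Proof.
move=> HT z0 ha hz.
have key a : a \in [:: a0; a1; a2] -> Gam (q * a * z) = theta (a * z) p * Gam (a * z).
  by move=> /ha[a00 al]; rewrite -mulrA gamma_shiftq// mulf_neq0.
rewrite /cvar /dvar /tvar prod_sg /dvar1 !(HT (fun x => Gam (x * _))) !big_cons !big_nil.
rewrite !key ?inE ?eqxx ?orbT//.
rewrite exprVn -theta_reflect ?expf_neq0//; ring.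
Qed.

Lemma tpairE x y : t != 0 -> x != 0 -> y != 0 -> ~ lattice (t * x * y) -> ~ lattice (x * y) -> ~ lattice (x / y) ->
  cpair x y * dpair x y = tpair x y.
Proof.
move=> t0 x0 y0 h1 h2 h3; rewrite /cpair /dpair /tpair prod_sg /dpairl !prod_sg /dpair1.
have -> : Gam (t * q * x * y) = theta (t * x * y) p * Gam (t * x * y).
  rewrite -(gamma_shiftq _ h1); last by rewrite !mulf_neq0.
  by rewrite (_ : q * _ = t * q * x * y)//; ring.
rewrite -theta_reflect ?mulf_neq0// -(gamma_reflect _ h3) ?mulf_neq0 ?invr_eq0//.
rewrite (_ : t / (x * y) = t * x^-1 * y^-1); last by rewrite invfM mulrA.
rewrite (_ : t * (x / y) = t * x * y^-1); last by rewrite mulrA.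
rewrite (_ : t / (x / y) = t * x^-1 * y); last by rewrite invfM invrK mulrA.
rewrite (_ : (x * y)^-1 = x^-1 * y^-1); last by rewrite invfM.
rewrite (_ : (x / y)^-1 = x^-1 * y); last by rewrite invfM invrK.
by rewrite invfM; ring.
Qed.

Section Duality.
Variables (sq : C).
Hypothesis hsq : sq ^+ 2 = q.
Let sq0 := sqrt_neq0 hq hsq.

(** The substitution exchanges t q x y with t/(x y) and replaces x/y by its inverse, so the Gamma
    factors are permuted. This works because the substitution contains an inversion besides the
    scaling. *)
Lemma tpair_dual x y : x != 0 -> y != 0 -> tpair (sq * x)^-1 (sq * y)^-1 = tpair x y.
Proof.
move=> x0 y0; rewrite /tpair.
rewrite (_ : t * q * (sq * x)^-1 * (sq * y)^-1 = t / (x * y)); last first.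
  by rewrite -hsq; field; rewrite !(x0, y0, sq0).
rewrite (_ : t / ((sq * x)^-1 * (sq * y)^-1) = t * q * x * y); last first.
  by rewrite -hsq; field; rewrite !(x0, y0, sq0).
rewrite (_ : (sq * x)^-1 / (sq * y)^-1 = (x / y)^-1); last by field; rewrite !(x0, y0, sq0).
rewrite Vpq_inv ?mulf_neq0 ?invr_eq0//.
rewrite (_ : ((sq * x)^-1 * (sq * y)^-1)^-1 = q / (x * y)^-1); last first.
  by rewrite -hsq; field; rewrite !(x0, y0, sq0).
rewrite (theta_inv q1) ?invr_eq0 ?mulf_neq0// !invrK.
by ring.
Qed.

(** The two triples of parameters trade places, scaled by [sq] in opposite directions. The relation
    between [a3] and [a3'] is what the balancing condition says about the fourth parameters. *)
Lemma tvar_dual (a0 a1 a2 a3 b0 b1 b2 a3' z : C) : z != 0 -> a3 != 0 -> a3' = sq * p / a3 ->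
  tvar (sq^-1 * b0) (sq^-1 * b1) (sq^-1 * b2) a3' (sq * a0) (sq * a1) (sq * a2) (sq * z)^-1 =
  tvar a0 a1 a2 a3 b0 b1 b2 z.
Proof.
move=> z0 a30 ->; rewrite /tvar !big_cons !big_nil.
have e1 b : q * (sq^-1 * b) / (sq * z) = b / z by rewrite -hsq; field; rewrite z0 sq0.
have e2 b : sq^-1 * b / (sq * z)^-1 = b * z by field; rewrite z0 sq0.
have e3 a : sq * a / (sq * z) = a / z by field; rewrite z0 sq0.
have e4 a : sq * a / (sq * z)^-1 = q * a * z by rewrite -hsq; field; rewrite z0 sq0.
rewrite !e1 !e2 !e3 !e4.
rewrite (_ : sq * p / a3 / (sq * z) = p / (a3 * z)); last by field; rewrite !(z0, sq0, a30).
rewrite (theta_inv p1) ?mulf_neq0//.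
rewrite (_ : ((sq * z)^-1 ^+ 2)^-1 = q / (z ^+ 2)^-1); last by rewrite -hsq; field; rewrite z0 sq0.
rewrite (theta_inv q1) ?invr_eq0 ?expf_neq0//; ring.
Qed.

End Duality.
End GammaIdentities.

(** * Holomorphic functions of several variables *)

Section SeveralVariables.
Variables (R : realType) (n : nat).
Local Notation C := R[i].
Implicit Types (F G : 'rV[C]_n -> C) (z : 'rV[C]_n).

Definition hol1 F z := rcont F z /\ forall i, cdiff (fun x => F (set_coord i x z)) (z 0 i).

Lemma hol1_cst k z : hol1 (fun=> k) z.
Proof. by split=> [|i]; [exact: rcont_cst|exact: cdiff_cst]. Qed.

Lemma hol1_coord i z : hol1 (fun w => w 0 i) z.
Proof.
split=> [|j]; first exact: rcont_coord.
case: (eqVneq i j) => [->|ij].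
  by apply: eq_cdiff (cdiff_id _) => x; rewrite set_coord_coord eqxx.
by apply: eq_cdiff (cdiff_cst (z 0 i) _) => x; rewrite set_coord_coord (negbTE ij).
Qed.

Lemma hol1M F G z : hol1 F z -> hol1 G z -> hol1 (fun w => F w * G w) z.
Proof. by move=> [f1 f2] [g1 g2]; split=> [|i]; [exact: rcontM|exact: cdiffM]. Qed.

Lemma hol1_comp (phi : C -> C) F z : cdiff phi (F z) -> hol1 F z -> hol1 (fun w => phi (F w)) z.
Proof.
move=> dphi [f1 f2]; split=> [|i].
  by apply: rcont_comp f1 _ => e e0; exact: cdiff_cont dphi e e0.
by apply: cdiff_comp (f2 i) _; rewrite set_coord_id.
Qed.

Lemma hol1V F z : F z != 0 -> hol1 F z -> hol1 (fun w => (F w)^-1) z.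
Proof. by move=> F0; apply: hol1_comp; exact: cdiff_inv. Qed.

Lemma hol1_prod (I : Type) (r : seq I) (P : pred I) (F : I -> 'rV[C]_n -> C) z :
  (forall i, P i -> hol1 (F i) z) -> hol1 (fun w => \prod_(i <- r | P i) F i w) z.
Proof.
move=> H; elim: r => [|i r [IH1 IH2]].
  by have [h1 h2] := hol1_cst 1 z; split=> [|i] => [e /h1[d d0 Hd]|];
    [exists d => // w ww; rewrite !big_nil; have := Hd w ww|
     apply: eq_cdiff (h2 i) => x; rewrite big_nil].
case Pi: (P i); last first.
  split=> [e /IH1[d d0 Hd]|j]; first by exists d => // w ww; rewrite !big_cons Pi; exact: Hd.
  by apply: eq_cdiff (IH2 j) => x; rewrite big_cons Pi.
have [h1 h2] := hol1M (H i Pi) (conj IH1 IH2).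
split=> [e /h1[d d0 Hd]|j]; first by exists d => // w ww; rewrite !big_cons Pi; exact: Hd.
by apply: eq_cdiff (h2 j) => x; rewrite big_cons Pi.
Qed.

Lemma hol1_map (a : 'I_n -> C -> C) F z : hol1 F (\row_i a i (z 0 i)) ->
  (forall i, cdiff (a i) (z 0 i)) -> hol1 (fun w => F (\row_i a i (w 0 i))) z.
Proof.
move=> [f1 f2] da; split.
  move=> e /f1[d d0 Hd].
  have /choice[r Hr] : forall i, exists r, 0 < r /\ forall w, nm (w - z 0 i) < r -> nm (a i w - a i (z 0 i)) < d.
    by move=> i; have [r r0 h] := cdiff_cont (da i) d0; exists r.
  have [s s0 Hs] : exists2 s, 0 < s & forall i, i \in enum 'I_n -> s <= r i.
    by apply: seq_min_gt0 => i _; case: (Hr i).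
  exists s => // w ww; apply: Hd => i; rewrite !mxE; apply: (Hr i).2.
  by apply: lt_le_trans (ww i) _; apply: Hs; rewrite mem_enum.
move=> i; have E x : \row_j a j (set_coord i x z 0 j) = set_coord i (a i x) (\row_j a j (z 0 j)).
  by apply/rowP => j; rewrite mxE !set_coord_coord mxE; case: eqVneq => [->|].
apply: (@eq_cdiff _ (fun x => F (set_coord i (a i x) (\row_j a j (z 0 j))))) => [x|]; first by rewrite E.
apply: (@cdiff_comp _ (fun x => F (set_coord i x (\row_j a j (z 0 j)))) (a i)); first exact: da.
by have := f2 i; rewrite mxE.
Qed.

End SeveralVariables.

(** * Integrands and the location of their poles *)

Section Integrands.
Variable R : realType.
Local Notation C := R[i].
Variables p q t : C.
Hypothesis hp : 0 < nm p < 1.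
Hypothesis hq : 0 < nm q < 1.
Let p0 := unit_neq0 hp.
Let q0 := unit_neq0 hq.
Let p1 := unit_lt1 hp.
Let q1 := unit_lt1 hq.
Local Notation Gam x := (ellGamma x p q).

Lemma cdiff_theta1 b (x : C) : nm b < 1 -> x != 0 -> cdiff (fun y => theta y b) x.
Proof.
move=> b1 x0; have := @cdiff_theta _ _ b1 1 x; rewrite mul1r => /(_ x0).
by apply: eq_cdiff => y; rewrite mul1r.
Qed.

Lemma cdiff_Vpq (x : C) : x != 0 -> cdiff (Vpq p q) x.
Proof.
move=> x0; apply: cdiffM; first exact: cdiff_theta1.
apply: (@cdiff_comp _ (fun y => theta y q)); first exact: cdiff_inv.
by apply: cdiff_theta1 => //; rewrite invr_eq0.
Qed.

Lemma cdiff_gamma (x : C) : x != 0 -> (forall j k : nat, p ^+ j * q ^+ k * x != 1) ->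
  cdiff (fun y => Gam y) x.
Proof.
move=> x0 h; apply: (@eq_cdiff _ (fun y => dprod p q (p * q / y) / dprod p q y)).
  by move=> y; rewrite ellGammaE.
apply: cdiff_div; [exact: dprod_neq0| |exact: cdiff_dprod].
apply: (@cdiff_comp _ (dprod p q)); last exact: cdiff_dprod.
by apply: cdiffM; [exact: cdiff_cst|exact: cdiff_inv].
Qed.

Definition gpts (l : seq C) : set C := [set x | exists a (i j : nat), a \in l /\ x = p ^+ i * q ^+ j * a].
Definition ginv (l : seq C) : set C := [set s^-1 | s in gpts l].

Section OnePoint.
Variables (Sin Sout : seq C) (z : C).
Hypothesis z0 : z != 0.
Hypothesis zin : ~ gpts Sin z.
Hypothesis zout : ~ ginv Sout z.

Lemma cdiff_gamma_out a : a \in Sout -> a != 0 -> cdiff (fun x => Gam (a * x)) z.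
Proof.
move=> al a0; apply: (@cdiff_comp _ (fun y => Gam y)); first exact: cdiff_lin.
apply: cdiff_gamma => [|j k]; first by rewrite mulf_neq0.
apply/eqP => e; apply: zout; exists (p ^+ j * q ^+ k * a); first by exists a, j, k.
have u0 : p ^+ j * q ^+ k * a != 0 by rewrite !mulf_neq0 ?expf_neq0.
by apply: (mulfI u0); rewrite mulfV// -e mulrA.
Qed.

Lemma cdiff_gamma_in a : a \in Sin -> a != 0 -> cdiff (fun x => Gam (a / x)) z.
Proof.
move=> al a0; apply: (@cdiff_comp _ (fun y => Gam y)); first by apply: cdiffM; [exact: cdiff_cst|exact: cdiff_inv].
apply: cdiff_gamma => [|j k]; first by rewrite mulf_neq0 ?invr_eq0.
apply/eqP => e; apply: zin; exists a, j, k; split=> //.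
by rewrite -[LHS]mul1r -e; field.
Qed.

Lemma cdiff_pole_out c l m a : a / (p ^+ l * q ^+ m) \in Sout -> a != 0 -> cdiff (fun x => Gpole p q c l m (a * x)) z.
Proof.
move=> al a0; apply: cdiffM.
  apply: cdiffM; first exact: cdiff_cst.
  apply: (@eq_cdiff _ (fun x => \prod_(i < l * m) (a * x))); first by move=> w; rewrite prodr_const card_ord.
  by apply: cdiff_prod => i _; exact: cdiff_lin.
apply: eq_cdiff (cdiff_gamma_out al _) => [x|]; first by rewrite mulrAC.
by rewrite mulf_neq0 ?invr_eq0 ?mulf_neq0 ?expf_neq0.
Qed.

Lemma cdiff_pole_in c l m a : a / (p ^+ l * q ^+ m) \in Sin -> a != 0 -> cdiff (fun x => Gpole p q c l m (a / x)) z.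
Proof.
move=> al a0; apply: cdiffM.
  apply: cdiffM; first exact: cdiff_cst.
  apply: (@eq_cdiff _ (fun x => \prod_(i < l * m) (a / x))); first by move=> w; rewrite prodr_const card_ord.
  by apply: cdiff_prod => i _; apply: cdiffM; [exact: cdiff_cst|exact: cdiff_inv].
apply: eq_cdiff (cdiff_gamma_in al _) => [x|]; first by rewrite mulrAC.
by rewrite mulf_neq0 ?invr_eq0 ?mulf_neq0 ?expf_neq0.
Qed.

End OnePoint.

(** Used with [kappa = 1] and [phi = Vpq] for the density, and with [kappa = q] and theta(1/x; q)
    for a single term. *)
Definition pair_factor (kappa : C) (phi : C -> C) x y : C :=
  Gam (t * kappa * x * y) * Gam (t / (x * y)) * (Gam (t * (x / y)) * Gam (t / (x / y))) *
  (phi (x * y) * Vpq p q (x / y)).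

Lemma hol1_pair n (kappa : C) phi (z : 'rV[C]_n) i j : t != 0 -> kappa != 0 -> z 0 i != 0 -> z 0 j != 0 ->
  pairfree (mset p q t) kappa (z 0 i) (z 0 j) -> (forall x, x != 0 -> cdiff phi x) ->
  hol1 (fun w => pair_factor kappa phi (w 0 i) (w 0 j)) z.
Proof.
move=> t0 k0 zi zj pf dphi.
have M a b : mset p q t (t * p ^+ a * q ^+ b) by exists a, b.
have hM : hol1 (fun w => w 0 i * w 0 j) z by apply: hol1M; exact: hol1_coord.
have hD : hol1 (fun w => w 0 i / w 0 j) z.
  by apply: hol1M; [exact: hol1_coord|apply: hol1V; [|exact: hol1_coord]].
have D0 : z 0 i / z 0 j != 0 by rewrite mulf_neq0 ?invr_eq0.
have M0 : z 0 i * z 0 j != 0 by rewrite mulf_neq0.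
have gam F : hol1 F z -> F z != 0 -> (forall a b : nat, p ^+ a * q ^+ b * F z != 1) -> hol1 (fun w => Gam (F w)) z.
  by move=> hF F0 FF; apply: (@hol1_comp _ _ (fun x => Gam x)) => //; exact: cdiff_gamma.
have mul F a : hol1 F z -> hol1 (fun w => a * F w) z by apply: hol1M; exact: hol1_cst.
have div F a : F z != 0 -> hol1 F z -> hol1 (fun w => a / F w) z.
  by move=> F0 hF; apply: hol1M; [exact: hol1_cst|exact: hol1V].
apply: hol1M; first (apply: hol1M; apply: hol1M).
- apply: gam => [| |a b].
  + by apply: hol1M; [apply: mul; exact: hol1_coord|exact: hol1_coord].
  + by rewrite !mulf_neq0.
  + have [_ _ _ /eqP] := pf _ (M a b); apply: contra_neq => <-; ring.
- apply: gam => [| |a b]; [exact: div|by rewrite mulf_neq0 ?invr_eq0|].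
  have [_ _ /eqP h _] := pf _ (M a b); apply: contra_neq h => h.
  by rewrite -[LHS]mul1r -h; field; rewrite zi zj.
- apply: gam => [| |a b]; [exact: mul|by rewrite mulf_neq0|].
  have [_ /eqP h _ _] := pf _ (M a b); apply: contra_neq h => h.
  by rewrite -[LHS]mul1r -h; field.
- apply: gam => [| |a b]; [exact: div|by rewrite mulf_neq0 ?invr_eq0|].
  have [/eqP h _ _ _] := pf _ (M a b); apply: contra_neq h => h.
  by rewrite -[LHS]mul1r -h; field; rewrite zi zj.
by apply: hol1M; [apply: (hol1_comp (dphi _ M0))|apply: (hol1_comp (cdiff_Vpq D0))].
Qed.

Section Product.
Variables (n : nat) (kappa : C) (Sin Sout : seq C) (phi chi : C -> C) (F1 F2 : 'rV[C]_n -> C) (a : C).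
Hypothesis t0 : t != 0.
Hypothesis k0 : kappa != 0.
Hypothesis a0 : a != 0.
Hypothesis hF1 : hol F1 (@torus R n).
Hypothesis hF2 : hol F2 (@torus R n).
Hypothesis dphi : forall x, x != 0 -> cdiff phi x.
Hypothesis dchi : forall z, z != 0 -> ~ gpts Sin z -> ~ ginv Sout z -> cdiff chi z.

(** The factor [a] is 1 for the density and [sq] for a term, in which the first function is
    evaluated at a shifted point. *)
Definition integrand (z : 'rV[C]_n) : C :=
  (\prod_(i < n) chi (z 0 i)) *
  (\prod_(i < n) \prod_(j < n | (i < j)%N) pair_factor kappa phi (z 0 i) (z 0 j)) *
  (F1 (\row_i (a * z 0 i)) * F2 z).

Lemma hol_integrand : hol integrand (holdom (mset p q t) (gpts Sin) (ginv Sout) kappa (n := n)).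
Proof.
move=> z [z1 z2]; have zT : torus z by move=> i; case: (z1 i).
apply: hol1M; first apply: hol1M.
- apply: hol1_prod => i _; apply: hol1_comp (hol1_coord i z).
  by have [h1 h2 h3] := z1 i; exact: dchi.
- apply: hol1_prod => i _; apply: hol1_prod => j ij; apply: hol1_pair => //.
  by apply: z2; apply/eqP => e; rewrite e ltnn in ij.
- apply: hol1M; last exact: hF2.
  apply: (@hol1_map _ _ (fun _ x => a * x)); last by move=> i; exact: cdiff_lin.
  by apply: hF1 => i; rewrite mxE mulf_neq0.
Qed.

End Product.
End Integrands.

(** * Generic points and symmetry under inversions *)

Section GenericPoints.
Variable R : realType.
Local Notation C := R[i].

Definition generically n (P : 'rV[C]_n -> Prop) := slim [set z | torus z /\ ~ P z].

Section Filter.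
Variable n : nat.
Implicit Types P Q : 'rV[C]_n -> Prop.

Lemma gen_mono P Q : (forall z, torus z -> P z -> Q z) -> generically P -> generically Q.
Proof. by move=> PQ; apply: sub_slim => z [Tz nQ]; split=> // Pz; apply: nQ; exact: PQ. Qed.

Lemma gen_and P Q : generically P -> generically Q -> generically (fun z => P z /\ Q z).
Proof.
move=> gP gQ; apply: sub_slim (slimU gP gQ) => z [Tz nPQ].
by have [Pz|nP] := pselect (P z); [right|left]; split=> // Qz; exact: nPQ.
Qed.

Lemma gen_fin (I : finType) (P : I -> 'rV[C]_n -> Prop) : (forall i, generically (P i)) ->
  generically (fun z => forall i, P i z).
Proof.
move=> gP; apply: sub_slim (slim_bigcup_fin gP) => z [Tz nP].
by apply: contrapT => h; apply: nP => i; apply: contrapT => nPi; apply: h; exists i.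
Qed.

Lemma gen_map (a : 'I_n -> C -> C) P : (forall i, injective (a i)) ->
  (forall i x, x != 0 -> a i x != 0) -> generically P -> generically (fun z => P (\row_i a i (z 0 i))).
Proof.
move=> inj a0 gP; apply: sub_slim (slim_map inj gP) => z [Tz nP]; split=> // i.
by rewrite mxE a0.
Qed.

Lemma gen_mero (f g : 'rV[C]_n -> C) : mero_eq f g -> generically (fun z => f z = g z).
Proof. by move=> /mero_eq_slim. Qed.

End Filter.

Section Lattice.
Variables p q t : C.
Hypothesis hp : 0 < nm p < 1.
Hypothesis hq : 0 < nm q < 1.
Hypothesis t0 : t != 0.
Local Notation lat := (lattice p q t).

Lemma countable_lattice : countable lat.
Proof.
have -> : lat = \bigcup_(e in [set: int * int * int]) [set p ^ e.1.1 * q ^ e.1.2 * t ^ e.2].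
  apply/seteqP; split=> [x [i [j [k ->]]]|x [[[i j] k] _ ->]]; first by exists (i, j, k).
  by exists i, j, k.
by apply: bigcup_countable => // e _; exact: countable1.
Qed.

Lemma nlattice_t x : ~ lat x -> ~ lat (t * x).
Proof.
move=> h [i [j [k e]]]; apply: h; exists i, j, (k - 1).
by rewrite expfzDr// -[x](mulKf t0) e exprN1; field.
Qed.

Definition generic_point (ls : seq C) n (z : 'rV[C]_n) :=
  [/\ torus z, forall i a, a \in ls -> ~ lat (a * z 0 i) /\ ~ lat (a / z 0 i),
    forall i, ~ lat (z 0 i ^+ 2) &
    forall i j : 'I_n, (i < j)%N -> ~ lat (z 0 i * z 0 j) /\ ~ lat (z 0 i / z 0 j)].

Lemma gen_generic_point ls n : (forall a, a \in ls -> a != 0) -> generically (generic_point ls (n := n)).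
Proof.
move=> ls0.
pose D := [set x | lat (x ^+ 2)] `|` \bigcup_(a in [set a | a \in ls]) ([set x | lat (a * x)] `|` [set x | lat (a / x)]).
have cD : countable D.
  apply: countable_setU.
    have -> : [set x | lat (x ^+ 2)] = \bigcup_(e in lat) [set x | x ^+ 2 = e].
      by apply/seteqP; split=> [x h|x [e h]]; [exists (x ^+ 2)|move=> /= ->].
    apply: bigcup_countable; first exact: countable_lattice.
    move=> e _; have [[x xe]|none] := pselect (exists x, x ^+ 2 = e); last first.
      by rewrite (_ : [set _ | _] = set0)// -subset0 => x xe; apply: none; exists x.
    apply: (@sub_countable _ _ _ ([set x] `|` [set - x])); last by apply: countable_setU; exact: countable1.
    apply: subset_card_le => y /= ye; have /eqP := congr2 (fun a b => a - b) ye xe.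
    by rewrite subrr subr_sqr mulf_eq0 subr_eq0 addr_eq0 => /orP[/eqP|/eqP]; [left|right].
  apply: bigcup_countable; first exact: finite_set_countable (finite_seq ls).
  move=> a /= al; have a0 := ls0 _ al.
  apply: countable_setU; apply: (countable_preimage _ countable_lattice) => x y.
    exact: mulfI.
  by move=> /(mulfI a0); exact: invr_inj.
apply: sub_slim (slim_coords n cD countable_lattice) => z [Tz nz].
apply: contrapT => h; apply: nz; split=> //.
- move=> i a al; split=> l; apply: h; left; exists i; right; exists a => //; [by left|by right].
- by move=> i l; apply: h; left; exists i; left.
- by move=> i j ij; split=> l; apply: h; right; exists i, j; do 2!split=> //; [left|right].
Qed.

Lemma generic_point_sg ls n (z : 'rV[C]_n) (s : 'I_n -> bool) :
  generic_point ls z -> generic_point ls (\row_i (z 0 i ^ sg (s i))).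
Proof.
move=> [Tz h1 h2 h3]; split=> [i|i a al|i|i j ij]; rewrite ?mxE.
- by case: (s i); rewrite ?sg_true ?sg_false ?invr_eq0.
- have [l1 l2] := h1 i a al.
  by case: (s i); rewrite ?sg_true ?sg_false ?invrK.
- case: (s i); rewrite ?sg_true ?sg_false// exprVn; apply: nlattice_inv; exact: h2.
have [l1 l2] := h3 i j ij.
case: (s i); case: (s j); rewrite ?sg_true ?sg_false ?invrK//.
- by split; [rewrite -invfM; exact: nlattice_inv|move=> /lattice_inv; rewrite invfM invrK].
- by split; [move=> /lattice_inv; rewrite invfM invrK|rewrite -invfM; exact: nlattice_inv].
Qed.

End Lattice.

Section Symmetry.
Variables (p q : C) (n : nat).

Definition flip (s : 'I_n -> bool) (z : 'rV[C]_n) : 'rV[C]_n := \row_i (z 0 i ^ sg (s i)).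

Lemma sg_inj e : injective (fun x : C => x ^ sg e).
Proof. by case: e => x y; rewrite ?sg_true ?sg_false//; exact: invr_inj. Qed.

Lemma sg_neq0 e (x : C) : x != 0 -> x ^ sg e != 0.
Proof. by case: e; rewrite ?sg_true ?sg_false ?invr_eq0. Qed.

Lemma gen_flip s (P : 'rV[C]_n -> Prop) : generically P -> generically (fun z => P (flip s z)).
Proof. by apply: (@gen_map n (fun i x => x ^ sg (s i))) => i; [exact: sg_inj|exact: sg_neq0]. Qed.

(** Symmetry is given for one coordinate at a time and only off a thin set. The inversions are
    composed by induction on the number of coordinates that may be flipped, staying at generic
    points throughout. *)
Lemma BCn_flip (f : 'rV[C]_n -> C) s : BCn_symmetric f -> generically (fun z => f (flip s z) = f z).
Proof.
move=> [_ sym].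
suff main k s' : (forall i : 'I_n, (k <= i)%N -> s' i = false) -> generically (fun z => f (flip s' z) = f z).
  by apply: (main n) => i; rewrite leqNgt ltn_ord.
elim: k s' => [|k IH] s' hs.
  have -> : (fun z => f (flip s' z) = f z) = (fun=> True).
    apply/funext => z; apply/propext; split=> // _; congr f; apply/rowP => i.
    by rewrite mxE hs// sg_false.
  by apply: sub_slim (slim0 _ _) => z [].
have [kn|nk] := ltnP k n; last by apply: IH => i ki; move: (leq_ltn_trans ki (ltn_ord i)); rewrite ltnNge nk.
pose i0 := Ordinal kn; pose s'' i := if i == i0 then false else s' i.
have g1 : generically (fun z => f (flip s'' z) = f z).
  apply: IH => i ki; rewrite /s''; case: eqP => // /eqP ne; apply: hs.
  by rewrite ltn_neqAle ki andbT; apply: contra_neq ne => e; exact/val_inj.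
case E: (s' i0); last first.
  apply: gen_mono g1 => z _ <-; congr f; apply/rowP => i; rewrite !mxE /s''.
  by case: eqP => [->|//]; rewrite E.
have g2 := gen_flip s'' (gen_mero (sym i0)).
apply: gen_mono (gen_and g1 g2) => z _ [<- <-]; congr f; apply/rowP => i.
rewrite set_coord_coord !mxE /s'' eqxx.
by case: eqP => [->|//]; rewrite E sg_true sg_false.
Qed.

Lemma calAspace_flip u0 f s : calAspace u0 p q f -> generically (fun z : 'rV[C]_n => f (flip s z) = f z).
Proof.
move=> [_ [N [c [g [h [Ag Ah /gen_mero fE]]]]]].
have gs : generically (fun z => forall k, g k (flip s z) = g k z).
  by apply: gen_fin => k; have [_ + _ _] := Ag k; exact: BCn_flip.
have hs : generically (fun z => forall k, h k (flip s z) = h k z).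
  by apply: gen_fin => k; have [_ + _ _] := Ah k; exact: BCn_flip.
apply: gen_mono (gen_and (gen_and gs hs) (gen_and fE (gen_flip s fE))) => z _ [[gz hz] [-> ->]].
by apply: eq_bigr => k _; rewrite gz hz.
Qed.

End Symmetry.
End GenericPoints.

(** * The integrand as a sum over sign vectors *)

Section Symmetrization.
Variable R : realType.
Local Notation C := R[i].
Variables p q t sq : C.
Hypothesis hp : 0 < nm p < 1.
Hypothesis hq : 0 < nm q < 1.
Hypothesis t0 : t != 0.
Hypothesis hsq : sq ^+ 2 = q.
Let p0 := unit_neq0 hp.
Let q0 := unit_neq0 hq.
Let sq0 := sqrt_neq0 hq hsq.
Variable n : nat.
Implicit Types (f g : 'rV[C]_n -> C) (z : 'rV[C]_n) (T : 6.-tuple C).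
Local Notation Gam x := (ellGamma x p q).
Local Notation lat := (lattice p q t).

Definition split_tuple T a0 a1 a2 b0 b1 b2 := forall F : C -> C,
  \prod_(r < 6) F (tnth T r) = F a0 * F a1 * F a2 * (F b0 * F b1 * F b2).

Definition fourth (a0 a1 a2 : C) : C := t ^ (1 - n%:Z) * p / (a0 * a1 * a2).
Definition dnorm (a0 a1 a2 : C) : C := \prod_(1 <= i < n.+1)
  (theta (t ^+ (n - i) * a0 * a1) p * theta (t ^+ (n - i) * a0 * a2) p * theta (t ^+ (n - i) * a1 * a2) p).

Definition term (a0 a1 a2 a3 b0 b1 b2 : C) f g z : C :=
  (\prod_(i < n) tvar p q a0 a1 a2 a3 b0 b1 b2 (z 0 i)) *
  (\prod_(i < n) \prod_(j < n | (i < j)%N) tpair p q t (z 0 i) (z 0 j)) *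
  (f (\row_i (sq * z 0 i)) * g z).

(** The density and, generically, [g] are invariant under flips, so both can be carried into the sum
    and evaluated at the flipped point, where the coefficient merges with the density into [tvar]
    and [tpair]. *)
Lemma symmetrized_density T a0 a1 a2 b0 b1 b2 f g : split_tuple T a0 a1 a2 b0 b1 b2 ->
  (forall a, a \in [:: a0; a1; a2] -> a != 0) ->
  (forall s, generically (fun z => f (flip s z) = f z)) ->
  (forall s, generically (fun z => g (flip s z) = g z)) ->
  generically (fun z => cal_diff_op sq a0 a1 a2 t p f z * g z * selberg_density T t p q z =
    (dnorm a0 a1 a2)^-1 * \sum_(s : {ffun 'I_n -> bool}) term a0 a1 a2 (fourth a0 a1 a2) b0 b1 b2 f g (flip s z)).
Proof.
move=> HT ha fs gs.
have gf : generically (fun z => forall s : {ffun 'I_n -> bool}, f (flip s (\row_i (sq * (flip s z) 0 i))) = f (\row_i (sq * (flip s z) 0 i))).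
  apply: gen_fin => s; apply: (gen_flip s (P := fun z => f (flip s (\row_i (sq * z 0 i))) = f (\row_i (sq * z 0 i)))).
  by apply: (@gen_map R n (fun _ x => sq * x)) (fs s) => i; [exact: mulfI|move=> x x0; rewrite mulf_neq0].
have gg : generically (fun z => forall s : {ffun 'I_n -> bool}, g (flip s z) = g z) by apply: gen_fin => s; exact: gs.
have gp := gen_generic_point p q t n ha.
apply: gen_mono (gen_and gp (gen_and gf gg)) => z _ [pz [fz gz]].
rewrite /cal_diff_op -/(fourth a0 a1 a2) -/(dnorm a0 a1 a2) diff_opE selberg_densityE.
rewrite [_ / dnorm _ _ _]mulrC -2!mulrA; congr (_ * _); rewrite mulr_suml; apply: eq_bigr => s _.
rewrite /term -(gz s) -(fz s).
rewrite (_ : flip s (\row_i (sq * flip s z 0 i)) = \row_i (sq ^ sg (s i) * z 0 i)); last first.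
  by apply/rowP => i; rewrite !mxE; case: (s i); rewrite ?sg_true ?sg_false// invfM invrK.
have [Tz h1 h2 h3] := generic_point_sg s pz.
have e1 : \prod_(i < n) tvar p q a0 a1 a2 (fourth a0 a1 a2) b0 b1 b2 (flip s z 0 i) =
    (\prod_(i < n) cvar p [:: a0; a1; a2; fourth a0 a1 a2] (z 0 i ^ sg (s i))) * \prod_(i < n) dvar p q T (z 0 i).
  rewrite -big_split /=; apply: eq_bigr => i _; rewrite mxE -(dvar_sg p q T (z 0 i) (s i)).
  apply/esym; apply: (tvarE (t := t)) => //.
  - by have := Tz i; rewrite mxE.
  - by move=> a al; split; [exact: ha|have [] := h1 i a al; rewrite mxE].
  - by have := h2 i; rewrite mxE.
have e2 : \prod_(i < n) \prod_(j < n | (i < j)%N) tpair p q t (flip s z 0 i) (flip s z 0 j) =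
    (\prod_(i < n) \prod_(j < n | (i < j)%N) cpair p t (z 0 i ^ sg (s i)) (z 0 j ^ sg (s j))) *
    (\prod_(i < n) \prod_(j < n | (i < j)%N) dpair p q t (z 0 i) (z 0 j)).
  rewrite -big_split /=; apply: eq_bigr => i _; rewrite -big_split /=; apply: eq_bigr => j ij.
  rewrite !mxE -(dpair_sg p q t (z 0 i) (z 0 j) (s i) (s j)).
  have [] := h3 i j ij; rewrite !mxE => l1 l2.
  rewrite -tpairE//; [by have := Tz i; rewrite mxE|by have := Tz j; rewrite mxE|].
  by rewrite -mulrA; exact: nlattice_t.
have alg (X Z A G Y W XY ZW : C) : XY = X * Y -> ZW = Z * W -> X * Z * A * (G * (Y * W)) = XY * ZW * (A * G).
  by move=> -> ->; ring.
exact: alg e1 e2.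
Qed.

Lemma term_dual a0 a1 a2 b0 b1 b2 f g :
  (forall a, a \in [:: a0; a1; a2; b0; b1; b2] -> a != 0) ->
  t ^ (2 * n%:Z - 2) * a0 * b0 * a1 * a2 * b1 * b2 = p * q ->
  (forall s, generically (fun z => f (flip s z) = f z)) ->
  (forall s, generically (fun z => g (flip s z) = g z)) ->
  generically (fun w =>
    term (sq^-1 * b0) (sq^-1 * b1) (sq^-1 * b2) (fourth (sq^-1 * b0) (sq^-1 * b1) (sq^-1 * b2))
      (sq * a0) (sq * a1) (sq * a2) g f w =
    term a0 a1 a2 (fourth a0 a1 a2) b0 b1 b2 f g (\row_i (sq * w 0 i)^-1)).
Proof.
move=> hne hbal fs gs.
have gg : generically (fun w => g (flip (fun=> true) (\row_i (sq * w 0 i))) = g (\row_i (sq * w 0 i))).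
  by apply: (@gen_map R n (fun _ x => sq * x)) (gs _) => i; [exact: mulfI|move=> x x0; rewrite mulf_neq0].
apply: gen_mono (gen_and (fs (fun=> true)) gg) => w Tw [fw gw].
have [a00 a10 a20 [b00 b10 b20]] : [/\ a0 != 0, a1 != 0, a2 != 0 & [/\ b0 != 0, b1 != 0 & b2 != 0]].
  by do !split; apply: hne; rewrite !inE eqxx ?orbT.
have F0 : fourth a0 a1 a2 != 0 by rewrite /fourth !mulf_neq0 ?invr_eq0 ?mulf_neq0 ?expfz_neq0.
(* The balancing condition enters the duality here: it makes the product of the two fourth
   parameters equal to [sq * p]. *)
have FE : fourth (sq^-1 * b0) (sq^-1 * b1) (sq^-1 * b2) = sq * p / fourth a0 a1 a2.
  have u0 : t ^ (1 - n%:Z) != 0 by rewrite expfz_neq0.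
  have e : t ^ (2 * n%:Z - 2) * (t ^ (1 - n%:Z) * t ^ (1 - n%:Z)) = 1.
    rewrite -!expfzDr// (_ : _ + _ = 0 :> int) ?expr0z//; ring.
  move: e hbal; rewrite /fourth; move: (t ^ (1 - n%:Z)) (t ^ (2 * n%:Z - 2)) u0 => u v u0 e hbal.
  have e2 : u^-1 ^+ 2 * (a0 * a1 * a2) * (b0 * b1 * b2) = p * sq ^+ 2.
    rewrite hsq -hbal (_ : u^-1 ^+ 2 = v); first by ring.
    by rewrite -[LHS]mul1r -e; field.
  have e3 : (b0 * b1 * b2)^-1 = u^-1 ^+ 2 * (a0 * a1 * a2) / (p * sq ^+ 2).
    by rewrite -e2; field; rewrite !(a00, a10, a20, b00, b10, b20, u0).
  have -> : u * p / (sq^-1 * b0 * (sq^-1 * b1) * (sq^-1 * b2)) = u * p * sq ^+ 3 * (b0 * b1 * b2)^-1.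
    by field; rewrite !(b00, b10, b20, sq0).
  by rewrite e3; field; rewrite !(a00, a10, a20, p0, sq0, u0).
have w0 i : w 0 i != 0 := Tw i.
rewrite /term; congr (_ * _ * _).
- apply: eq_bigr => i _; rewrite mxE -(tvar_dual hp hq hsq _ _ _ _ _ _ _ F0 FE); last by rewrite invr_eq0 mulf_neq0.
  by congr (tvar _ _ _ _ _ _ _ _ _ _); field; rewrite sq0 w0.
- apply: eq_bigr => i _; apply: eq_bigr => j _; rewrite !mxE.
  by apply/esym; apply: tpair_dual.
- rewrite mulrC; congr (_ * _).
    by rewrite -fw; congr f; apply/rowP => i; rewrite !mxE sg_true invfM mulrA mulfV// mul1r.
  by rewrite -gw; congr g; apply/rowP => i; rewrite !mxE sg_true.
Qed.

Section Representatives.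
Variables (u c : C) (l m : nat) (f F : 'rV[C]_n -> C).
Hypothesis hc : forall x, x != 0 -> ~ lat x ->
  Gam x = theta2 (p * q / x) p q l m * Gpole p q c l m x.
Hypothesis u0 : u != 0.

Lemma pole_factor_gamma z : torus z -> pole_factor u p q l m z * f z = F z ->
  (forall i, ~ lat (u * z 0 i) /\ ~ lat (u / z 0 i)) ->
  f z * \prod_(i < n) (Gam (u * z 0 i) * Gam (u / z 0 i)) =
  F z * \prod_(i < n) (Gpole p q c l m (u * z 0 i) * Gpole p q c l m (u / z 0 i)).
Proof.
move=> Tz <- hz; rewrite (mulrC (pole_factor _ _ _ _ _ _)) -[RHS]mulrA; congr (_ * _).
rewrite /pole_factor -big_split /=; apply: eq_bigr => i _.
have [l1 l2] := hz i.
rewrite (hc _ l1) ?mulf_neq0// (hc _ l2) ?mulf_neq0 ?invr_eq0//.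
rewrite (prod_sg (fun w => theta2 (p * q * w / u) p q l m)).
rewrite (_ : p * q * _ / u = p * q / (u * z 0 i)); last by field; rewrite u0 Tz.
rewrite (_ : p * q * _ / u = p * q / (u / z 0 i)); last by field; rewrite u0 Tz.
ring.
Qed.

End Representatives.

Section Integrands.
Variables (c1 c2 : C) (l1 m1 l2 m2 : nat) (f g F G : 'rV[C]_n -> C).
Hypothesis hc1 : forall x, x != 0 -> ~ lat x -> Gam x = theta2 (p * q / x) p q l1 m1 * Gpole p q c1 l1 m1 x.
Hypothesis hc2 : forall x, x != 0 -> ~ lat x -> Gam x = theta2 (p * q / x) p q l2 m2 * Gpole p q c2 l2 m2 x.

Definition density_var (a b : C) (bs : seq C) x : C :=
  Gpole p q c1 l1 m1 (a * x) * Gpole p q c1 l1 m1 (a / x) *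
  (Gpole p q c2 l2 m2 (b * x) * Gpole p q c2 l2 m2 (b / x)) *
  \prod_(b <- bs) (Gam (b * x) * Gam (b / x)) * Vpq p q (x ^+ 2).

(** The integrand as written has default values at poles and is arbitrary on thin sets. This
    representative agrees with it generically and is holomorphic off the genuine poles, so it can be
    integrated along deformed chains. *)
Definition density_rep a b bs : 'rV[C]_n -> C :=
  integrand p q t 1 (Vpq p q) (density_var a b bs) F G 1.

Lemma density_repE T a b b1 b2 b3 b4 : split_tuple T a b b1 b2 b3 b4 ->
  (forall x, x \in [:: a; b] -> x != 0) ->
  generically (fun z => pole_factor a p q l1 m1 z * f z = F z) ->
  generically (fun z => pole_factor b p q l2 m2 z * g z = G z) ->
  generically (fun z => f z * g z * selberg_density T t p q z = density_rep a b [:: b1; b2; b3; b4] z).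
Proof.
move=> HT hab fF gG; have gp := gen_generic_point p q t n hab.
have [a0 b0] : a != 0 /\ b != 0 by split; apply: hab; rewrite !inE eqxx ?orbT.
apply: gen_mono (gen_and gp (gen_and fF gG)) => z Tz [[_ h1 h2 h3] [fz gz]].
have ef := pole_factor_gamma hc1 a0 Tz fz (fun i => h1 i a (mem_head _ _)).
have eg := pole_factor_gamma hc2 b0 Tz gz (fun i => h1 i b (mem_last a [:: b])).
rewrite selberg_densityE /density_rep /integrand.
have e1 : \prod_(i < n) dvar p q T (z 0 i) = (\prod_(i < n) (Gam (a * z 0 i) * Gam (a / z 0 i))) *
   (\prod_(i < n) (Gam (b * z 0 i) * Gam (b / z 0 i))) *
   \prod_(i < n) ((\prod_(b <- [:: b1; b2; b3; b4]) (Gam (b * z 0 i) * Gam (b / z 0 i))) * Vpq p q (z 0 i ^+ 2)).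
  rewrite -!big_split /=; apply: eq_bigr => i _.
  rewrite /dvar prod_sg /dvar1 !(HT (fun x => Gam (x * _))) !big_cons big_nil.
  have -> : Vpq p q (z 0 i ^+ 2) = (Gam (z 0 i ^+ 2))^-1 * (Gam ((z 0 i ^+ 2)^-1))^-1.
    rewrite -(gamma_reflect hp hq _ (h2 i)) ?invfM//; apply: expf_neq0; exact: Tz.
  by rewrite exprVn; ring.
have e2 : \prod_(i < n) density_var a b [:: b1; b2; b3; b4] (z 0 i) =
   (\prod_(i < n) (Gpole p q c1 l1 m1 (a * z 0 i) * Gpole p q c1 l1 m1 (a / z 0 i))) *
   (\prod_(i < n) (Gpole p q c2 l2 m2 (b * z 0 i) * Gpole p q c2 l2 m2 (b / z 0 i))) *
   \prod_(i < n) ((\prod_(b <- [:: b1; b2; b3; b4]) (Gam (b * z 0 i) * Gam (b / z 0 i))) * Vpq p q (z 0 i ^+ 2)).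
  by rewrite -!big_split /=; apply: eq_bigr => i _; rewrite /density_var -!mulrA.
have e3 : \prod_(i < n) \prod_(j < n | (i < j)%N) dpair p q t (z 0 i) (z 0 j) =
    \prod_(i < n) \prod_(j < n | (i < j)%N) pair_factor p q t 1 (Vpq p q) (z 0 i) (z 0 j).
  apply: eq_bigr => i _; apply: eq_bigr => j ij; have [k1 k2] := h3 i j ij.
  have x0 := Tz i; have y0 := Tz j.
  rewrite /dpair prod_sg /dpairl !prod_sg /dpair1 /pair_factor.
  rewrite -(gamma_reflect hp hq _ k1) ?mulf_neq0// -(gamma_reflect hp hq _ k2) ?mulf_neq0 ?invr_eq0//.
  rewrite mulr1 (_ : t / (z 0 i * z 0 j) = t * (z 0 i)^-1 * (z 0 j)^-1); last by rewrite invfM mulrA.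
  rewrite (_ : t * (z 0 i / z 0 j) = t * z 0 i * (z 0 j)^-1); last by rewrite mulrA.
  rewrite (_ : t / (z 0 i / z 0 j) = t * (z 0 i)^-1 * z 0 j); last by rewrite invfM invrK mulrA.
  rewrite (_ : (z 0 i * z 0 j)^-1 = (z 0 i)^-1 * (z 0 j)^-1); last by rewrite invfM.
  rewrite (_ : (z 0 i / z 0 j)^-1 = (z 0 i)^-1 * z 0 j); last by rewrite invfM invrK.
  by rewrite !invfM; ring.
rewrite (_ : \row_i (1 * z 0 i) = z); last by apply/rowP => i; rewrite mxE mul1r.
rewrite e1 e2 e3; set A := \prod_(i < n) (Gam _ * _) in ef *; set B := \prod_(i < n) (Gam (b * _) * _) in eg *.
set A' := \prod_(i < n) (Gpole _ _ _ _ _ _ * _) in ef *; set B' := \prod_(i < n) (Gpole _ _ _ _ _ (b * _) * _) in eg *.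
set X := \prod_(i < n) _; set Y := \prod_(i < n) _.
transitivity ((f z * A) * (g z * B) * (X * Y)); first by ring.
by rewrite ef eg; ring.
Qed.

Definition term_var (a0 a1 a2 a3 b0 b1 b2 x : C) : C :=
  Gpole p q c1 l1 m1 (q * a0 * x) * Gpole p q c1 l1 m1 (a0 / x) *
  (Gpole p q c2 l2 m2 (b0 * x) * Gpole p q c2 l2 m2 (b0 / x)) *
  (\prod_(a <- [:: a1; a2]) (Gam (q * a * x) * Gam (a / x)) *
   \prod_(b <- [:: b1; b2]) (Gam (b * x) * Gam (b / x)) *
   (theta (a3 * x) p * theta (x ^+ 2)^-1 q)).

Definition term_rep a0 a1 a2 a3 b0 b1 b2 : 'rV[C]_n -> C :=
  integrand p q t q (fun x => theta x^-1 q) (term_var a0 a1 a2 a3 b0 b1 b2) F G sq.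

Lemma term_repE a0 a1 a2 a3 b0 b1 b2 : a0 != 0 -> b0 != 0 ->
  generically (fun z => pole_factor (sq * a0) p q l1 m1 z * f z = F z) ->
  generically (fun z => pole_factor b0 p q l2 m2 z * g z = G z) ->
  generically (fun z => term a0 a1 a2 a3 b0 b1 b2 f g z = term_rep a0 a1 a2 a3 b0 b1 b2 z).
Proof.
move=> a00 b00 fF gG.
have hl x : x \in [:: q * a0; a0; b0] -> x != 0 by rewrite !inE => /or3P[] /eqP -> //; rewrite mulf_neq0.
have gp := gen_generic_point p q t n hl.
have fF' : generically (fun z => pole_factor (sq * a0) p q l1 m1 (\row_i (sq * z 0 i)) * f (\row_i (sq * z 0 i)) = F (\row_i (sq * z 0 i))).
  by apply: (@gen_map R n (fun _ x => sq * x)) fF => i; [exact: mulfI|move=> x x0; rewrite mulf_neq0].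
apply: gen_mono (gen_and gp (gen_and fF' gG)) => z Tz [[_ h1 _ _] [fz gz]].
have ha0 i : sq * a0 * (\row_i (sq * z 0 i)) 0 i = q * a0 * z 0 i by rewrite mxE -hsq; ring.
have ha1 i : sq * a0 / (\row_i (sq * z 0 i)) 0 i = a0 / z 0 i by rewrite mxE; field; rewrite sq0 Tz.
have Tz' : torus (\row_i (sq * z 0 i)) by move=> i; rewrite mxE mulf_neq0.
have ef : f (\row_i (sq * z 0 i)) * \prod_(i < n) (Gam (q * a0 * z 0 i) * Gam (a0 / z 0 i)) =
    F (\row_i (sq * z 0 i)) * \prod_(i < n) (Gpole p q c1 l1 m1 (q * a0 * z 0 i) * Gpole p q c1 l1 m1 (a0 / z 0 i)).
  have := pole_factor_gamma hc1 (mulf_neq0 sq0 a00) Tz' fz.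
  under eq_bigr => i _ do rewrite ha0 ha1.
  under [X in (_ -> _ = _ * X) -> _]eq_bigr => i _ do rewrite ha0 ha1.
  apply => i; rewrite ha0 ha1; have [k1 _] := h1 i (q * a0) (mem_head _ _).
  by have [|_ k2] := h1 i a0; first by rewrite !inE eqxx orbT.
have eg := pole_factor_gamma hc2 b00 Tz gz (fun i => h1 i b0 (mem_last _ [:: a0; b0])).
rewrite /term /term_rep /integrand.
have e1 : \prod_(i < n) tvar p q a0 a1 a2 a3 b0 b1 b2 (z 0 i) = (\prod_(i < n) (Gam (q * a0 * z 0 i) * Gam (a0 / z 0 i))) *
   (\prod_(i < n) (Gam (b0 * z 0 i) * Gam (b0 / z 0 i))) *
   \prod_(i < n) (\prod_(a <- [:: a1; a2]) (Gam (q * a * z 0 i) * Gam (a / z 0 i)) *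
   \prod_(b <- [:: b1; b2]) (Gam (b * z 0 i) * Gam (b / z 0 i)) *
   (theta (a3 * z 0 i) p * theta (z 0 i ^+ 2)^-1 q)).
  rewrite -!big_split /=; apply: eq_bigr => i _; rewrite /tvar !big_cons !big_nil; ring.
have e2 : \prod_(i < n) term_var a0 a1 a2 a3 b0 b1 b2 (z 0 i) =
   (\prod_(i < n) (Gpole p q c1 l1 m1 (q * a0 * z 0 i) * Gpole p q c1 l1 m1 (a0 / z 0 i))) *
   (\prod_(i < n) (Gpole p q c2 l2 m2 (b0 * z 0 i) * Gpole p q c2 l2 m2 (b0 / z 0 i))) *
   \prod_(i < n) (\prod_(a <- [:: a1; a2]) (Gam (q * a * z 0 i) * Gam (a / z 0 i)) *
   \prod_(b <- [:: b1; b2]) (Gam (b * z 0 i) * Gam (b / z 0 i)) *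
   (theta (a3 * z 0 i) p * theta (z 0 i ^+ 2)^-1 q)).
  by rewrite -!big_split.
rewrite e1 e2; set A := \prod_(i < n) (Gam _ * _) in ef *; set B := \prod_(i < n) (Gam (b0 * _) * _) in eg *.
set A' := \prod_(i < n) (Gpole _ _ _ _ _ _ * _) in ef *; set B' := \prod_(i < n) (Gpole _ _ _ _ _ (b0 * _) * _) in eg *.
set X := \prod_(i < n) _; set Y := \prod_(i < n) \prod_(j < n | _) _.
set f1 := f _ in ef *; set F1 := F _ in ef *.
transitivity ((f1 * A) * (g z * B) * (X * Y)); first by ring.
by rewrite ef eg; ring.
Qed.

End Integrands.
End Symmetrization.

(** * Images of chains under inversion and scaling *)

Section Chains.
Variable R : realType.
Local Notation C := R[i].
Local Notation fnl := ((C -> C) -> C).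
Implicit Types (J : fnl) (T K I : set C).

Lemma mint_subst n (Js Js' : nat -> fnl) (h : nat -> C -> C) (Phi : 'rV[C]_n -> C) :
  (forall k f, Js' k f = Js k (fun z => f (h k z))) ->
  mint Js' Phi = mint Js (fun z => Phi (\row_i h i (z 0 i))).
Proof.
elim: n Js Js' h Phi => [|n IH] Js Js' h Phi H /=.
  by congr Phi; apply/rowP => -[].
rewrite H; apply: (congr1 (Js 0%N)); apply/funext => x.
rewrite (IH (fun k => Js k.+1) _ (fun k => h k.+1))//.
apply: (congr1 (fun u => mint _ u)); apply/funext => v; congr Phi; apply/rowP => i.
by case: (unliftP ord0 i) => [j|] ->; rewrite mxE ?cnsS ?cns0 ?mxE.
Qed.

(** The derivative of inversion would give the weight with a minus sign. The sign is dropped because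
    inversion takes the boundary of a region to that of the complement, that is, with reversed
    orientation. Under [wfun] the plain substitution z -> 1/z results. *)
Definition invJ J : fnl := fun f => J (fun z => f z^-1 * z^-1 ^+ 2).
Definition scaleJ (a : C) J : fnl := fun f => J (fun z => f (a * z) * a).

Lemma wfun_invJ J f : wfun (invJ J) f = wfun J (fun z => f z^-1).
Proof.
rewrite /wfun /invJ; apply: (congr1 J); apply/funext => z.
have [->|z0] := eqVneq z 0; first by rewrite !(invr0, mulr0, expr0n).
by rewrite -mulrA; congr (_ * _); field; rewrite z0 two_pi_i_neq0.
Qed.

Lemma wfun_scaleJ a J f : a != 0 -> wfun (scaleJ a J) f = wfun J (fun z => f (a * z)).
Proof.
move=> a0; rewrite /wfun /scaleJ; apply: (congr1 J); apply/funext => z.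
have [->|z0] := eqVneq z 0; first by rewrite !(invr0, mulr0, mul0r).
by rewrite -mulrA; congr (_ * _); field; rewrite z0 a0 two_pi_i_neq0.
Qed.

Lemma contT_shiftV T (b : C) : ~ T b -> contT T (fun z => (z - b)^-1).
Proof.
move=> Tb; apply: contT_V; last by apply: contT_B; [exact: contT_id|exact: contT_cst].
by move=> z Tz; rewrite subr_eq0; apply/eqP => zb; apply: Tb; rewrite -zb.
Qed.

Lemma adapted_scale K I (eta : R) T J (a : C) : a != 0 -> adapted K I (eta / nm a) T J ->
  adapted [set z | K (a^-1 * z)] [set z | I (a^-1 * z)] eta [set a * z | z in T] (scaleJ a J).
Proof.
move=> a0 [cJ J1 J2]; have na : 0 < nm a by rewrite nm_gt0.
have key z w : nm (a * z - a * w) = nm a * nm (z - w) by rewrite -mulrBr nmM.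
have val b : ~ T (a^-1 * b) -> scaleJ a J (fun z => (z - b)^-1) = J (fun z => (z - a^-1 * b)^-1).
  move=> Tb; apply: (cyc_ext cJ) => z Tz; have zb : z - a^-1 * b != 0.
    by rewrite subr_eq0; apply/eqP => zb; apply: Tb; rewrite -zb.
  rewrite (_ : a * z - b = a * (z - a^-1 * b)); last by rewrite mulrBr mulVKf.
  by rewrite invfM mulrAC mulVf// mul1r.
have mem b : ~ T (a^-1 * b) -> ~ [set a * z | z in T] b.
  by move=> Tb [z Tz zb]; apply: Tb; rewrite -zb mulKf.
split.
- apply: cyc_map cJ _ _ _; [by apply: contT_M; [exact: contT_cst|exact: contT_id]|exact: contT_cst|].
  by move=> z w _ _; exact: mulfI.
- move=> b bI; have [] := J1 (a^-1 * b).
    move=> w wb; have := bI (a * w); rewrite /= mulKf//; apply.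
    by rewrite -(mulVKf a0 b) key mulrC -ltr_pdivlMr.
  by move=> h1 h2; split; [exact: mem|rewrite val].
- move=> b bK; have [] := J2 (a^-1 * b).
    move=> [w Kw wb]; apply: bK; exists (a * w); first by rewrite /= mulKf.
    by rewrite -{1}(mulVKf a0 b) key mulrC -ltr_pdivlMr.
  by move=> h1 h2; split; [exact: mem|rewrite val].
Qed.

Section Inversion.
Variables K I : set C.
Hypothesis Kb : exists B : R, forall z, K z -> nm z < B.
Hypothesis oI : open_set I.
Hypothesis IK : I `<=` K.
Hypothesis I0 : I 0.
Hypothesis star : forall z, z != 0 -> (I z^-1 <-> ~ K z).

Let nm_invB (a b : C) : a != 0 -> b != 0 -> nm (b^-1 - a) = nm (b - a^-1) * nm a / nm b.
Proof.
move=> a0 b0; rewrite -nmV -!nmM -[RHS]nmN; congr nm.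
by field; rewrite a0 b0.
Qed.

(** Winding numbers become 1 minus those at the inverse point, which by [star] fit the same region
    again. Inversion distorts distances, so [eta] has to be small in terms of [e], of the bound [B]
    for [K], and of the radius [rho] of a disc about 0 contained in [I]. *)
Lemma adapted_inv (e : R) : 0 < e -> exists2 eta, 0 < eta & forall T J, adapted K I eta T J ->
  ~ T 0 /\ adapted K I e [set z^-1 | z in T] (invJ J).
Proof.
move=> e0; have [B HB] := Kb; have [rho rho0 Hrho] := oI I0.
have B0 : 0 < B by have := HB 0 (IK I0); rewrite nm0.
have c1 : 0 < (2 * B)^-1 by rewrite invr_gt0 mulr_gt0.
have c2 : 0 < e / (2 * B ^+ 2) by rewrite divr_gt0// mulr_gt0// exprn_gt0.
have c3 : 0 < rho / 2 by rewrite divr_gt0.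
have c4 : 0 < e * rho ^+ 2 / 2 by rewrite divr_gt0// mulr_gt0// exprn_gt0.
exists (Num.min (Num.min (2 * B)^-1 (e / (2 * B ^+ 2))) (Num.min (rho / 2) (e * rho ^+ 2 / 2))).
  by rewrite !lt_min c1 c2 c3 c4.
move=> T J; set eta := Num.min _ _ => -[cJ J1 J2].
have [g1 g2 g3 g4] : [/\ eta <= (2 * B)^-1, eta <= e / (2 * B ^+ 2), eta <= rho / 2 & eta <= e * rho ^+ 2 / 2].
  by split; rewrite /eta !ge_min lexx ?orbT.
have claim1 a : a != 0 -> inball I e a -> ~ near K eta a^-1.
  move=> a0 aI [b Kb' ba]; have na : nm a < B by apply/HB/IK; exact: inball_in aI.
  have na0 : 0 < nm a by rewrite nm_gt0.
  have iB : 2 * (2 * B)^-1 < nm a^-1.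
    by rewrite nmV invfM mulrA mulfV// mul1r ltf_pV2.
  have nb : (2 * B)^-1 < nm b by have := nm_subge a^-1 b; rewrite nm_sub => h; lra.
  have b0 : b != 0 by rewrite -nm_gt0; exact: lt_trans nb.
  case: (star b0) => /(_ _) h _; apply: h => //; apply: aI; rewrite nm_invB//.
  rewrite ltr_pdivrMr; last exact: lt_trans nb.
  have k1 : nm (b - a^-1) * nm a <= eta * B by rewrite ler_pM ?nm_ge0// ltW.
  have k2 : eta * B <= e / (2 * B ^+ 2) * B by rewrite ler_wpM2r// ltW.
  have k3 : e / (2 * B ^+ 2) * B = e * (2 * B)^-1 by field; rewrite gt_eqF.
  by rewrite k3 in k2; apply: le_lt_trans (le_trans k1 k2) _; rewrite ltr_pM2l.
have claim2 a : a != 0 -> ~ near K e a -> inball I eta a^-1.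
  move=> a0 aK w wa; apply: contrapT => nI.
  have w0 : w != 0 by apply/eqP => w0; apply: nI; rewrite w0.
  have Kw : K w^-1.
    apply: contrapT => nK; apply: nI; rewrite -[w]invrK; apply/star => //.
    by rewrite invr_eq0.
  have rw : rho <= nm w by rewrite leNgt; apply/negP => wr; apply: nI; apply: Hrho; rewrite subr0.
  have ra : rho / 2 <= nm a^-1 by have := nm_subge w a^-1; lra.
  have na : nm a <= 2 / rho.
    by rewrite -[nm a]invrK -nmV -[2 / rho]invrK invf_div lef_pV2// posrE// nm_gt0 invr_eq0.
  apply: aK; exists w^-1 => //; rewrite nm_invB// ltr_pdivrMr ?nm_gt0//.
  have k1 : nm (w - a^-1) * nm a < e * rho ^+ 2 / 2 * (2 / rho).
    have k0 : nm (w - a^-1) * nm a <= nm (w - a^-1) * (2 / rho) by rewrite ler_wpM2l// nm_ge0.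
    apply: le_lt_trans k0 _; rewrite ltr_pM2r ?divr_gt0//; lra.
  have k2 : e * rho ^+ 2 / 2 * (2 / rho) = e * rho by field; rewrite gt_eqF.
  by rewrite k2 in k1; apply: lt_le_trans k1 _; rewrite ler_pM2l.
have in0 : inball I eta 0.
  by move=> w; rewrite subr0 => ww; apply: Hrho; rewrite subr0; lra.
have [T0 J0] := J1 _ in0; split=> //.
have mem a : ~ T a^-1 -> ~ [set z^-1 | z in T] a by move=> Ta [z Tz za]; apply: Ta; rewrite -za invrK.
have Tne z : T z -> z != 0 by move=> Tz; apply/eqP => z0; apply: T0; rewrite -z0.
have val a : a != 0 -> ~ T a^-1 -> invJ J (fun z => (z - a)^-1) = two_pi_i R - J (fun z => (z - a^-1)^-1).
  move=> a0 Ta; rewrite -J0 -(cycB cJ); [|exact: contT_shiftV..].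
  apply: (cyc_ext cJ) => z Tz; have z0 := Tne z Tz.
  have za : z - a^-1 != 0 by rewrite subr_eq0; apply/eqP => zb; apply: Ta; rewrite -zb.
  have za1 : z * a - 1 != 0.
    by apply: contra_neq za => h; rewrite -[z](mulfK a0) -[z * a](subrK 1) h add0r mul1r subrr.
  have za2 : z^-1 - a != 0.
    by apply: contra_neq za1 => h; rewrite -[a](subrK z^-1) -[a - _]opprB h oppr0 add0r mulfV// subrr.
  rewrite subr0; have -> : z^-1 - a = - (z * a - 1) / z by field.
  have -> : z - a^-1 = (z * a - 1) / a by field.
  by field; rewrite a0 z0 za1.
split.
- apply: cyc_map cJ _ _ _; [by apply: contT_V => //; exact: contT_id| |by move=> z w _ _; exact: invr_inj].
  by apply: contT_M; apply: contT_V => //; exact: contT_id.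
- move=> a aI; have [->|a0] := eqVneq a 0.
    split; first by apply: mem; rewrite invr0.
    rewrite -J0; apply: (cyc_ext cJ) => z Tz; rewrite !subr0 invrK.
    by field; exact: Tne.
  have [Ta Ja] := J2 _ (claim1 a a0 aI).
  by split; [exact: mem|rewrite val// Ja subr0].
- move=> a aK; have a0 : a != 0.
    by apply/eqP => a0; apply: aK; exists 0; [exact: IK|rewrite a0 subrr nm0].
  have [Ta Ja] := J1 _ (claim2 a a0 aK).
  by split; [exact: mem|rewrite val// Ja subrr].
Qed.

End Inversion.

Lemma adapted_exists (M Sin Sout : set C) kappa (tau : R) K I (e : R) :
  (forall m, M m -> m != 0 /\ nm m <= tau) -> 0 < tau ->
  gcompact (M `|` [set 0]) -> gcompact (Sin `|` [set 0]) ->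
  (forall z, ~ Sout z -> exists2 r, 0 < r & forall w, nm (w - z) < r -> ~ Sout w) ->
  region M Sin Sout kappa K I -> 0 < e -> exists T J, adapted K I e T J.
Proof.
move=> HM tau0 gM gS cS reg e0.
have [eta [B [eta0 mg]]] : exists eta B, 0 < eta /\ margined M Sin Sout kappa K I eta B.
  by apply: (region_margined (tau := tau)).
pose d := Num.min e eta; have d0 : 0 < d by rewrite lt_min e0.
have mgd : margined M Sin Sout kappa K I d B by apply: margined_le mg; rewrite ?lexx// ge_min lexx orbT.
have h0 : 0 < d / 5 by rewrite divr_gt0.
have h4 : 4 * (d / 5) < d by lra.
have := cover_cells_adapted d0 mgd h0 h4; set T := edgeset _ _ _ _ _; set J := bdG _ _ _ _ _ => ad.
exists T, J; apply: adapted_le ad; have : d <= e by rewrite ge_min lexx.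
lra.
Qed.

End Chains.

(** * Integration of the symmetrized integrand *)

Section SymmetrizedIntegral.
Variable R : realType.
Local Notation C := R[i].
Variables p q t : C.
Hypothesis hp : 0 < nm p < 1.
Hypothesis hq : 0 < nm q < 1.
Hypothesis ht : 0 < nm t < 1.
Let p0 := unit_neq0 hp.
Let q0 := unit_neq0 hq.
Let t0 := unit_neq0 ht.
Local Notation M := (mset p q t).
Local Notation gpts := (gpts p q).
Local Notation ginv := (ginv p q).
Implicit Types (Sin Sout : seq C) (K I : set C).

Lemma mset_bound m : M m -> m != 0 /\ nm m <= nm t.
Proof.
move=> [i [j ->]]; rewrite !mulf_neq0 ?expf_neq0//; split=> //.
have le1 x k : 0 < nm x < 1 -> nm x ^+ k <= 1.
  by move=> /andP[/ltW h0 /ltW h1]; exact: exprn_ile1.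
rewrite !nmM !nmX -mulrA ler_piMr ?nm_ge0// -[leRHS]mulr1.
by rewrite ler_pM ?exprn_ge0 ?nm_ge0 ?le1.
Qed.

Lemma mset_small (e : R) : 0 < e -> exists2 m, M m & nm m < e.
Proof.
move=> e0; have /andP[h0 h1] := hp; have [|N HN] := @pow_small R (nm p) (nm t) e _ (nm_ge0 _) e0.
  by rewrite h1 ltW.
exists (t * p ^+ N * q ^+ 0); first by exists N, 0%N.
by rewrite expr0 mulr1 nmM nmX; exact: HN.
Qed.

Lemma gpts_monom Sin : gpts Sin `<=` monom p q t Sin.
Proof. by move=> x [a [i [j [aS ->]]]]; exists a, i, j, 0%N; split=> //; rewrite expr0; ring. Qed.

Lemma gpts_compact Sin : gcompact (gpts Sin `|` [set 0]).
Proof. exact: (gcompact_monom hp hq ht (@gpts_monom Sin)). Qed.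

Lemma gpts_neq0 Sin : (forall a, a \in Sin -> a != 0) -> ~ gpts Sin 0.
Proof.
move=> S0 [a [i [j [/S0 a0 /esym/eqP]]]].
by rewrite !mulf_eq0 (negbTE a0) !expf_eq0 (negbTE p0) (negbTE q0) !andbF.
Qed.

Lemma mset_compact : gcompact (M `|` [set 0]).
Proof.
apply: (gcompact_monom hp hq ht (as_ := [:: t])) => m [i [j ->]].
by exists t, i, j, 0%N; rewrite mem_head expr0 mulr1.
Qed.

Definition gregion Sin Sout kappa := region M (gpts Sin) (ginv Sout) kappa.
Definition ghol n Sin Sout kappa (F : 'rV[C]_n -> C) :=
  hol F (holdom M (gpts Sin) (ginv Sout) kappa (n := n)).

Section Regions.
Variables (Sin Sout : seq C) (kappa : C).
Hypothesis So0 : forall a, a \in Sout -> a != 0.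

Let tau0 : 0 < nm t. Proof. by case/andP: ht. Qed.
Let tau1 := unit_lt1 ht.
Let So_closed z : ~ ginv Sout z -> exists2 r, 0 < r & forall w, nm (w - z) < r -> ~ ginv Sout w.
Proof. apply: inv_closed; [exact: gpts_compact|exact: gpts_neq0]. Qed.

Lemma gregion_invariance K I K' I' n : nm kappa <= 1 -> gregion Sin Sout kappa K I -> gregion Sin Sout kappa K' I' ->
  exists2 eta, 0 < eta & forall (F : 'rV[C]_n -> C) Ts Js Ts' Js', ghol Sin Sout kappa F ->
    (forall k, adapted K I eta (Ts k) (Js k)) -> (forall k, adapted K' I' eta (Ts' k) (Js' k)) ->
    mint (fun k => wfun (Js k)) F = mint (fun k => wfun (Js' k)) F.
Proof.
move=> k1; apply: (region_invariance mset_bound tau0 tau1 k1 mset_compact _ So_closed).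
exact: gpts_compact.
Qed.

Lemma gregion_adapted K I (e : R) : gregion Sin Sout kappa K I -> 0 < e -> exists T J, adapted K I e T J.
Proof. exact: (adapted_exists mset_bound tau0 mset_compact (@gpts_compact Sin) So_closed). Qed.

Lemma gregion_margin K I : gregion Sin Sout kappa K I ->
  exists eta B, 0 < eta /\ margined M (gpts Sin) (ginv Sout) kappa K I eta B.
Proof. exact: (region_margined mset_bound tau0 mset_compact (@gpts_compact Sin) So_closed). Qed.

Lemma ghol_UC K I eta B n (F : 'rV[C]_n -> C) Ts Js :
  margined M (gpts Sin) (ginv Sout) kappa K I eta B -> ghol Sin Sout kappa F ->
  (forall k, adapted K I eta (Ts k) (Js k)) -> UC Ts F.
Proof.
move=> mg hF ad; apply: heine_cantor => [k|]; first exact: cyc_compact (ad_cyc (ad k)).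
apply: rcont_contV => z /(margin_holdom mg (fun k => adapted_margin (ad k))) /hF[]//.
Qed.

Lemma ghol_flip_UC K I eta B n (F : 'rV[C]_n -> C) T Ts Js (s : nat -> bool) :
  margined M (gpts Sin) (ginv Sout) kappa K I eta B -> ghol Sin Sout kappa F ->
  gcompact T -> ~ T 0 ->
  (forall k, adapted K I eta (Ts k) (Js k)) ->
  (forall k z, T z -> Ts k (z ^ sg (s k))) ->
  UC (fun=> T) (fun z => F (flip (fun i : 'I_n => s i) z)).
Proof.
move=> mg hF gT T0 ad TTs; apply: heine_cantor => //; apply: rcont_contV => z Tz.
have dz : holdom M (gpts Sin) (ginv Sout) kappa (flip (fun i : 'I_n => s i) z).
  apply: (margin_holdom mg (fun k => adapted_margin (ad k))) => i.
  by rewrite mxE; apply: TTs; exact: Tz.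
have [] := @hol1_map R n (fun i x => x ^ sg (s i)) F z (hF _ dz).
  move=> i; have z0 : z 0 i != 0 by apply/eqP => z0; apply: T0; rewrite -z0; exact: Tz.
  by case: (s i); [exact: cdiff_inv|exact: cdiff_id].
by [].
Qed.

End Regions.

Lemma kappa_one : nm (1 : C) <= 1. Proof. by rewrite nm1. Qed.

Definition nested_contour (Ct : contour R) := [/\ is_contour Ct, forall z, trace Ct z -> trace Ct z^-1 &
  forall (i j : nat) z, trace Ct z \/ inside Ct z -> inside Ct (p ^+ i * q ^+ j * t * z)].

(** [PhiL] represents the whole integrand; its poles are those that [Ct] separates, so it can be
    moved from [Ct] to the region of [K] and [I]. The summands may have other poles and are
    integrated only there. Flipping some coordinates of [Phi] amounts to inverting the corresponding
    chains, which stay adapted by [adapted_inv], so all [2 ^ n] integrals agree. *)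
Lemma symmetrized_integral (Ct : contour R) n (X PhiL Phi : 'rV[C]_n -> C) (c : C)
    (SinL SoutL Sin Sout : seq C) K I :
  nested_contour Ct -> (exists z, inside Ct z) -> gpts SinL `<=` inside Ct -> ginv SoutL `<=` outside Ct ->
  (forall a, a \in SoutL ++ Sout -> a != 0) ->
  gregion SinL SoutL 1 K I -> gregion Sin Sout 1 K I ->
  (forall z, z != 0 -> (I z^-1 <-> ~ K z)) ->
  ghol SinL SoutL 1 PhiL -> ghol Sin Sout 1 Phi ->
  generically (fun z => X z = PhiL z) ->
  generically (fun z => X z = c * \sum_(s : {ffun 'I_n -> bool}) Phi (flip s z)) ->
  exists2 eta, 0 < eta & forall T J, adapted K I eta T J ->
    torus_integral Ct X = c * 2 ^+ n * mint (fun=> wfun J) Phi.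
Proof.
move=> [isC Tinv Cmul] C0 Cin Cout S0 regL reg star hL hPhi XL XS.
have SL0 a : a \in SoutL -> a != 0 by move=> aS; apply: S0; rewrite mem_cat aS.
have So0 a : a \in Sout -> a != 0 by move=> aS; apply: S0; rewrite mem_cat aS orbT.
have regC : gregion SinL SoutL 1 (trace Ct `|` inside Ct) (inside Ct).
  apply: contour_region => //; [|by move=> m /mset_bound[]|exact: mset_small].
  by move=> m z [i [j ->]]; rewrite (_ : t * p ^+ i * q ^+ j = p ^+ i * q ^+ j * t); [exact: Cmul|ring].
have [eC [BC [eC0 mgC]]] := gregion_margin SL0 regC.
have [eL [BL [eL0 mgL]]] := gregion_margin SL0 regL.
have [eP [BP [eP0 mgP]]] := gregion_margin So0 reg.
have [e1 e10 inv1] := gregion_invariance SL0 n kappa_one regC regL.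
have [e2 e20 inv2] := gregion_invariance So0 n kappa_one reg reg.
have e3p : 0 < Num.min e2 eP by rewrite lt_min e20.
have [e3 e30 inv3] := adapted_inv (rg_bound reg) (rg_open reg) (rg_sub reg) (rg_zero reg) star e3p.
exists (Num.min (Num.min e1 eL) (Num.min e3 (Num.min e2 eP))); first by rewrite !lt_min e10 eL0 e30 e20.
move=> T J ad; set eta := Num.min _ _ in ad.
have [l1 l2 l3 l4] : [/\ eta <= e1, eta <= eL, eta <= e3 & eta <= Num.min e2 eP].
  by split; rewrite /eta ?le_min !ge_min !lexx ?orbT.
have adC e : 0 < e -> adapted (trace Ct `|` inside Ct) (inside Ct) e (trace Ct) (contour_integral Ct).
  exact: contour_adapted.
have cC := adapted_cyc mgC (adC _ eC0).
have cT : cyc T (wfun J) := adapted_cyc mgL (adapted_le l2 ad).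
have ucL : UC (fun=> T) PhiL.
  by apply: (ghol_UC mgL hL (Js := fun=> J)) => _; exact: adapted_le ad.
have [T0 adI] := inv3 T J (adapted_le l3 ad).
have adJ : adapted K I (Num.min e2 eP) T J := adapted_le l4 ad.
(* Functionals are indexed by [nat], sign vectors by ['I_n]; beyond [n] no coordinate is flipped. *)
pose ext (s : {ffun 'I_n -> bool}) k := if insub k is Some i then s i else false.
have extE s (i : 'I_n) : ext s i = s i by rewrite /ext valK.
pose Ts s k := if ext s k then [set z^-1 | z in T] else T.
pose Js s k := if ext s k then invJ J else J.
have adS s k : adapted K I (Num.min e2 eP) (Ts s k) (Js s k).
  by rewrite /Ts /Js; case: (ext s k).
have flipE (s : {ffun 'I_n -> bool}) (z : 'rV[C]_n) : flip s z = flip (fun i : 'I_n => ext s i) z.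
  by apply/rowP => i; rewrite !mxE extE.
have ucS (s : {ffun 'I_n -> bool}) : UC (fun=> T) (fun z => Phi (flip s z)).
  have -> : (fun z => Phi (flip s z)) = (fun z => Phi (flip (fun i : 'I_n => ext s i) z)).
    by apply/funext => z; rewrite flipE.
  apply: (ghol_flip_UC mgP hPhi (cyc_compact cT) T0 (Ts := Ts s) (Js := Js s)).
    by move=> k; apply: adapted_le (adS s k); rewrite ge_min lexx orbT.
  move=> k z Tz; rewrite /Ts; case: (ext s k); last by rewrite sg_false.
  by exists z.
have cTs (k : nat) : cyc T (wfun J) := cT.
have [ucSum sumE] := mint_sum (index_enum _) cTs ucS.
have ucc : UC (fun=> T) (fun z => c * \sum_(s : {ffun 'I_n -> bool}) Phi (flip s z)).
  have := UCD (n := n) c ucSum (UC_B ucL ucL).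
  by congr (UC _ _); apply/funext => z; rewrite subrr addr0.
rewrite torus_integralE.
have Cne z : trace Ct z -> z != 0 by case: isC => _ _ h _ /h.
have Tne z : T z -> z != 0 by move=> Tz; apply/eqP => z0; apply: T0; rewrite -z0.
have -> : mint (fun=> wfun (contour_integral Ct)) X = mint (fun=> wfun (contour_integral Ct)) PhiL.
  apply: (@mint_slim R n _ (fun=> trace Ct) _ _ _ (fun=> cC) XL).
    by apply: (ghol_UC mgC hL (Js := fun=> contour_integral Ct)) => _; exact: adC.
  move=> z Tz h; apply: contrapT => ne; apply: h; split=> // i; exact/Cne/Tz.
rewrite (inv1 PhiL (fun=> trace Ct) _ (fun=> T) (fun=> J) hL) //; [|by move=> _; exact: adC|by move=> _; exact: adapted_le ad].
have -> : mint (fun=> wfun J) PhiL = mint (fun=> wfun J) (fun z => c * \sum_(s : {ffun 'I_n -> bool}) Phi (flip s z)).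
  have PS : generically (fun z => PhiL z = c * \sum_(s : {ffun 'I_n -> bool}) Phi (flip s z)).
    by apply: gen_mono (gen_and XL XS) => z _ [<-].
  apply: (@mint_slim R n _ (fun=> T) _ _ _ cTs PS ucc) => z Tz h.
  by apply: contrapT => ne; apply: h; split=> // i; exact/Tne/Tz.
rewrite (mintZ c cTs ucSum) sumE -mulrA; congr (_ * _).
rewrite (eq_bigr (fun=> mint (fun=> wfun J) Phi)) => [|s _].
  by rewrite sumr_const card_ffun card_bool card_ord -natrX mulr_natl.
rewrite (inv2 Phi (fun=> T) (fun=> J) (Ts s) (Js s) hPhi).
- have -> : (fun z => Phi (flip s z)) = (fun z => Phi (flip (fun i : 'I_n => ext s i) z)).
    by apply/funext => z; rewrite flipE.
  apply/esym; apply: (mint_subst (Js := fun=> wfun J) (h := fun k z => z ^ sg (ext s k))) => k f.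
  rewrite /Js; case: (ext s k); first exact: wfun_invJ.
  by apply: (congr1 (wfun J)); apply/funext => z; rewrite sg_false.
- by move=> _; apply: adapted_le adJ; rewrite ge_min lexx.
- by move=> k; apply: adapted_le (adS s k); rewrite ge_min lexx.
Qed.

End SymmetrizedIntegral.

Lemma in_later (T : eqType) (x y : T) l : x \in l -> x \in y :: l.
Proof. by move=> xl; rewrite inE xl orbT. Qed.

Ltac find_mem := first [exact: mem_head | apply: in_later; find_mem].

(** * Regions for a single term, before and after scaling *)

Section Adjointness.
Variable R : realType.
Local Notation C := R[i].
Variables p q sq t : C.
Hypothesis hp : 0 < nm p < 1.
Hypothesis hq : 0 < nm q < 1.
Hypothesis ht : 0 < nm t < 1.
Hypothesis hsq : sq ^+ 2 = q.
Let p0 := unit_neq0 hp.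
Let q0 := unit_neq0 hq.
Let t0 := unit_neq0 ht.
Let sq0 := sqrt_neq0 hq hsq.
Let p1 := unit_lt1 hp.
Let q1 := unit_lt1 hq.
Local Notation M := (mset p q t).
Local Notation gpts := (gpts p q).
Local Notation ginv := (ginv p q).
Local Notation gregion := (gregion p q t).
Local Notation ghol := (ghol p q t).
Local Notation Gam x := (ellGamma x p q).

(** Since [M] is stable under [q], conditions imposed for all of [M] with [kappa = 1] include those
    with [kappa = q]. *)
Lemma mset_q m : M m -> M (q * m).
Proof. by move=> [i [j ->]]; exists i, j.+1; rewrite exprS; ring. Qed.

Lemma star_gregion (l : seq C) : (forall a, a \in l -> a != 0) ->
  (forall a b (i j k : int), a \in l -> b \in l -> a * b != p ^ i * q ^ j * t ^ k) ->
  exists K I : set C,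
    (forall Sin Sout : seq C, (forall a, a \in Sin ++ Sout -> gpts l a) -> gregion Sin Sout 1 K I) /\
    (forall z, z != 0 -> (I z^-1 <-> ~ K z)).
Proof.
move=> l0 lg; have [K [I [reg star _]]] := star_region hp hq ht l0 lg.
exists K, I; split=> // Sin Sout sub.
have key (S : seq C) : (forall a, a \in S -> gpts l a) -> gpts S `<=` monom p q t l.
  move=> Sl x [a [i [j [/Sl [b [i' [j' [bl ->]]]] ->]]]].
  by exists b, (i + i')%N, (j + j')%N, 0%N; split=> //; rewrite !exprD expr0; ring.
apply: reg; first by apply: key => a aS; apply: sub; rewrite mem_cat aS.
move=> s [x xS <-]; exists x => //; apply: key xS => a aS; apply: sub.
by rewrite mem_cat aS orbT.
Qed.

Section Rescaling.
Variables Sin Sout : seq C.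
Local Notation Sin' := [seq sq * a | a <- Sin].
Local Notation Sout' := [seq a / sq | a <- Sout].

Let gptsS (S : seq C) c x : c != 0 -> gpts S x -> gpts [seq c * a | a <- S] (c * x).
Proof. by move=> c0 [a [i [j [aS ->]]]]; exists (c * a), i, j; rewrite map_f//; split=> //; ring. Qed.

Let gptsI (S : seq C) x : ginv S x -> ginv [seq a / sq | a <- S] (sq * x).
Proof.
move=> [y /(gptsS (c := sq^-1))h <-]; exists (sq^-1 * y); last by rewrite invfM invrK.
have := h _; rewrite invr_eq0 => /(_ sq0).
by rewrite (@eq_map _ _ _ (fun a => a / sq))// => a; rewrite mulrC.
Qed.

(** Scaling both variables by [sq] multiplies their product by q: the poles of the term at x y = m
    and q m x y = 1 move to products equal to q m and to 1/m. Both are excluded by the conditions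
    with [kappa = 1]. *)
Lemma ghol_rescale n (F : 'rV[C]_n -> C) : ghol Sin Sout q F ->
  ghol Sin' Sout' 1 (fun w => F (\row_i (sq^-1 * w 0 i))).
Proof.
move=> hF w [w1 w2]; apply: (@hol1_map R n (fun _ x => sq^-1 * x)); last first.
  by move=> i; exact: cdiff_lin.
apply: hF; split=> [i|i j ij]; rewrite !mxE.
  have [wi0 nin nout] := w1 i; split; first by rewrite mulf_neq0 ?invr_eq0.
    by move=> /(gptsS sq0); rewrite mulVKf.
  by move=> /gptsI; rewrite mulVKf.
move=> m Mm; have [h1 h2 h3 h4] := w2 i j ij m Mm.
have [_ _ h5 _] := w2 i j ij _ (mset_q Mm).
have s1 : sq^-1 != 0 by rewrite invr_eq0.
split.
- by rewrite mulrCA => /(mulfI s1).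
- by rewrite mulrCA => /(mulfI s1).
- by move=> e; apply: h5; rewrite -e -hsq; field.
- by move=> e; apply: h4; apply: etrans e; rewrite -hsq; field.
Qed.

(** Because q z y is the product of [sq * z] and [sq * y], the clause [rg_inv] with [kappa = 1]
    becomes the one with [kappa = q]; for [rg_div] the multiplier [m] becomes [q * m]. *)
Lemma gregion_rescale K I : gregion Sin' Sout' 1 K I ->
  gregion Sin Sout q [set z | K (sq * z)] [set z | I (sq * z)].
Proof.
have nsq : 0 < nm sq by rewrite nm_gt0.
have key z w : nm (sq * z - sq * w) = nm sq * nm (z - w) by rewrite -mulrBr nmM.
have opn (A : set C) : open_set A -> open_set [set z | A (sq * z)].
  move=> oA z /oA[r r0 Hr]; exists (r / nm sq) => [|w wz]; first by rewrite divr_gt0.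
  by apply: Hr; rewrite key mulrC -ltr_pdivlMr.
move=> [[B HB] cK oI IK I0 mul div inv sin sout]; split.
- by exists (B / nm sq) => z /HB; rewrite nmM mulrC -ltr_pdivlMr.
- exact: (opn [set z | ~ K z]).
- exact: opn.
- by move=> z /IK.
- by rewrite /= mulr0.
- by move=> m z Mm Kz; rewrite /= mulrCA; exact: mul.
- move=> m z Mm nI; rewrite /= (_ : sq * (m / z) = (q * m) / (sq * z)); last first.
    have z0 : z != 0 by apply/eqP => z0; apply: nI; rewrite /= z0 mulr0.
    by rewrite -hsq; field; rewrite z0 sq0.
  by apply: div => //; exact: mset_q.
- move=> m z y Mm Kz Ky e; apply: (inv m _ _ Mm Kz Ky); apply: etrans e; rewrite -hsq; ring.
- by move=> z zS; apply: sin; exact: gptsS.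
- by move=> z zS; apply: sout; exact: gptsI.
Qed.

Lemma ghol_one n (F : 'rV[C]_n -> C) : ghol Sin Sout q F -> ghol Sin Sout 1 F.
Proof.
move=> hF z [z1 z2]; apply: hF; split=> // i j ij m Mm.
have [h1 h2 h3 _] := z2 i j ij m Mm; split=> //.
by have [_ _ _] := z2 i j ij _ (mset_q Mm); rewrite mul1r.
Qed.

Lemma gregion_q K I : gregion Sin Sout 1 K I -> gregion Sin Sout q K I.
Proof.
move=> [? ? ? ? ? ? ? inv ? ?]; split=> // m z y Mm Kz Ky.
by have := inv _ _ _ (mset_q Mm) Kz Ky; rewrite mul1r.
Qed.

End Rescaling.

Lemma cdiff_gammas Sin Sout (bs : seq C) (a : C) z : a != 0 -> z != 0 -> ~ gpts Sin z -> ~ ginv Sout z ->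
  (forall b, b \in bs -> [/\ b != 0, b \in Sin & a * b \in Sout]) ->
  cdiff (fun x => \prod_(b <- bs) (Gam (a * b * x) * Gam (b / x))) z.
Proof.
move=> a0 z0 zin zout hbs.
apply: (@eq_cdiff _ (fun x => \prod_(b <- bs | b \in bs) (Gam (a * b * x) * Gam (b / x)))) => [x|].
  by rewrite -big_seq.
apply: cdiff_prod => b /hbs[b0 b1 b2]; apply: cdiffM.
  by apply: (cdiff_gamma_out hp hq z0 zout b2); rewrite mulf_neq0.
exact: (cdiff_gamma_in hp hq z0 zin b1).
Qed.

Lemma cdiff_sqr z : cdiff (fun x : C => x ^+ 2) z.
Proof. by apply: (@eq_cdiff _ (fun x => x * x)) => //; apply: cdiffM; exact: cdiff_id. Qed.

Lemma hol_density n c1 c2 l1 m1 l2 m2 (F G : 'rV[C]_n -> C) a b bs (S : seq C) :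
  hol F (@torus R n) -> hol G (@torus R n) -> a != 0 -> b != 0 ->
  (forall x, x \in bs -> x != 0 /\ x \in S) ->
  a / (p ^+ l1 * q ^+ m1) \in S -> b / (p ^+ l2 * q ^+ m2) \in S ->
  ghol S S 1 (density_rep p q t c1 c2 l1 m1 l2 m2 F G a b bs).
Proof.
move=> hF hG a0 b0 hbs aS bS; apply: hol_integrand => //.
  by move=> x x0; exact: cdiff_Vpq.
move=> z z0 zin zout; apply: cdiffM; last first.
  apply: (@cdiff_comp _ (Vpq p q) (fun x => x ^+ 2)); first exact: cdiff_sqr.
  by apply: cdiff_Vpq => //; rewrite expf_neq0.
apply: cdiffM.
  apply: cdiffM; apply: cdiffM.
  - exact: (cdiff_pole_out hp hq z0 zout).
  - exact: (cdiff_pole_in hp hq z0 zin).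
  - exact: (cdiff_pole_out hp hq z0 zout).
  - exact: (cdiff_pole_in hp hq z0 zin).
apply: (@eq_cdiff _ (fun x => \prod_(b <- bs) (Gam (1 * b * x) * Gam (b / x)))).
  by move=> x; apply: eq_bigr => y _; rewrite mul1r.
apply: (cdiff_gammas _ z0 zin zout); first by rewrite oner_neq0.
by move=> x /hbs[x0 xS]; rewrite mul1r.
Qed.

Lemma hol_term n c1 c2 l1 m1 l2 m2 (F G : 'rV[C]_n -> C) a0 a1 a2 a3 b0 b1 b2 (Sin Sout : seq C) :
  hol F (@torus R n) -> hol G (@torus R n) -> (forall a, a \in [:: a0; a1; a2; a3; b0; b1; b2] -> a != 0) ->
  (forall x, x \in [:: a0 / (p ^+ l1 * q ^+ m1); a1; a2; b0 / (p ^+ l2 * q ^+ m2); b1; b2] -> x \in Sin) ->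
  (forall x, x \in [:: q * a0 / (p ^+ l1 * q ^+ m1); q * a1; q * a2; b0 / (p ^+ l2 * q ^+ m2); b1; b2] -> x \in Sout) ->
  ghol Sin Sout q (term_rep p q t sq c1 c2 l1 m1 l2 m2 F G a0 a1 a2 a3 b0 b1 b2).
Proof.
move=> hF hG hne hin hout; apply: hol_integrand => //.
  move=> x x0; apply: (@cdiff_comp _ (fun y => theta y q) (fun y => y^-1)); first exact: cdiff_inv.
  by apply: cdiff_theta1 => //; rewrite invr_eq0.
move=> z z0 zin zout; have [a00 b00 a30] : [/\ a0 != 0, b0 != 0 & a3 != 0].
  by split; apply: hne; [exact: mem_head|find_mem|find_mem].
apply: cdiffM.
  apply: cdiffM; apply: cdiffM.
  - by apply: (cdiff_pole_out hp hq z0 zout); [apply: hout; exact: mem_head|rewrite mulf_neq0].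
  - by apply: (cdiff_pole_in hp hq z0 zin); [apply: hin; exact: mem_head|].
  - by apply: (cdiff_pole_out hp hq z0 zout); [apply: hout; find_mem|].
  - by apply: (cdiff_pole_in hp hq z0 zin); [apply: hin; find_mem|].
apply: cdiffM.
  apply: cdiffM.
    apply: (cdiff_gammas q0 z0 zin zout) => a; rewrite !inE => /orP[]/eqP->.
      by split; [apply: hne; find_mem|apply: hin; find_mem|apply: hout; find_mem].
    by split; [apply: hne; find_mem|apply: hin; find_mem|apply: hout; find_mem].
  apply: (@eq_cdiff _ (fun x => \prod_(b <- [:: b1; b2]) (Gam (1 * b * x) * Gam (b / x)))).
    by move=> x; apply: eq_bigr => y _; rewrite mul1r.
  apply: (cdiff_gammas _ z0 zin zout) => [|a]; first by rewrite oner_neq0.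
  rewrite !inE mul1r => /orP[]/eqP->.
    by split; [apply: hne; find_mem|apply: hin; find_mem|apply: hout; find_mem].
  by split; [apply: hne; find_mem|apply: hin; find_mem|apply: hout; find_mem].
apply: cdiffM; first by apply: cdiff_theta => //; rewrite mulf_neq0.
apply: (@cdiff_comp _ (fun y => theta y q) (fun x => (x ^+ 2)^-1)); last first.
  by apply: cdiff_theta1 => //; rewrite invr_eq0 expf_neq0.
apply: (@cdiff_comp _ (fun y => y^-1) (fun x => x ^+ 2)); first exact: cdiff_sqr.
by apply: cdiff_inv; rewrite expf_neq0.
Qed.

Lemma contour_gpts (v0 v1 v2 v3 w0 w1 : C) (l m l' m' : nat) (Ct : contour R) :
  (forall i j : nat, forall a, a \in [:: p ^+ i * q ^+ j * v0; p ^+ i * q ^+ j * v1;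
     p ^+ i * q ^+ j * v2; p ^+ i * q ^+ j * v3;
     p ^ (i%:Z - l%:Z) * q ^ (j%:Z - m%:Z) * w0;
     p ^ (i%:Z - l'%:Z) * q ^ (j%:Z - m'%:Z) * w1] -> inside Ct a /\ outside Ct a^-1) ->
  forall a (i j : nat), a \in [:: v0; v1; v2; v3; w0 / (p ^+ l * q ^+ m); w1 / (p ^+ l' * q ^+ m')] ->
    inside Ct (p ^+ i * q ^+ j * a) /\ outside Ct (p ^+ i * q ^+ j * a)^-1.
Proof.
move=> h a i j al; apply: (h i j).
have e (k k' : nat) w : p ^+ i * q ^+ j * (w / (p ^+ k * q ^+ k')) = p ^ (i%:Z - k%:Z) * q ^ (j%:Z - k'%:Z) * w.
  by rewrite !expfzDr// -!invr_expz -!exprnP; field; rewrite !expf_neq0.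
rewrite -!e; have := map_f (fun x => p ^+ i * q ^+ j * x) al; exact.
Qed.

Section OneSide.
Variables (n : nat) (T : 6.-tuple C) (a0 a1 a2 b0 b1 b2 : C) (l1 m1 l2 m2 : nat).
Variables (Ct : contour R) (f g : 'rV[C]_n -> C).
Let S := [:: a1; a2; b1; b2; a0 / (p ^+ l1 * q ^+ m1); b0 / (p ^+ l2 * q ^+ m2)].

(** Serves both scalar products: the function with the difference operator is [f] here, so on the
    second side the two factors change places. *)
Lemma one_side (c : C) (Phi : 'rV[C]_n -> C) Sin Sout K I :
  split_tuple T a0 b0 a1 a2 b1 b2 -> (forall a, a \in [:: a0; a1; a2; b0; b1; b2] -> a != 0) ->
  nested_contour p q t Ct ->
  (forall a (i j : nat), a \in S -> inside Ct (p ^+ i * q ^+ j * a) /\ outside Ct (p ^+ i * q ^+ j * a)^-1) ->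
  is_holomorphic (fun z => pole_factor a0 p q l1 m1 z * f z) ->
  is_holomorphic (fun z => pole_factor b0 p q l2 m2 z * g z) ->
  gregion S S 1 K I -> gregion Sin Sout 1 K I -> (forall a, a \in Sout -> a != 0) ->
  (forall z, z != 0 -> (I z^-1 <-> ~ K z)) -> ghol Sin Sout 1 Phi ->
  generically (fun z => f z * g z * selberg_density T t p q z =
     c * \sum_(s : {ffun 'I_n -> bool}) Phi (flip s z)) ->
  exists2 eta, 0 < eta & forall X J, adapted K I eta X J ->
    torus_integral Ct (fun z => f z * g z * selberg_density T t p q z) =
    c * 2 ^+ n * mint (fun=> wfun J) Phi.
Proof.
move=> HT hne nC CS [F /holomorphic_hol hF /gen_mero fF] [G /holomorphic_hol hG /gen_mero gG].
move=> regS reg So0 star hPhi XS.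
have [c1 hc1] := gamma_pole t hp hq l1 m1; have [c2 hc2] := gamma_pole t hp hq l2 m2.
have a00 : a0 != 0 by apply: hne; rewrite mem_head.
have b00 : b0 != 0 by apply: hne; find_mem.
have S0 a : a \in S -> a != 0.
  have u0 x k k' : x != 0 -> x / (p ^+ k * q ^+ k') != 0.
    by move=> x0; rewrite mulf_neq0// invr_eq0 mulf_neq0// expf_neq0.
  rewrite /S !inE => /or4P[/eqP->|/eqP->|/eqP->|/or3P[/eqP->|/eqP->|/eqP->]]; rewrite ?u0//;
    apply: hne; [find_mem|find_mem|find_mem|find_mem].
have XL : generically (fun z => f z * g z * selberg_density T t p q z =
    density_rep p q t c1 c2 l1 m1 l2 m2 F G a0 b0 [:: a1; a2; b1; b2] z).
  apply: (density_repE hp hq hc1 hc2 HT) => // x; rewrite !inE => /orP[]/eqP-> //.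
apply: (symmetrized_integral hp hq ht nC _ _ _ _ regS reg star _ hPhi XL XS).
- by exists (p ^+ 0 * q ^+ 0 * a1); have [|] := CS a1 0%N 0%N; first by rewrite mem_head.
- by move=> x [a [i [j [aS ->]]]]; case: (CS a i j aS).
- by move=> x [y [a [i [j [aS ->]]]] <-]; case: (CS a i j aS).
- by move=> a; rewrite mem_cat => /orP[/S0|/So0].
apply: hol_density => //; last 2 first.
- find_mem.
- find_mem.
move=> x xb; have xS : x \in S by move: xb; rewrite /S !inE => /or4P[] ->; rewrite ?orbT.
by split=> //; exact: S0.
Qed.

End OneSide.
End Adjointness.

(** * The normalizing constants *)

Section Normalization.
Variable R : realType.
Local Notation C := R[i].
Variables p q sq t : C.
Hypothesis hp : 0 < nm p < 1.
Hypothesis hq : 0 < nm q < 1.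
Hypothesis ht : 0 < nm t < 1.
Hypothesis hsq : sq ^+ 2 = q.
Let p0 := unit_neq0 hp.
Let q0 := unit_neq0 hq.
Let t0 := unit_neq0 ht.
Let sq0 := sqrt_neq0 hq hsq.
Local Notation Gam x := (ellGamma x p q).

Lemma prod_tuple6 (F : C -> C) v0 v1 v2 v3 v4 v5 :
  \prod_(r < 6) F (tnth [tuple v0; v1; v2; v3; v4; v5] r) = F v0 * F v1 * F v2 * F v3 * F v4 * F v5.
Proof. by rewrite !big_ord_recr big_ord0 /= mul1r !(tnth_nth 0). Qed.

(** The 15 pairs are grouped by the effect of the parameter shift: products within the indices 0, 1,
    4 are multiplied by q, those within 2, 3, 5 are divided by q, and mixed ones do not change. *)
Lemma prod_pairs6 (G : C -> C -> C) v0 v1 v2 v3 v4 v5 (T := [tuple v0; v1; v2; v3; v4; v5]) :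
  \prod_(r < 6) \prod_(s < 6 | (r < s)%N) G (tnth T r) (tnth T s) =
  (G v0 v1 * G v0 v4 * G v1 v4) * (G v2 v3 * G v2 v5 * G v3 v5) *
  (G v0 v2 * G v0 v3 * G v0 v5 * G v1 v2 * G v1 v3 * G v1 v5 * G v2 v4 * G v3 v4 * G v4 v5).
Proof.
under eq_bigr => r _ do rewrite big_mkcond !big_ord_recr big_ord0.
by rewrite !big_ord_recr big_ord0 /= !(tnth_nth 0) /=; ring.
Qed.

(** The pairs multiplied by q produce the thetas of the left [dnorm], the pairs divided by q those
    of the right one. *)
Lemma selberg_norm_dual n t0' t1' t2' t3' u0 u1 (l := [:: t0'; t1'; t2'; t3'; u0; u1]) :
  (forall a b (i j k : int), a \in l -> b \in l -> a * b != p ^ i * q ^ j * t ^ k) ->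
  (forall a, a \in l -> a != 0) ->
  selberg_norm n [tuple t0'; t1'; t2'; t3'; u0; u1] t p q * dnorm p t n u0 t0' t1' =
  selberg_norm n [tuple sq * t0'; sq * t1'; sq^-1 * t2'; sq^-1 * t3'; sq * u0; sq^-1 * u1] t p q *
    dnorm p t n (sq^-1 * u1) (sq^-1 * t2') (sq^-1 * t3').
Proof.
move=> hgen hne.
have nl k a b : a \in l -> b \in l -> ~ lattice p q t (t ^+ k * a * b).
  move=> al bl [i [j [m e]]]; have /eqP := hgen a b i j (m - k%:Z) al bl; apply.
  have tk : t ^+ k != 0 by rewrite expf_neq0.
  rewrite expfzDr// -invr_expz -exprnP; apply: (mulfI tk).
  by rewrite mulrA e; field.
have [m0 m1 m2 [m3 m4 m5]] : [/\ t0' \in l, t1' \in l, t2' \in l & [/\ t3' \in l, u0 \in l & u1 \in l]].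
  by split; [|..|split]; rewrite /l; [exact: mem_head|find_mem|find_mem
    |find_mem|find_mem|find_mem].
rewrite /selberg_norm /dnorm; apply: etrans (esym (mulrA _ _ _)) _; apply: etrans _ (mulrA _ _ _).
congr (_ * _); rewrite -!big_split /=; apply: eq_bigr => i _.
apply: etrans (esym (mulrA _ _ _)) _; apply: etrans _ (mulrA _ _ _); congr (_ * _).
set x := t ^+ (n - i); have x0 : x != 0 by rewrite expf_neq0.
rewrite (prod_pairs6 (fun a b => Gam (x * a * b))) (prod_pairs6 (fun a b => Gam (x * a * b))).
have up a b : a \in l -> b \in l -> Gam (x * (sq * a) * (sq * b)) = theta (x * a * b) p * Gam (x * a * b).
  move=> al bl; rewrite (_ : x * (sq * a) * (sq * b) = q * (x * a * b)); last by rewrite -hsq; ring.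
  by apply: (gamma_shiftq (t := t) hp hq); [rewrite mulf_neq0 ?(hne b)// mulf_neq0 ?(hne a)|exact: nl].
have down a b : a \in l -> b \in l -> Gam (x * a * b) =
    theta (x * (sq^-1 * a) * (sq^-1 * b)) p * Gam (x * (sq^-1 * a) * (sq^-1 * b)).
  move=> al bl; have E : x * (sq^-1 * a) * (sq^-1 * b) = p ^ 0 * q ^ (-1) * (x * a * b).
    by rewrite exprN1 expr0z -hsq; field.
  have {1}-> : x * a * b = q * (x * (sq^-1 * a) * (sq^-1 * b)) by rewrite -hsq; field.
  apply: (gamma_shiftq (t := t) hp hq); first by rewrite !mulf_neq0 ?invr_eq0 ?(hne a) ?(hne b).
  by rewrite E; apply: nlattice_pq => //; exact: nl.
have cross a b : Gam (x * (sq * a) * (sq^-1 * b)) = Gam (x * a * b).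
  by rewrite (_ : x * (sq * a) * (sq^-1 * b) = x * a * b)//; field.
have cross' a b : Gam (x * (sq^-1 * a) * (sq * b)) = Gam (x * a * b).
  by rewrite (_ : x * (sq^-1 * a) * (sq * b) = x * a * b)//; field.
rewrite !cross !cross' (up _ _ m0 m1) (up _ _ m0 m4) (up _ _ m1 m4).
rewrite (down _ _ m2 m3) (down _ _ m2 m5) (down _ _ m3 m5).
rewrite (mulrAC x u0 t0') (mulrAC x u0 t1') (mulrAC x (sq^-1 * u1) (sq^-1 * t2')) (mulrAC x (sq^-1 * u1) (sq^-1 * t3')).
by ring.
Qed.

End Normalization.

(** * Bookkeeping of parameters and pole positions *)

Section MembershipTools.
Variable R : realType.
Local Notation C := R[i].
Implicit Types (l : seq C) (P : C -> Prop).

Lemma all_nil P : forall a, a \in [::] -> P a.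
Proof. by []. Qed.

Lemma all_cons P x l : P x -> (forall a, a \in l -> P a) -> forall a, a \in x :: l -> P a.
Proof. by move=> Px Pl a; rewrite inE => /orP[/eqP->|/Pl]. Qed.

Variables p q : C.
Hypothesis p0 : p != 0.
Hypothesis q0 : q != 0.

Lemma gpts_base l u j a : u \in l -> a = q ^+ j * u -> gpts p q l a.
Proof. by move=> ul ->; exists u, 0%N, j; rewrite expr0 mul1r. Qed.

Lemma gpts_pole l u L k k' j a : u / (p ^+ L * q ^+ L) \in l -> (k <= L)%N -> (k' <= L)%N ->
  a = q ^+ j * (u / (p ^+ k * q ^+ k')) -> gpts p q l a.
Proof.
move=> ul kL kL' ->; exists (u / (p ^+ L * q ^+ L)), (L - k)%N, (L - k' + j)%N; split=> //.
have e1 : p ^+ L = p ^+ (L - k) * p ^+ k by rewrite -exprD subnK.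
have e2 : q ^+ L = q ^+ (L - k') * q ^+ k' by rewrite -exprD subnK.
rewrite exprD e1 e2.
by field; rewrite !expf_neq0.
Qed.

End MembershipTools.

Ltac each_mem tac := repeat (apply: all_cons; [by tac|]); exact: all_nil.

(** * The two sides and their comparison *)

Section Conclusion.
Variable R : realType.
Local Notation C := R[i].

Lemma norm_lt1 (x : C) : 0 < `|x| < 1 -> 0 < nm x < 1.
Proof. by rewrite normE !ltcE /= !eqxx. Qed.

(** Applied with [e = 1] to the original parameters and with [e = sq] to the shifted ones. Each of
    the latter is an odd power of [sq] times a parameter, so the square root disappears from
    products of two. *)
Lemma generic_products (T : seq C) (p q t e : C) (k0 : int) (l : seq C) :
  p != 0 -> q != 0 -> e ^+ 2 = q ^ k0 ->
  (forall a b (i j k : int), a \in T -> b \in T -> a * b != p ^ i * q ^ j * t ^ k) ->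
  (forall a, a \in l -> exists (i j : int) v, v \in T /\ a = p ^ i * q ^ j * e * v) ->
  forall a b (i j k : int), a \in l -> b \in l -> a * b != p ^ i * q ^ j * t ^ k.
Proof.
move=> p0 q0 he hT hl a b i j k /hl[i1 [j1 [v [vT ->]]]] /hl[i2 [j2 [w [wT ->]]]].
apply/eqP => h; have /eqP := hT v w (i - i1 - i2) (j - j1 - j2 - k0) k vT wT; apply.
have pn m : p ^ m != 0 by rewrite expfz_neq0.
have qn m : q ^ m != 0 by rewrite expfz_neq0.
rewrite !expfzDr// -!invr_expz -he.
have e0 : e != 0.
  by apply/eqP => e0; have /eqP := qn k0; apply; rewrite -he e0 expr0n.
have -> : v * w = (p ^ i1 * q ^ j1 * e * v * (p ^ i2 * q ^ j2 * e * w)) / (p ^ i1 * p ^ i2 * (q ^ j1 * q ^ j2) * e ^+ 2).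
  by field; rewrite !pn !qn e0.
by rewrite h; field; rewrite !pn !qn e0.
Qed.

Lemma common_bound (ks : seq nat) : exists L, forall k, k \in ks -> (k <= L)%N.
Proof.
exists (\sum_(k <- ks) k)%N => k kin; rewrite (big_rem _ kin) /=; exact: leq_addr.
Qed.

Section Sides.
Variables (n : nat) (p q sq t t0 t1 t2 t3 u0 u1 : C) (f g : 'rV[C]_n -> C).
Hypothesis hp : 0 < nm p < 1.
Hypothesis hq : 0 < nm q < 1.
Hypothesis ht : 0 < nm t < 1.
Hypothesis hsq : sq ^+ 2 = q.
Let p0 := unit_neq0 hp.
Let q0 := unit_neq0 hq.
Let t_neq0 := unit_neq0 ht.
Let sq0 := sqrt_neq0 hq hsq.
Let params := [:: t0; t1; t2; t3; u0; u1].
Hypothesis hgen : forall a b (i j k : int), a \in params -> b \in params -> a * b != p ^ i * q ^ j * t ^ k.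
Hypothesis hne : forall a, a \in params -> a != 0.
Hypothesis hbal : t ^ (2 * n%:Z - 2) * u0 * u1 * t0 * t1 * t2 * t3 = p * q.
Hypothesis fsym : forall s, generically (fun z => f (flip s z) = f z).
Hypothesis gsym : forall s, generically (fun z => g (flip s z) = g z).
Local Notation the_term := (term p q t sq u0 t0 t1 (fourth p t n u0 t0 t1) u1 t2 t3 f g).
Let sq0V : sq^-1 != 0. Proof. by rewrite invr_eq0. Qed.
Let t00 : t0 != 0. Proof. by apply: hne; exact: mem_head. Qed.
Let t10 : t1 != 0. Proof. by apply: hne; find_mem. Qed.
Let t20 : t2 != 0. Proof. by apply: hne; find_mem. Qed.
Let t30 : t3 != 0. Proof. by apply: hne; find_mem. Qed.
Let u00 : u0 != 0. Proof. by apply: hne; find_mem. Qed.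
Let u10 : u1 != 0. Proof. by apply: hne; find_mem. Qed.

Variables (L lf mf lg mg l1 m1 : nat) (F G : 'rV[C]_n -> C).
Hypothesis hF : hol F (@torus R n).
Hypothesis hG : hol G (@torus R n).
Hypothesis fF : generically (fun z => pole_factor (sq * u0) p q lf mf z * f z = F z).
Hypothesis gG : generically (fun z => pole_factor u1 p q lg mg z * g z = G z).
Hypothesis lfL : (lf <= L)%N.
Hypothesis mfL : (mf <= L)%N.
Hypothesis lgL : (lg <= L)%N.
Hypothesis mgL : (mg <= L)%N.
Hypothesis l1L : (l1 <= L)%N.
Hypothesis m1L : (m1 <= L)%N.

(** Pole positions of a single term. The first three entries of [Sout] carry the factor q of Gamma(q
    a z) in [tvar], which makes the two lists unequal. *)
Let Sin := [:: u0 / (p ^+ lf * q ^+ mf); t0; t1; u1 / (p ^+ lg * q ^+ mg); t2; t3].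
Let Sout := [:: q * u0 / (p ^+ lf * q ^+ mf); q * t0; q * t1; u1 / (p ^+ lg * q ^+ mg); t2; t3].

Let pole_neq0 u k k' : u != 0 -> u / (p ^+ k * q ^+ k') != 0.
Proof. by move=> v0; rewrite mulf_neq0// invr_eq0 mulf_neq0// expf_neq0. Qed.

Lemma Sout_neq0 a : a \in Sout -> a != 0.
Proof.
move: a; each_mem ltac:(rewrite ?pole_neq0 ?mulf_neq0).
Qed.

Lemma term_representative : exists Phi : 'rV[C]_n -> C, ghol p q t Sin Sout q Phi /\
  generically (fun z => the_term z = Phi z).
Proof.
have [c1 hc1] := gamma_pole t hp hq lf mf; have [c2 hc2] := gamma_pole t hp hq lg mg.
exists (term_rep p q t sq c1 c2 lf mf lg mg F G u0 t0 t1 (fourth p t n u0 t0 t1) u1 t2 t3).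
split; last exact: (term_repE hq hsq hc1 hc2).
apply: hol_term => //.
do 3!apply: all_cons => //; apply: all_cons; last by do 3!apply: all_cons => //.
by rewrite /fourth !mulf_neq0 ?invr_eq0 ?mulf_neq0 ?expfz_neq0.
Qed.

(** The region is built from [u0] and [u1] divided by (p q)^L with [L] above all pole orders: it has
    to separate the poles of the single term, of orders [lf] and [mf], together with those recorded
    for [Df], of orders [l1] and [m1]. *)
Lemma first_side (Phi : 'rV[C]_n -> C) : ghol p q t Sin Sout q Phi ->
  generically (fun z => the_term z = Phi z) ->
  exists K I, gregion p q t Sin Sout q K I /\
  forall Ct, let Df := cal_diff_op sq u0 t0 t1 t p f in
  let T := [tuple t0; t1; t2; t3; u0; u1] in
  nested_contour p q t Ct ->
  (forall a (i j : nat), a \in [:: t0; t1; t2; t3; u0 / (p ^+ l1 * q ^+ m1); u1 / (p ^+ lg * q ^+ mg)] ->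
     inside Ct (p ^+ i * q ^+ j * a) /\ outside Ct (p ^+ i * q ^+ j * a)^-1) ->
  is_holomorphic (fun z => pole_factor u0 p q l1 m1 z * Df z) ->
  is_holomorphic (fun z => pole_factor u1 p q lg mg z * g z) ->
  exists2 eta, 0 < eta & forall X J, adapted K I eta X J ->
    torus_integral Ct (fun z => Df z * g z * selberg_density T t p q z) =
    (dnorm p t n u0 t0 t1)^-1 * 2 ^+ n * mint (fun=> wfun J) Phi.
Proof.
move=> hPhi termE.
pose l := [:: t0; t1; t2; t3; u0 / (p ^+ L * q ^+ L); u1 / (p ^+ L * q ^+ L)].
have l0 a : a \in l -> a != 0 by move: a; each_mem ltac:(rewrite ?pole_neq0).
have lE : forall a, a \in l -> exists (i j : int) v, v \in params /\ a = p ^ i * q ^ j * 1 * v.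
  have base v : v \in params -> exists (i j : int) w, w \in params /\ v = p ^ i * q ^ j * 1 * w.
    by move=> vT; exists 0, 0, v; rewrite !expr0z !mul1r.
  have pole v : v \in params -> exists (i j : int) w, w \in params /\ v / (p ^+ L * q ^+ L) = p ^ i * q ^ j * 1 * w.
    by move=> vT; exists (- L%:Z), (- L%:Z), v; rewrite -!invr_expz -!exprnP; split=> //; field; rewrite !expf_neq0.
  do 4!(apply: all_cons; first by apply: base; rewrite !inE eqxx ?orbT).
  by do 2!(apply: all_cons; first by apply: pole; rewrite !inE eqxx ?orbT).
have lg' := generic_products (k0 := 0) p0 q0 (expr1n _ 2) hgen lE.
have [K [I [reg star]]] := star_gregion hp hq ht l0 lg'.
have u0l : u0 / (p ^+ L * q ^+ L) \in l by find_mem.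
have u1l : u1 / (p ^+ L * q ^+ L) \in l by find_mem.
have t0l : t0 \in l by exact: mem_head.
have t1l : t1 \in l by find_mem.
have t2l : t2 \in l by find_mem.
have t3l : t3 \in l by find_mem.
have e0 (x : C) : x = q ^+ 0 * x by rewrite mul1r.
have e1 (x : C) : q * x = q ^+ 1 * x by [].
have b0 u : u \in l -> gpts p q l u by move=> ul; exact: (gpts_base p ul (e0 _)).
have po u k k' : u / (p ^+ L * q ^+ L) \in l -> (k <= L)%N -> (k' <= L)%N -> gpts p q l (u / (p ^+ k * q ^+ k')).
  by move=> ul k1 k2; exact: (gpts_pole p0 q0 ul k1 k2 (e0 _)).
have regP : gregion p q t Sin Sout 1 K I.
  apply: reg; rewrite /Sin /Sout /=.
  apply: all_cons (po _ _ _ u0l lfL mfL) _; apply: all_cons (b0 _ t0l) _; apply: all_cons (b0 _ t1l) _.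
  apply: all_cons (po _ _ _ u1l lgL mgL) _; apply: all_cons (b0 _ t2l) _; apply: all_cons (b0 _ t3l) _.
  apply: all_cons; first by rewrite -mulrA; exact: (gpts_pole p0 q0 u0l lfL mfL (e1 _)).
  apply: all_cons (gpts_base p t0l (e1 _)) _; apply: all_cons (gpts_base p t1l (e1 _)) _.
  apply: all_cons (po _ _ _ u1l lgL mgL) _; apply: all_cons (b0 _ t2l) _; apply: all_cons (b0 _ t3l) _.
  exact: all_nil.
exists K, I; split; first exact: gregion_q.
move=> Ct Df T nC CS hDf hg.
have splitT : split_tuple T u0 u1 t0 t1 t2 t3 by move=> H; rewrite prod_tuple6; ring.
apply: (@one_side R p q t hp hq ht n T u0 t0 t1 u1 t2 t3 l1 m1 lg mg Ct Df g _ Phi Sin Sout K I splitT) => //.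
- do 3!apply: all_cons => //; by do 3!apply: all_cons => //.
- apply: reg => a; rewrite mem_cat orbb; move: a.
  apply: all_cons (b0 _ t0l) _; apply: all_cons (b0 _ t1l) _; apply: all_cons (b0 _ t2l) _.
  apply: all_cons (b0 _ t3l) _; apply: all_cons (po _ _ _ u0l l1L m1L) _; apply: all_cons (po _ _ _ u1l lgL mgL) _.
  exact: all_nil.
- exact: Sout_neq0.
- exact: ghol_one.
- have splitT' : split_tuple T u0 t0 t1 u1 t2 t3 by move=> H; rewrite prod_tuple6; ring.
  have sd := symmetrized_density hp hq t_neq0 hsq splitT' _ fsym gsym.
  have gt : generically (fun z => forall s : {ffun 'I_n -> bool},
     the_term (flip s z) = Phi (flip s z)).
    by apply: gen_fin => s; exact: (gen_flip s termE).
  apply: gen_mono (gen_and (sd _) gt) => [z _ [-> ts]|]; last by do 3!apply: all_cons => //.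
  by congr (_ * _); apply: eq_bigr => s _; exact: ts.
Qed.

Let t0' := sq * t0.
Let t1' := sq * t1.
Let t2' := sq^-1 * t2.
Let t3' := sq^-1 * t3.
Let u0' := sq * u0.
Let u1' := sq^-1 * u1.
Local Notation dual_term := (term p q t sq u1' t2' t3' (fourth p t n u1' t2' t3') u0' t0' t1' g f).
Let Sin' := [seq sq * a | a <- Sin].
Let Sout' := [seq a / sq | a <- Sout].

(** By [term_dual] the dual term at [w] is the original one at the inverse of [sq * w]. Summing over
    opposite sign vectors removes the inversion and leaves the scaling alone. *)
Lemma dual_symmetrized (Phi : 'rV[C]_n -> C) :
  let D'g := cal_diff_op sq u1' t2' t3' t p g in
  let T := [tuple t0'; t1'; t2'; t3'; u0'; u1'] in
  generically (fun z => the_term z = Phi z) ->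
  generically (fun w => D'g w * f w * selberg_density T t p q w =
    (dnorm p t n u1' t2' t3')^-1 * \sum_(s : {ffun 'I_n -> bool}) Phi (\row_i (sq^-1 * flip s w 0 i))).
Proof.
move=> D'g T termE.
have splitT : split_tuple T u1' t2' t3' u0' t0' t1' by move=> H; rewrite prod_tuple6; ring.
have hne' : forall a, a \in [:: u1'; t2'; t3'] -> a != 0.
  by each_mem ltac:(rewrite mulf_neq0).
have sd := symmetrized_density hp hq t_neq0 hsq splitT hne' gsym fsym.
have bal : t ^ (2 * n%:Z - 2) * u0 * u1 * t0 * t1 * t2 * t3 = p * q by [].
have hne6 : forall a, a \in [:: u0; t0; t1; u1; t2; t3] -> a != 0 by each_mem idtac.
have td := term_dual hp hq t_neq0 hsq hne6 bal fsym gsym.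
have termE' : generically (fun w : 'rV[C]_n => the_term (\row_i (sq * w 0 i)^-1) =
    Phi (\row_i (sq * w 0 i)^-1)).
  apply: (@gen_map R n (fun _ x => (sq * x)^-1)) termE => [i x y /invr_inj /(mulfI sq0)//|i x x0].
  by rewrite invr_eq0 mulf_neq0.
have gt : generically (fun w => forall s : {ffun 'I_n -> bool},
   dual_term (flip s w) =
   Phi (\row_i (sq * flip s w 0 i)^-1)).
  apply: gen_fin => s; apply: (gen_flip s (P := fun w => dual_term w =
    Phi (\row_i (sq * w 0 i)^-1))).
  by apply: gen_mono (gen_and td termE') => w _ [-> ->].
apply: gen_mono (gen_and sd gt) => w _ [-> ts]; congr (_ * _).
rewrite (reindex_inj (h := fun s : {ffun 'I_n -> bool} => [ffun i => ~~ s i])); last first.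
  by apply: inv_inj => s; apply/ffunP => i; rewrite !ffunE negbK.
apply: eq_bigr => s _; rewrite ts; congr Phi; apply/rowP => i; rewrite !mxE ffunE invfM.
by case: (s i); rewrite ?sg_true ?sg_false ?invrK.
Qed.

Lemma second_side (Phi : 'rV[C]_n -> C) : ghol p q t Sin Sout q Phi ->
  generically (fun z => the_term z = Phi z) ->
  exists K I, gregion p q t Sin' Sout' 1 K I /\
  forall Ct, let D'g := cal_diff_op sq u1' t2' t3' t p g in
  let T := [tuple t0'; t1'; t2'; t3'; u0'; u1'] in
  nested_contour p q t Ct ->
  (forall a (i j : nat), a \in [:: t0'; t1'; t2'; t3'; u0' / (p ^+ lf * q ^+ mf); u1' / (p ^+ l1 * q ^+ m1)] ->
     inside Ct (p ^+ i * q ^+ j * a) /\ outside Ct (p ^+ i * q ^+ j * a)^-1) ->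
  is_holomorphic (fun z => pole_factor u0' p q lf mf z * f z) ->
  is_holomorphic (fun z => pole_factor u1' p q l1 m1 z * D'g z) ->
  exists2 eta, 0 < eta & forall X J, adapted K I eta X J ->
    torus_integral Ct (fun z => f z * D'g z * selberg_density T t p q z) =
    (dnorm p t n u1' t2' t3')^-1 * 2 ^+ n * mint (fun=> wfun J) (fun w => Phi (\row_i (sq^-1 * w 0 i))).
Proof.
move=> hPhi termE.
pose l := [:: t0'; t1'; t2'; t3'; u0' / (p ^+ L * q ^+ L); u1' / (p ^+ L * q ^+ L)].
have l0 a : a \in l -> a != 0.
  by move: a; each_mem ltac:(rewrite ?pole_neq0 ?mulf_neq0).
have lE : forall a, a \in l -> exists (i j : int) v, v \in params /\ a = p ^ i * q ^ j * sq * v.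
  have up v : v \in params -> exists (i j : int) w, w \in params /\ sq * v = p ^ i * q ^ j * sq * w.
    by move=> vT; exists 0, 0, v; rewrite !expr0z !mul1r.
  have down v : v \in params -> exists (i j : int) w, w \in params /\ sq^-1 * v = p ^ i * q ^ j * sq * w.
    by move=> vT; exists 0, (- 1), v; rewrite exprN1 expr0z -hsq; split=> //; field.
  have pole v : (exists (i j : int) w, w \in params /\ v = p ^ i * q ^ j * sq * w) ->
      exists (i j : int) w, w \in params /\ v / (p ^+ L * q ^+ L) = p ^ i * q ^ j * sq * w.
    move=> [i [j [w [wT ->]]]]; exists (i - L%:Z), (j - L%:Z), w.
    by rewrite !expfzDr// -!invr_expz -!exprnP; split=> //; field; rewrite !expf_neq0.
  have [m0 m1' m2 [m3 m4 m5]] : [/\ t0 \in params, t1 \in params, t2 \in params & [/\ t3 \in params, u0 \in params & u1 \in params]].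
    by do !split; rewrite /params; find_mem.
  apply: all_cons (up _ m0) _; apply: all_cons (up _ m1') _; apply: all_cons (down _ m2) _; apply: all_cons (down _ m3) _.
  apply: all_cons (pole _ (up _ m4)) _; apply: all_cons (pole _ (down _ m5)) _; exact: all_nil.
have lg' := generic_products (k0 := 1) p0 q0 hsq hgen lE.
have [K [I [reg star]]] := star_gregion hp hq ht l0 lg'.
have u0l : u0' / (p ^+ L * q ^+ L) \in l by find_mem.
have u1l : u1' / (p ^+ L * q ^+ L) \in l by find_mem.
have t0l : t0' \in l by exact: mem_head.
have t1l : t1' \in l by find_mem.
have t2l : t2' \in l by find_mem.
have t3l : t3' \in l by find_mem.
have e0 (x : C) : x = q ^+ 0 * x by rewrite mul1r.
have e1 (x : C) : q * x = q ^+ 1 * x by [].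
have b0 u : u \in l -> gpts p q l u by move=> ul; exact: (gpts_base p ul (e0 _)).
have po u k k' : u / (p ^+ L * q ^+ L) \in l -> (k <= L)%N -> (k' <= L)%N -> gpts p q l (u / (p ^+ k * q ^+ k')).
  by move=> ul k1 k2; exact: (gpts_pole p0 q0 ul k1 k2 (e0 _)).
have dn (x : C) : sq * x = q ^+ 1 * (sq^-1 * x) by rewrite expr1 -hsq; field.
have up (x : C) : q * x / sq = sq * x by rewrite -hsq; field.
have regP : gregion p q t Sin' Sout' 1 K I.
  apply: reg; rewrite /Sin' /Sout' /Sin /Sout /=.
  apply: all_cons; first by rewrite mulrA; exact: po u0l lfL mfL.
  apply: all_cons (b0 _ t0l) _; apply: all_cons (b0 _ t1l) _.
  apply: all_cons; first by rewrite dn [sq^-1 * _]mulrA; exact: (gpts_pole p0 q0 u1l lgL mgL (erefl _)).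
  apply: all_cons (gpts_base p t2l (dn _)) _; apply: all_cons (gpts_base p t3l (dn _)) _.
  apply: all_cons; first by rewrite -[q * u0 / _]mulrA up [sq * _]mulrA; exact: po u0l lfL mfL.
  apply: all_cons; first by rewrite up; exact: b0 t0l.
  apply: all_cons; first by rewrite up; exact: b0 t1l.
  apply: all_cons; first by rewrite [_ / sq]mulrC [sq^-1 * _]mulrA; exact: po u1l lgL mgL.
  apply: all_cons; first by rewrite mulrC; exact: b0 t2l.
  apply: all_cons; first by rewrite mulrC; exact: b0 t3l.
  exact: all_nil.
exists K, I; split=> // Ct D'g T nC CS hf hDg.
have -> : (fun z => f z * D'g z * selberg_density T t p q z) = (fun z => D'g z * f z * selberg_density T t p q z).
  by apply/funext => z; rewrite (mulrC (f z)).
have splitT : split_tuple T u1' u0' t2' t3' t0' t1' by move=> H; rewrite prod_tuple6; ring.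
apply: (@one_side R p q t hp hq ht n T u1' t2' t3' u0' t0' t1' l1 m1 lf mf Ct D'g f _ (fun w => Phi (\row_i (sq^-1 * w 0 i))) Sin' Sout' K I splitT) => //.
- by each_mem ltac:(rewrite mulf_neq0).
- move=> a i j al; apply: CS; move: a al.
  by each_mem find_mem.
- apply: reg => a; rewrite mem_cat orbb; move: a.
  apply: all_cons (b0 _ t2l) _; apply: all_cons (b0 _ t3l) _; apply: all_cons (b0 _ t0l) _.
  apply: all_cons (b0 _ t1l) _; apply: all_cons (po _ _ _ u1l l1L m1L) _; apply: all_cons (po _ _ _ u0l lfL mfL) _.
  exact: all_nil.
- by move=> a /mapP[b /Sout_neq0 bn ->]; rewrite mulf_neq0.
- exact: ghol_rescale.
- exact: dual_symmetrized.
Qed.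

End Sides.
End Conclusion.

Theorem theorem6p4 (R : realType) (n : nat)
    (p q sq t t0 t1 t2 t3 u0 u1 : R[i]) (f g : 'rV[R[i]]_n -> R[i])
    (hp : 0 < `|p| < 1) (hq : 0 < `|q| < 1) (ht : 0 < `|t| < 1)
    (hsq : sq ^+ 2 = q)
    (hgen : generic_params t0 t1 t2 t3 u0 u1 t p q)
    (hbal : t ^ (2 * n%:Z - 2) * u0 * u1 * t0 * t1 * t2 * t3 = p * q)
    (hf : calAspace (sq * u0) p q f)
    (hg : calAspace u1 p q g) :
  let t0' := sq * t0 in
  let t1' := sq * t1 in
  let t2' := sq^-1 * t2 in
  let t3' := sq^-1 * t3 in
  let u0' := sq * u0 in
  let u1' := sq^-1 * u1 in
  let Df := cal_diff_op sq u0 t0 t1 t p f in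
  let D'g := cal_diff_op sq u1' t2' t3' t p g in
  forall C C' : contour R,
    admissible_contour t0 t1 t2 t3 u0 u1 t p q Df g C ->
    admissible_contour t0' t1' t2' t3' u0' u1' t p q f D'g C' ->
    scalar_product t0 t1 t2 t3 u0 u1 t p q C Df g =
    scalar_product t0' t1' t2' t3' u0' u1' t p q C' f D'g.
Proof.
move=> t0' t1' t2' t3' u0' u1' Df D'g C C' [isC [Cinv [l1 [m1 [lg [mg [hDf hgG HC]]]]]]].
move=> [isC' [Cinv' [lf [mf [l2 [m2 [hfF hDg HC']]]]]]].
have np := norm_lt1 hp; have nq := norm_lt1 hq; have nt := norm_lt1 ht.
have p0 := unit_neq0 np.
have q0 := unit_neq0 nq.
have sq0 := sqrt_neq0 nq hsq.
pose params := [:: t0; t1; t2; t3; u0; u1].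
have gen a b (i j k : int) : a \in params -> b \in params -> a * b != p ^ i * q ^ j * t ^ k.
  by move=> /(@tnthP _ _ [tuple t0; t1; t2; t3; u0; u1])[r ->] /(@tnthP _ _ [tuple t0; t1; t2; t3; u0; u1])[s ->]; exact: hgen.
(* A vanishing parameter would contradict the balancing condition, since [p * q] is not 0. *)
have ne : forall a, a \in params -> a != 0.
  have := mulf_neq0 p0 q0; rewrite -hbal !mulf_eq0 !negb_or.
  by move=> /andP[/andP[/andP[/andP[/andP[/andP[_ ?] ?] ?] ?] ?] ?]; each_mem idtac.
have fsym s := calAspace_flip s hf; have gsym s := calAspace_flip s hg.
have [F /holomorphic_hol hF /gen_mero fF] := hfF.
have [G /holomorphic_hol hG /gen_mero gG] := hgG.
have [L HL] := common_bound [:: lf; mf; lg; mg; l1; m1; l2; m2].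
have [[L1 L2 L3 L4] [L5 L6 L7 L8]] : [/\ lf <= L, mf <= L, lg <= L & mg <= L]%N /\ [/\ l1 <= L, m1 <= L, l2 <= L & m2 <= L]%N.
  by do !split; apply: HL; rewrite !inE eqxx ?orbT.
have [Phi [hPhi termE]] := term_representative np nq nt hsq ne hF hG fF gG.
have [K [I [reg side]]] := first_side np nq nt hsq gen ne fsym gsym L1 L2 L3 L4 L5 L6 hPhi termE.
have [K' [I' [reg' side']]] := second_side np nq nt hsq gen ne hbal fsym gsym L1 L2 L3 L4 L7 L8 hPhi termE.
have [||eta eta0 {}side] := side C _ _ hDf hgG.
- by split=> // i j z; case: (HC i j) => _; exact.
- by apply: contour_gpts => // i j a; case: (HC i j) => + _; exact.
have [||eta' eta0' {}side'] := side' C' _ _ hfF hDg.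
- by split=> // i j z; case: (HC' i j) => _; exact.
- by apply: contour_gpts => // i j a; case: (HC' i j) => + _; exact.
have So0 := Sout_neq0 np nq ne (lf := lf) (mf := mf) (lg := lg) (mg := mg).
have nq1 : nm q <= 1 by case/andP: nq => _ /ltW.
(* Both sides now integrate the same [Phi]. The second region is scaled back to the variable of the
   first; with [kappa = q] both are regions for [Phi]. *)
have [e e0 inv] := gregion_invariance np nq nt So0 n nq1 reg (gregion_rescale nq hsq reg').
have m0 : 0 < Num.min eta e by rewrite lt_min eta0.
have [X [J ad]] := gregion_adapted np nq nt So0 reg m0.
have nsq : 0 < nm sq^-1 by rewrite nm_gt0 invr_eq0.
(* The second width makes the chain adapted to width [e] after it is scaled by [sq^-1]. *)
have m0' : 0 < Num.min eta' (e / nm sq^-1) by rewrite lt_min eta0' divr_gt0.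
have So0' a : a \in [seq b / sq | b <- [:: q * u0 / (p ^+ lf * q ^+ mf); q * t0; q * t1;
    u1 / (p ^+ lg * q ^+ mg); t2; t3]] -> a != 0.
  by move=> /mapP[b /So0 b0 ->]; rewrite mulf_neq0 ?invr_eq0.
have [X' [J' ad']] := gregion_adapted np nq nt So0' reg' m0'.
have le1 : Num.min eta e <= eta by rewrite ge_min lexx.
have le2 : Num.min eta e <= e by rewrite ge_min lexx orbT.
have le3 : Num.min eta' (e / nm sq^-1) <= eta' by rewrite ge_min lexx.
have le4 : Num.min eta' (e / nm sq^-1) <= e / nm sq^-1 by rewrite ge_min lexx orbT.
rewrite /scalar_product (side X J (adapted_le le1 ad)) (side' X' J' (adapted_le le3 ad')).
have sq0V : sq^-1 != 0 by rewrite invr_eq0.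
have -> : mint (fun=> wfun J) Phi = mint (fun=> wfun J') (fun w => Phi (\row_i (sq^-1 * w 0 i))).
  rewrite (inv Phi (fun=> X) (fun=> J) (fun=> [set sq^-1 * z | z in X']) (fun=> scaleJ sq^-1 J') hPhi).
  - by apply: (mint_subst (Js := fun=> wfun J') (h := fun _ z => sq^-1 * z)) => k h; exact: wfun_scaleJ.
  - by move=> _; exact: adapted_le ad.
  - by move=> _; have := adapted_scale sq0V (adapted_le le4 ad'); rewrite invrK.
by rewrite !mulrA -!invfM (selberg_norm_dual np nq nt hsq n gen ne).
Qed.
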